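(* Let $\pi$ be a group such that there exists a connected finite CW-complex $X$ with $\pi=\pi_1(X)$ which is $L^2$-acyclic. Consider any element $\omega\in\mathrm{Wh}^w(\pi)$. Then there is a connected finite CW-complex $Y$ with $\pi=\pi_1(Y)$ such that $Y$ is $L^2$-acyclic and $\rho^{(2)}_u(\widetilde Y)=\omega$.
   Context: Modules are left modules. For a group $G$, a finitely generated based free $\mathbb ZG$-module is a finitely generated free $\mathbb ZG$-module $M$ with a finite unordered basis $B$; $\mathbb ZG^n$ carries the standard basis. Put $\Lambda(M)=L^2(G)\otimes_{\mathbb ZG}M$ with the Hilbert space structure for which $\bigoplus_{b\in B}L^2(G)\to\Lambda(M)$ is isometric; a $\mathbb ZG$-map $f$ induces a bounded $G$-equivariant operator $\Lambda(f)$, called a weak isomorphism if it is injective with dense image. A finite based free $\mathbb ZG$-chain complex $C_*$ has finitely generated based free chain modules, with $C_n=0$ for $|n|$ large. $\Lambda(C_* )$ is $L^2$-acyclic if for every $n$ its $n$-th $L^2$-homology (kernel of the $n$-th differential modulo closure of the image of the $(n+1)$-st) vanishes. $K_1^w(\mathbb ZG)$ is the abelian group with generators $[f]$ for $\mathbb ZG$-endomorphisms $f\colon\mathbb ZG^n\to\mathbb ZG^n$, $n\ge0$, with $\Lambda(f)$ a weak isomorphism, and relations $[f_2\circ f_1]=[f_1]+[f_2]$ and $\left[\begin{pmatrix}f_0&f_1\\0&f_2\end{pmatrix}\right]=[f_0]+[f_2]$ (for $\Lambda(f_0),\Lambda(f_2)$ weak isomorphisms, $f_1$ arbitrary). $\widetilde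 K_1^w(\mathbb ZG)$ is the quotient by the subgroup generated by $[-\mathrm{id}_{\mathbb ZG}]$, and $\mathrm{Wh}^w(G)$ is the quotient of $K_1^w(\mathbb ZG)$ by the subgroup of all $[r_{\pm g}\colon\mathbb ZG\to\mathbb ZG]$, $g\in G$ ($r_A$ is right multiplication with $A$). For $f\colon M\to N$ between finitely generated based free modules with $\Lambda(f)$ a weak isomorphism (then the ranks agree), $[f]:=[b\circ f]\in\widetilde K_1^w(\mathbb ZG)$ for $b\colon N\to M$ induced by any bijection of bases. A weak chain contraction $(\gamma_*,u_* )$ of $C_*$ is a $\mathbb ZG$-chain map $u_*\colon C_*\to C_*$ with all $\Lambda(u_n)$ weak isomorphisms together with a chain homotopy $\gamma_*\colon u_*\simeq0_*$ with $\gamma_n\circ u_n=u_{n+1}\circ\gamma_n$. If $\Lambda(C_* )$ is $L^2$-acyclic, a weak chain contraction exists and $\rho^{(2)}_u(C_* )=[(uc+\gamma)_{\mathrm{odd}}\colon C_{\mathrm{odd}}\to C_{\mathrm{ev}}]-[u_{\mathrm{odd}}]\in\widetilde K_1^w(\mathbb ZG)$ (independent of the choice), where $c$ is the differential. A connected finite CW-complex $X$ is $L^2$-acyclic if $\Lambda(C_*(\widetilde X))$ is $L^2$-acyclic, where $C_*(\widetilde X)$ is the cellular $\mathbb Z[\pi_1(X)]$-chain complex of the universal covering with a cellular basis; then $\rho^{(2)}_u(\widetilde X)\in\mathrm{Wh}^w(\pi_1(X))$ is the image of $\rho^{(2)}_u(C_*(\widetilde X))$ (independent of the choice of cellular basis).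 *)

(* Defs.v *)
From HB Require Import structures.
From mathcomp Require Import all_boot all_order all_algebra.
From mathcomp Require Import perm generic_quotient ring_quotient complex.
From mathcomp Require Import all_classical all_reals topology normedtype esum.
From mathcomp.multinomials Require Import freeg.

Set Implicit Arguments.
Unset Strict Implicit.
Unset Printing Implicit Defensive.

Import Order.TTheory GRing.Theory Num.Theory.
Import numFieldNormedType.Exports.

Local Open Scope classical_set_scope.
Local Open Scope quotient_scope.
Local Open Scope ring_scope.

Notation fgen k := (<< (1 : int) *g k >>).

Lemma freeg_additive_ext (K : choiceType) (W : zmodType)
    (f g : {freeg K / int} -> W) :
  zmod_morphism f -> zmod_morphism g ->
  (forall k, f (fgen k) = g (fgen k)) -> f =1 g.
Proof.
move=> fB gB fg D.
pose Fm := GRing.isZmodMorphism.Build _ _ f fB.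
pose F : {additive {freeg K / int} -> W} := HB.pack f Fm.
pose Gm := GRing.isZmodMorphism.Build _ _ g gB.
pose G : {additive {freeg K / int} -> W} := HB.pack g Gm.
rewrite -[LHS]/(F D) -[RHS]/(G D) -(freeg_sumE D) !raddf_sum.
apply: eq_bigr => k _.
have -> : << coeff k D *g k >> = (fgen k) *~ coeff k D.
  by rewrite freeg_mulz intz.
by rewrite !raddfMz /= fg.
Qed.

Lemma fglift_zmod_morphism (K : choiceType) (V : lmodType int) (f : K -> V) :
  zmod_morphism (fglift f).
Proof. exact: lift_is_additive. Qed.

HB.instance Definition _ (K : choiceType) (V : lmodType int) (f : K -> V) :=
  GRing.isZmodMorphism.Build {freeg K / int} V (fglift f)
    (fglift_zmod_morphism f).

Section QuotientByGenerated.
Variables (V : zmodType) (S : set V).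

Definition generated_subgroup : {pred V} := fun x =>
  `[< forall H : set V, H 0 -> (forall y z, H y -> H z -> H (y - z)) ->
        S `<=` H -> H x >].

Lemma generated_subgroup_zmod_closed : zmod_closed generated_subgroup.
Proof.
split=> [|x y]; first by apply/asboolP => H.
rewrite !unfold_in => /asboolP Hx /asboolP Hy; apply/asboolP => H H0 HB SH.
by apply: (HB); [exact: (Hx H)|exact: (Hy H)].
Qed.

HB.instance Definition _ :=
  GRing.isZmodClosed.Build V generated_subgroup generated_subgroup_zmod_closed.

Definition quotient_by : zmodType := Quotient.quot generated_subgroup.

End QuotientByGenerated.

Definition group_ring (G : groupType) : Type := {freeg G / int}.

Section GroupRing.
Variable G : groupType.
HB.instance Definition _ := GRing.Lmodule.on (group_ring G).

Implicit Types (a b c : group_ring G) (g h : G).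

Definition gr (g : G) : group_ring G := fgen g.

Definition gr_mul a b : group_ring G :=
  fglift (fun g => fglift (fun h => gr (g * h)%g) b) a.

Lemma fglift_gen (V : lmodType int) (f : G -> V) g : fglift f (gr g) = f g.
Proof. by rewrite liftU scale1r. Qed.

Lemma gr_mulBl b : zmod_morphism (gr_mul ^~ b).
Proof. exact: fglift_zmod_morphism. Qed.

Lemma gr_mulBr a : zmod_morphism (gr_mul a).
Proof.
move=> b c; apply: (@freeg_additive_ext G _ (gr_mul ^~ (b - c))
  (fun a => gr_mul a b - gr_mul a c)) => [||g] /=.
- exact: gr_mulBl.
- by move=> x y; rewrite !(gr_mulBl _ x y) !opprD !opprK addrACA.
- by rewrite /gr_mul !fglift_gen raddfB.
Qed.

Lemma gr_mulg g h : gr_mul (gr g) (gr h) = gr (g * h)%g.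
Proof. by rewrite /gr_mul !fglift_gen. Qed.

Lemma gr_mulA : associative gr_mul.
Proof.
move=> a b c; apply: (@freeg_additive_ext G _ (gr_mul ^~ (gr_mul b c))
  (fun a => gr_mul (gr_mul a b) c)) => [||g] /=.
- exact: gr_mulBl.
- by move=> x y; rewrite (gr_mulBl b x y) (gr_mulBl c).
apply: (@freeg_additive_ext G _ (fun b => gr_mul (gr g) (gr_mul b c))
  (fun b => gr_mul (gr_mul (gr g) b) c)) => [||h] /=.
- by move=> x y; rewrite (gr_mulBl c x y) gr_mulBr.
- by move=> x y; rewrite (gr_mulBr _ x y) (gr_mulBl c).
apply: (@freeg_additive_ext G _ (fun c => gr_mul (gr g) (gr_mul (gr h) c))
  (gr_mul (gr_mul (gr g) (gr h)))) => [||k] /=.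
- by move=> x y; rewrite (gr_mulBr _ x y) gr_mulBr.
- exact: gr_mulBr.
by rewrite !gr_mulg mulgA.
Qed.

Lemma gr_mul1l : left_id (gr 1%g) gr_mul.
Proof.
apply: (@freeg_additive_ext G _ (gr_mul (gr 1%g)) id) => [||g] //=.
  exact: gr_mulBr.
by rewrite gr_mulg mul1g.
Qed.

Lemma gr_mul1r : right_id (gr 1%g) gr_mul.
Proof.
apply: (@freeg_additive_ext G _ (gr_mul ^~ (gr 1%g)) id) => [||g] //=.
  exact: gr_mulBl.
by rewrite gr_mulg mulg1.
Qed.

Lemma gr_mulDl : left_distributive gr_mul +%R.
Proof.
move=> a b c; pose Fm := GRing.isZmodMorphism.Build _ _ _ (gr_mulBl c).
pose F : {additive group_ring G -> group_ring G} := HB.pack (gr_mul ^~ c) Fm.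
exact: (raddfD F a b).
Qed.

Lemma gr_mulDr : right_distributive gr_mul +%R.
Proof.
move=> a b c; pose Fm := GRing.isZmodMorphism.Build _ _ _ (gr_mulBr a).
pose F : {additive group_ring G -> group_ring G} := HB.pack (gr_mul a) Fm.
exact: (raddfD F b c).
Qed.

Lemma gr1_neq0 : gr 1%g != 0.
Proof. by rewrite freegU_eq0. Qed.

HB.instance Definition _ := GRing.Zmodule_isNzRing.Build (group_ring G)
  gr_mulA gr_mul1l gr_mul1r gr_mulDl gr_mulDr gr1_neq0.

End GroupRing.

(* Modules are left modules and vectors of [ZG^n] are rows, so a matrix [A]
    stands for the map [r_A : x |-> x *m A], and [r_B \o r_A = r_(A *m B)]. *)

Section L2.
Variables (R : realType) (G : groupType).
Local Notation ZG := (group_ring G).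
Local Notation C := R[i].

Definition l2_norm2 n (x : G -> 'rV[C]_n) : \bar R :=
  \esum_(g in [set: G])
    (\sum_j (complex.Re (x g ord0 j) ^+ 2 + complex.Im (x g ord0 j) ^+ 2))%:E.

Definition in_l2 n (x : G -> 'rV[C]_n) := (l2_norm2 x < +oo)%E.

(* [Lambda (r_A)]: right multiplication by [A] on [L^2(G)^m]; the coefficient
   of [(\sum_k x_k k) * h] at [g] is [x_(g h^-1)]. *)
Definition Lambda m n (A : 'M[ZG]_(m, n)) (x : G -> 'rV[C]_m) : G -> 'rV[C]_n :=
  fun g => \row_j \sum_i \sum_(h <- dom (A i j))
    x (g * h^-1)%g ord0 i *~ coeff h (A i j).

Definition weak_iso m n (A : 'M[ZG]_(m, n)) : Prop :=
  (forall x, in_l2 x -> Lambda A x = 0 -> x = 0) /\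
  (forall y, in_l2 y -> forall e : R, 0 < e ->
     exists x, in_l2 x /\ (l2_norm2 (y \- Lambda A x)%R < e%:E)%E).

Definition weak_aut_n n : Type := {A : 'M[ZG]_n | `[< weak_iso A >]}.
HB.instance Definition _ n := SubChoice.on (weak_aut_n n).
Definition weak_aut : Type := {n : nat & weak_aut_n n}.
HB.instance Definition _ := Choice.on weak_aut.

(* Junk value [0] when [A] is not a weak isomorphism. *)
Definition weak_gen n (A : 'M[ZG]_n) : {freeg weak_aut / int} :=
  if insub A is Some B then fgen (existT weak_aut_n n B : weak_aut) else 0.

Definition K1w_relators : set {freeg weak_aut / int} :=
  [set z | exists n (A1 A2 : 'M[ZG]_n), weak_iso A1 /\ weak_iso A2 /\
     z = weak_gen (A1 *m A2) - (weak_gen A1 + weak_gen A2)] `|`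
  [set z | exists m n (A0 : 'M[ZG]_m) (A1 : 'M[ZG]_(n, m)) (A2 : 'M[ZG]_n),
     weak_iso A0 /\ weak_iso A2 /\
     z = weak_gen (block_mx A0 0 A1 A2) - (weak_gen A0 + weak_gen A2)].

Definition K1w : zmodType := quotient_by K1w_relators.

Definition K1w_class n (A : 'M[ZG]_n) : K1w :=
  \pi_(Quotient.quot (generated_subgroup K1w_relators)) (weak_gen A).

Definition minus_id : set K1w := [set K1w_class (- 1%:M : 'M[ZG]_1)].

Definition K1wt : zmodType := quotient_by minus_id.

Definition K1w_to_K1wt (x : K1w) : K1wt :=
  \pi_(Quotient.quot (generated_subgroup minus_id)) x.

Definition trivial_units : set K1w :=
  [set z | exists (s : bool) (g : G),
     z = K1w_class (((-1) ^+ s * gr g)%:M : 'M[ZG]_1)].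

Definition Whw : zmodType := quotient_by trivial_units.

Definition K1w_to_Whw (x : K1w) : Whw :=
  \pi_(Quotient.quot (generated_subgroup trivial_units)) x.

(* The induced projection: [minus_id] is contained in [trivial_units]. *)
Definition K1wt_to_Whw (x : K1wt) : Whw :=
  K1w_to_Whw (repr (x : Quotient.quot (generated_subgroup minus_id))).

(* [x = [f]] for a weak isomorphism [f = r_A] between based free modules of
   ranks [m] and [n], which is made an endomorphism by a bijection of bases. *)
Definition based_class m n (A : 'M[ZG]_(m, n)) (x : K1wt) : Prop :=
  weak_iso A /\
  exists (e : n = m) (s : {perm 'I_m}),
    x = K1w_to_K1wt (K1w_class (col_perm s (castmx (erefl, e) A))).

(* Complexes are concentrated in degrees [n >= 0], as cellular ones are:
    [C_n = ZG^(r n)] and [c n] is the matrix of the differential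
    [C_(n+1) -> C_n]. *)

Section Complex.
Variables (r : nat -> nat) (c : forall n, 'M[ZG]_(r n.+1, r n)).

Definition is_fbf_complex : Prop :=
  (forall n, c n.+1 *m c n = 0) /\ (exists N, forall n, (N <= n)%N -> r n = 0%N).

Definition l2_cycle n : (G -> 'rV[C]_(r n)) -> Prop :=
  match n with
  | 0 => fun=> True
  | n'.+1 => fun x => Lambda (c n') x = 0
  end.

Definition l2_acyclic : Prop :=
  forall n (x : G -> 'rV[C]_(r n)), in_l2 x -> l2_cycle x ->
    forall e : R, 0 < e ->
      exists y, in_l2 y /\ (l2_norm2 (x \- Lambda (c n) y)%R < e%:E)%E.

Section Contraction.
Variables (u : forall n, 'M[ZG]_(r n)) (gamma : forall n, 'M[ZG]_(r n, r n.+1)).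

Definition weak_contraction : Prop :=
  [/\ forall n, c n *m u n = u n.+1 *m c n,
      forall n, weak_iso (u n),
      gamma 0 *m c 0 = u 0,
      forall n, gamma n.+1 *m c n.+1 + c n *m gamma n = u n.+1 &
      forall n, u n *m gamma n = gamma n *m u n.+1].

(* [conform_mx 0 B] is [B], transported along an equality of dimensions. *)
Definition odd_to_even K :
    'M[ZG]_(\sum_(k < K) r k.*2.+1, \sum_(k < K) r k.*2) :=
  \mxblock_(k < K, l < K)
    if l == k then conform_mx 0 (c k.*2 *m u k.*2)
    else if l == k.+1 :> nat then conform_mx 0 (gamma k.*2.+1)
    else 0.

Definition u_odd K : 'M[ZG]_(\sum_(k < K) r k.*2.+1) :=
  \mxdiag_(k < K) u k.*2.+1.

End Contraction.

Definition is_universal_torsion (x : K1wt) : Prop :=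
  exists u gamma K y,
    [/\ weak_contraction u gamma,
        forall n, (K.*2 <= n)%N -> r n = 0%N,
        based_class (odd_to_even u gamma K) y &
        x = y - K1w_to_K1wt (K1w_class (u_odd u K))].

End Complex.

End L2.

Section CW.
Variable R : realType.

Definition disk n : topologicalType :=
  [the topologicalType of
     [set x : 'rV[R]_n | \sum_i x ord0 i ^+ 2 <= 1] : Type].

Definition sphere n : set (disk n) :=
  [set x | \sum_i (set_val x : 'rV[R]_n) ord0 i ^+ 2 = 1].
Definition open_disk n : set (disk n) :=
  [set x | \sum_i (set_val x : 'rV[R]_n) ord0 i ^+ 2 < 1].
Arguments sphere : clear implicits.
Arguments open_disk : clear implicits.

(* As there are finitely many cells and the space is Hausdorff, closure
   finiteness and the weak topology are automatic, and the characteristic maps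
   are homeomorphisms from the open disks onto the open cells. *)
Record finite_cw (X : topologicalType) := FiniteCW {
  ncells : nat -> nat;
  char_map : forall n, 'I_(ncells n) -> continuousType (disk n) X;
  cw_finite : exists N, forall n, (N <= n)%N -> ncells n = 0%N;
  cw_hausdorff : hausdorff_space X;
  cw_cover : forall p : X, exists n i x,
    open_disk n x /\ @char_map n i x = p;
  cw_disjoint : forall m i x n j y, open_disk m x -> open_disk n y ->
    @char_map m i x = @char_map n j y ->
    existT (fun n => ('I_(ncells n) * disk n)%type) m (i, x) =
    existT (fun n => ('I_(ncells n) * disk n)%type) n (j, y);
  cw_attach : forall n i x, sphere n x -> exists m j y,
    [/\ (m < n)%N, open_disk m y & @char_map m j y = @char_map n i x]
}.

(* The union of the cells of dimension [< n], i.e. the [(n-1)]-skeleton. *)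
Definition skel_lt (X : topologicalType) (K : finite_cw X) n : set X :=
  [set p | exists m i x,
     [/\ (m < n)%N, open_disk m x & @char_map X K m i x = p]].

Section Paths.
Variable X : topologicalType.
Implicit Types (f g : R -> X) (x y z : X).

(* Paths are parametrized by [0, 1]; values outside are irrelevant. *)
Definition is_path x y f : Prop :=
  [/\ {within `[(0 : R), 1], continuous f}, f 0 = x & f 1 = y].

Definition path_cat f g : R -> X :=
  fun t => if t <= 2^-1 then f (2 * t) else g (2 * t - 1).

Definition path_homotopic f g : Prop :=
  exists H : R * R -> X,
    [/\ {within `[(0 : R), 1] `*` `[(0 : R), 1], continuous H},
        forall t, t \in `[(0 : R), 1] -> H (0, t) = f t,
        forall t, t \in `[(0 : R), 1] -> H (1, t) = g t,
        forall s, s \in `[(0 : R), 1] -> H (s, 0) = f 0 &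
        forall s, s \in `[(0 : R), 1] -> H (s, 1) = f 1].

(* An isomorphism [pi_1(X, x) -> G], given on loops. *)
Record pi1_iso (G : groupType) (x : X) := Pi1Iso {
  loop_class :> (R -> X) -> G;
  loop_class_eq : forall f g, is_path x x f -> is_path x x g ->
    loop_class f = loop_class g <-> path_homotopic f g;
  loop_class_cat : forall f g, is_path x x f -> is_path x x g ->
    loop_class (path_cat f g) = (loop_class f * loop_class g)%g;
  loop_class_surj : forall a : G, exists f, is_path x x f /\ loop_class f = a
}.

Definition simply_connected : Prop :=
  (forall x y, exists f, is_path x y f) /\
  (forall x f, is_path x x f -> path_homotopic f (fun=> x)).

End Paths.

Definition evenly_covered (E X : topologicalType) (p : E -> X) (U : set X) :=
  exists (I : Type) (V : I -> set E),
    [/\ p @^-1` U = \bigcup_i V i, trivIset setT V &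
        forall i, [/\ open (V i), set_bij (V i) U p &
          forall O, open O -> O `<=` V i -> open (p @` O)]].

(* A pointed universal covering together with the action of [G = pi_1(X, x0)]
   by deck transformations: the class of a loop moves the base point to the
   endpoint of the lift of that loop. *)
Record universal_covering (G : groupType) (X : topologicalType) (x0 : X)
    (th : pi1_iso G x0) := UniversalCovering {
  ucover : topologicalType;
  uproj : continuousType ucover X;
  uproj_covering : forall x, exists U, [/\ open U, U x & evenly_covered uproj U];
  ucover_sc : simply_connected ucover;
  ubase : ucover;
  ubaseE : uproj ubase = x0;
  deck : G -> continuousType ucover ucover;
  deck1 : forall e, deck 1%g e = e;
  deckM : forall g h e, deck (g * h)%g e = deck g (deck h e);
  deck_proj : forall g e, uproj (deck g e) = uproj e;
  deck_monodromy : forall f e, is_path ubase e f -> uproj e = x0 ->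
    deck (th (uproj \o f)) ubase = e
}.

Definition std_simplex k : set 'rV[R]_k.+1 :=
  [set x | (forall i, 0 <= x ord0 i) /\ \sum_i x ord0 i = 1].

Arguments std_simplex : clear implicits.

Definition simplex k : topologicalType :=
  [the topologicalType of set_type (std_simplex k)].

Definition insert0 k (i : 'I_k.+2) (x : 'rV[R]_k.+1) : 'rV[R]_k.+2 :=
  \row_j if unlift i j is Some l then x ord0 l else 0.

Lemma insert0_simplex k (i : 'I_k.+2) (x : 'rV[R]_k.+1) :
  std_simplex k x -> std_simplex k.+1 (insert0 i x).
Proof.
move=> [x0 x1]; split=> [j|]; first by rewrite mxE; case: unlift.
rewrite (bigD1 i) //= mxE unlift_none add0r -x1 (reindex_onto (fintype.lift i)
  (fun j => odflt ord0 (unlift i j))) /=; last first.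
  by move=> j; rewrite eq_sym => /unlift_some[l -> ->].
under eq_bigl => j do rewrite eq_sym neq_lift liftK eqxx.
by apply: eq_bigr => j _; rewrite mxE liftK.
Qed.

Definition face_fun k (i : 'I_k.+2) (x : simplex k) : simplex k.+1 :=
  SigSub (mem_set (insert0_simplex i (set_valP x))).

Lemma face_fun_continuous k (i : 'I_k.+2) : continuous (face_fun i).
Proof.
apply: (@continuous_comp_initial _ _ _ set_val) => x A [P PN PA].
suff : \forall y \near x, forall a b, P a b (insert0 i (set_val y) a b).
  by apply: filterS => y Py; exact: PA.
have FF : Filter (nbhs x) := nbhs_filter x.
apply: (@filter_forall _ _
  (fun a y => forall b, P a b (insert0 i (set_val y) a b)) _ FF) => a.
apply: (@filter_forall _ _
  (fun b y => P a b (insert0 i (set_val y) a b)) _ FF) => b.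
have := PN a b; rewrite /= !mxE; case E: (unlift i b) => [l|] Pl.
  have /(_ x) : continuous
      (fun y : simplex k => (set_val y : 'rV[R]_k.+1) ord0 l).
    move=> y; apply: (@continuous_comp _ _ _ set_val
      (fun M : 'rV[R]_k.+1 => M ord0 l)).
      exact: initial_continuous.
    exact: coord_continuous.
  move=> cx; have := cx _ Pl; apply: (@filterS _ (nbhs x) FF) => y.
  by rewrite mxE E (ord1 a).
apply: (@filterS _ (nbhs x) FF setT); last exact: filterT.
by move=> y _; rewrite mxE E; exact: nbhs_singleton.
Qed.

HB.instance Definition _ k (i : 'I_k.+2) :=
  isContinuous.Build _ _ (face_fun i) (@face_fun_continuous k i).

Definition face k (i : 'I_k.+2) : continuousType (simplex k) (simplex k.+1) :=
  face_fun i.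

Section Chains.

Definition chain k (Z : topologicalType) : Type :=
  {freeg (continuousType (simplex k) Z) / int}.
HB.instance Definition _ k Z := GRing.Lmodule.on (chain k Z).

Definition push (Z W : topologicalType) (f : continuousType Z W) k
    (c : chain k Z) : chain k W :=
  fglift (fun s : continuousType (simplex k) Z =>
    fgen (f \o s : continuousType (simplex k) W) : chain k W) c.

Definition bd (Z : topologicalType) k : chain k Z -> chain k.-1 Z :=
  match k with
  | 0 => fun=> 0
  | k'.+1 => fglift (fun s : continuousType (simplex k'.+1) Z =>
      \sum_(i < k'.+2) (-1) ^+ i *:
        (fgen (s \o face i : continuousType (simplex k') Z) : chain k' Z))
  end.

Definition supported (Z : topologicalType) (A : set Z) k (c : chain k Z) : Prop :=
  forall s, s \in dom c -> forall x, A (s x).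

(* Relative cycles and the relation defining [H_k(A, B)], for subspaces
   [B `<=` A] of [Z]. *)
Definition rel_cycle (Z : topologicalType) (A B : set Z) k (c : chain k Z) :=
  supported A c /\ supported B (bd c).

Definition rel_homologous (Z : topologicalType) (A B : set Z) k
    (c c' : chain k Z) : Prop :=
  exists e : chain k.+1 Z, supported A e /\ supported B (c - c' - bd e).

(* [z] represents a generator of the infinite cyclic group [H_n(D^n, S^(n-1))]. *)
Definition disk_generator n (z : chain n (disk n)) : Prop :=
  rel_cycle setT (sphere n) z /\
  forall z', rel_cycle setT (sphere n) z' ->
    exists m : int, rel_homologous setT (sphere n) z' (m *: z).

End Chains.

Section Cellular.
Variables (G : groupType) (X : topologicalType) (K : finite_cw X).
Variables (x0 : X) (th : pi1_iso G x0) (U : universal_covering th).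

Definition uskel_lt n : set (ucover U) := uproj U @^-1` skel_lt K n.

(* A choice, for each cell, of a lift of its characteristic map and of an
   orientation; [cell_chain] represents the resulting element of
   [C_n = H_n(X~_n, X~_(n-1))], and these elements are a [ZG]-basis. *)
Record cellular_basis := CellularBasis {
  cell_lift : forall n, 'I_(ncells K n) -> continuousType (disk n) (ucover U);
  cell_liftP : forall n i x, uproj U (@cell_lift n i x) = @char_map X K n i x;
  cell_orient : forall n, 'I_(ncells K n) -> chain n (disk n);
  cell_orientP : forall n i, disk_generator (@cell_orient n i)
}.

Definition cell_chain (b : cellular_basis) n (i : 'I_(ncells K n)) :
    chain n (ucover U) :=
  push (cell_lift b i) (cell_orient b i).

Definition gr_act (a : group_ring G) k (c : chain k (ucover U)) :
    chain k (ucover U) :=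
  fglift (fun g => push (deck U g) c) a.

(* [c] is the matrix, in the basis [b], of the differential
   [H_(n+1)(X~_(n+1), X~_n) -> H_n(X~_n, X~_(n-1)), [z] |-> [bd z]]. *)
Definition cellular_differential (b : cellular_basis)
    (c : forall n, 'M[group_ring G]_(ncells K n.+1, ncells K n)) : Prop :=
  forall n (i : 'I_(ncells K n.+1)),
    @rel_homologous (ucover U) (uskel_lt n.+1) (uskel_lt n) n
      (bd (cell_chain b i)) (\sum_j gr_act (c n i j) (cell_chain b j)).

End Cellular.

(* The next two notions depend neither on the universal covering nor on the
   cellular basis; the matrix [c] is determined by [b], as the cells form a
   basis, so that the existential quantifiers express "for some, equivalently
   any, choice". The class in [is_universal_torsion] is likewise independent of
   the weak chain contraction, hence at most one [w] satisfies
   [has_universal_torsion]. *)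
Definition l2_acyclic_cw (G : groupType) (X : topologicalType)
    (K : finite_cw X) (x0 : X) (th : pi1_iso G x0) : Prop :=
  exists (U : universal_covering th) (b : cellular_basis K U) c,
    [/\ cellular_differential b c, is_fbf_complex c & l2_acyclic R c].

Definition has_universal_torsion (G : groupType) (X : topologicalType)
    (K : finite_cw X) (x0 : X) (th : pi1_iso G x0) (w : Whw R G) : Prop :=
  exists (U : universal_covering th) (b : cellular_basis K U) c,
    [/\ cellular_differential b c, is_fbf_complex c, l2_acyclic R c &
        exists x, is_universal_torsion c x /\ w = K1wt_to_Whw x].

End CW.

(* Main.v *)
(* Fix a connected finite L2-acyclic complex X with fundamental group pi. Every
   element of the weak Whitehead group, in particular the difference between the
   prescribed class and the torsion of X, has the form [A] - [B] for square
   matrices A and B over the group ring which are weak isomorphisms. For a large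
   even n, trivial spheres of dimensions n and n+1 are wedged to X, one for each
   row of A, respectively of B, and then cells of dimensions n+1 and n+2 are
   attached whose boundaries over the spheres are given by A and B. The resulting Y
   retracts onto X, has the same fundamental group, and its universal covering is
   the pullback of that of X along the retraction. The cellular complex of Y is the
   direct sum of that of X and of the complexes A in degrees n+1, n and B in degrees
   n+2, n+1; these are L2-acyclic and contribute [A] - [B] to the torsion.

   A row of a matrix is a signed sum of group elements times basis vectors. The
   boundary of the attached cell is a simplex having disjoint corners, one for each
   term: a corner is mapped along a loop representing the group element and then
   over the sphere, and the sign is the parity of the index of the face containing
   the corner; n is taken large enough for there to be room for all terms.

   On the analytic side, if A is injective then A A^* is a weak isomorphism, which
   makes the Laplacian of X a weak chain contraction together with the adjoint of
   the differential. *)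

Require Import Defs.
From HB Require Import structures.
From mathcomp Require Import all_boot all_order all_algebra.
From mathcomp Require Import perm generic_quotient ring_quotient complex.
From mathcomp Require Import all_classical all_reals topology normedtype ereal esum sequences.
From mathcomp.multinomials Require Import freeg.
From mathcomp Require Import ring lra zify realfun derive.
From Stdlib Require Import Eqdep_dec.
Set Implicit Arguments.
Unset Strict Implicit.
Unset Printing Implicit Defensive.

Import Order.TTheory GRing.Theory Num.Theory.
Import numFieldNormedType.Exports.

Local Open Scope classical_set_scope.
Local Open Scope quotient_scope.
Local Open Scope ring_scope.

(** Cells enter the statement only through singular chains, so an oriented simplex has to be shown
    to generate the homology of a disk modulo its sphere; small simplices and an excision inside the
    boundary of the simplex serve this purpose alone. Van Kampen's theorem is bypassed: in a cell of
    dimension at least 2 a path can be pushed off the centre and then radially out. With the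
    retraction this gives the fundamental group of Y, and it makes the pulled back covering simply
    connected.

    Evenness of n settles a sign: a matrix counts positively when its spheres have even dimension. A
    class [f] of a map between different modules asks for a bijection of bases, hence for equal
    ranks on both sides of a weak isomorphism; this is read off integer traces of powers.
    Contractions are chosen with gamma gamma = 0. Then (uc + gamma) squared is u squared, and this
    makes the odd-to-even part a weak isomorphism and lets the torsion of a direct sum be computed
    block by block. *)

Section TopBasics.
Variable R : realType.

Lemma sum_continuous (T : topologicalType) (I : Type) (r : seq I) (P : pred I)
    (F : I -> T -> R) : (forall i, P i -> continuous (F i)) ->
  continuous (fun x => \sum_(i <- r | P i) F i x).
Proof.
move=> Fc; elim: r => [|i r IH].
  have -> : (fun x => \sum_(i <- [::] | P i) F i x) = cst 0.
    by apply/funext => x; rewrite big_nil.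
  exact: cst_continuous.
have -> : (fun x => \sum_(j <- i :: r | P j) F j x) = (fun x =>
    if P i then F i x + \sum_(j <- r | P j) F j x else \sum_(j <- r | P j) F j x).
  by apply/funext => x; rewrite big_cons.
case Pi: (P i) => // x; apply: cvgD; last exact: IH.
exact: Fc.
Qed.

Lemma pair_continuous_at (T U V : topologicalType) (f : T -> U) (g : T -> V) x :
  {for x, continuous f} -> {for x, continuous g} ->
  {for x, continuous (fun t => (f t, g t))}.
Proof. by move=> fc gc; apply: cvg_pair. Qed.

Lemma pair_continuous (T U V : topologicalType) (f : T -> U) (g : T -> V) :
  continuous f -> continuous g -> continuous (fun t => (f t, g t)).
Proof. by move=> fc gc x; apply: pair_continuous_at; [exact: fc|exact: gc]. Qed.

Lemma comp_continuous (T U V : topologicalType) (f : T -> U) (g : U -> V) :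
  continuous f -> continuous g -> continuous (fun t => g (f t)).
Proof.
by move=> fc gc x; apply: (@continuous_comp _ _ _ f g); [exact: fc|exact: gc].
Qed.

Lemma fst_continuous (U V : topologicalType) : continuous (@fst U V).
Proof. by move=> x; exact: cvg_fst. Qed.

Lemma snd_continuous (U V : topologicalType) : continuous (@snd U V).
Proof. by move=> x; exact: cvg_snd. Qed.

Lemma row_cvg (T : Type) (F : set_system T) (FF : Filter F) n (f : T -> 'rV[R]_n) (l : 'rV[R]_n) :
  (forall j, f t ord0 j @[t --> F] --> l ord0 j) -> f t @[t --> F] --> l.
Proof.
move=> fc A [P PN PA].
suff : \forall y \near F, forall a b, P a b (f y a b).
  by apply: filterS => y Py; exact: PA.
apply: (@filter_forall _ _ (fun a y => forall b, P a b (f y a b)) _ FF) => a.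
apply: (@filter_forall _ _ (fun b y => P a b (f y a b)) _ FF) => b.
by have := fc b _ (PN ord0 b); rewrite (ord1 a).
Qed.

Lemma row_continuous (T : topologicalType) n (f : T -> 'rV[R]_n) :
  (forall j, continuous (fun t => f t ord0 j)) -> continuous f.
Proof. by move=> fc x; apply: row_cvg => j; exact: fc. Qed.

Lemma subtype_cvg (T : Type) (X : topologicalType) (A : set X) (F : set_system T)
    (FF : Filter F) (f : T -> set_type A) (l : set_type A) :
  set_val (f t) @[t --> F] --> set_val l -> f t @[t --> F] --> l.
Proof.
move=> fc C [D [[D' oD' DD'] Dl DC]].
have /fc : nbhs (set_val l) D'.
  by rewrite nbhsE; exists D' => //; split => //; move: Dl; rewrite -DD'.
move=> h; apply: (@filterS _ F FF (fun t => D' (set_val (f t)))) => // t D't.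
by apply: DC; rewrite -DD'.
Qed.

Lemma subtype_continuous (T X : topologicalType) (A : set X)
    (f : T -> set_type A) : continuous (set_val \o f) -> continuous f.
Proof. by move=> fc; exact: (@continuous_comp_initial _ _ _ set_val). Qed.

Lemma subtype_val_continuous (X : topologicalType) (A : set X) :
  continuous (set_val : set_type A -> X).
Proof. exact: initial_continuous. Qed.

Lemma row_coord_continuous n (j : 'I_n) :
  continuous (fun x : 'rV[R]_n => x ord0 j).
Proof. exact: coord_continuous. Qed.

Lemma subtype_compact (X : topologicalType) (A : set X) :
  compact A -> compact [set: set_type A].
Proof.
move=> cA F PF _; have PG : ProperFilter (set_val @ F) by exact: fmap_proper_filter.
have FA : (set_val @ F) A.
  by apply: (@filterS _ F _ setT) => [x _|]; [exact: set_valP|exact: filterT].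
have [p [Ap cp]] := cA _ PG FA.
exists (SigSub (mem_set Ap)); split=> // B C FB /= nC.
have [D [[D' oD' DD'] Dp DC]] := nC.
have : (set_val @` B) `&` D' !=set0.
  apply: cp.
    by move: FB; apply: (@filterS _ F) => x Bx /=; exists x.
  rewrite nbhsE; exists D' => //; split=> //.
  by move: Dp; rewrite -DD'.
move=> [_ [[x Bx <-] D'x]]; exists x; split=> //.
by apply: DC; rewrite -DD'.
Qed.

Definition sx k (t : simplex R k) (i : 'I_k.+1) : R :=
  (set_val t : 'rV[R]_k.+1) ord0 i.

Lemma sx_continuous k (i : 'I_k.+1) : continuous (fun t : simplex R k => sx t i).
Proof.
move=> t; apply: (@continuous_comp _ _ _ set_val (fun x : 'rV[R]_k.+1 => x ord0 i)).
  exact: subtype_val_continuous.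
exact: row_coord_continuous.
Qed.

Lemma sx_ge0 k (t : simplex R k) i : 0 <= sx t i.
Proof. by case: (set_valP t) => + _; apply. Qed.

Lemma sx_sum k (t : simplex R k) : \sum_i sx t i = 1.
Proof. by case: (set_valP t). Qed.

Lemma sx_le1 k (t : simplex R k) i : sx t i <= 1.
Proof.
rewrite -(sx_sum t) (bigD1 i) //= lerDl.
by apply: sumr_ge0 => j _; exact: sx_ge0.
Qed.

Lemma sxP k (s t : simplex R k) : sx s =1 sx t -> s = t.
Proof.
move=> st; apply: val_inj; apply/rowP => i; exact: st.
Qed.

Lemma simplex_continuous (T : topologicalType) k (f : T -> simplex R k) :
  (forall i, continuous (fun t => sx (f t) i)) -> continuous f.
Proof. by move=> fc; apply: subtype_continuous; apply: row_continuous. Qed.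

Lemma simplex_cvg (T : Type) (F : set_system T) (FF : Filter F) k
    (f : T -> simplex R k) (l : simplex R k) :
  (forall i, sx (f t) i @[t --> F] --> sx l i) -> f t @[t --> F] --> l.
Proof. by move=> fc; apply: subtype_cvg; apply: row_cvg. Qed.

Definition mksx_row k (x : 'I_k.+1 -> R) : 'rV[R]_k.+1 := 
  if `[< std_simplex (\row_i x i) >] then \row_i x i else delta_mx ord0 ord0.

Lemma mksx_rowP k (x : 'I_k.+1 -> R) : std_simplex (mksx_row x).
Proof.
rewrite /mksx_row; case: ifPn => [/asboolP //|_]; split=> [i|].
  by rewrite mxE ler0n.
rewrite (bigD1 ord0) //= mxE !eqxx big1 ?addr0 // => i /negPf i0.
by rewrite mxE i0 andbF.
Qed.

(* Junk value: the vertex [0] when [x] is not a point of the simplex. *)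
Definition mksx k (x : 'I_k.+1 -> R) : simplex R k := SigSub (mem_set (mksx_rowP x)).

Lemma mksxE k (x : 'I_k.+1 -> R) i :
  (forall i, 0 <= x i) -> \sum_i x i = 1 -> sx (mksx x) i = x i.
Proof.
move=> x0 x1; rewrite -[LHS]/(mksx_row x ord0 i) /mksx_row asboolT ?mxE //.
by split=> [j|]; [rewrite mxE|rewrite -x1; apply: eq_bigr => j _; rewrite mxE].
Qed.

Lemma simplex_compact k : compact [set: simplex R k].
Proof.
apply: subtype_compact; apply: bounded_closed_compact; last first.
  have -> : @std_simplex R k = (\bigcap_(i in [set: 'I_k.+1]) [set x | 0 <= x ord0 i])
      `&` [set x | \sum_i x ord0 i = 1].
    by apply/seteqP; split=> x /= [A B]; split=> // i; [move=> _; exact: A|exact: A].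
  apply: closedI.
    apply: closed_bigI => i _.
    by apply: (@preimage_closed _ _ _ [set y : R | 0 <= y]);
      [move=> x _; exact: row_coord_continuous|exact: closed_ge].
  apply: (@preimage_closed _ _ (fun x : 'rV[R]_k.+1 => \sum_i x ord0 i) [set y : R | y = 1]);
    last exact: closed_eq.
  by move=> x _; apply: sum_continuous => i _; exact: row_coord_continuous.
exists 1; split; first exact: ger0_real.
move=> M M1 x [x0 x1]; apply: le_trans (ltW M1).
rewrite [leLHS]mx_normrE; apply: bigmax_le => // -[i j] _ /=.
rewrite (ord1 i) ger0_norm ?x0// -x1 (bigD1 j)//= lerDl.
by apply: sumr_ge0 => l _; exact: x0.
Qed.

End TopBasics.

Arguments bd : simpl never.
Arguments push : simpl never.

(** * Singular chains and subdivision *)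

Section ChainBasics.
Variable R : realType.
Local Notation simplex := (simplex R).
Local Notation chain := (chain R).
Implicit Types Z W V : topologicalType.

Definition sing k Z (s : continuousType (simplex k) Z) : chain k Z := fgen s.

HB.instance Definition _ Z W (f : continuousType Z W) k :=
  GRing.isZmodMorphism.Build (chain k Z) (chain k W) (@push R Z W f k)
    (fglift_zmod_morphism _).

Lemma bd_zmod_morphism Z k : zmod_morphism (@bd R Z k).
Proof.
case: k => [|k]; last exact: fglift_zmod_morphism.
by move=> x y; rewrite /bd subr0.
Qed.

HB.instance Definition _ Z k :=
  GRing.isZmodMorphism.Build (chain k Z) (chain k.-1 Z) (@bd R Z k)
    (@bd_zmod_morphism Z k).

Lemma chain_extm k Z (V : zmodType) (F G : chain k Z -> V) :
  zmod_morphism F -> zmod_morphism G ->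
  (forall s, F (sing s) = G (sing s)) -> forall c, F c = G c.
Proof. by move=> FB GB FG; exact: freeg_additive_ext. Qed.

Lemma chain_sumE k Z (c : chain k Z) :
  c = \sum_(s <- dom c) coeff s c *: sing s.
Proof.
rewrite -[LHS]freeg_sumE; apply: eq_bigr => s _; apply/eqP/freeg_eqP => t.
by rewrite coeffZ !coeffU mul1r.
Qed.

(** Integer multiples are covered by sums and negatives. Confining the generators to those of [c] by
    [Q] lets support conditions enter the induction. *)
Lemma chain_ind k Z (P : chain k Z -> Prop) (Q : continuousType (simplex k) Z -> Prop) c :
  P 0 -> (forall a b, P a -> P b -> P (a + b)) -> (forall a, P a -> P (- a)) ->
  (forall s, Q s -> P (sing s)) -> (forall s, s \in dom c -> Q s) -> P c.
Proof.
move=> P0 PD PN PQ Qc; rewrite (chain_sumE c).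
have Pn n a : P a -> P (a *+ n).
  by move=> Pa; elim: n => [|n IH]; rewrite ?mulr0n// mulrS; exact: PD.
have Pz (z : int) a : P a -> P (z *: a).
  move=> Pa; rewrite -(intz z) scaler_int; case: z => n; rewrite ?NegzE ?mulrNz -?pmulrn.
    exact: Pn.
  by apply: PN; apply: Pn.
elim: (dom c) Qc => [|s r IH] Qc; first by rewrite big_nil.
rewrite big_cons; apply: PD; last by apply: IH => t tr; apply: Qc; rewrite inE tr orbT.
by apply: Pz; apply: PQ; apply: Qc; rewrite inE eqxx.
Qed.

Lemma push_sing Z W (f : continuousType Z W) k (s : continuousType (simplex k) Z) :
  push f (sing s) = sing (f \o s).
Proof. by rewrite /push liftU scale1r. Qed.

Lemma bd_sing Z k (s : continuousType (simplex k.+1) Z) :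
  bd (sing s) = \sum_(i < k.+2) (-1) ^+ i *: sing (s \o face R i).
Proof. by rewrite /bd liftU scale1r. Qed.

Lemma push_comp Z W V (f : continuousType Z W) (g : continuousType W V)
    (h : continuousType Z V) k (c : chain k Z) :
  (forall x, h x = g (f x)) -> push h c = push g (push f c).
Proof.
move=> hE; move: c; apply: chain_extm => [a b|a b|s]; rewrite ?raddfB//.
rewrite !push_sing; congr sing; apply/continuousEP => x /=; exact: hE.
Qed.

Lemma push_ext Z W (f g : continuousType Z W) k (c : chain k Z) :
  (forall x, f x = g x) -> push f c = push g c.
Proof. by move=> /continuousEP ->. Qed.

Lemma push_id Z (f : continuousType Z Z) k (c : chain k Z) :
  (forall x, f x = x) -> push f c = c.
Proof.
move=> fE; move: c; apply: chain_extm; [by move=> a b; rewrite ?raddfB..|move=> s].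
rewrite !push_sing; congr sing; apply/continuousEP => x /=; exact: fE.
Qed.

Lemma pushZ Z W (f : continuousType Z W) k (a : int) (c : chain k Z) :
  push f (a *: c) = a *: push f c.
Proof. by rewrite -(intz a) !scaler_int raddfMz. Qed.

Lemma bdZ Z k (a : int) (c : chain k Z) : bd (a *: c) = a *: bd c.
Proof. by rewrite -(intz a) !scaler_int raddfMz. Qed.

Lemma pushB Z W (f : continuousType Z W) k : {morph @push R Z W f k : a b / a - b}.
Proof. exact: raddfB. Qed.

Lemma pushD Z W (f : continuousType Z W) k : {morph @push R Z W f k : a b / a + b}.
Proof. exact: raddfD. Qed.

Lemma bdB Z k : {morph @bd R Z k : a b / a - b}.
Proof. exact: raddfB. Qed.

Lemma bdD Z k : {morph @bd R Z k : a b / a + b}.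
Proof. exact: raddfD. Qed.

Lemma push_sum Z W (f : continuousType Z W) k I (r : seq I) (P : pred I)
    (F : I -> chain k Z) :
  push f (\sum_(i <- r | P i) F i) = \sum_(i <- r | P i) push f (F i).
Proof. exact: raddf_sum. Qed.

Lemma bd_sum Z k I (r : seq I) (P : pred I) (F : I -> chain k Z) :
  bd (\sum_(i <- r | P i) F i) = \sum_(i <- r | P i) bd (F i).
Proof. exact: raddf_sum. Qed.

Lemma bd_push Z W (f : continuousType Z W) k (c : chain k Z) :
  bd (push f c) = push f (bd c).
Proof.
case: k c => [|k] c; first by rewrite /bd raddf0.
move: c; apply: chain_extm; [by move=> a b; rewrite !raddfB..|move=> s].
rewrite push_sing !bd_sing push_sum; apply: eq_bigr => i _.
by rewrite pushZ push_sing; congr (_ *: sing _); apply/continuousEP.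
Qed.

Lemma sx_face k (i : 'I_k.+2) (t : simplex k) j :
  sx (face R i t) j = if unlift i j is Some l then sx t l else 0.
Proof. by rewrite /sx /= mxE. Qed.

Lemma sx_face_lift k (i : 'I_k.+2) (t : simplex k) l :
  sx (face R i t) (fintype.lift i l) = sx t l.
Proof. by rewrite sx_face liftK. Qed.

Lemma sx_face_eq k (i : 'I_k.+2) (t : simplex k) : sx (face R i t) i = 0.
Proof. by rewrite sx_face unlift_none. Qed.

(** The simplicial identity. [i'] and [j'] are free ordinals tied to [i] and [j] by value alone, so
    that ordinals made by [inord] fit without casts. *)
Lemma face_face k (i : 'I_k.+2) (j : 'I_k.+3) (i' : 'I_k.+3) (j' : 'I_k.+2)
    (t : simplex k) : (i < j)%N -> i' = i :> nat -> j' = j.-1 :> nat ->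
  face R j (face R i t) = face R i' (face R j' t).
Proof.
move=> ij Ei Ej; apply: sxP => l.
case: (unliftP j l) => [a|] ->; last first.
  have -> : j = fintype.lift i' j'.
    by apply/val_inj; rewrite /= Ei Ej /bump; case: ltngtP ij => //; lia.
  by rewrite sx_face_eq sx_face_lift sx_face_eq.
rewrite sx_face_lift; case: (unliftP i a) => [b|] ->; last first.
  have -> : fintype.lift j i = i' by apply/val_inj; rewrite /= /bump Ei; lia.
  by rewrite !sx_face_eq.
have -> : fintype.lift j (fintype.lift i b) = fintype.lift i' (fintype.lift j' b).
  by apply/val_inj; rewrite /= /bump Ei Ej; lia.
by rewrite !sx_face_lift.
Qed.

Lemma inord_face_cond k (j : 'I_k.+3) (i : 'I_k.+2) :
  inord (inord j : 'I_k.+2) = j -> ((inord j : 'I_k.+2) < (inord i.+1 : 'I_k.+3))%N ->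
  (j <= i)%N.
Proof.
move=> /(congr1 val) /=; have lj := ltn_ord (inord j : 'I_k.+2).
have := ltn_ord i; move=> li; rewrite (inordK (m := i.+1)); last by lia.
by rewrite inordK; [move=> ->; lia|lia].
Qed.

(** Each composite of two faces occurs twice with opposite signs: [h] matches the pairs [(j, i)]
    with [j <= i] with those with [i < j]. *)
Lemma bd_bd Z k (c : chain k Z) : bd (bd c) = 0.
Proof.
case: k c => [|[|k]] // c.
move: c; apply: chain_extm => [a b|a b|s]; first by rewrite !raddfB.
  by rewrite subr0.
rewrite bd_sing bd_sum.
under eq_bigr => j _ do
  rewrite bdZ bd_sing scaler_sumr.
rewrite pair_big /=.
pose F (p : 'I_k.+3 * 'I_k.+2) := (-1) ^+ p.1 *: ((-1) ^+ p.2 *: 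
   sing ((s \o face R p.1) \o face R p.2)) : chain k Z.
rewrite -/(\sum_p F p) (bigID (fun p : 'I_k.+3 * 'I_k.+2 => (p.2 < p.1)%N)) /=.
pose h (p : 'I_k.+3 * 'I_k.+2) : 'I_k.+3 * 'I_k.+2 := (inord p.2.+1, inord p.1).
pose h' (p : 'I_k.+3 * 'I_k.+2) : 'I_k.+3 * 'I_k.+2 := (inord p.2, inord p.1.-1).
rewrite (reindex_onto h h') /=; last first.
  move=> [j i] /= ij; rewrite /h /h' /=.
  have := ltn_ord i; have := ltn_ord j => lj li.
  by congr pair; apply: val_inj; rewrite /= !inordK //; lia.
rewrite [X in X + _](_ : _ = - \sum_(p : 'I_k.+3 * 'I_k.+2 | ~~ (p.2 < p.1)%N) F p) ?addNr//.
have hE (p : 'I_k.+3 * 'I_k.+2) : ~~ (p.2 < p.1)%N ->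
  ((inord p.2.+1 : 'I_k.+3) = p.2.+1 :> nat) * ((inord p.1 : 'I_k.+2) = p.1 :> nat).
  by case: p => j i /= ij; have := ltn_ord i; have := ltn_ord j => lj li;
     rewrite !inordK //; lia.
rewrite -sumrN; apply: eq_big => [[j i]|[j i] P] /=.
  have := ltn_ord i; have := ltn_ord j => lj li.
  apply/andP/idP => [[A /eqP[B _]]|ij].
    by rewrite -leqNgt; exact: inord_face_cond B A.
  have [E1 E2] := hE (j, i) ij; rewrite /= in E1 E2; rewrite E1 E2; split; first by lia.
  by apply/eqP; congr pair; apply: val_inj => /=; rewrite ?E1 ?E2 inordK; lia.
have ij : ~~ (i < j)%N.
  move: P => /andP[A /eqP[B _]].
  by rewrite -leqNgt; exact: inord_face_cond B A.
have [/= E1 E2] := hE (j, i) ij.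
rewrite /F /= E1 E2 !scalerA -!exprD -scaleNr; congr (_ *: sing _).
  by rewrite addSn exprS mulN1r addnC.
apply/continuousEP => t /=; congr (s _).
by rewrite (@face_face _ (inord j) (inord i.+1) j i) ?E1 ?E2//; lia.
Qed.

Lemma bd_bdS Z k (c : chain k.+2 Z) : @bd R Z k.+1 (bd c) = 0.
Proof. exact: (@bd_bd Z k.+2 c). Qed.

Lemma supported0 Z (A : set Z) k : supported A (0 : chain k Z).
Proof. by move=> s; rewrite dom0. Qed.

Lemma supportedD Z (A : set Z) k (c d : chain k Z) :
  supported A c -> supported A d -> supported A (c + d).
Proof.
move=> Ac Ad s /domD_subset; rewrite mem_cat => /orP[/Ac|/Ad] //.
Qed.

Lemma supportedN Z (A : set Z) k (c : chain k Z) : supported A c -> supported A (- c).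
Proof. by move=> Ac s; rewrite domN; exact: Ac. Qed.

Lemma supportedB Z (A : set Z) k (c d : chain k Z) :
  supported A c -> supported A d -> supported A (c - d).
Proof. by move=> Ac Ad; apply: supportedD => //; exact: supportedN. Qed.

Lemma supportedZ Z (A : set Z) k (a : int) (c : chain k Z) :
  supported A c -> supported A (a *: c).
Proof. by move=> Ac s /domZ_subset; exact: Ac. Qed.

Lemma supported_sum Z (A : set Z) k I (r : seq I) (P : pred I) (F : I -> chain k Z) :
  (forall i, P i -> supported A (F i)) -> supported A (\sum_(i <- r | P i) F i).
Proof.
by move=> AF; apply: big_ind => //; [exact: supported0|exact: supportedD].
Qed.

Lemma supported_sing Z (A : set Z) k (s : continuousType (simplex k) Z) :
  (forall x, A (s x)) -> supported A (sing s).
Proof. by move=> As t; rewrite domU1 inE => /eqP ->. Qed.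

Lemma supported_additive Z W (A : set Z) (B : set W) k l
    (F : {additive chain k Z -> chain l W}) c :
  (forall s : continuousType (simplex k) Z, (forall x, A (s x)) ->
    supported B (F (sing s))) ->
  supported A c -> supported B (F c).
Proof.
move=> FB Ac; apply: (@chain_ind _ _ (fun c => supported B (F c))
  (fun s => forall x, A (s x))) => //.
- by rewrite raddf0; exact: supported0.
- by move=> a b Ba Bb; rewrite raddfD; exact: supportedD.
- by move=> a Ba; rewrite raddfN; exact: supportedN.
Qed.

Lemma supported_push Z W (A : set Z) (B : set W) (f : continuousType Z W) k
    (c : chain k Z) : (forall x, A x -> B (f x)) -> supported A c ->
  supported B (push f c).
Proof.
move=> AB; apply: supported_additive => s As.
change (supported B (push f (sing s))); rewrite push_sing.
by apply: supported_sing => x /=; apply: AB; exact: As.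
Qed.

Lemma supported_bd Z (A : set Z) k (c : chain k Z) :
  supported A c -> supported A (bd c).
Proof.
case: k c => [|k] c; first by move=> _; exact: supported0.
apply: supported_additive => s As; change (supported A (bd (sing s))).
rewrite bd_sing; apply: supported_sum => i _.
by apply: supportedZ; apply: supported_sing => x; exact: As.
Qed.

Lemma supportedS Z (A B : set Z) k (c : chain k Z) :
  A `<=` B -> supported A c -> supported B c.
Proof. by move=> AB Ac s sc x; apply: AB; exact: Ac. Qed.

Lemma supportedT Z k (c : chain k Z) : supported setT c.
Proof. by []. Qed.

Lemma supportedI Z (A B : set Z) k (c : chain k Z) :
  supported A c -> supported B c -> supported (A `&` B) c.
Proof. by move=> Ac Bc s sc x; split; [exact: Ac|exact: Bc]. Qed.

Lemma supported_pushT Z W (B : set W) (f : continuousType Z W) k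
    (c : chain k Z) : (forall x, B (f x)) -> supported B (push f c).
Proof. by move=> Bf; apply: (@supported_push _ _ setT) => // x _; exact: Bf. Qed.

End ChainBasics.

(** * Cones over chains in a contractible space *)

Section Cone.
Variable R : realType.
Local Notation simplex := (simplex R).
Local Notation chain := (chain R).

Lemma near_eq_cvg_to (T : Type) (U : topologicalType) (F : set_system T) (FF : Filter F)
    (f g : T -> U) (l : U) :
  (\forall x \near F, g x = f x) -> f x @[x --> F] --> l -> g x @[x --> F] --> l.
Proof.
move=> fg fl A /fl /= FA.
by apply: (@filterS2 _ F FF _ _ _ _ fg FA) => x /= -> .
Qed.

(* Coordinates of the point from which [t] is obtained by joining it with the
   vertex [0]; meaningless when [t] is that vertex. *)
Definition rest k (t : simplex k.+1) : simplex k :=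
  mksx (fun i => sx t (fintype.lift ord0 i) / (1 - sx t ord0)).

Lemma sx_rest k (t : simplex k.+1) i : sx t ord0 < 1 ->
  sx (rest t) i = sx t (fintype.lift ord0 i) / (1 - sx t ord0).
Proof.
move=> t1; have d0 : 0 < 1 - sx t ord0 by rewrite subr_gt0.
rewrite mksxE // => [j|]; first by rewrite divr_ge0 ?sx_ge0// ltW.
rewrite -mulr_suml; apply: (@mulIf _ (1 - sx t ord0)); first by rewrite gt_eqF.
rewrite divfK ?gt_eqF// mul1r; apply/eqP; rewrite eq_sym subr_eq addrC -(sx_sum t) big_ord_recl; exact/eqP.
Qed.

Lemma rest_face0 k (t : simplex k) : rest (face R ord0 t) = t.
Proof.
apply: sxP => i; rewrite sx_rest sx_face_eq ?ltr01//.
by rewrite subr0 divr1 sx_face_lift.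
Qed.

Lemma sx_face_lift0 k (i : 'I_k.+2) (t : simplex k.+1) :
  sx (face R (fintype.lift ord0 i) t) ord0 = sx t ord0.
Proof.
have -> : (ord0 : 'I_k.+3) = fintype.lift (fintype.lift ord0 i) (ord0 : 'I_k.+2).
  exact: val_inj.
by rewrite sx_face_lift.
Qed.

Lemma rest_face_lift k (i : 'I_k.+2) (t : simplex k.+1) : sx t ord0 < 1 ->
  rest (face R (fintype.lift ord0 i) t) = face R i (rest t).
Proof.
move=> t1; apply: sxP => j; rewrite sx_rest sx_face_lift0//.
case: (unliftP i j) => [l|] ->; last by rewrite !sx_face_eq mul0r.
rewrite [RHS]sx_face_lift sx_rest//.
have -> : fintype.lift ord0 (fintype.lift i l) =
    fintype.lift (fintype.lift ord0 i) (fintype.lift ord0 l).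
  by apply: val_inj; rewrite /= /bump /=; case: leqP; case: leqP => /=; lia.
by rewrite sx_face_lift.
Qed.

Lemma rest_cvg k (t : simplex k.+1) : sx t ord0 < 1 -> {for t, continuous (@rest k)}.
Proof.
move=> t1; apply: (@simplex_cvg _ _ _ (nbhs_filter t)) => i.
have oO : \forall x \near t, sx x ord0 < 1.
  have := @sx_continuous R k.+1 ord0 t [set y | y < 1].
  by apply; apply: open_nbhs_nbhs; split=> //; exact: open_lt.
rewrite sx_rest//.
apply: (@near_eq_cvg_to _ _ _ (nbhs_filter t)
  (fun x => sx x (fintype.lift ord0 i) / (1 - sx x ord0))).
  by apply: filterS oO => x x1; rewrite sx_rest.
apply: cvgM; first exact: sx_continuous.
apply: cvgV; first by rewrite subr_eq0 gt_eqF.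
by apply: cvgB; [exact: cvg_cst|exact: sx_continuous].
Qed.

Section ConeOn.
Variables (W : topologicalType) (kap : W * R -> W) (b : W).
Hypothesis kapC : continuous kap.
Hypothesis kap0 : forall w, kap (w, 0) = w.
Hypothesis kap1 : forall w, kap (w, 1) = b.

(** The join of [s] with the apex [b]: the vertex 0 goes to the apex, the opposite face carries [s].
    At the vertex 0 the point [rest t] is arbitrary, but [kap1] makes the value independent of
    it. *)
Definition cone_fun k (s : simplex k -> W) (t : simplex k.+1) : W :=
  kap (s (rest t), sx t ord0).

(** [rest] is not continuous at the vertex 0. There compactness of the simplex helps: near time 1
    the contraction takes all points of the image of [s] close to [b] at once. *)
Lemma cone_fun_continuous k (s : simplex k -> W) :
  continuous s -> continuous (cone_fun s).
Proof.
move=> sc t; have [t1|t1] := ltP (sx t ord0) 1.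
  apply: (@continuous_comp _ _ _ (fun x => (s (rest x), sx x ord0)) kap); last exact: kapC.
  apply: pair_continuous_at; last exact: sx_continuous.
  by apply: (@continuous_comp _ _ _ (@rest k) s); [exact: rest_cvg|exact: sc].
have {}t1 : sx t ord0 = 1 by apply/eqP; rewrite eq_le sx_le1.
rewrite /continuous_at /cone_fun t1 kap1 => A nA.
have : \forall u \near (1 : R), [set: simplex k] `<=` [set x | A (kap (s x, u))].
  have /compact_near_coveringP nc := @simplex_compact R k.
  apply: (nc _ (nbhs (1 : R)) (fun u x => A (kap (s x, u)))) => x _.
  have : {for (x, 1 : R), continuous (fun xu : simplex k * R => kap (s xu.1, xu.2))}.
    apply: (@continuous_comp _ _ _ (fun xu : simplex k * R => (s xu.1, xu.2)) kap); last exact: kapC.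
    apply: pair_continuous => //; last exact: snd_continuous.
    by apply: comp_continuous => //; exact: fst_continuous.
  by move=> h; apply: h; rewrite /= kap1.
rewrite -{1}t1 => /(@sx_continuous R k.+1 ord0 t); apply: (@filterS _ (nbhs t)) => x /= xA.
exact: xA.
Qed.

Definition cone_map k (s : continuousType (simplex k) W) :
  continuousType (simplex k.+1) W := mkcts (cone_fun_continuous (@cts_fun _ _ s)).

Definition cone k (c : chain k W) : chain k.+1 W :=
  fglift (fun s => sing (cone_map s)) c.

HB.instance Definition _ k :=
  GRing.isZmodMorphism.Build (chain k W) (chain k.+1 W) (@cone k)
    (fglift_zmod_morphism _).

Lemma cone_sing k (s : continuousType (simplex k) W) :
  cone (sing s) = sing (cone_map s).
Proof. by rewrite /cone liftU scale1r. Qed.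

Lemma coneZ k (a : int) (c : chain k W) : cone (a *: c) = a *: cone c.
Proof. by rewrite -(intz a) !scaler_int raddfMz. Qed.

Lemma cone_sum k I (r : seq I) (P : pred I) (F : I -> chain k W) :
  cone (\sum_(i <- r | P i) F i) = \sum_(i <- r | P i) cone (F i).
Proof. exact: raddf_sum. Qed.

(** The apex being vertex 0, face 0 of the cone returns [c], and the other faces are cones over the
    faces of [c] with the index, hence the sign, shifted by one. *)
Lemma bd_cone_succ k (c : chain k.+1 W) : bd (cone c) = c - cone (bd c).
Proof.
move: c; apply: chain_extm => [x y|x y|s]; rewrite ?raddfB//=.
  by rewrite addrACA.
rewrite cone_sing !bd_sing big_ord_recl expr0 scale1r; congr (_ + _).
  congr sing; apply/continuousEP => t /=.
  by rewrite /mkcts /cone_fun rest_face0 sx_face_eq kap0.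
rewrite cone_sum -sumrN; apply: eq_bigr => i _.
rewrite coneZ cone_sing -scaleNr /= exprS mulN1r; congr (_ *: sing _).
apply/continuousEP => t /=; rewrite /mkcts /cone_fun sx_face_lift0.
have [t1|t1] := ltP (sx t ord0) 1; first by rewrite rest_face_lift.
have -> : sx t ord0 = 1 by apply/eqP; rewrite eq_le sx_le1.
by rewrite !kap1.
Qed.

(** Each edge of the cone has the apex as one end, and [deg] counts these copies. This is why
    [reduced_cycle] asks for degree 0 in dimension 0. *)
Lemma bd_cone0 (c : chain 0 W) : bd (cone c) = c - deg c *: sing (cst b).
Proof.
move: c; apply: chain_extm => [x y|x y|s]; rewrite ?raddfB//=.
  by rewrite scalerBl !opprD opprK addrACA.
rewrite cone_sing bd_sing degU scale1r !big_ord_recl big_ord0 addr0 expr0 scale1r.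
rewrite expr1 scaleN1r; congr (_ - _).
  congr sing; apply/continuousEP => t /=.
  by rewrite /mkcts /cone_fun rest_face0 sx_face_eq kap0.
congr sing; apply/continuousEP => t /=.
rewrite /mkcts /cone_fun.
rewrite (_ : sx _ _ = 1) ?kap1//.
have -> : ord0 = fintype.lift (fintype.lift ord0 ord0) (ord0 : 'I_1) by exact: val_inj.
by rewrite sx_face_lift -(sx_sum t) big_ord1.
Qed.

Lemma supported_cone k (A : set W) (c : chain k W) :
  (forall w u, A w -> 0 <= u <= 1 -> A (kap (w, u))) ->
  supported A c -> supported A (cone c).
Proof.
move=> Ak; apply: supported_additive => s As.
change (supported A (cone (sing s))); rewrite cone_sing.
by apply: supported_sing => x; apply: Ak; [exact: As|rewrite sx_ge0 sx_le1].
Qed.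

End ConeOn.

(* Cycles of the augmented singular complex. *)
Definition reduced_cycle (Z : topologicalType) k (c : chain k Z) : Prop :=
  match k return chain k Z -> Prop with
  | 0 => fun c => deg c = 0
  | _ => fun c => bd c = 0
  end c.

Lemma deg_bd (Z : topologicalType) (c : chain 1 Z) : deg (bd c) = 0.
Proof.
move: c; apply: chain_extm => [x y|x y|s]; rewrite ?raddfB// ?subr0//.
rewrite bd_sing !big_ord_recl big_ord0 addr0 expr0 scale1r expr1 scaleN1r.
by rewrite raddfB /= !degU subrr.
Qed.

Lemma reduced_bd (Z : topologicalType) k (c : chain k.+1 Z) : reduced_cycle (bd c).
Proof. by case: k c => [|k] c; [exact: deg_bd|exact: (@bd_bd _ _ k.+2 c)]. Qed.

Lemma reducedB (Z : topologicalType) k (c d : chain k Z) :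
  reduced_cycle c -> reduced_cycle d -> reduced_cycle (c - d).
Proof.
by case: k c d => [|k] c d /= Hc Hd; rewrite /reduced_cycle raddfB /= Hc Hd subr0.
Qed.

Lemma reducedZ (Z : topologicalType) k (a : int) (c : chain k Z) :
  reduced_cycle c -> reduced_cycle (a *: c).
Proof.
case: k c => [|k] c /= Hc; rewrite /reduced_cycle ?bdZ ?Hc ?scaler0//.
by rewrite -(intz a) scaler_int raddfMz /= Hc mul0rz.
Qed.

Lemma bd_cone (W : topologicalType) (kap : W * R -> W) (b : W)
    (kapC : continuous kap) (kap0 : forall w, kap (w, 0) = w)
    (kap1 : forall w, kap (w, 1) = b) k (c : chain k W) :
  reduced_cycle c -> bd (cone kapC kap1 c) = c.
Proof.
case: k c => [|k] c /= Hc; first by rewrite bd_cone0// Hc scale0r subr0.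
by rewrite bd_cone_succ// Hc raddf0 subr0.
Qed.

End Cone.

(** * Barycentric subdivision and the prism operator *)

Section Subdivision.
Variable R : realType.
Local Notation simplex := (simplex R).
Local Notation chain := (chain R).
Implicit Types Z W : topologicalType.

(** Homotopies and paths are taken on all of R and clamped, so that plain continuity replaces
    continuity within the unit interval. *)
Definition clamp (u : R) : R := Num.max 0 (Num.min 1 u).

Lemma clampE u : clamp u = Num.max 0 (Num.min 1 u). Proof. by []. Qed.
Lemma clamp_ge0 u : 0 <= clamp u. Proof. by rewrite le_max lexx. Qed.
Lemma clamp_le1 u : clamp u <= 1.
Proof. by rewrite ge_max ler01 ge_min lexx. Qed.
Lemma clamp_id u : 0 <= u <= 1 -> clamp u = u.
Proof. by move=> /andP[u0 u1]; rewrite /clamp min_r// max_r. Qed.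
Lemma clamp0 : clamp 0 = 0. Proof. by rewrite clamp_id// lexx ler01. Qed.
Lemma clamp1 : clamp 1 = 1. Proof. by rewrite clamp_id// lexx ler01. Qed.

Lemma clamp_continuous : continuous clamp.
Proof.
move=> u; apply: (@continuous_max R R (fun=> 0) (fun u => Num.min 1 u)); first exact: cvg_cst.
by apply: (@continuous_min R R (fun=> 1) id); [exact: cvg_cst|exact: cvg_id].
Qed.

Lemma realD_continuous (T : topologicalType) (f g : T -> R) :
  continuous f -> continuous g -> continuous (fun t => f t + g t).
Proof. by move=> fc gc t; apply: cvgD; [exact: fc|exact: gc]. Qed.

Lemma realB_continuous (T : topologicalType) (f g : T -> R) :
  continuous f -> continuous g -> continuous (fun t => f t - g t).
Proof. by move=> fc gc t; apply: cvgB; [exact: fc|exact: gc]. Qed.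

Lemma realM_continuous (T : topologicalType) (f g : T -> R) :
  continuous f -> continuous g -> continuous (fun t => f t * g t).
Proof. by move=> fc gc t; apply: cvgM; [exact: fc|exact: gc]. Qed.

Lemma realcst_continuous (T : topologicalType) (a : R) : continuous (fun _ : T => a).
Proof. by move=> t; exact: cvg_cst. Qed.

Definition lin k (b t : simplex k) (u : R) : simplex k :=
  mksx (fun i => (1 - clamp u) * sx t i + clamp u * sx b i).

Lemma sx_lin k (b t : simplex k) u i :
  sx (lin b t u) i = (1 - clamp u) * sx t i + clamp u * sx b i.
Proof.
rewrite mksxE // => [j|].
  by rewrite addr_ge0// mulr_ge0 ?sx_ge0 ?clamp_ge0// subr_ge0 clamp_le1.
by rewrite big_split /= -!mulr_sumr !sx_sum; ring.
Qed.

Lemma lin0 k (b t : simplex k) : lin b t 0 = t.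
Proof. by apply: sxP => i; rewrite sx_lin clamp0; ring. Qed.

Lemma lin1 k (b t : simplex k) : lin b t 1 = b.
Proof. by apply: sxP => i; rewrite sx_lin clamp1; ring. Qed.

Lemma lin_continuous k (b : simplex k) :
  continuous (fun tu : simplex k * R => lin b tu.1 tu.2).
Proof.
have cc : continuous (fun tu : simplex k * R => clamp tu.2).
  by apply: comp_continuous; [exact: snd_continuous|exact: clamp_continuous].
move=> x; apply: (@simplex_cvg _ _ _ (nbhs_filter x)) => i.
under eq_fun do rewrite sx_lin; rewrite sx_lin.
apply: (@realD_continuous _ (fun tu : simplex k * R => (1 - clamp tu.2) * sx tu.1 i)
  (fun tu => clamp tu.2 * sx b i)).
  apply: realM_continuous; first by apply: realB_continuous => //; exact: realcst_continuous.
  apply: (@comp_continuous _ _ _ fst (fun t : simplex k => sx t i)).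
    exact: fst_continuous.
  exact: sx_continuous.
by apply: realM_continuous => //; exact: realcst_continuous.
Qed.

Lemma linP0 k (b : simplex k) (t : simplex k) : (fun tu => lin b tu.1 tu.2) (t, 0) = t.
Proof. exact: lin0. Qed.
Lemma linP1 k (b : simplex k) (t : simplex k) : (fun tu => lin b tu.1 tu.2) (t, 1) = b.
Proof. exact: lin1. Qed.

Definition lcone k (b : simplex k) l : chain l (simplex k) -> chain l.+1 (simplex k) :=
  cone (@lin_continuous k b) (linP1 b) (k := l).

Lemma bd_lcone k (b : simplex k) l (c : chain l (simplex k)) :
  reduced_cycle c -> bd (lcone b c) = c.
Proof. by apply: bd_cone => t; exact: linP0. Qed.

(** A contraction of the prism to [(b, 0)]. As the second factor of the prism is the whole line,
    that coordinate may simply be scaled. *)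
Definition linR k (b : simplex k) (x : (simplex k * R) * R) : simplex k * R :=
  (lin b x.1.1 x.2, (1 - x.2) * x.1.2).

Lemma linR0 k (b : simplex k) x : linR b (x, 0) = x.
Proof. by case: x => t u; rewrite /linR /= lin0 subr0 mul1r. Qed.
Lemma linR1 k (b : simplex k) x : linR b (x, 1) = (b, 0).
Proof. by rewrite /linR lin1 subrr mul0r. Qed.

Lemma linR_continuous k (b : simplex k) : continuous (linR b).
Proof.
apply: pair_continuous.
  apply: (@comp_continuous _ _ _ (fun x : (simplex k * R) * R => (x.1.1, x.2))
    (fun tu : simplex k * R => lin b tu.1 tu.2)); last exact: lin_continuous.
  apply: pair_continuous; last exact: snd_continuous.
  by apply: comp_continuous; exact: fst_continuous.
apply: realM_continuous.
  by apply: realB_continuous; [exact: realcst_continuous|exact: snd_continuous].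
by apply: comp_continuous; [exact: fst_continuous|exact: snd_continuous].
Qed.

Definition rcone k (b : simplex k) l :
    chain l (simplex k * R)%type -> chain l.+1 (simplex k * R)%type :=
  cone (@linR_continuous k b) (@linR1 k b) (k := l).

Lemma bd_rcone k (b : simplex k) l (c : chain l (simplex k * R)%type) :
  reduced_cycle c -> bd (rcone b c) = c.
Proof. by apply: bd_cone => t; exact: linR0. Qed.

Definition bary k : simplex k := mksx (fun _ => k.+1%:R^-1).

Lemma sx_bary k i : sx (bary k) i = k.+1%:R^-1.
Proof.
rewrite mksxE // => *; rewrite ?invr_ge0 ?ler0n//.
by rewrite sumr_const card_ord -[_ *+ _]mulr_natr mulVf// pnatr_eq0.
Qed.

Definition iota_sx k : chain k (simplex k) := sing idfun.

Fixpoint sdi k : chain k (simplex k) :=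
  match k with
  | 0 => iota_sx 0
  | k'.+1 => lcone (bary k'.+1) (\sum_(i < k'.+2) (-1) ^+ i *: push (face R i) (sdi k'))
  end.

Definition sd Z k (c : chain k Z) : chain k Z :=
  fglift (fun s => push s (sdi k)) c.

HB.instance Definition _ Z k :=
  GRing.isZmodMorphism.Build (chain k Z) (chain k Z) (@sd Z k)
    (fglift_zmod_morphism _).

Lemma sd_sing Z k (s : continuousType (simplex k) Z) : sd (sing s) = push s (sdi k).
Proof. by rewrite /sd liftU scale1r. Qed.

Lemma sdZ Z k (a : int) (c : chain k Z) : sd (a *: c) = a *: sd c.
Proof. by rewrite -(intz a) !scaler_int raddfMz. Qed.

Lemma sd_sum Z k I (r : seq I) (P : pred I) (F : I -> chain k Z) :
  sd (\sum_(i <- r | P i) F i) = \sum_(i <- r | P i) sd (F i).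
Proof. exact: raddf_sum. Qed.

Lemma sd_push Z W (f : continuousType Z W) k (c : chain k Z) :
  sd (push f c) = push f (sd c).
Proof.
move: c; apply: chain_extm => [a b|a b|s]; rewrite ?raddfB//.
rewrite push_sing !sd_sing; exact: push_comp.
Qed.

Lemma iota_push Z k (s : continuousType (simplex k) Z) : sing s = push s (iota_sx k).
Proof. by rewrite push_sing; congr sing; apply/continuousEP. Qed.

Lemma sdi_succ k : sdi k.+1 = lcone (bary k.+1) (sd (bd (iota_sx k.+1))).
Proof.
rewrite bd_sing sd_sum /=; congr lcone; apply: eq_bigr => i _.
by rewrite sdZ sd_sing; congr (_ *: _); apply: push_ext.
Qed.

Lemma sd_dim0 Z (c : chain 0 Z) : sd c = c.
Proof.
move: c; apply: chain_extm => [a b|a b|s]; rewrite ?raddfB//.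
by rewrite sd_sing iota_push.
Qed.

Lemma bd_sd Z k (c : chain k Z) : bd (sd c) = sd (bd c).
Proof.
case: k c => [|k] c; first by rewrite /bd raddf0.
elim: k Z c => [|k IH] Z c; move: c; apply: chain_extm => [a b|a b|s]; rewrite ?raddfB//.
  rewrite sd_sing bd_push sdi_succ bd_lcone; last first.
    by rewrite /reduced_cycle sd_dim0; exact: deg_bd.
  by rewrite -sd_push -bd_push -iota_push.
rewrite sd_sing bd_push sdi_succ bd_lcone; last first.
  by rewrite /reduced_cycle IH bd_bdS raddf0.
by rewrite -sd_push -bd_push -iota_push.
Qed.

Lemma reduced_sd Z k (c : chain k Z) : reduced_cycle c -> reduced_cycle (sd c).
Proof.
by case: k c => [|k] c; rewrite /reduced_cycle ?sd_dim0// bd_sd => ->; rewrite raddf0.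
Qed.

Lemma supported_sd Z k (A : set Z) (c : chain k Z) : supported A c -> supported A (sd c).
Proof.
apply: supported_additive => s As; change (supported A (sd (sing s))).
by rewrite sd_sing; exact: supported_pushT.
Qed.

Definition incl_at Z (a : R) (x : Z) : Z * R := (x, a).
Lemma incl_at_continuous Z a : continuous (@incl_at Z a).
Proof. by apply: pair_continuous; [move=> x; exact: cvg_id|exact: realcst_continuous]. Qed.
HB.instance Definition _ Z a := isContinuous.Build _ _ _ (@incl_at_continuous Z a).

Definition timesR Z W (f : Z -> W) (x : Z * R) : W * R := (f x.1, x.2).
Lemma timesR_continuous Z W (f : continuousType Z W) : continuous (timesR f).
Proof.
apply: pair_continuous; last exact: snd_continuous.
by apply: comp_continuous; [exact: fst_continuous|exact: cts_fun].
Qed.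
HB.instance Definition _ Z W (f : continuousType Z W) :=
  isContinuous.Build _ _ _ (@timesR_continuous Z W f).

Definition tbd k (t : chain k.+1 (simplex k * R)%type) : chain k.+1 (simplex k.+1 * R)%type :=
  \sum_(i < k.+2) (-1) ^+ i *: push (timesR (face R i)) t.

(** Acyclic models: the chain with a prescribed boundary is obtained by coning off that boundary in
    the contractible prism. That the prescribed boundary is a cycle is shown within [bd_tc0] and
    [bd_tcS]. *)
Fixpoint ti k : chain k.+1 (simplex k * R)%type :=
  match k return chain k.+1 (simplex k * R)%type with
  | 0 => rcone (bary 0) (push (incl_at 1) (sdi 0) - push (incl_at 0) (iota_sx 0))
  | k'.+1 => rcone (bary k'.+1) (push (incl_at 1) (sdi k'.+1)
       - push (incl_at 0) (iota_sx k'.+1) - tbd (ti k'))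
  end.

(* The chain homotopy from the bottom of [Z * R] to the subdivided top. *)
Definition tc Z k (c : chain k Z) : chain k.+1 (Z * R)%type :=
  fglift (fun s : continuousType (simplex k) Z => push (timesR s) (ti k)) c.

HB.instance Definition _ Z k :=
  GRing.isZmodMorphism.Build (chain k Z) (chain k.+1 (Z * R)%type) (@tc Z k)
    (fglift_zmod_morphism _).

Lemma tc_sing Z k (s : continuousType (simplex k) Z) :
  tc (sing s) = push (timesR s) (ti k).
Proof. by rewrite /tc liftU scale1r. Qed.

Lemma tcZ Z k (a : int) (c : chain k Z) : tc (a *: c) = a *: tc c.
Proof. by rewrite -(intz a) !scaler_int raddfMz. Qed.

Lemma tc_sum Z k I (r : seq I) (P : pred I) (F : I -> chain k Z) :
  tc (\sum_(i <- r | P i) F i) = \sum_(i <- r | P i) tc (F i).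
Proof. exact: raddf_sum. Qed.

Lemma tc_push Z W (f : continuousType Z W) k (c : chain k Z) :
  tc (push f c) = push (timesR f) (tc c).
Proof.
move: c; apply: chain_extm => [a b|a b|s]; rewrite ?raddfB//.
rewrite push_sing !tc_sing; exact: push_comp.
Qed.

Lemma tbdE k : tbd (ti k) = tc (bd (iota_sx k.+1)).
Proof.
rewrite bd_sing tc_sum; apply: eq_bigr => i _.
by rewrite tcZ tc_sing; congr (_ *: _); apply: push_ext.
Qed.

Lemma push_incl_timesR Z W (f : continuousType Z W) a k (c : chain k Z) :
  push (timesR f) (push (incl_at a) c) = push (incl_at a) (push f c).
Proof.
by rewrite -(@push_comp _ _ _ _ _ _ (timesR f \o incl_at a))// (@push_comp _ _ _ _ f (incl_at a)).
Qed.

Lemma deg_push Z W (f : continuousType Z W) (c : chain 0 Z) : deg (push f c) = deg c.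
Proof.
move: c; apply: chain_extm => [a b|a b|s]; rewrite ?raddfB//.
by rewrite push_sing !degU.
Qed.

Lemma bd_tc0 Z (c : chain 0 Z) : bd (tc c) = push (incl_at 1) (sd c) - push (incl_at 0) c.
Proof.
move: c; apply: chain_extm => [a b|a b|s]; rewrite ?raddfB//=.
  by rewrite addrACA.
rewrite tc_sing bd_push /= bd_rcone; last first.
  by rewrite /reduced_cycle raddfB /= !deg_push !degU subrr.
by rewrite raddfB /= sd_sing !push_incl_timesR -iota_push.
Qed.

Lemma sdiE k : sdi k = sd (iota_sx k).
Proof. by rewrite sd_sing push_id. Qed.

Lemma tiS k : ti k.+1 = rcone (bary k.+1) (push (incl_at 1) (sdi k.+1)
  - push (incl_at 0) (iota_sx k.+1) - tbd (ti k)).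
Proof. by []. Qed.

Lemma zmod6 (V : zmodType) (a b c d e f : V) :
  a - b + (- c - - d) + (- e - - f) = a - c - e + (- b - - d - - f).
Proof. by rewrite [a - b + _]addrACA (addrACA (a - c)). Qed.

(** By naturality only the identity simplex matters, where the cone formula applies once the base of
    the cone is a cycle; the same formula one degree lower shows that it is. *)
Lemma bd_tcS Z k (c : chain k.+1 Z) :
  bd (tc c) = push (incl_at 1) (sd c) - push (incl_at 0) c - tc (bd c).
Proof.
elim: k Z c => [|k IH] Z c; move: c; apply: chain_extm => [a b|a b|s];
  rewrite ?raddfB//=.
- exact: zmod6.
- rewrite tc_sing bd_push tiS bd_rcone; last first.
    rewrite tbdE sdiE /reduced_cycle !bdB !bd_push bd_tc0 bd_sd.
    by rewrite subrr.
  rewrite !pushB tbdE !push_incl_timesR -iota_push.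
  by rewrite -tc_push -(bd_push s (iota_sx 1)) -iota_push sd_sing.
- exact: zmod6.
rewrite tc_sing bd_push tiS bd_rcone; last first.
  rewrite tbdE sdiE /reduced_cycle !bdB !bd_push IH bd_sd bd_bdS raddf0 subr0.
  by rewrite subrr.
rewrite !pushB tbdE !push_incl_timesR -iota_push.
by rewrite -tc_push -(bd_push s (iota_sx k.+2)) -iota_push sd_sing.
Qed.

Lemma bd_tc_cycle Z k (c : chain k Z) : bd c = 0 ->
  bd (tc c) = push (incl_at 1) (sd c) - push (incl_at 0) c.
Proof.
by case: k c => [|k] c c0; rewrite ?bd_tc0// bd_tcS c0 raddf0 subr0.
Qed.

Lemma supported_tc Z k (A : set Z) (c : chain k Z) :
  supported A c -> supported (A `*` setT) (tc c).
Proof.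
apply: supported_additive => s As; change (supported (A `*` setT) (tc (sing s))).
by rewrite tc_sing; apply: supported_pushT => x; split => //; exact: As.
Qed.

Lemma homotopy_sd Z W (F : continuousType (Z * R)%type W) (f0 f1 : continuousType Z W)
    k (c : chain k Z) :
  (forall x, F (x, 0) = f0 x) -> (forall x, F (x, 1) = f1 x) -> bd c = 0 ->
  bd (push F (tc c)) = push f1 (sd c) - push f0 c.
Proof.
move=> F0 F1 c0; rewrite bd_push bd_tc_cycle// pushB.
rewrite (@push_comp R _ _ _ (incl_at 1) F f1); last by move=> x; rewrite F1.
by rewrite (@push_comp R _ _ _ (incl_at 0) F f0) => // x; rewrite F0.
Qed.

Definition proj1R Z (x : Z * R) : Z := x.1.
Lemma proj1R_continuous Z : continuous (@proj1R Z).
Proof. exact: fst_continuous. Qed.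
HB.instance Definition _ Z := isContinuous.Build _ _ _ (@proj1R_continuous Z).

Lemma sd_homologous Z (A : set Z) k (c : chain k Z) : bd c = 0 -> supported A c ->
  exists2 e : chain k.+1 Z, supported A e & bd e = sd c - c.
Proof.
move=> c0 Ac; exists (push (@proj1R Z) (tc c)).
  by apply: supported_push (supported_tc Ac) => x [].
by rewrite (@homotopy_sd _ _ _ idfun idfun)// !push_id.
Qed.

Lemma iter_sd_homologous Z (A : set Z) k (c : chain k Z) m : bd c = 0 -> supported A c ->
  exists2 e : chain k.+1 Z, supported A e & bd e = iter m (@sd Z k) c - c.
Proof.
move=> c0 Ac; elim: m => [|m [e Ae be]]; first by exists 0; [exact: supported0|rewrite raddf0 subrr].
have Am : supported A (iter m (@sd Z k) c) by elim: m {e Ae be} => //= m; exact: supported_sd.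
have bm : bd (iter m (@sd Z k) c) = 0.
  by elim: m {e Ae be Am} => //= m IH; rewrite bd_sd IH raddf0.
have [e' Ae' be'] := sd_homologous bm Am.
exists (e + e'); first exact: supportedD.
by rewrite raddfD /= be be' addrC addrA subrK.
Qed.

End Subdivision.

(** * Small simplices after iterated subdivision *)

Section SmallChains.
Variable R : realType.
Local Notation simplex := (simplex R).
Local Notation chain := (chain R).
Implicit Types Z W : topologicalType.

Definition all_in Z k (Q : (simplex k -> Z) -> Prop) (c : chain k Z) : Prop :=
  forall s : continuousType (simplex k) Z, s \in dom c -> Q s.

Lemma all_in0 Z k (Q : (simplex k -> Z) -> Prop) : all_in Q (0 : chain k Z).
Proof. by move=> s; rewrite dom0. Qed.

Lemma all_inD Z k (Q : (simplex k -> Z) -> Prop) (c d : chain k Z) :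
  all_in Q c -> all_in Q d -> all_in Q (c + d).
Proof. by move=> Ac Ad s /domD_subset; rewrite mem_cat => /orP[/Ac|/Ad]. Qed.

Lemma all_inN Z k (Q : (simplex k -> Z) -> Prop) (c : chain k Z) :
  all_in Q c -> all_in Q (- c).
Proof. by move=> Ac s; rewrite domN; exact: Ac. Qed.

Lemma all_in_sing Z k (Q : (simplex k -> Z) -> Prop) (s : continuousType (simplex k) Z) :
  Q s -> all_in Q (sing s).
Proof. by move=> Qs t; rewrite domU1 inE => /eqP ->. Qed.

Lemma all_in_additive Z W k l (Q : (simplex k -> Z) -> Prop) (P : (simplex l -> W) -> Prop)
    (F : {additive chain k Z -> chain l W}) c :
  (forall s : continuousType (simplex k) Z, Q s -> all_in P (F (sing s))) ->
  all_in Q c -> all_in P (F c).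
Proof.
move=> FB Ac; apply: (@chain_ind R _ _ (fun c => all_in P (F c)) Q) => //.
- by rewrite raddf0; exact: all_in0.
- by move=> a b Ba Bb; rewrite raddfD; exact: all_inD.
- by move=> a Ba; rewrite raddfN; exact: all_inN.
Qed.

Lemma all_in_sum Z k (Q : (simplex k -> Z) -> Prop) I (r : seq I) (P : pred I)
    (F : I -> chain k Z) :
  (forall i, P i -> all_in Q (F i)) -> all_in Q (\sum_(i <- r | P i) F i).
Proof. by move=> AF; apply: big_ind => //; [exact: all_in0|exact: all_inD]. Qed.

Lemma all_in_push Z W k (Q : (simplex k -> Z) -> Prop)
    (P : (simplex k -> W) -> Prop) (f : continuousType Z W)
    (c : chain k Z) : (forall s, Q s -> P (f \o s)) -> all_in Q c ->
  all_in P (push f c).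
Proof.
move=> AB; apply: all_in_additive => s As.
change (all_in P (push f (sing s))); rewrite push_sing.
by apply: all_in_sing; exact: AB.
Qed.

Lemma all_inZ Z k (Q : (simplex k -> Z) -> Prop) (a : int) (c : chain k Z) :
  all_in Q c -> all_in Q (a *: c).
Proof. by move=> Ac s /domZ_subset; exact: Ac. Qed.

(** The l1-distance: the simplex has diameter 2, and convex combinations are estimated by the
    triangle inequality alone. *)
Definition d1 n (x y : simplex n) : R := \sum_i `|sx x i - sx y i|.

Lemma d1_le2 n (x y : simplex n) : d1 x y <= 2.
Proof.
apply: (@le_trans _ _ (\sum_i (sx x i + sx y i))).
  apply: ler_sum => i _; rewrite (le_trans (ler_normB _ _))//.
  by rewrite !ger0_norm ?sx_ge0.
by rewrite big_split /= !sx_sum.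
Qed.

Definition affine_map k n (s : simplex k -> simplex n) (w : 'I_k.+1 -> simplex n) :=
  forall t i, sx (s t) i = \sum_j sx t j * sx (w j) i.

(** A bound on the distances between the images of vertices bounds the diameter of the whole image,
    the map being affine. *)
Definition small_map k n (e : R) (s : simplex k -> simplex n) : Prop :=
  exists2 w, affine_map s w & forall a b, d1 (w a) (w b) <= e.

(* Two points of the standard simplex differ by [d1 x y / 2] times a difference
   of two points with disjoint supports. *)
Lemma small_map_lipschitz k n e (s : simplex k -> simplex n) x y :
  small_map e s -> d1 (s x) (s y) <= d1 x y / 2 * e.
Proof.
move=> [w sw we].
pose a j := sx x j - sx y j.
pose p j := Num.max (a j) 0; pose q j := Num.max (- a j) 0.
have p0 j : 0 <= p j by rewrite le_max lexx orbT.
have q0 j : 0 <= q j by rewrite le_max lexx orbT.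
have apq j : a j = p j - q j.
  by rewrite /p /q; case: (leP (a j) 0) => ?; [rewrite max_l ?oppr_ge0|rewrite max_r ?oppr_le0 1?ltW]; lra.
have napq j : `|a j| = p j + q j.
  rewrite /p /q; case: (leP (a j) 0) => ?; [rewrite max_l ?oppr_ge0// ler0_norm|rewrite max_r ?oppr_le0 1?ltW// gtr0_norm]; lra.
have suma : \sum_j a j = 0 by rewrite /a sumrB !sx_sum subrr.
pose P := \sum_j p j.
have QP : \sum_j q j = P.
  move: suma; under eq_bigr do rewrite apq.
  by rewrite sumrB => /eqP; rewrite subr_eq0 => /eqP.
have d1P : d1 x y / 2 = P.
  by rewrite /d1; under eq_bigr do rewrite napq; rewrite big_split /= QP -/P; field.
have P0 : 0 <= P by apply: sumr_ge0.
rewrite d1P; have [Pn0|Pn0] := eqVneq P 0.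
  rewrite Pn0 mul0r /d1.
  rename Pn0 into Pz.
  have pz j : p j = 0 /\ q j = 0.
    split; apply/eqP.
      by have /eqP := Pz; rewrite psumr_eq0// => /allP/(_ j (mem_index_enum _)).
    by have /eqP := etrans QP Pz; rewrite psumr_eq0// => /allP/(_ j (mem_index_enum _)).
  rewrite big1 // => i _; rewrite !sw -sumrB big1 ?normr0// => j _.
  rewrite -mulrBl -/(a j) apq; have [-> ->] := pz j; by rewrite subrr mul0r.
have Pgt0 : 0 < P by rewrite lt_def Pn0.
rewrite -(ler_pM2l Pgt0).
(* [p j * q l] is a transport plan from the positive to the negative part of [x - y], both of mass
   [P]. It writes the difference of the images through differences of images of vertices. *)
have E i : P * (sx (s x) i - sx (s y) i) =
    \sum_j \sum_l p j * q l * (sx (w j) i - sx (w l) i).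
  rewrite !sw -sumrB.
  transitivity (P * \sum_j (p j - q j) * sx (w j) i).
    by congr (_ * _); apply: eq_bigr => j _; rewrite -mulrBl -/(a j) apq.
  transitivity (\sum_j \sum_l p j * q l * sx (w j) i - \sum_j \sum_l p j * q l * sx (w l) i); last first.
    rewrite -sumrB; apply: eq_bigr => j _; rewrite -sumrB; apply: eq_bigr => l _; ring.
  rewrite [X in _ = _ - X]exchange_big /=.
  under [X in _ = X - _]eq_bigr => j _ do rewrite -mulr_suml -mulr_sumr QP.
  under [X in _ = _ - X]eq_bigr => l _ do rewrite -mulr_suml -mulr_suml -/P.
  by rewrite -sumrB mulr_sumr; apply: eq_bigr => j _; ring.
rewrite /d1 mulr_sumr.
under eq_bigr => i _ do rewrite -{1}(ger0_norm P0) -normrM E.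
apply: (@le_trans _ _ (\sum_i \sum_j \sum_l p j * q l * `|sx (w j) i - sx (w l) i|)).
  apply: ler_sum => i _; apply: le_trans (ler_norm_sum _ _ _) _; apply: ler_sum => j _.
  apply: le_trans (ler_norm_sum _ _ _) _; apply: ler_sum => l _.
  by rewrite normrM ger0_norm// mulr_ge0.
rewrite exchange_big /=; under eq_bigr do rewrite exchange_big /=.
under eq_bigr => j _ do under eq_bigr => l _ do rewrite -mulr_sumr -/(d1 (w j) (w l)).
apply: (@le_trans _ _ (\sum_j \sum_l p j * q l * e)).
  by apply: ler_sum => j _; apply: ler_sum => l _; rewrite ler_wpM2l ?mulr_ge0.
under eq_bigr => j _ do rewrite -mulr_suml -mulr_sumr QP.
by rewrite -mulr_suml -mulr_suml -/P mulrA.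
Qed.

Lemma d1xx n (x : simplex n) : d1 x x = 0.
Proof. by rewrite /d1 big1 // => i _; rewrite subrr normr0. Qed.

Lemma small_map_ge0 k n e (s : simplex k -> simplex n) : small_map e s -> 0 <= e.
Proof. by move=> [w _ /(_ ord0 ord0)]; rewrite d1xx. Qed.

Lemma small_map_le k n e e' (s : simplex k -> simplex n) :
  e <= e' -> small_map e s -> small_map e' s.
Proof. by move=> ee' [w sw we]; exists w => // a b; exact: le_trans (we a b) ee'. Qed.

(** By [small_map_lipschitz] the map [s] multiplies distances by at most [d / 2]. *)
Lemma small_map_comp k n m d e (r : simplex k -> simplex n) (s : simplex n -> simplex m) :
  small_map e r -> small_map d s -> small_map (e / 2 * d) (s \o r).
Proof.
move=> [w rw we] ss; have d0 := small_map_ge0 ss; have [v sv vd] := ss.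
exists (fun a => s (w a)) => [t i|a b].
  transitivity (\sum_j sx (r t) j * sx (v j) i); first exact: sv.
  under eq_bigr => j _ do rewrite rw mulr_suml.
  rewrite exchange_big /=; apply: eq_bigr => j _.
  by rewrite sv mulr_sumr; apply: eq_bigr => l _; rewrite mulrA.
apply: le_trans (small_map_lipschitz _ _ ss) _.
by rewrite ler_wpM2r// ler_pM2r ?invr_gt0.
Qed.

Lemma d1_face n (i : 'I_n.+2) (x y : simplex n) : d1 (face R i x) (face R i y) = d1 x y.
Proof.
rewrite /d1 (bigD1 i) //= !sx_face_eq subrr normr0 add0r.
rewrite (reindex_onto (fintype.lift i) (fun j => odflt ord0 (unlift i j))) /=; last first.
  by move=> j; rewrite eq_sym => /unlift_some[l -> ->].
under eq_bigl => j do rewrite eq_sym neq_lift liftK eqxx.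
by apply: eq_bigr => j _; rewrite !sx_face_lift.
Qed.

Lemma small_map_face k n e (i : 'I_n.+2) (s : simplex k -> simplex n) :
  small_map e s -> small_map e (face R i \o s).
Proof.
move=> [w sw we]; exists (fun a => face R i (w a)) => [t j|a b]; last by rewrite d1_face.
rewrite /= sx_face; case: (unliftP i j) => [l|] -> /=.
  by rewrite sw; apply: eq_bigr => a _; rewrite sx_face_lift.
by rewrite big1// => a _; rewrite sx_face_eq mulr0.
Qed.

Lemma small_map_cone k n e (b : simplex n) (s : continuousType (simplex k) (simplex n)) :
  small_map e s -> (forall x, d1 b x <= e) ->
  small_map e (cone_map (@lin_continuous R n b) (linP1 b) s).
Proof.
move=> [w sw we] be.
exists (fun a => if unlift ord0 a is Some l then w l else b) => [t i|x y].
  rewrite /= /mkcts /cone_fun /= sx_lin clamp_id ?sx_ge0 ?sx_le1//.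
  rewrite big_ord_recl unlift_none addrC; congr (_ + _).
  rewrite sw mulr_sumr; apply: eq_bigr => j _; rewrite liftK mulrA; congr (_ * _).
  have [t1|t1] := ltP (sx t ord0) 1.
    by rewrite sx_rest// mulrC divfK// gt_eqF// subr_gt0.
  (* At the apex [rest t] is arbitrary, but its factor [1 - 1] and all other coordinates of [t]
     vanish. *)
  have t1' : sx t ord0 = 1 by apply/eqP; rewrite eq_le sx_le1.
  rewrite t1' subrr mul0r; apply/esym/eqP; rewrite eq_le sx_ge0 andbT.
  have := sx_sum t; rewrite big_ord_recl t1' => E.
  have {E} <- : \sum_(i0 < k.+1) sx t (fintype.lift ord0 i0) = 0 by lra.
  rewrite (bigD1 j) //= lerDl sumr_ge0// => l _.
  exact: sx_ge0.
have d1C (u v : simplex n) : d1 u v = d1 v u.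
  by apply: eq_bigr => i _; rewrite distrC.
case: (unliftP ord0 x) => [l|] _; case: (unliftP ord0 y) => [l'|] _ //.
by rewrite d1C.
Qed.

Definition vertex n (j : 'I_n.+1) : simplex n := mksx (fun i => (i == j)%:R).

Lemma sx_vertex n (j i : 'I_n.+1) : sx (vertex j) i = (i == j)%:R.
Proof.
rewrite mksxE //.
by rewrite (bigD1 j)//= eqxx big1 ?addr0// => l /negPf ->.
Qed.

Lemma sx_vertexE n (t : simplex n) i : sx t i = \sum_j sx t j * sx (vertex j) i.
Proof.
rewrite (bigD1 i)//= sx_vertex eqxx mulr1 big1 ?addr0// => j ji.
by rewrite sx_vertex eq_sym (negPf ji) mulr0.
Qed.

(** The contraction factor [n / (n + 1)] of barycentric subdivision times the diameter 2. *)
Definition mesh n : R := 2 * (n%:R / n.+1%:R).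

(** A point is a convex combination of vertices, so its distance from the barycentre is at most that
    of a vertex, which equals [mesh n]. *)
Lemma d1_bary n (x : simplex n) : d1 (bary R n) x <= mesh n.
Proof.
apply: (@le_trans _ _ (\sum_i \sum_j sx x j * `|n.+1%:R^-1 - (i == j)%:R|)).
  apply: ler_sum => i _; rewrite sx_bary.
  have -> : n.+1%:R^-1 - sx x i = \sum_j sx x j * (n.+1%:R^-1 - (i == j)%:R).
    under eq_bigr do rewrite mulrBr; rewrite sumrB -mulr_suml sx_sum mul1r; congr (_ - _).
    by rewrite [LHS]sx_vertexE; apply: eq_bigr => j _; rewrite sx_vertex.
  apply: le_trans (ler_norm_sum _ _ _) _; apply: ler_sum => j _.
  by rewrite normrM ger0_norm ?sx_ge0.
rewrite exchange_big /= -[leRHS]mul1r -[X in X * _](sx_sum x) mulr_suml.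
apply: ler_sum => j _; rewrite -mulr_sumr ler_wpM2l ?sx_ge0//.
rewrite (bigD1 j)//= eqxx.
under eq_bigr => i ij do rewrite (negPf ij) subr0 ger0_norm ?invr_ge0 ?ler0n//.
rewrite sumr_const cardC1 card_ord /= distrC ger0_norm; last first.
  by rewrite subr_ge0 invf_le1 ?ltr0n// ler1n.
have n0 : n.+1%:R != 0 :> R by rewrite pnatr_eq0.
have E : n%:R * n.+1%:R^-1 + n.+1%:R^-1 = 1 :> R.
  by rewrite -{2}[n.+1%:R^-1]mul1r -mulrDl natr1 mulfV.
rewrite /mesh -[_ *+ n]mulr_natl; move: E; set a := n.+1%:R^-1; lra.
Qed.

Lemma mesh_ge0 n : 0 <= mesh n.
Proof. by rewrite mulr_ge0// divr_ge0 ?ler0n. Qed.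

Lemma mesh_le n : mesh n <= mesh n.+1.
Proof.
rewrite /mesh ler_pM2l// ler_pdivrMr ?ltr0n// mulrAC ler_pdivlMr ?ltr0n//.
by rewrite -!natrM ler_nat; nia.
Qed.

Lemma sdi_small n : all_in (small_map (mesh n)) (sdi R n).
Proof.
elim: n => [|n IH].
  apply: all_in_sing; exists (fun a => vertex a) => [t i|a b]; first exact: sx_vertexE.
  by rewrite (ord1 a) (ord1 b) d1xx mesh_ge0.
rewrite [sdi R n.+1]/=.
apply: (@all_in_additive _ _ _ _ (small_map (mesh n.+1)) _ (cone (@lin_continuous R n.+1 (bary R n.+1)) (linP1 _) (k:=n))).
  move=> s ss; change (all_in (small_map (mesh n.+1)) (cone (@lin_continuous R n.+1 (bary R n.+1)) (linP1 (bary R n.+1)) (sing s))).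
  rewrite cone_sing; apply: all_in_sing; apply: small_map_cone => // x; exact: d1_bary.
apply: all_in_sum => i _; apply: all_inZ.
apply: (@all_in_push _ _ _ (small_map (mesh n)) (small_map (mesh n.+1))) => // s ss.
exact: small_map_le (mesh_le n) (small_map_face i ss).
Qed.

Lemma iter_sd_small n m :
  all_in (small_map (2 * (n%:R / n.+1%:R) ^+ m)) (iter m (@sd R _ n) (iota_sx R n)).
Proof.
elim: m => [|m IH].
  apply: all_in_sing; exists (fun a => vertex a) => [t i|a b]; first exact: sx_vertexE.
  by rewrite expr0 mulr1 d1_le2.
rewrite iterS; apply: all_in_additive IH => s ss.
change (all_in (small_map (2 * (n%:R / n.+1%:R) ^+ m.+1)) (sd (sing s))).
rewrite sd_sing.
apply: (@all_in_push _ _ _ (small_map (mesh n)) (small_map _)) (@sdi_small n) => r rs.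
apply: small_map_le (small_map_comp rs ss).
by rewrite /mesh exprS; set q := _ / _; lra.
Qed.

Lemma d1_nbhs n (x : simplex n) (A : set (simplex n)) : nbhs x A ->
  exists2 e, 0 < e & forall y, d1 x y < e -> A y.
Proof.
move=> [D [[D' oD' DD'] Dx DA]].
have : nbhs (set_val x : 'rV[R]_n.+1) D'.
  by rewrite nbhsE; exists D' => //; split => //; move: Dx; rewrite -DD'.
move=> /nbhs_ballP[e /= e0 eD']; exists e => // y xy; apply: DA.
rewrite -DD'; apply: eD'; split => // i j; rewrite (ord1 i) /ball /=.
apply: le_lt_trans xy; rewrite /d1 (bigD1 j)//= lerDl.
by apply: sumr_ge0.
Qed.

(** Compactness in its near-covering form: if the scale [e] works at [x], then every scale below
    [e / 2] works at all points within [e / 2] of [x]. *)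
Lemma lebesgue_number n Z (f : simplex n -> Z) (O1 O2 : set Z) :
  continuous f -> open O1 -> open O2 -> (forall x, O1 (f x) \/ O2 (f x)) ->
  exists2 e : R, 0 < e & forall x, (forall y, d1 x y < e -> O1 (f y)) \/
    (forall y, d1 x y < e -> O2 (f y)).
Proof.
move=> fc o1 o2 f12.
pose P (e : R) (x : simplex n) := (forall y, d1 x y < e -> O1 (f y)) \/
    (forall y, d1 x y < e -> O2 (f y)).
have d1T (x y z : simplex n) : d1 x z <= d1 x y + d1 y z.
  rewrite /d1 -big_split /=; apply: ler_sum => i _.
  by rewrite -[X in `|X|](subrKA (sx y i)) ler_normD.
have d1C (u v : simplex n) : d1 u v = d1 v u.
  by apply: eq_bigr => i _; rewrite distrC.
have nearb (x : simplex n) e : 0 < e -> nbhs x [set y | d1 x y < e].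
  move=> e0; have : continuous (d1 x).
    apply: sum_continuous => i _; apply: (@comp_continuous _ _ _ (fun y => sx x i - sx y i) Num.norm).
      apply: realB_continuous; [exact: realcst_continuous|exact: sx_continuous].
    exact: norm_continuous.
  move=> /(_ x [set y | y < e]); rewrite d1xx; apply.
  by apply: open_nbhs_nbhs; split => //; exact: open_lt.
have /compact_near_coveringP nc := @simplex_compact R n.
have H : \forall e \near 0^'+, [set: simplex n] `<=` [set x | P e x].
  apply: (nc _ (0^'+) (fun e x => P e x)) => x _.
  have [e e0 xe] : exists2 e, 0 < e & P e x.
    have [Ox|Ox] := f12 x.
      have /d1_nbhs[e e0 xe] : nbhs x (f @^-1` O1) by apply: fc; exact: open_nbhs_nbhs.
      by exists e => //; left.
    have /d1_nbhs[e e0 xe] : nbhs x (f @^-1` O2) by apply: fc; exact: open_nbhs_nbhs.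
    by exists e => //; right.
  exists ([set y | d1 x y < e / 2], [set u | 0 < u /\ u < e / 2]); first split => /=.
  - by apply: nearb; rewrite divr_gt0.
  - near=> u; split; near: u; first exact: nbhs_right_gt.
    by apply: nbhs_right_lt; rewrite divr_gt0.
  move=> [y u] /= [xy [u0 ue]]; case: xe => xe; [left|right] => z yz; apply: xe;
    by apply: le_lt_trans (d1T _ y _) _; rewrite [e]splitr ltrD// (lt_trans yz).
near (0 : R)^'+ => e; exists e => [|x]; first by [].
by apply: (_ : [set: simplex n] `<=` [set x | P e x]) => //; near: e.
Unshelve. all: by end_near. Qed.

Lemma iter_sd_sing n Z (s : continuousType (simplex n) Z) m :
  iter m (@sd R Z n) (sing s) = push s (iter m (@sd R _ n) (iota_sx R n)).
Proof.
elim: m => [|m IH]; first exact: iota_push.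
by rewrite !iterS IH sd_push.
Qed.

Lemma iter_sdD n Z m (c d : chain n Z) :
  iter m (@sd R Z n) (c + d) = iter m (@sd R Z n) c + iter m (@sd R Z n) d.
Proof. by elim: m => //= m ->; rewrite raddfD. Qed.

Lemma iter_sdN n Z m (c : chain n Z) :
  iter m (@sd R Z n) (- c) = - iter m (@sd R Z n) c.
Proof. by elim: m => //= m ->; rewrite raddfN. Qed.

Lemma iter_sd0 n Z m : iter m (@sd R Z n) 0 = 0.
Proof. by elim: m => //= m ->; rewrite raddf0. Qed.

Definition in_one Z (O1 O2 : set Z) k (r : simplex k -> Z) : Prop :=
  (forall x, O1 (r x)) \/ (forall x, O2 (r x)).

(** The claim is made for all [m] beyond a bound, so that the bounds for the finitely many simplices
    of a chain can be combined. Once the mesh is below the Lebesgue number, a simplex lies in the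
    same set as a ball around the image of its vertex 0. *)
Lemma small_simplices n Z (s : continuousType (simplex n) Z) (O1 O2 : set Z) :
  open O1 -> open O2 -> (forall x, O1 (s x) \/ O2 (s x)) ->
  exists M, forall m, (M <= m)%N ->
    all_in (@in_one Z O1 O2 n) (iter m (@sd R Z n) (sing s)).
Proof.
move=> o1 o2 s12; have [e e0 eP] := lebesgue_number (@cts_fun _ _ s) o1 o2 s12.
set q : R := n%:R / n.+1%:R.
have q0 : 0 <= q by rewrite divr_ge0 ?ler0n.
have q1 : q < 1 by rewrite ltr_pdivrMr ?ltr0n// mul1r ltr_nat.
have [M qM] : exists M, 2 * q ^+ M < e.
  have : q ^+ m @[m --> \oo] --> (0 : R) by apply: cvg_expr; rewrite ger0_norm.
  move=> /(_ [set y | y < e / 2]) /= H.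
  have [|M _ MP] := H; first by apply: open_nbhs_nbhs; split; [exact: open_lt|rewrite /= divr_gt0].
  by exists M; have := MP M (leqnn M); rewrite /= ltr_pdivlMr// mulrC.
exists M => m Mm; rewrite iter_sd_sing.
have qm : 2 * q ^+ m < e.
  by apply: le_lt_trans qM; rewrite ler_pM2l// ler_wiXn2l// ltW.
apply: (@all_in_push _ _ _ (small_map (2 * q ^+ m)) (in_one O1 O2 (k := n))) (@iter_sd_small n m) => r rs.
have close x : d1 (r (vertex ord0)) (r x) < e.
  apply: le_lt_trans (small_map_lipschitz _ _ rs) _; apply: le_lt_trans qm.
  rewrite -[leRHS]mul1r ler_wpM2r ?mulr_ge0 ?exprn_ge0//.
  by rewrite ler_pdivrMr// mul1r d1_le2.
by have [H|H] := eP (r (vertex ord0)); [left|right] => x; exact: H.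
Qed.

Lemma small_chain n Z (c : chain n Z) (O1 O2 : set Z) :
  open O1 -> open O2 -> (forall x, O1 x \/ O2 x) ->
  exists m, all_in (@in_one Z O1 O2 n) (iter m (@sd R Z n) c).
Proof.
move=> o1 o2 o12.
suff [M MP] : exists M, forall m, (M <= m)%N ->
    all_in (@in_one Z O1 O2 n) (iter m (@sd R Z n) c) by exists M; exact: MP.
apply: (@chain_ind R n Z (fun c => exists M, forall m, (M <= m)%N ->
    all_in (@in_one Z O1 O2 n) (iter m (@sd R Z n) c)) (fun _ => True)) => //.
- by exists 0%N => m _; rewrite iter_sd0; exact: all_in0.
- move=> a b [Ma aP] [Mb bP]; exists (maxn Ma Mb) => m; rewrite geq_max => /andP[ma mb].
  by rewrite iter_sdD; apply: all_inD; [exact: aP|exact: bP].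
- by move=> a [Ma aP]; exists Ma => m ma; rewrite iter_sdN; apply: all_inN; exact: aP.
by move=> s _; exact: small_simplices.
Qed.

Lemma all_in_split n Z (A B : set Z) (c : chain n Z) :
  all_in (@in_one Z A B n) c ->
  exists a b, [/\ c = a + b, supported A a & supported B b].
Proof.
move=> cAB; apply: (@chain_ind R n Z (fun c => exists a b,
  [/\ c = a + b, supported A a & supported B b]) (@in_one Z A B n)) => //.
- by exists 0, 0; split; [rewrite addr0|exact: supported0|exact: supported0].
- move=> _ _ [a [b [-> Aa Bb]]] [a' [b' [-> Aa' Bb']]].
  by exists (a + a'), (b + b'); split; [rewrite addrACA|exact: supportedD|exact: supportedD].
- move=> _ [a [b [-> Aa Bb]]]; exists (- a), (- b).
  by split; [rewrite opprD|exact: supportedN|exact: supportedN].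
move=> s [sA|sB]; [exists (sing s), 0|exists 0, (sing s)];
  by split; rewrite ?addr0 ?add0r//; [exact: supported_sing|exact: supported0] ||
     by split; rewrite ?addr0 ?add0r//; [exact: supported0|exact: supported_sing].
Qed.

Lemma push_eq_on Z W (A : set Z) (f g : continuousType Z W) n (c : chain n Z) :
  (forall x, A x -> f x = g x) -> supported A c -> push f c = push g c.
Proof.
move=> fg Ac; apply: (@chain_ind R n Z (fun c => push f c = push g c)
  (fun s => forall x, A (s x))) => //.
- by rewrite !raddf0.
- by move=> a b; rewrite !pushD => -> ->.
- by move=> a; rewrite !raddfN /= => ->.
move=> s As; rewrite !push_sing; congr sing; apply/continuousEP => x /=; exact: fg.
Qed.

End SmallChains.

(** * The generator of the homology of a simplex modulo its boundary *)

Section Generator.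
Variable R : realType.
Local Notation simplex := (simplex R).
Local Notation chain := (chain R).

Definition bdry n : set (simplex n) := [set t | exists i, sx t i = 0].
(** All faces but the one opposite to the vertex 0. Their union is star-shaped about that vertex. *)
Definition horn n : set (simplex n.+1) := [set t | exists i, sx t (fintype.lift ord0 i) = 0].

Definition sx_tail n (t : simplex n.+1) (i : 'I_n.+1) : R := sx t (fintype.lift ord0 i).

(** Lowering each of the [n.+1] tail coordinates by this amount removes at most 1/2 from their sum,
    so the normalizing denominator stays positive. *)
Definition expand_cst n : R := (2 * n.+1%:R)^-1.

Definition expand_num n (tu : simplex n.+1 * R) (i : 'I_n.+2) : R :=
  if unlift ord0 i is Some j then Num.max (sx tu.1 i - expand_cst n * clamp tu.2) 0
  else sx tu.1 i.

(* Pushes the points of the face opposite to the vertex [0] radially away from its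
   barycentre. *)
Definition expand n (tu : simplex n.+1 * R) : simplex n.+1 :=
  mksx (fun i => expand_num tu i / \sum_j expand_num tu j).

Lemma expand_cst_gt0 n : 0 < expand_cst n.
Proof. by rewrite invr_gt0 mulr_gt0 ?ltr0n. Qed.

Lemma expand_num_ge0 n (tu : simplex n.+1 * R) i : 0 <= expand_num tu i.
Proof.
by rewrite /expand_num; case: (unlift ord0 i) => [_|]; rewrite ?sx_ge0// le_max lexx orbT.
Qed.

Lemma expand_den n (tu : simplex n.+1 * R) : 0 < \sum_j expand_num tu j.
Proof.
apply: (@lt_le_trans _ _ (1 - expand_cst n * n.+1%:R)).
  rewrite /expand_cst invfM -mulrA mulVf ?pnatr_eq0// mulr1 subr_gt0 invf_lt1//.
  by rewrite ltr1n.
have H : \sum_(i < n.+1) (sx tu.1 (fintype.lift ord0 i) - expand_cst n) <=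
    \sum_(i < n.+1) expand_num tu (fintype.lift ord0 i).
  apply: ler_sum => i _; rewrite /expand_num liftK le_max lerD2l lerN2.
  by rewrite ler_piMr ?clamp_le1// ltW// expand_cst_gt0.
have S : sx tu.1 ord0 + \sum_(i < n.+1) sx tu.1 (fintype.lift ord0 i) = 1.
  by rewrite -(sx_sum tu.1) [RHS]big_ord_recl.
rewrite [leRHS]big_ord_recl {1}/expand_num unlift_none.
move: H; rewrite sumrB sumr_const card_ord -[_ *+ n.+1]mulr_natr; lra.
Qed.

Lemma sx_expand n (tu : simplex n.+1 * R) i :
  sx (expand tu) i = expand_num tu i / \sum_j expand_num tu j.
Proof.
rewrite mksxE // => [j|]; first by rewrite divr_ge0 ?expand_num_ge0// ltW// expand_den.
by rewrite -mulr_suml mulfV// gt_eqF// expand_den.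
Qed.

Lemma expand_num_continuous n i : continuous (fun tu : simplex n.+1 * R => expand_num tu i).
Proof.
have c1 : continuous (fun tu : simplex n.+1 * R => sx tu.1 i).
  apply: (@comp_continuous _ _ _ fst (fun t : simplex n.+1 => sx t i)).
    exact: fst_continuous.
  exact: sx_continuous.
rewrite /expand_num; case: (unlift ord0 i) => [_|//] x.
apply: (@continuous_max R _ (fun tu : simplex n.+1 * R => sx tu.1 i - expand_cst n * clamp tu.2) (fun=> 0)); last exact: cvg_cst.
apply: realB_continuous => //; apply: realM_continuous; first exact: realcst_continuous.
by apply: comp_continuous; [exact: snd_continuous|exact: clamp_continuous].
Qed.

Lemma expand_continuous n : continuous (@expand n).
Proof.
move=> x; apply: (@simplex_cvg _ _ _ (nbhs_filter x)) => i.
under eq_fun do rewrite sx_expand; rewrite sx_expand.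
apply: cvgM; first exact: expand_num_continuous.
apply: cvgV; first by rewrite gt_eqF// expand_den.
by apply: sum_continuous => j _; exact: expand_num_continuous.
Qed.

HB.instance Definition _ n := isContinuous.Build _ _ (@expand n) (@expand_continuous n).

Lemma expand0 n t : @expand n (t, 0) = t.
Proof.
have E i : expand_num (t, 0) i = sx t i.
  rewrite /expand_num /= clamp0 mulr0 subr0; case: (unlift ord0 i) => // _.
  by rewrite max_l// sx_ge0.
apply: sxP => i; rewrite sx_expand E; under eq_bigr do rewrite E.
by rewrite sx_sum divr1.
Qed.

Lemma expand_zero n t u i : sx t i = 0 -> sx (@expand n (t, u)) i = 0.
Proof.
move=> t0; rewrite sx_expand /expand_num /= t0; case: (unlift ord0 i) => [_|]; rewrite ?mul0r//.
by rewrite max_r ?mul0r// sub0r oppr_le0 mulr_ge0 ?clamp_ge0// ltW// expand_cst_gt0.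
Qed.

Lemma expand1_horn n t i : sx t (fintype.lift ord0 i) < expand_cst n ->
  horn (@expand n (t, 1)).
Proof.
move=> ti; exists i; rewrite sx_expand /expand_num /= liftK clamp1 mulr1.
by rewrite max_r ?mul0r// subr_le0 ltW.
Qed.

Definition expand1 n : simplex n.+1 -> simplex n.+1 := @expand n \o incl_at 1.
HB.instance Definition _ n := Continuous.on (@expand1 n).

Definition to_face0 n (t : simplex n.+1) : simplex n :=
  mksx (fun i => sx_tail t i + sx t ord0 * n.+1%:R^-1).

Lemma sx_to_face0 n (t : simplex n.+1) i :
  sx (to_face0 t) i = sx_tail t i + sx t ord0 * n.+1%:R^-1.
Proof.
rewrite mksxE // => [j|]; first by rewrite addr_ge0 ?sx_ge0// mulr_ge0 ?sx_ge0// invr_ge0 ler0n.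
rewrite big_split /= sumr_const card_ord -mulrnAr -[_ *+ _]mulr_natr mulVf ?pnatr_eq0// mulr1.
by rewrite addrC -[RHS](sx_sum t) [RHS]big_ord_recl.
Qed.

Lemma to_face0_continuous n : continuous (@to_face0 n).
Proof.
apply: simplex_continuous => i; under eq_fun do rewrite sx_to_face0.
apply: realD_continuous; first exact: sx_continuous.
by apply: realM_continuous; [exact: sx_continuous|exact: realcst_continuous].
Qed.
HB.instance Definition _ n := isContinuous.Build _ _ (@to_face0 n) (@to_face0_continuous n).

Lemma to_face0K n (t : simplex n.+1) : sx t ord0 = 0 -> face R ord0 (to_face0 t) = t.
Proof.
move=> t0; apply: sxP => i; case: (unliftP ord0 i) => [j|] ->; last by rewrite sx_face_eq t0.
by rewrite sx_face_lift sx_to_face0 t0 mul0r addr0.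
Qed.

Lemma zmod_rearr1 (V : zmodType) (a b w q d : V) :
  a + b - w - d = b + (a - q - d) - (w - q).
Proof. by rewrite -{1}[w](subrK q) opprD !addrA [RHS](ACl (2*1*5*3*4)). Qed.

Lemma zmod_rearr2 (V : zmodType) (w0 w w2 w3 d : V) :
  w = w0 + (d + (w3 - w0 - d) - (w3 - w2) - (w2 - w)).
Proof.
rewrite [d + _]addrC subrK !opprB [w3 - w0 + _]addrC subrKA addrC.
by rewrite [w2 - w0 + _]addrC subrKA subrK.
Qed.

Lemma zmod_rearr3 (V : zmodType) (a b : V) : a + b - a - b = 0.
Proof. by rewrite [a + b - a]addrAC subrr add0r subrr. Qed.

Lemma reduced_push (Z W : topologicalType) (f : continuousType Z W) k (c : chain k Z) :
  reduced_cycle c -> reduced_cycle (push f c).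
Proof.
case: k c => [|k] c; rewrite /reduced_cycle ?deg_push// bd_push => ->.
exact: raddf0.
Qed.

(** Excision, by induction on [n]. The boundary [w] of [z] is subdivided and split into a part
    inside face 0 and a part near the other faces, which [expand] pushes into the horn. On face 0
    the induction hypothesis supplies [m], and what then remains is a cycle of the horn, which
    contracts to the vertex 0. So [w] and [m] times the boundary of the simplex are homologous
    within the boundary, and after a correction there [z] and [m] times the simplex differ by a
    cycle, which bounds since the simplex is contractible. *)
Lemma simplex_bdry_generated n (z : chain n (simplex n)) :
  rel_cycle setT (@bdry n) z ->
  exists m : int, rel_homologous setT (@bdry n) z (m *: iota_sx R n).
Proof.
elim: n z => [|n IH] z [_ bz].
  exists (deg z), 0; split; first exact: supported0.
  rewrite [bd 0]raddf0 subr0 [X in supported _ X](_ : _ = 0); first exact: supported0.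
  apply/eqP; rewrite subr_eq0; apply/eqP.
  move: z {bz}; apply: chain_extm => [a b|a b|s]; rewrite ?raddfB ?scalerBl//=.
  rewrite degU scale1r; congr sing; apply/continuousEP => t.
  have E (u : simplex 0) : sx u ord0 = 1 by rewrite -(sx_sum u) big_ord1.
  by apply: sxP => i; rewrite (ord1 i) !E.
pose w := bd z.
have wr : reduced_cycle w := reduced_bd z.
have bw : bd w = 0 := bd_bd z.
(* [O1] is the complement of the horn, [O2] a neighbourhood of the horn that [expand] carries into
   it at time 1. *)
pose O1 : set (simplex n.+1) := [set t | forall i, 0 < sx_tail t i].
pose O2 : set (simplex n.+1) := [set t | exists i, sx_tail t i < expand_cst n].
have oO1 : open O1.
  rewrite openE => t /= Ht.
  apply: (@filter_forall _ _ (fun i y => 0 < sx_tail y i) _ (nbhs_filter t)) => i.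
  apply: (@sx_continuous R n.+1 (fintype.lift ord0 i) t [set y | 0 < y]).
  by apply: open_nbhs_nbhs; split; [exact: open_gt|exact: Ht].
have oO2 : open O2.
  have -> : O2 = \bigcup_(i in [set: 'I_n.+1]) [set t | sx_tail t i < expand_cst n].
    by apply/seteqP; split => t; [move=> [i ti]; exists i|move=> [i _ ti]; exists i].
  apply: bigcup_open => i _.
  have c : continuous (fun t : simplex n.+1 => sx_tail t i) by exact: sx_continuous.
  move/continuousP: c => /(_ [set y | y < expand_cst n]); apply; exact: open_lt.
have [M Msm] : exists m, all_in (in_one O1 O2 (k:=n)) (iter m (@sd R _ n) w).
  apply: small_chain => // t; have [?|/existsNP[i /negP]] := pselect (O1 t); first by left.
  by rewrite -leNgt => ti; right; exists i; exact: le_lt_trans ti (expand_cst_gt0 n).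
have [e1 be1 e1E] := iter_sd_homologous M bw bz.
set w2 := iter M _ w in Msm e1E.
have bw2 : bd w2 = 0.
  by rewrite /w2; elim: (M) => //= m E; rewrite bd_sd E raddf0.
have w2r : reduced_cycle w2.
  by rewrite /w2; elim: (M) => //= m E; exact: reduced_sd.
have sw2 : supported (@bdry n.+1) w2.
  by rewrite /w2; elim: (M) => //= m E; exact: supported_sd.
have [a [b [w2E sa sb]]] : exists a b, [/\ w2 = a + b,
    supported (O1 `&` @bdry n.+1) a & supported (O2 `&` @bdry n.+1) b].
  apply: all_in_split => s sw; have [H|H] := Msm s sw; [left|right] => x;
    by split => //; exact: sw2.
pose e2 := push (@expand n) (tc w2).
have se2 : supported (@bdry n.+1) e2.
  apply: supported_push (supported_tc sw2) => -[t u] /= [[i ti] _].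
  by exists i; exact: expand_zero.
have e2E : bd e2 = push (@expand1 n) (sd w2) - w2.
  rewrite /e2 (@homotopy_sd _ _ _ (@expand n) idfun (@expand1 n) _ w2 (@expand0 n) (fun _ => erefl) bw2).
  by rewrite (@push_id R _ idfun).
pose a3 := push (@expand1 n) (sd a); pose b3 := push (@expand1 n) (sd b).
pose F0 : set (simplex n.+1) := [set t | sx t ord0 = 0].
(* A boundary point off the horn can only have its coordinate 0 equal to zero, and [expand]
   preserves faces. *)
have sa3 : supported F0 a3.
  apply: supported_push (supported_sd sa) => t [t1 [i ti]].
  apply: expand_zero; case: (unliftP ord0 i) ti => [j|] -> // tj.
  by have := t1 j; rewrite /sx_tail tj ltxx.
have sb3 : supported (@horn n) b3.
  by apply: supported_push (supported_sd sb) => t [[i ti] _]; exact: expand1_horn ti.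
have w3E : push (@expand1 n) (sd w2) = a3 + b3 by rewrite w2E raddfD /= pushD.
set w3 := push _ (sd w2) in e2E w3E.
have bw3 : bd w3 = 0 by rewrite bd_push bd_sd bw2 !raddf0.
pose a' := push (@to_face0 n) a3.
have a'K : push (face R ord0) a' = a3.
  rewrite -(@push_comp _ _ _ _ (@to_face0 n) (face R ord0) (face R ord0 \o @to_face0 n))//.
  by rewrite (@push_eq_on _ _ _ F0 _ idfun)// ?push_id// => x /= xF; exact: to_face0K.
have a'c : rel_cycle setT (@bdry n) a'.
  split => //; rewrite bd_push; apply: (@supported_push _ _ _ (F0 `&` @horn n)).
    by move=> t [t0 [i ti]]; exists i; rewrite sx_to_face0 t0 mul0r addr0.
  apply: supportedI; first exact: supported_bd.
  have -> : bd a3 = - bd b3 by apply/eqP; rewrite -addr_eq0 -bdD -w3E bw3.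
  by apply: supportedN; exact: supported_bd.
have [m [e [_ eE]]] := IH _ a'c.
exists m.
pose w0 := bd (iota_sx R n.+1).
(* Everything outside the horn is removed: a multiple of the boundary of the simplex, and a boundary
   inside face 0. *)
pose x := w3 - m *: w0 - bd (push (face R ord0) e).
have sx3 : supported (@horn n) x.
  have -> : x = b3 + push (face R ord0) (a' - m *: iota_sx R n - bd e)
       - m *: (w0 - push (face R ord0) (iota_sx R n)).
    rewrite /x !pushB a'K pushZ w3E scalerBr (bd_push (face R ord0) e).
    exact: zmod_rearr1.
  apply: supportedB; first apply: supportedD => //.
    apply: supported_push eE => t [i ti]; exists i; by rewrite sx_face_lift.
  apply: supportedZ; rewrite /w0 bd_sing big_ord_recl expr0 scale1r push_sing.
  rewrite [X in X + _ - _](_ : _ = sing (face R ord0 \o idfun)); last first.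
    by congr sing; apply/continuousEP.
  rewrite addrAC subrr add0r; apply: supported_sum => i _; apply: supportedZ.
  by apply: supported_sing => t; exists i; exact: sx_face_eq.
have rx : reduced_cycle x.
  apply: reducedB; last exact: reduced_bd.
  apply: reducedB; last by apply: reducedZ; exact: reduced_bd.
  by apply: reduced_push; exact: reduced_sd.
have sxc : supported (@horn n) (lcone (vertex R ord0) x).
  apply: supported_cone sx3 => t u [i ti] /andP[u0 u1]; exists i.
  by rewrite /= sx_lin ti sx_vertex mulr0 add0r /= mulr0.
pose B := push (face R ord0) e + lcone (vertex R ord0) x - e2 - e1.
have sB : supported (@bdry n.+1) B.
  apply: supportedB => //; apply: supportedB => //; apply: supportedD.
    by apply: supported_pushT => t; exists ord0; exact: sx_face_eq.
  by apply: supportedS sxc => t [i ti]; exists (fintype.lift ord0 i).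
have wE : w = m *: w0 + bd B.
  rewrite /B !bdB bdD e2E e1E bd_lcone//.
  exact: zmod_rearr2.
(* [wE] makes [y] a reduced cycle of the simplex, so it is the boundary of its cone. *)
pose y := z - m *: iota_sx R n.+1 - B.
have yr : reduced_cycle y.
  move: wE; rewrite /reduced_cycle /y; move: (B) => B' wE.
  by rewrite bdB [bd (z - _)]bdB bdZ -/w wE; exact: zmod_rearr3.
exists (lcone (vertex R ord0) y); split => //.
by rewrite bd_lcone// /y opprB addrC subrK.
Qed.

End Generator.

(** * Path lifting and pullbacks of coverings *)

Section Intervals.
Variable R : realType.

(** Continuous induction, in place of the choice of a finite subdivision: since [P] holds on short
    intervals and can be concatenated, the supremum of the [t] with [P 0 t] cannot be less than
    1. *)
Lemma interval_induction (P : R -> R -> Prop) :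
  (forall a b c, 0 <= a -> a <= b -> b <= c -> c <= 1 -> P a b -> P b c -> P a c) ->
  (forall x, 0 <= x <= 1 -> exists2 e, 0 < e & forall a b, 0 <= a -> a <= b -> b <= 1 ->
     `|a - x| < e -> `|b - x| < e -> P a b) ->
  P 0 1.
Proof.
move=> Pcat Ploc.
pose S := [set t : R | 0 <= t <= 1 /\ P 0 t].
have S0 : S 0.
  split; first by rewrite lexx ler01.
  have [|e e0 eP] := Ploc 0; first by rewrite lexx ler01.
  by apply: eP; rewrite ?subrr ?normr0.
have Sub : has_sup S.
  by split; [exists 0|exists 1 => t [/andP[]]].
set s := sup S.
have s0 : 0 <= s by apply: sup_upper_bound.
have s1 : s <= 1 by apply: sup_le_ub => [|t [/andP[]] //]; exists 0.
have [|e e0 eP] := Ploc s; first by rewrite s0.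
have [t [/andP[t0 t1] Pt] tse] := sup_adherent e0 Sub.
have ts : t <= s by apply: sup_upper_bound => //; split => //; rewrite t0.
have key b : s <= b -> b <= 1 -> b < s + e -> P 0 b.
  move=> sb b1 be; apply: (Pcat 0 t b) => //; first exact: le_trans sb.
  apply: eP => //; first exact: le_trans sb.
    by rewrite distrC ger0_norm ?subr_ge0// -/s in tse *; lra.
  by rewrite ger0_norm ?subr_ge0//; lra.
have [se1|se1] := ltP 1 (s + e); first by apply: key.
have b1 : s + e / 2 <= 1 by lra.
have : S (s + e / 2).
  split; first by apply/andP; split => //; lra.
  by apply: key => //; lra.
move=> /(sup_upper_bound Sub); rewrite -/s; lra.
Qed.

Lemma glue_continuous (T X : topologicalType) (f g k : T -> X) (h : T -> R) :
  continuous h -> continuous f -> continuous g ->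
  (forall t, h t <= 0 -> k t = f t) -> (forall t, 0 <= h t -> k t = g t) ->
  continuous k.
Proof.
move=> hc fc gc kf kg.
suff : {within [set t | h t <= 0] `|` [set t | 0 <= h t], continuous k}.
  have -> : [set t | h t <= 0] `|` [set t | 0 <= h t] = setT.
    by apply/seteqP; split => // t _; case: (leP (h t) 0) => ht; [left|right => /=; exact: ltW].
  by move=> ?; apply/continuous_subspace_setT.
apply: withinU_continuous.
- apply: (@preimage_closed _ _ h [set y | y <= 0]); last exact: closed_le.
  by move=> t _; exact: hc.
- apply: (@preimage_closed _ _ h [set y | 0 <= y]); last exact: closed_ge.
  by move=> t _; exact: hc.
- apply: (@subspace_eq_continuous _ _ _ (f : subspace _ -> _)); last exact: continuous_subspaceT.
  by move=> t; rewrite inE /= => ht; exact/esym/kf.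
- apply: (@subspace_eq_continuous _ _ _ (g : subspace _ -> _)); last exact: continuous_subspaceT.
  by move=> t; rewrite inE /= => ht; exact/esym/kg.
Qed.

Lemma if_le_continuous (T X : topologicalType) (f g : T -> X) (h : T -> R) :
  continuous h -> continuous f -> continuous g ->
  (forall t, h t = 0 -> f t = g t) ->
  continuous (fun t => if h t <= 0 then f t else g t).
Proof.
move=> hc fc gc fg; apply: (glue_continuous hc fc gc) => t ht; first by rewrite ht.
by case: ifP => // ht'; apply: fg; apply/eqP; rewrite eq_le ht ht'.
Qed.

Definition clampab (a b u : R) : R := Num.max a (Num.min b u).

Lemma clampab_continuous a b : continuous (clampab a b).
Proof.
move=> u; apply: (@continuous_max R R (fun=> a) (fun u => Num.min b u)); first exact: cvg_cst.
by apply: (@continuous_min R R (fun=> b) id); [exact: cvg_cst|exact: cvg_id].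
Qed.

Lemma clampab_id a b u : a <= u <= b -> clampab a b u = u.
Proof. by move=> /andP[au ub]; rewrite /clampab min_r// max_r. Qed.

Lemma clampab_in a b u : a <= b -> a <= clampab a b u <= b.
Proof. by move=> ab; rewrite le_max lexx /= ge_max ab ge_min lexx. Qed.

Section Covering.
Variables (E X : topologicalType) (p : E -> X).
Hypothesis cov : forall x, exists U, [/\ open U, U x & evenly_covered p U].

(** The induction is on the statement that agreement at the left end of an interval propagates
    through it. Locally the two lifts stay in sheets, which coincide because the lifts meet at the
    left end. *)
Lemma unique_path_lifting (f g : R -> E) :
  continuous f -> continuous g -> (forall t, 0 <= t <= 1 -> p (f t) = p (g t)) ->
  f 0 = g 0 -> forall t, 0 <= t <= 1 -> f t = g t.
Proof.
move=> fc gc fg fg0.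
suff: f 0 = g 0 -> forall t, 0 <= t <= 1 -> f t = g t by exact.
apply: (interval_induction (P := fun a b => f a = g a -> forall t, a <= t <= b -> f t = g t)).
  move=> a b c _ ab bc _ Pab Pbc fga t /andP[at_ tc].
  have [tb|tb] := leP t b; first by apply: Pab => //; rewrite at_.
  apply: Pbc; last by rewrite ltW.
  by apply: Pab => //; rewrite ab lexx.
move=> x x01; have [U [oU Ux [I [V [UV tV Vi]]]]] := cov (p (f x)).
have Vf : (\bigcup_i V i) (f x) by rewrite -UV.
have Vg : (\bigcup_i V i) (g x) by rewrite -UV /= -fg.
case: Vf => i _ Vif; case: Vg => j _ Vjg.
have [oVi [_ inji _] _] := Vi i; have [oVj _ _] := Vi j.
have nf : nbhs x (f @^-1` V i) by apply: fc; exact: open_nbhs_nbhs.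
have ng : nbhs x (g @^-1` V j) by apply: gc; exact: open_nbhs_nbhs.
have /nbhs_ballP[e /= e0 eB] : nbhs x ((f @^-1` V i) `&` (g @^-1` V j)) by exact: filterI.
exists e => // a b a0 ab b1 ax bx fga t /andP[at_ tb].
have xin y : a <= y <= b -> V i (f y) /\ V j (g y).
  move=> /andP[ay yb]; apply: eB; rewrite /ball /= distrC.
  by move: ax bx; rewrite !ltr_norml => /andP[??] /andP[??]; apply/andP; split; lra.
have [fa ga] : V i (f a) /\ V j (g a) by apply: xin; rewrite lexx.
have ij : i = j by apply: tV => //; exists (f a); split => //; rewrite fga.
have [ft gt] : V i (f t) /\ V j (g t) by apply: xin; rewrite at_.
apply: inji; rewrite ?inE//; first by rewrite ij.
apply: fg; rewrite (le_trans a0 at_)//; exact: le_trans tb b1.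
Qed.

Lemma unique_path_lifting_ab (f g : R -> E) a b : a <= b ->
  continuous f -> continuous g -> (forall t, a <= t <= b -> p (f t) = p (g t)) ->
  f a = g a -> forall t, a <= t <= b -> f t = g t.
Proof.
move=> ab fc gc fg fga t; have [E1|anb] := eqVneq a b.
  by rewrite E1 -eq_le => /eqP <-; rewrite -E1.
have lab : 0 < b - a by rewrite subr_gt0 lt_neqAle anb.
move=> /andP[at_ tb].
pose h u := a + u * (b - a).
have hc : continuous h.
  apply: realD_continuous; first exact: realcst_continuous.
  by apply: realM_continuous; [move=> ?; exact: cvg_id|exact: realcst_continuous].
have h0 : h 0 = a by rewrite /h mul0r addr0.
have ht : h ((t - a) / (b - a)) = t by rewrite /h divfK ?gt_eqF// addrC subrK.
rewrite -ht; apply: (@unique_path_lifting (f \o h) (g \o h)).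
- exact: comp_continuous.
- exact: comp_continuous.
- move=> u /andP[u0 u1]; apply: fg; rewrite /h lerDl mulr_ge0 ?(ltW lab)//=.
  by rewrite -lerBrDl ler_piMl// ltW.
- by rewrite /= h0.
by rewrite divr_ge0 ?subr_ge0// ler_pdivrMr// mul1r lerD2r.
Qed.

Variable H : R * R -> X.
Hypothesis HC : continuous H.

(** A lift is a map on the whole plane of which only the values on the rectangle are constrained.
    Allowing any starting point over the corner [(a, c)] makes the property stable under
    juxtaposition of rectangles. *)
Definition good a b c d : Prop := forall e, p e = H (a, c) ->
  exists L : R * R -> E, [/\ continuous L,
    forall s t, a <= s <= b -> c <= t <= d -> p (L (s, t)) = H (s, t) & L (a, c) = e].

(** The second lift starts where the first one arrives; along the common edge they agree by
    uniqueness of path lifting. *)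
Lemma good_cat2 a b c d e : a <= b -> c <= d -> d <= e ->
  good a b c d -> good a b d e -> good a b c e.
Proof.
move=> ab cd de G1 G2 x px.
have [L1 [c1 p1 e1]] := G1 x px.
have [|L2 [c2 p2 e2]] := G2 (L1 (a, d)).
  by rewrite p1// ?lexx ?ab ?cd.
have eqd s : a <= s <= b -> L1 (s, d) = L2 (s, d).
  have slc (L : R * R -> E) : continuous L -> continuous (fun s => L (s, d)).
    move=> Lc; apply: comp_continuous => //.
    by apply: pair_continuous; [move=> ?; exact: cvg_id|exact: realcst_continuous].
  apply: (@unique_path_lifting_ab (fun s => L1 (s, d)) (fun s => L2 (s, d))) => //.
  - exact: slc.
  - exact: slc.
  by move=> t tab; rewrite p1 ?p2// ?lexx ?cd ?de.
have cc (L : R * R -> E) : continuous L -> continuous (fun x : R * R => L (clampab a b x.1, x.2)).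
  move=> Lc; apply: comp_continuous => //; apply: pair_continuous; last exact: snd_continuous.
  by apply: comp_continuous; [exact: fst_continuous|exact: clampab_continuous].
exists (fun x => if x.2 - d <= 0 then L1 (clampab a b x.1, x.2) else L2 (clampab a b x.1, x.2)).
split.
- apply: if_le_continuous; [|exact: cc|exact: cc|].
    by apply: realB_continuous; [exact: snd_continuous|exact: realcst_continuous].
  move=> [s t] /= /eqP; rewrite subr_eq0 => /eqP ->; apply: eqd; exact: clampab_in.
- move=> s t sab /andP[ct te] /=; rewrite clampab_id// subr_le0.
  by case: (leP t d) => td; [apply: p1 => //; rewrite ct td|apply: p2 => //; rewrite (ltW td) te].
- by rewrite /= subr_le0 cd clampab_id// lexx.
Qed.

Lemma good_cat1 a b c d e : c <= d -> a <= b -> b <= e ->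
  good a b c d -> good b e c d -> good a e c d.
Proof.
move=> cd ab be G1 G2 x px.
have [L1 [c1 p1 e1]] := G1 x px.
have [|L2 [c2 p2 e2]] := G2 (L1 (b, c)).
  by rewrite p1// ?lexx ?ab ?cd.
have eqd s : c <= s <= d -> L1 (b, s) = L2 (b, s).
  have slc (L : R * R -> E) : continuous L -> continuous (fun s => L (b, s)).
    move=> Lc; apply: comp_continuous => //.
    by apply: pair_continuous; [exact: realcst_continuous|move=> ?; exact: cvg_id].
  apply: (@unique_path_lifting_ab (fun s => L1 (b, s)) (fun s => L2 (b, s))) => //.
  - exact: slc.
  - exact: slc.
  by move=> t tab; rewrite p1 ?p2// ?lexx ?ab ?be.
have cc (L : R * R -> E) : continuous L -> continuous (fun x : R * R => L (x.1, clampab c d x.2)).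
  move=> Lc; apply: comp_continuous => //; apply: pair_continuous; first exact: fst_continuous.
  by apply: comp_continuous; [exact: snd_continuous|exact: clampab_continuous].
exists (fun x => if x.1 - b <= 0 then L1 (x.1, clampab c d x.2) else L2 (x.1, clampab c d x.2)).
split.
- apply: if_le_continuous; [|exact: cc|exact: cc|].
    by apply: realB_continuous; [exact: fst_continuous|exact: realcst_continuous].
  move=> [s t] /= /eqP; rewrite subr_eq0 => /eqP ->; apply: eqd; exact: clampab_in.
- move=> s t /andP[as_ se] tcd /=; rewrite clampab_id// subr_le0.
  by case: (leP s b) => sb; [apply: p1 => //; rewrite as_ sb|apply: p2 => //; rewrite (ltW sb) se].
- by rewrite /= subr_le0 ab clampab_id// lexx.
Qed.

(** A small rectangle maps into an evenly covered set, and the lift is the inverse of [p] on the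
    sheet of the given point. Its continuity is the openness clause of [evenly_covered]. *)
Lemma good_local x y : exists2 e, 0 < e & forall a b c d, a <= b -> c <= d ->
  `|a - x| < e -> `|b - x| < e -> `|c - y| < e -> `|d - y| < e -> good a b c d.
Proof.
have [U [oU Ux [I [V [UV tV Vi]]]]] := cov (H (x, y)).
have /nbhs_ballP[e /= e0 eB] : nbhs (x, y) (H @^-1` U) by apply: HC; exact: open_nbhs_nbhs.
exists e => // a b c d ab cd ax bx cy dy z pz.
have inU s t : a <= s <= b -> c <= t <= d -> U (H (s, t)).
  move=> /andP[as_ sb] /andP[ct td]; apply: eB; split; rewrite /= /ball /= distrC.
    by move: ax bx; rewrite !ltr_norml => /andP[??] /andP[??]; apply/andP; split; lra.
  by move: cy dy; rewrite !ltr_norml => /andP[??] /andP[??]; apply/andP; split; lra.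
have Vz : (\bigcup_i V i) z by rewrite -UV /= pz; apply: inU; rewrite lexx.
case: Vz => i _ Viz; have [oVi [VU injV surjV] openp] := Vi i.
have qP u : exists z', U u -> V i z' /\ p z' = u.
  have [Uu|nU] := pselect (U u); last by exists z.
  by have [z' Vz' pz'] := surjV u Uu; exists z'.
pose q u := projT1 (cid (qP u)).
have qE u : U u -> V i (q u) /\ p (q u) = u := projT2 (cid (qP u)).
pose cl (st : R * R) := (clampab a b st.1, clampab c d st.2).
have clc : continuous cl.
  apply: pair_continuous.
    by apply: comp_continuous; [exact: fst_continuous|exact: clampab_continuous].
  by apply: comp_continuous; [exact: snd_continuous|exact: clampab_continuous].
have Ucl st : U (H (cl st)) by apply: inU; exact: clampab_in.
exists (fun st => q (H (cl st))); split.
- move=> st N; rewrite nbhsE => -[O [oO Oq] ON].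
  have [Vq pq] := qE _ (Ucl st).
  have oOV : open (p @` (O `&` V i)) by apply: openp => [|? []//]; exact: openI.
  have : nbhs (H (cl st)) (p @` (O `&` V i)).
    by apply: open_nbhs_nbhs; split => //; exists (q (H (cl st))).
  have Hcl : continuous (fun st => H (cl st)) by exact: comp_continuous.
  move=> /Hcl; apply: (@filterS _ (nbhs st)) => st' [z' [Oz' Vz'] pz']; apply: ON.
  have [Vq' pq'] := qE _ (Ucl st').
  by rewrite (_ : q _ = z')//; apply: injV; rewrite ?inE// pq'.
- by move=> s t sab tcd; rewrite /cl /= !clampab_id//; have [] := qE _ (inU s t sab tcd).
- rewrite /cl /= !clampab_id ?lexx//.
  have [|Vq pq] := qE (H (a, c)); first by apply: inU; rewrite lexx.
  by apply: injV; rewrite ?inE// pq.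
Qed.

(** Interval induction twice: in the second variable it yields a strip of some width around each
    [x], in the first variable it joins the strips. *)
Theorem square_lifting : good 0 1 0 1.
Proof.
have strip x : 0 <= x <= 1 -> exists2 e, 0 < e & forall a b, a <= b ->
    `|a - x| < e -> `|b - x| < e -> good a b 0 1.
  move=> x01; apply: (interval_induction (P := fun c d => exists2 e, 0 < e &
    forall a b, a <= b -> `|a - x| < e -> `|b - x| < e -> good a b c d)).
    move=> c d d' _ cd dd' _ [e1 e10 G1] [e2 e20 G2].
    exists (Num.min e1 e2); first by rewrite lt_min e10.
    move=> a b ab; rewrite !lt_min => /andP[a1 a2] /andP[b1 b2].
    by apply: (@good_cat2 _ _ _ d) => //; [exact: G1|exact: G2].
  move=> y _; have [e e0 G] := good_local x y; exists e => // c d _ cd _ cy dy.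
  by exists e => // a b ab ax bx; exact: G.
apply: (interval_induction (P := fun a b => good a b 0 1)).
  by move=> a b c _ ab bc _; exact: good_cat1.
by move=> x /strip[e e0 G]; exists e => // a b _ ab _; exact: G.
Qed.

End Covering.

Section PathLifting.
Variables (E X : topologicalType) (p : E -> X).
Hypothesis cov : forall x, exists U, [/\ open U, U x & evenly_covered p U].

Theorem path_lifting (f : R -> X) e : continuous f -> p e = f 0 ->
  exists L : R -> E, [/\ continuous L, forall t, 0 <= t <= 1 -> p (L t) = f t & L 0 = e].
Proof.
move=> fc pe.
have Hc : continuous (fun st : R * R => f st.1).
  by apply: comp_continuous => //; exact: fst_continuous.
have [L [Lc pL Le]] := square_lifting cov Hc pe.
exists (fun t => L (t, 0)); split => //.
  apply: comp_continuous => //.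
  by apply: pair_continuous; [move=> ?; exact: cvg_id|exact: realcst_continuous].
by move=> t t01; apply: pL => //; rewrite lexx ler01.
Qed.

End PathLifting.

End Intervals.

(** * Homotopies of paths, and deformation along paths *)

Section Paths.
Variable R : realType.
Local Notation clamp := (@clamp R).

Lemma clamp_in u : 0 <= clamp u <= 1.
Proof. by rewrite clamp_ge0 clamp_le1. Qed.

Lemma clampK u : clamp (clamp u) = clamp u.
Proof. by rewrite clamp_id// clamp_in. Qed.

Lemma clamp_01 (b : bool) : 0 <= (b%:R : R) <= 1.
Proof. by case: b; rewrite ?lexx ?ler01. Qed.

Lemma realcst_continuous' (X : topologicalType) (x : X) : continuous (fun _ : R => x).
Proof. by move=> t; exact: cvg_cst. Qed.

Definition clamp2 (x : R * R) : R * R := (clamp x.1, clamp x.2).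

Lemma clamp2_continuous : continuous clamp2.
Proof.
by apply: pair_continuous; apply: comp_continuous; [exact: fst_continuous|
  exact: clamp_continuous|exact: snd_continuous|exact: clamp_continuous].
Qed.

Lemma id_continuous (T : topologicalType) : continuous (fun x : T => x).
Proof. by move=> x; exact: cvg_id. Qed.

Lemma within_continuous_comp (T Z X : topologicalType) (A : set Z) (c : T -> Z) (f : Z -> X) :
  continuous c -> (forall t, A (c t)) -> {within A, continuous f} ->
  continuous (fun t => f (c t)).
Proof.
move=> cc Ac /subspace_continuousP fc t N /(fc _ (Ac t)) fN.
have /(cc t) : nbhs (c t) [set z | A z -> N (f z)] by exact: fN.
by apply: (@filterS _ (nbhs t)) => t' /=; apply; exact: Ac.
Qed.

Lemma within_clamp (X : topologicalType) (f : R -> X) :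
  {within `[(0 : R), 1], continuous f} <-> continuous (f \o clamp).
Proof.
split.
  move=> fc; apply: within_continuous_comp fc; first exact: clamp_continuous.
  by move=> t; rewrite /= in_itv /= clamp_in.
move=> fc; apply: (@subspace_eq_continuous _ _ _ ((f \o clamp) : subspace _ -> _)); last exact: continuous_subspaceT.
by move=> t; rewrite inE /= in_itv /= => t01; rewrite /from_subspace /= clamp_id.
Qed.

Section OneSpace.
Variable X : topologicalType.
Implicit Types (f g h : R -> X).

(** Continuity on the whole plane avoids subspace topologies; by clamping, the notion is equivalent
    to [path_homotopic]. *)
Definition homot f g : Prop := exists H : R * R -> X, [/\ continuous H,
  forall t : R, 0 <= t <= 1 -> H (0, t) = f t,
  forall t : R, 0 <= t <= 1 -> H (1, t) = g t,
  forall s : R, 0 <= s <= 1 -> H (s, 0) = f 0 &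
  forall s : R, 0 <= s <= 1 -> H (s, 1) = f 1].

Lemma homotP f g : path_homotopic f g <-> homot f g.
Proof.
split=> [[H [Hc H0 H1 H2 H3]]|[H [Hc H0 H1 H2 H3]]].
  exists (H \o clamp2); split.
  - apply: within_continuous_comp Hc; first exact: clamp2_continuous.
    by move=> t; split; rewrite /= in_itv /= clamp_in.
  - by move=> t t01; rewrite /= /clamp2 /= clamp0 clamp_id// H0.
  - by move=> t t01; rewrite /= /clamp2 /= clamp1 clamp_id// H1.
  - by move=> t t01; rewrite /= /clamp2 /= clamp0 clamp_id// H2.
  - by move=> t t01; rewrite /= /clamp2 /= clamp1 clamp_id// H3.
exists H; split=> [|t|t|t|t]; rewrite ?in_itv //=; try by [exact: H0|exact: H1|exact: H2|exact: H3].
exact: continuous_subspaceT.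
Qed.

Lemma homot_ext f f' g g' : (forall t : R, 0 <= t <= 1 -> f t = f' t) ->
  (forall t : R, 0 <= t <= 1 -> g t = g' t) -> homot f g -> homot f' g'.
Proof.
move=> ff gg [H [Hc H0 H1 H2 H3]]; exists H; split => //.
- by move=> t t01; rewrite H0// ff.
- by move=> t t01; rewrite H1// gg.
- by move=> t t01; rewrite H2// ff// lexx ler01.
- by move=> t t01; rewrite H3// ff// lexx ler01.
Qed.

Lemma homot_ends f g : homot f g -> f 0 = g 0 /\ f 1 = g 1.
Proof.
by move=> [H [Hc H0 H1 H2 H3]]; split; [rewrite -(H2 1) ?H1|rewrite -(H3 1) ?H1];
  rewrite ?lexx ?ler01.
Qed.

Lemma homot_sym f g : homot f g -> homot g f.
Proof.
move=> fg; have [e0 e1] := homot_ends fg; move: fg => [H [Hc H0 H1 H2 H3]].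
exists (fun x => H (1 - x.1, x.2)); split=> [|t t01|t t01|s /andP[s0 s1]|s /andP[s0 s1]] /=.
- apply: comp_continuous => //; apply: pair_continuous; last exact: snd_continuous.
  by apply: realB_continuous; [exact: realcst_continuous|exact: fst_continuous].
- by rewrite subr0 H1.
- by rewrite subrr H0.
- by rewrite H2 ?e0//; apply/andP; split; lra.
- by rewrite H3 ?e1//; apply/andP; split; lra.
Qed.

Lemma homot_trans f g h : homot f g -> homot g h -> homot f h.
Proof.
move=> fg; have [e0 e1] := homot_ends fg; move: fg => [H [Hc H0 H1 H2 H3]].
move=> [K [Kc K0 K1 K2 K3]].
exists (fun x => if x.1 - 2^-1 <= 0 then H (2 * x.1, clamp x.2) else K (2 * x.1 - 1, clamp x.2)).
have sc : continuous (fun x : R * R => clamp x.2).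
  by apply: comp_continuous; [exact: snd_continuous|exact: clamp_continuous].
have dc : continuous (fun x : R * R => 2 * x.1).
  by apply: realM_continuous; [exact: realcst_continuous|exact: fst_continuous].
split=> [|t t01|t t01|s /andP[s0 s1]|s /andP[s0 s1]] /=.
- apply: if_le_continuous.
  + by apply: realB_continuous; [exact: fst_continuous|exact: realcst_continuous].
  + by apply: comp_continuous => //; exact: pair_continuous.
  + apply: comp_continuous => //; apply: pair_continuous => //.
    by apply: realB_continuous => //; exact: realcst_continuous.
  move=> [s t] /= st; have -> : 2 * s = 1 by lra.
  by rewrite subrr H1 ?clamp_in// K0 ?clamp_in.
- by rewrite ifT; [rewrite mulr0 clamp_id// H0|lra].
- rewrite ifF; last by apply/negbTE; rewrite -ltNge; lra.
  by rewrite mulr1 clamp_id// (_ : 2 - 1 = 1) ?K1//; lra.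
- by rewrite clamp0; case: ifP => ss; rewrite ?H2 ?K2 ?e0//; apply/andP; split; lra.
- by rewrite clamp1; case: ifP => ss; rewrite ?H3 ?K3 ?e1//; apply/andP; split; lra.
Qed.

(* The boundary of a square is null-homotopic: [f] is first dragged to the other
   three sides, where it runs out and back along the common side. *)
Lemma free_null (H : R * R -> X) f : continuous H ->
  (forall t : R, 0 <= t <= 1 -> H (0, t) = f t) ->
  (forall s : R, 0 <= s <= 1 -> H (s, 0) = H (s, 1)) ->
  (forall t : R, 0 <= t <= 1 -> H (1, t) = H (1, 0)) ->
  homot f (fun=> f 0).
Proof.
move=> Hc H0 Hs H1.
(* On the three thirds of the unit interval [(k, w)] runs along the side [w = 0], then along
   [k = 1], then back along [w = 1]. *)
pose k (t : R) := clamp (Num.min (3 * t) (3 - 3 * t)).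
pose w (t : R) := clamp (3 * t - 1).
have i0 : 0 <= (0 : R) <= 1 by rewrite lexx ler01.
have i1 : 0 <= (1 : R) <= 1 by rewrite lexx ler01.
have t3c : continuous (fun t : R => 3 * t).
  by apply: realM_continuous; [exact: realcst_continuous|exact: id_continuous].
have kc : continuous k.
  apply: (@comp_continuous _ _ _ (fun t : R => Num.min (3 * t) (3 - 3 * t)) clamp); last exact: clamp_continuous.
  move=> t; apply: (@continuous_min R R (fun t => 3 * t) (fun t => 3 - 3 * t)); first exact: t3c.
  by apply: realB_continuous => //; exact: realcst_continuous.
have wc : continuous w.
  apply: (@comp_continuous _ _ _ (fun t : R => 3 * t - 1) clamp); last exact: clamp_continuous.
  by apply: realB_continuous => //; exact: realcst_continuous.
have k0 : k 0 = 0 by rewrite /k mulr0 subr0 min_l// clamp0.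
have k1 : k 1 = 0 by rewrite /k mulr1 subrr min_r// clamp0.
have w0 : w 0 = 0 by rewrite /w mulr0 sub0r /clamp min_r ?max_l//; lra.
have w1 : w 1 = 1 by rewrite /w mulr1 /clamp min_l ?max_r//; lra.
have Hkw t : 0 <= t <= 1 -> H (k t, w t) = H (k t, 0).
  move=> /andP[t0 t1]; have [t3|t3] := leP t 3^-1.
    by rewrite /w /clamp min_r ?max_l//; lra.
  have [t23|t23] := leP (2 / 3) t.
    have -> : w t = 1 by rewrite /w /clamp min_l ?max_r//; lra.
    by rewrite -Hs// clamp_in.
  have -> : k t = 1.
    by rewrite /k /clamp min_l ?max_r// le_min; apply/andP; split; lra.
  by rewrite H1// clamp_in.
apply: (@homot_trans _ (fun t => H (k t, 0))).
  exists (fun x => H (x.1 * k (clamp x.2), (1 - x.1) * clamp x.2 + x.1 * w (clamp x.2))).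
  have sc : continuous (fun x : R * R => clamp x.2).
    by apply: comp_continuous; [exact: snd_continuous|exact: clamp_continuous].
  have f1c : continuous (@fst R R) by exact: fst_continuous.
  split=> [|t t01|t t01|s /andP[s0 s1]|s /andP[s0 s1]] /=.
  - apply: comp_continuous => //; apply: pair_continuous.
      apply: realM_continuous => //.
      exact: (@comp_continuous _ _ _ (fun x : R * R => clamp x.2) k).
    apply: realD_continuous; apply: realM_continuous => //.
      by apply: realB_continuous => //; exact: realcst_continuous.
    exact: (@comp_continuous _ _ _ (fun x : R * R => clamp x.2) w).
  - by rewrite !mul0r subr0 mul1r addr0 clamp_id// H0.
  - by rewrite subrr mul0r !mul1r add0r clamp_id// Hkw.
  - by rewrite clamp0 k0 w0 !mulr0 addr0 H0.
  - rewrite clamp1 k1 w1 !mulr0 !mulr1 subrK H0//.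
exists (fun x => H ((1 - x.1) * k x.2, 0)).
split=> [|t t01|t t01|s /andP[s0 s1]|s /andP[s0 s1]] /=.
- apply: comp_continuous => //; apply: pair_continuous; last exact: realcst_continuous.
  apply: realM_continuous.
    by apply: realB_continuous; [exact: realcst_continuous|exact: fst_continuous].
  by apply: (@comp_continuous _ _ _ snd k) => //; exact: snd_continuous.
- by rewrite subr0 mul1r.
- by rewrite subrr mul0r H0.
- by rewrite k0 mulr0.
- by rewrite k1 mulr0.
Qed.

Definition pconn (x y : X) : Prop := exists f : R -> X, [/\ continuous f, f 0 = x & f 1 = y].

Lemma pconnP x y : (exists f : R -> X, is_path x y f) <-> pconn x y.
Proof.
split=> [[f [/within_clamp fc f0 f1]]|[f [fc f0 f1]]].
  by exists (f \o clamp); split; rewrite //= ?clamp0 ?clamp1.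
by exists f; split => //; exact: continuous_subspaceT.
Qed.

Lemma pconn_sym x y : pconn x y -> pconn y x.
Proof.
move=> [f [fc f0 f1]]; exists (fun t => f (1 - t)); split; rewrite ?subr0 ?subrr//.
apply: comp_continuous => //.
by apply: realB_continuous; [exact: realcst_continuous|exact: id_continuous].
Qed.

Lemma pconn_trans x y z : pconn x y -> pconn y z -> pconn x z.
Proof.
move=> [f [fc f0 f1]] [g [gc g0 g1]].
exists (fun t => if t - 2^-1 <= 0 then f (2 * t) else g (2 * t - 1)); split.
- have dc : continuous (fun x : R => 2 * x).
    by apply: realM_continuous; [exact: realcst_continuous|exact: id_continuous].
  apply: if_le_continuous.
  + by apply: realB_continuous; [exact: id_continuous|exact: realcst_continuous].
  + exact: comp_continuous.
  + apply: (@comp_continuous _ _ _ (fun t : R => 2 * t - 1) g) => //.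
    by apply: realB_continuous => //; exact: realcst_continuous.
  move=> t t2; have -> : 2 * t = 1 by lra.
  by rewrite subrr f1 g0.
- by rewrite ifT ?mulr0//; lra.
- rewrite ifF; last by apply/negbTE; rewrite -ltNge; lra.
  by rewrite (_ : 2 * 1 - 1 = 1)//; lra.
Qed.

End OneSpace.

Lemma homot_comp (X Y : topologicalType) (F : X -> Y) f g :
  continuous F -> homot f g -> homot (F \o f) (F \o g).
Proof.
move=> Fc [H [Hc H0 H1 H2 H3]]; exists (F \o H); split=> [|t t01|t t01|s s01|s s01] /=.
- exact: comp_continuous.
- by rewrite H0.
- by rewrite H1.
- by rewrite H2.
- by rewrite H3.
Qed.

(* With a retraction of [Y] onto [X], this is what is needed for [i] to induce an
   isomorphism of fundamental groups. *)
Definition deformable (X Y : topologicalType) (i : X -> Y) : Prop :=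
  exists eta : Y -> R -> Y, [/\ forall y, eta y 0 = y,
    forall x s, eta (i x) s = i x &
    forall f : R -> Y, continuous f -> exists H : R * R -> Y, [/\ continuous H,
      forall t : R, 0 <= t <= 1 -> H (0, t) = f t,
      forall t : R, 0 <= t <= 1 -> exists x, H (1, t) = i x,
      forall s : R, 0 <= s <= 1 -> H (s, 0) = eta (f 0) s &
      forall s : R, 0 <= s <= 1 -> H (s, 1) = eta (f 1) s]].

Lemma deformable_end (X Y : topologicalType) (i : X -> Y) eta :
  (forall f : R -> Y, continuous f -> exists H : R * R -> Y, [/\ continuous H,
      forall t : R, 0 <= t <= 1 -> H (0, t) = f t,
      forall t : R, 0 <= t <= 1 -> exists x, H (1, t) = i x,
      forall s : R, 0 <= s <= 1 -> H (s, 0) = eta (f 0) s &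
      forall s : R, 0 <= s <= 1 -> H (s, 1) = eta (f 1) s]) ->
  forall y, exists x, eta y 1 = i x.
Proof.
move=> eH y; have [H [_ _ H1 H2 _]] := eH _ (@realcst_continuous' Y y).
have [x Hx] := H1 0 (clamp_01 false); exists x; rewrite -H2 ?Hx//.
exact: (clamp_01 true).
Qed.

(** The first hypothesis says that a path inside the image of [j] is a path of [Y]. The deformation
    for [j] takes the first half of the time, the one for [i], inside [Y], the second. The tracks of
    the ends fit together because each [eta] depends on the end point only. *)
Lemma deformable_comp (X Y Z : topologicalType) (i : X -> Y) (j : Y -> Z) :
  (forall f : R -> Z, continuous f -> (forall t, exists y, f t = j y) ->
     exists2 g : R -> Y, continuous g & forall t, f t = j (g t)) ->
  continuous j -> injective j -> deformable i -> deformable j -> deformable (j \o i).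
Proof.
move=> jlift jc ji [eta [e0 ei eH]] [zeta [z0 zj zH]].
have zend z : exists y, zeta z 1 = j y := deformable_end zH z.
pose y z := projT1 (cid (zend z)).
have yE z : zeta z 1 = j (y z) := projT2 (cid (zend z)).
exists (fun z s => if s - 2^-1 <= 0 then zeta z (2 * s) else j (eta (y z) (2 * s - 1))).
split=> [z|x s|f fc].
- by rewrite ifT ?mulr0//; lra.
- have yx : y (j (i x)) = i x by apply: ji; rewrite -yE zj.
  by case: ifP => _; rewrite /= ?zj// yx ei.
have [H [Hc H0 H1 H2 H3]] := zH f fc.
have topc : continuous (fun t => H (1, clamp t)).
  apply: comp_continuous => //; apply: pair_continuous; first exact: realcst_continuous.
  exact: clamp_continuous.
have [|g gc gE] := jlift _ topc; first by move=> t; apply: H1; exact: clamp_in.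
have [K [Kc K0 K1 K2 K3]] := eH g gc.
have g0 : y (f 0) = g 0 by apply: ji; rewrite -yE -gE clamp0 H2 ?lexx ?ler01.
have g1 : y (f 1) = g 1 by apply: ji; rewrite -yE -gE clamp1 H3 ?lexx ?ler01.
exists (fun x => if x.1 - 2^-1 <= 0 then H (2 * x.1, clamp x.2) else j (K (2 * x.1 - 1, clamp x.2))).
have sc : continuous (fun x : R * R => clamp x.2).
  by apply: comp_continuous; [exact: snd_continuous|exact: clamp_continuous].
have dc : continuous (fun x : R * R => 2 * x.1).
  by apply: realM_continuous; [exact: realcst_continuous|exact: fst_continuous].
split=> [|t t01|t t01|s /andP[s0 s1]|s /andP[s0 s1]] /=.
- apply: if_le_continuous.
  + by apply: realB_continuous; [exact: fst_continuous|exact: realcst_continuous].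
  + by apply: comp_continuous => //; exact: pair_continuous.
  + apply: (@comp_continuous _ _ _ (fun x : R * R => K (2 * x.1 - 1, clamp x.2)) j) => //.
    apply: comp_continuous => //; apply: pair_continuous => //.
    by apply: realB_continuous => //; exact: realcst_continuous.
  move=> [s t] /= st; have -> : 2 * s = 1 by lra.
  by rewrite subrr K0 ?clamp_in// -gE clampK.
- by rewrite ifT; [rewrite mulr0 clamp_id// H0|lra].
- rewrite ifF; last by apply/negbTE; rewrite -ltNge; lra.
  rewrite mulr1 clamp_id// (_ : 2 - 1 = 1); last by lra.
  by have [x ->] := K1 t t01; exists x.
- by rewrite clamp0; case: ifP => ss; rewrite ?H2 ?K2 ?g0//; apply/andP; split; lra.
- by rewrite clamp1; case: ifP => ss; rewrite ?H3 ?K3 ?g1//; apply/andP; split; lra.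
Qed.

End Paths.

(** * The universal covering pulled back along a retraction *)

Section Pullback.
Variables (R : realType) (G : groupType) (X : topologicalType) (x0 : X)
  (th : pi1_iso R G x0) (U : universal_covering th).
Variables (Y : topologicalType) (i : continuousType X Y) (r : continuousType Y X).
Hypothesis iK : forall x, r (i x) = x.
Hypothesis idef : deformable R i.
Local Notation E := (ucover U).
Local Notation p := (uproj U).
Local Notation clamp := (@clamp R).

Definition pb_set : set (Y * E) := [set z | r z.1 = p z.2].
Definition pb : topologicalType := [the topologicalType of set_type pb_set].
Definition pbY (z : pb) : Y := (set_val z : Y * E).1.
Definition pbE (z : pb) : E := (set_val z : Y * E).2.

Lemma pb_eq z : r (pbY z) = p (pbE z).
Proof. by have := set_valP z. Qed.

Lemma pbY_continuous : continuous pbY.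
Proof. by apply: comp_continuous; [exact: subtype_val_continuous|exact: fst_continuous]. Qed.
Lemma pbE_continuous : continuous pbE.
Proof. by apply: comp_continuous; [exact: subtype_val_continuous|exact: snd_continuous]. Qed.
HB.instance Definition _ := isContinuous.Build _ _ pbY pbY_continuous.
HB.instance Definition _ := isContinuous.Build _ _ pbE pbE_continuous.

Lemma pbP z z' : pbY z = pbY z' -> pbE z = pbE z' -> z = z'.
Proof.
move=> y e; apply: val_inj; apply/eqP; rewrite -pair_eqE; apply/andP; split; apply/eqP.
  exact: y.
exact: e.
Qed.

Definition mkpb (T : Type) (a : T -> Y) (b : T -> E) (h : forall t, r (a t) = p (b t)) (t : T) : pb :=
  SigSub (mem_set (h t : pb_set (a t, b t))).

Lemma mkpb_continuous (T : topologicalType) (a : T -> Y) (b : T -> E) h :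
  continuous a -> continuous b -> continuous (@mkpb T a b h).
Proof. by move=> ac bc; apply: subtype_continuous; exact: pair_continuous. Qed.

Lemma ucover_is_cov x : exists O, [/\ open O, O x & evenly_covered p O].
Proof. exact: uproj_covering. Qed.

(** Sheets are the preimages of the sheets of [p]; on such a sheet the component in [Y] determines
    the other one. Openness of the projection comes from openness of [p] on the sheet below. *)
Lemma pb_covering y : exists O, [/\ open O, O y & evenly_covered pbY O].
Proof.
have [O [oO Oy [I [V [OV tV Vi]]]]] := ucover_is_cov (r y).
exists (r @^-1` O); split => //.
  by apply: open_comp => // z _; exact: cts_fun.
exists I, (fun k => pbE @^-1` V k); split.
- apply/seteqP; split => z /=.
    rewrite pb_eq => Oz; have : (p @^-1` O) (pbE z) by [].
    by rewrite OV => -[k _ Vk]; exists k.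
  move=> [k _ Vk]; rewrite pb_eq; have : (\bigcup_k V k) (pbE z) by exists k.
  by rewrite -OV.
- move=> k l _ _ [z [Vk Vl]]; apply: tV => //; by exists (pbE z).
move=> k; have [oV [Vf injV surjV] openp] := Vi k; split.
- by apply: open_comp => // z _; exact: pbE_continuous.
- split.
  + by move=> z /= Vz; rewrite pb_eq; exact: Vf.
  + move=> z z'; rewrite !inE /= => Vz Vz' yy'; apply: pbP => //.
    by apply: injV; rewrite ?inE// -!pb_eq yy'.
  + move=> y' /= Oy'; have [e Ve pe] := surjV _ Oy'.
    have h (_ : unit) : r y' = p e by rewrite pe.
    by exists (mkpb h tt).
move=> W oW WV; rewrite openE => _ [z Wz <-].
have [D [[D' oD' DD'] Dz DW]] : nbhs z W by exact: open_nbhs_nbhs.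
have : nbhs (pbY z, pbE z) D'.
  by apply: open_nbhs_nbhs; split => //; move: Dz; rewrite -DD' /= /pbY /pbE; case: (set_val z).
move=> [[A B] /= [nA nB] AB].
rewrite nbhsE in nB; case: nB => B' [oB' Bz] BB'.
have oB : open (p @` (B' `&` V k)) by apply: openp => [|e []//]; exact: openI.
have nr : nbhs (pbY z) (r @^-1` (p @` (B' `&` V k))).
  apply: cts_fun; apply: open_nbhs_nbhs; split => //; exists (pbE z); last by rewrite pb_eq.
  by split => //; exact: WV.
rewrite /interior; apply: filterS (filterI nA nr) => y' [Ay' [e [B'e Ve] pe]].
have h (_ : unit) : r y' = p e by rewrite pe.
exists (mkpb h tt) => //; apply: DW; rewrite -DD'; apply: (AB (y', e)); split => //=.
exact: BB'.
Qed.

Definition pb_incl : E -> pb := @mkpb E (i \o p) idfun (fun e => iK (p e)).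
Lemma pb_incl_continuous : continuous pb_incl.
Proof. by apply: mkpb_continuous; [exact: cts_fun|exact: id_continuous]. Qed.
HB.instance Definition _ := isContinuous.Build _ _ pb_incl pb_incl_continuous.

Lemma pb_deck_subproof g z : r (pbY z) = p (deck U g (pbE z)).
Proof. by rewrite deck_proj pb_eq. Qed.
Definition pb_deck g : pb -> pb := mkpb (pb_deck_subproof g).
Lemma pb_deck_continuous g : continuous (pb_deck g).
Proof.
apply: mkpb_continuous; first exact: pbY_continuous.
by apply: comp_continuous; [exact: pbE_continuous|exact: cts_fun].
Qed.
HB.instance Definition _ g := isContinuous.Build _ _ (pb_deck g) (@pb_deck_continuous g).

(** The [Y]-component moves into [X] along its track; lifting the retraction of this track to [E]
    supplies the second component. *)
Lemma pb_to_incl (z : pb) : exists e, pconn R z (pb_incl e).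
Proof.
have [eta [e0 ei eH]] := idef.
have [H [Hc H0 H1 H2 _]] := eH _ (@realcst_continuous' R Y (pbY z)).
pose a t := H (clamp t, 0).
have ac : continuous a.
  apply: comp_continuous => //; apply: pair_continuous; last exact: realcst_continuous.
  exact: clamp_continuous.
have a0 : a 0 = pbY z by rewrite /a clamp0 H0// (clamp_01 _ false).
have [x ax] : exists x, a 1 = i x.
  by rewrite /a clamp1; apply: H1; exact: (clamp_01 _ false).
have rac : continuous (fun t => r (a t)) by apply: comp_continuous => //; exact: cts_fun.
have [|L [Lc pL L0]] := path_lifting (e := pbE z) ucover_is_cov rac; first by rewrite a0 pb_eq.
have h t : r (a t) = p (L (clamp t)) by rewrite pL ?clamp_in// /a clampK.
exists (L 1), (mkpb h); split.
- by apply: mkpb_continuous => //; apply: comp_continuous => //; exact: clamp_continuous.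
- by apply: pbP; rewrite /pbY /pbE /= ?a0 ?clamp0.
- apply: pbP; rewrite /pbY /pbE /= ?clamp1// ax; congr (i _).
  by rewrite pL ?(clamp_01 _ true)// ax iK.
Qed.

Lemma pb_pconn (z z' : pb) : pconn R z z'.
Proof.
have [e ze] := pb_to_incl z; have [e' ze'] := pb_to_incl z'.
have /pconnP[f [fc f0 f1]] := (ucover_sc U).1 e e'.
apply: pconn_trans ze _; apply: pconn_trans (pconn_sym ze').
exists (pb_incl \o f); split; rewrite /= ?f0 ?f1//.
by apply: comp_continuous => //; exact: pb_incl_continuous.
Qed.

(** The [Y]-component of the loop is deformed into [X], and the retraction of this deformation is
    lifted to a square in [E]. Together they move the loop freely to a loop in the copy of [E],
    which is null-homotopic there; [free_null] turns the free homotopy into one with fixed ends. *)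
Lemma pb_loop_null z (F : R -> pb) : is_path z z F -> path_homotopic F (fun=> z).
Proof.
move=> FP; have [/within_clamp Fc F0 F1] := FP.
pose f t := pbY (F (clamp t)); pose e t := pbE (F (clamp t)).
have fc : continuous f by apply: comp_continuous Fc _; exact: pbY_continuous.
have ec : continuous e by apply: comp_continuous Fc _; exact: pbE_continuous.
have [eta [e0 ei eH]] := idef.
have [H [Hc H0 H1 H2 H3]] := eH f fc.
have f01 : f 0 = f 1 by rewrite /f clamp0 clamp1 F0 F1.
have e01 : e 0 = e 1 by rewrite /e clamp0 clamp1 F0 F1.
have i0 := clamp_01 R false; have i1 := clamp_01 R true.
have rHc : continuous (fun x => r (H x)) by apply: comp_continuous => //; exact: cts_fun.
have re t : r (f t) = p (e t) by exact: pb_eq.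
have [|L [Lc pL L0]] := square_lifting ucover_is_cov rHc (e := e 0); first by rewrite H0.
have slice1 (s : R) : continuous (fun t : R => (s, t)).
  by apply: pair_continuous; [exact: realcst_continuous|exact: id_continuous].
have slice2 (s : R) : continuous (fun t : R => (t, s)).
  by apply: pair_continuous; [exact: id_continuous|exact: realcst_continuous].
have Lbot t : 0 <= t <= 1 -> L (0, t) = e t.
  apply: (unique_path_lifting ucover_is_cov (f := fun t => L (0, t)) (g := e)) => //.
    exact: (comp_continuous (slice1 0)).
  by move=> u u01; rewrite pL// H0.
(* Both sides of the square lie over the same path, since the track of an end depends on the end
   only and the loop is closed; so the lifted loop stays closed. *)
have Lside s : 0 <= s <= 1 -> L (s, 0) = L (s, 1).
  apply: (unique_path_lifting ucover_is_cov (f := fun s => L (s, 0)) (g := fun s => L (s, 1))).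
  - exact: (comp_continuous (slice2 0)).
  - exact: (comp_continuous (slice2 1)).
  - by move=> u u01; rewrite !pL// H2// H3// f01.
  - by rewrite !Lbot.
have [K [Kc K0 K1 K2 K3]] : homot (fun t => L (1, t)) (fun=> L (1, 0)).
  apply/homotP; apply: (ucover_sc U).2; split => //; last by rewrite -Lside.
  by apply: continuous_subspaceT; exact: (comp_continuous (slice1 1)).
have Htop t : 0 <= t <= 1 -> H (1, t) = i (p (L (1, t))).
  by move=> t01; have [x Hx] := H1 t t01; rewrite pL// Hx iK.
have hM x : r (H (clamp2 x)) = p (L (clamp2 x)) by rewrite pL// clamp_in.
pose M1 := mkpb hM.
have M1c : continuous M1.
  by apply: mkpb_continuous; apply: comp_continuous => //; exact: clamp2_continuous.
pose M (x : R * R) := if x.1 - 2^-1 <= 0 then M1 (2 * x.1, x.2) else pb_incl (K (clamp2 (2 * x.1 - 1, x.2))).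
have dc : continuous (fun x : R * R => 2 * x.1).
  by apply: realM_continuous; [exact: realcst_continuous|exact: fst_continuous].
have Mc : continuous M.
  apply: if_le_continuous.
  - by apply: realB_continuous; [exact: fst_continuous|exact: realcst_continuous].
  - by apply: comp_continuous => //; apply: pair_continuous => //; exact: snd_continuous.
  - apply: (@comp_continuous _ _ _ (fun x : R * R => K (clamp2 (2 * x.1 - 1, x.2))) pb_incl); last exact: pb_incl_continuous.
    apply: comp_continuous => //.
    apply: (@comp_continuous _ _ _ (fun x : R * R => (2 * x.1 - 1, x.2)) (@clamp2 R)); last exact: clamp2_continuous.
    apply: pair_continuous; last exact: snd_continuous.
    by apply: realB_continuous => //; exact: realcst_continuous.
  move=> [s t] /= st; have -> : 2 * s = 1 by lra.
  rewrite subrr /clamp2 /= clamp0; apply: pbP; rewrite /pbY /pbE /= /clamp2 /= clamp1 K0 ?clamp_in//.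
  by rewrite Htop ?clamp_in.
have M0 t : 0 <= t <= 1 -> M (0, t) = F t.
  move=> t01; rewrite /M /= ifT; last by lra.
  apply: pbP; rewrite /pbY /pbE /= /clamp2 /= mulr0 clamp0 ?H0 ?Lbot ?clamp_in//.
    by rewrite /f clampK clamp_id.
  by rewrite /e clampK clamp_id.
apply/homotP; apply: (@homot_ext _ _ F _ (fun=> F 0)) => [//|t _//|]; apply: (free_null Mc) => //.
  move=> s s01; rewrite /M /=; case: ifP => _.
    apply: pbP; rewrite /pbY /pbE /= /clamp2 /= clamp0 clamp1 ?Lside ?clamp_in//.
    by rewrite H2 ?H3 ?clamp_in// f01.
  by rewrite /clamp2 /= clamp0 clamp1 K2 ?K3 ?clamp_in// Lside.
have nle : ((1 : R) - 2^-1 <= 0) = false by apply/negbTE; rewrite -ltNge; lra.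
move=> t t01; rewrite /M /= nle mulr1 (_ : 2 - 1 = 1); last by lra.
by rewrite /clamp2 /= clamp1 !K1 ?clamp_in.
Qed.

Lemma pb_sc : simply_connected R pb.
Proof. by split=> [z z'|z F]; [apply/pconnP; exact: pb_pconn|exact: pb_loop_null]. Qed.

Lemma is_path_comp (Z W : topologicalType) (F : Z -> W) (x y : Z) (f : R -> Z) :
  continuous F -> is_path x y f -> is_path (F x) (F y) (F \o f).
Proof.
move=> Fc [/within_clamp fc f0 f1]; split; rewrite /= ?f0 ?f1//.
by apply/within_clamp; apply: comp_continuous fc Fc.
Qed.

Lemma is_path_r (f : R -> Y) : is_path (i x0) (i x0) f -> is_path x0 x0 (r \o f).
Proof. by move=> fp; rewrite -{1 2}(iK x0); apply: is_path_comp fp; exact: cts_fun. Qed.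

(** The deformation fixes the base point and ends in [X], where [i \o r] is the identity. *)
Lemma retract_homot (f : R -> Y) : is_path (i x0) (i x0) f -> homot f (i \o r \o f).
Proof.
move=> fp; have [/within_clamp fc f0 f1] := fp.
have [eta [e0 ei eH]] := idef; have [H [Hc H0 H1 H2 H3]] := eH _ fc.
have fh : homot f (fun t => H (1, t)).
  exists H; split => // t t01; rewrite ?H0 ?H2 ?H3 /= ?clamp0 ?clamp1 ?clamp_id//.
    by rewrite f0 ei.
  by rewrite f1 ei.
apply: (homot_trans fh); apply: homot_sym.
apply: (homot_ext (f := i \o r \o f) (g := i \o r \o (fun t => H (1, t)))) => //.
  by move=> t t01 /=; have [x ->] := H1 t t01; rewrite iK.
by apply: homot_comp => //; apply: comp_continuous; exact: cts_fun.
Qed.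

Definition pb_loop_class (f : R -> Y) : G := th (r \o f).

Lemma pb_loop_class_eq (f g : R -> Y) : is_path (i x0) (i x0) f -> is_path (i x0) (i x0) g ->
  pb_loop_class f = pb_loop_class g <-> path_homotopic f g.
Proof.
move=> fp gp; have fr := is_path_r fp; have gr := is_path_r gp.
split.
  move=> /(loop_class_eq th fr gr)/homotP fg; apply/homotP.
  apply: homot_trans (retract_homot fp) _; apply: homot_trans _ (homot_sym (retract_homot gp)).
  by apply: (homot_comp (F := i)) fg; exact: cts_fun.
move=> /homotP fg; apply/(loop_class_eq th fr gr)/homotP.
by apply: homot_comp fg; exact: cts_fun.
Qed.

Lemma pb_loop_class_cat (f g : R -> Y) : is_path (i x0) (i x0) f -> is_path (i x0) (i x0) g ->
  pb_loop_class (path_cat f g) = (pb_loop_class f * pb_loop_class g)%g.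
Proof.
move=> fp gp; rewrite /pb_loop_class -(loop_class_cat th (is_path_r fp) (is_path_r gp)).
by congr (th _); apply/funext => t; rewrite /path_cat /=; case: ifP.
Qed.

Lemma pb_loop_class_surj a : exists f : R -> Y, is_path (i x0) (i x0) f /\ pb_loop_class f = a.
Proof.
have [f [fp fa]] := loop_class_surj th a.
exists (i \o f); split; first by apply: is_path_comp fp; exact: cts_fun.
by rewrite -fa /pb_loop_class; congr (th _); apply/funext => t; exact: iK.
Qed.

Definition pb_pi1 : pi1_iso R G (i x0) :=
  Pi1Iso pb_loop_class_eq pb_loop_class_cat pb_loop_class_surj.

Lemma pb_baseE : pbY (pb_incl (ubase U)) = i x0.
Proof. by rewrite /pbY /= ubaseE. Qed.

Lemma pb_deck1 z : pb_deck 1%g z = z.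
Proof. by apply: pbP => //; exact: deck1. Qed.
Lemma pb_deckM g h z : pb_deck (g * h)%g z = pb_deck g (pb_deck h z).
Proof. by apply: pbP => //; exact: deckM. Qed.
Lemma pb_deck_proj g z : pbY (pb_deck g z) = pbY z.
Proof. by []. Qed.

Lemma pb_monodromy (f : R -> pb) z : is_path (pb_incl (ubase U)) z f -> pbY z = i x0 ->
  pb_deck (pb_pi1 (pbY \o f)) (pb_incl (ubase U)) = z.
Proof.
move=> fp zx; apply: pbP; first by rewrite [LHS]pb_baseE.
have -> : pb_pi1 (pbY \o f) = th (p \o (pbE \o f)).
  by congr (th _); apply/funext => t; exact: pb_eq.
apply: (@deck_monodromy _ _ _ _ _ U); last by rewrite -pb_eq zx iK.
have -> : ubase U = pbE (pb_incl (ubase U)) by [].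
by apply: is_path_comp fp; exact: pbE_continuous.
Qed.

Definition pb_universal_covering : universal_covering pb_pi1 :=
  @UniversalCovering R G Y (i x0) pb_pi1 pb pbY pb_covering pb_sc
    (pb_incl (ubase U)) pb_baseE pb_deck pb_deck1 pb_deckM pb_deck_proj pb_monodromy.

End Pullback.

(** * Attaching cells *)

Section Disks.
Variable R : realType.

Definition dn k (x : 'rV[R]_k) : R := \sum_i x ord0 i ^+ 2.

Lemma dnE k (x : 'rV[R]_k) : dn x = \sum_i x ord0 i ^+ 2. Proof. by []. Qed.

Lemma dn_ge0 k (x : 'rV[R]_k) : 0 <= dn x.
Proof. by apply: sumr_ge0 => i _; exact: sqr_ge0. Qed.

Lemma dn0 k : dn (0 : 'rV[R]_k) = 0.
Proof. by rewrite /dn big1 // => i _; rewrite mxE expr0n. Qed.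

Lemma dn_eq0 k (x : 'rV[R]_k) : (dn x == 0) = (x == 0).
Proof.
apply/eqP/eqP => [|->]; last exact: dn0.
move=> /eqP; rewrite psumr_eq0 => [|i _]; last exact: sqr_ge0.
move=> /allP x0; apply/rowP => i; rewrite mxE; apply/eqP.
by have := x0 i (mem_index_enum _); rewrite /= sqrf_eq0.
Qed.

Lemma dnZ k (a : R) (x : 'rV[R]_k) : dn (a *: x) = a ^+ 2 * dn x.
Proof. by rewrite /dn mulr_sumr; apply: eq_bigr => i _; rewrite mxE exprMn. Qed.

Lemma dn_continuous k : continuous (@dn k).
Proof.
apply: sum_continuous => i _; under eq_fun do rewrite expr2.
by apply: realM_continuous; exact: row_coord_continuous.
Qed.

Lemma dn_convex k (x y : 'rV[R]_k) t : 0 <= t <= 1 ->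
  dn ((1 - t) *: x + t *: y) <= (1 - t) * dn x + t * dn y.
Proof.
move=> /andP[t0 t1]; rewrite /dn !mulr_sumr -big_split /=; apply: ler_sum => i _.
rewrite !mxE; set a := x _ _; set b := y _ _.
have -> : (1 - t) * a ^+ 2 + t * b ^+ 2 = ((1 - t) * a + t * b) ^+ 2 + t * (1 - t) * (a - b) ^+ 2 by ring.
by rewrite lerDl mulr_ge0 ?sqr_ge0// mulr_ge0// subr_ge0.
Qed.

Definition dval k (x : disk R k) : 'rV[R]_k := set_val x.

Lemma dval_le1 k (x : disk R k) : dn (dval x) <= 1.
Proof. exact: (set_valP x). Qed.

Lemma dval_inj k : injective (@dval k).
Proof. exact: val_inj. Qed.

Lemma dval_continuous k : continuous (@dval k).
Proof. exact: subtype_val_continuous. Qed.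

Lemma open_diskE k (x : disk R k) : open_disk x = (dn (dval x) < 1).
Proof. by []. Qed.

Lemma sphereE k (x : disk R k) : sphere x = (dn (dval x) = 1).
Proof. by []. Qed.

Lemma not_open_disk k (x : disk R k) : ~ open_disk x -> sphere x.
Proof. by rewrite open_diskE => /negP; rewrite -leNgt => x1; apply/eqP; rewrite eq_le dval_le1. Qed.

Lemma sphere_not_open k (x : disk R k) : sphere x -> ~ open_disk x.
Proof. by rewrite sphereE open_diskE => ->; rewrite ltxx. Qed.

(** Radial projection to the unit disk, the identity there; it makes [mkdisk] a total continuous
    map. *)
Definition disk_row k (v : 'rV[R]_k) : 'rV[R]_k := (Num.max 1 (Num.sqrt (dn v)))^-1 *: v.

Lemma max1_gt0 (a : R) : 0 < Num.max 1 a.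
Proof. by rewrite lt_max ltr01. Qed.

Lemma disk_row_le1 k (v : 'rV[R]_k) : dn (disk_row v) <= 1.
Proof.
rewrite dnZ exprVn mulrC ler_pdivrMr ?exprn_gt0 ?max1_gt0// mul1r.
rewrite -{1}[dn v]sqr_sqrtr ?dn_ge0//.
by rewrite lerXn2r ?nnegrE ?sqrtr_ge0 ?(ltW (max1_gt0 _))// le_max lexx orbT.
Qed.

Definition mkdisk k (v : 'rV[R]_k) : disk R k :=
  SigSub (mem_set (disk_row_le1 v : [set x : 'rV[R]_k | \sum_i x ord0 i ^+ 2 <= 1] _)).

Lemma mkdiskE k (v : 'rV[R]_k) : dn v <= 1 -> dval (mkdisk v) = v.
Proof.
move=> v1; rewrite -[LHS]/(disk_row v) /disk_row max_l ?invr1 ?scale1r//.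
by rewrite -[leRHS]sqrtr1 ler_sqrt.
Qed.

Lemma mkdisk_val k (x : disk R k) : mkdisk (dval x) = x.
Proof. by apply: dval_inj; rewrite mkdiskE// dval_le1. Qed.

Lemma scale_continuous (T : topologicalType) k (a : T -> R) (f : T -> 'rV[R]_k) :
  continuous a -> continuous f -> continuous (fun t => a t *: f t).
Proof.
move=> ac fc; apply: row_continuous => i.
under eq_fun do rewrite mxE; apply: realM_continuous => //.
by apply: (@comp_continuous _ _ _ f (fun x : 'rV[R]_k => x ord0 i)) => //; exact: row_coord_continuous.
Qed.

Lemma radd_continuous (T : topologicalType) k (f g : T -> 'rV[R]_k) :
  continuous f -> continuous g -> continuous (fun t => f t + g t).
Proof.
move=> fc gc; apply: row_continuous => i; under eq_fun do rewrite mxE.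
by apply: realD_continuous; apply: (@comp_continuous _ _ _ _ (fun x : 'rV[R]_k => x ord0 i)) => //;
  exact: row_coord_continuous.
Qed.

Lemma inv_continuous (T : topologicalType) (f : T -> R) :
  (forall t, f t != 0) -> continuous f -> continuous (fun t => (f t)^-1).
Proof. by move=> f0 fc t; apply: cvgV => //; exact: fc. Qed.

Lemma max_continuous (T : topologicalType) (f g : T -> R) :
  continuous f -> continuous g -> continuous (fun t => Num.max (f t) (g t)).
Proof. by move=> fc gc t; apply: (@continuous_max R T f g); [exact: fc|exact: gc]. Qed.

Lemma sqrt_dn_continuous k : continuous (fun v : 'rV[R]_k => Num.sqrt (dn v)).
Proof.
by apply: (@comp_continuous _ _ _ (@dn k) Num.sqrt); [exact: dn_continuous|exact: sqrt_continuous].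
Qed.

Lemma mkdisk_continuous k : continuous (@mkdisk k).
Proof.
apply: subtype_continuous; apply: scale_continuous; last exact: id_continuous.
apply: inv_continuous => [v|]; first by rewrite gt_eqF// max1_gt0.
by apply: max_continuous; [exact: realcst_continuous|exact: sqrt_dn_continuous].
Qed.

Lemma open_open_disk k : open (@open_disk R k : set (disk R k)).
Proof.
have c : continuous (fun x : disk R k => dn (dval x)).
  by apply: comp_continuous; [exact: dval_continuous|exact: dn_continuous].
move/continuousP: c => /(_ [set y | y < 1]); apply; exact: open_lt.
Qed.

(* Radial retraction onto the sphere, valid where [1/4 <= dn x]. *)
Definition radial k (x : disk R k) : disk R k :=
  mkdisk ((Num.max (2^-1) (Num.sqrt (dn (dval x))))^-1 *: dval x).

Lemma radial_den k (x : disk R k) : 0 < Num.max (2^-1) (Num.sqrt (dn (dval x))).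
Proof. by rewrite lt_max invr_gt0 ltr0n. Qed.

Lemma radial_le1 k (x : disk R k) :
  dn ((Num.max (2^-1) (Num.sqrt (dn (dval x))))^-1 *: dval x) <= 1.
Proof.
rewrite dnZ exprVn mulrC ler_pdivrMr ?exprn_gt0 ?radial_den// mul1r.
rewrite -{1}[dn (dval x)]sqr_sqrtr ?dn_ge0//.
by rewrite lerXn2r ?nnegrE ?sqrtr_ge0 ?(ltW (radial_den _))// le_max lexx orbT.
Qed.

Lemma radial_sphere k (x : disk R k) : 4^-1 <= dn (dval x) -> sphere (radial x).
Proof.
move=> x4; rewrite sphereE mkdiskE ?radial_le1// max_r; last first.
  rewrite -[leLHS]ger0_norm ?invr_ge0// -sqrtr_sqr ler_sqrt ?dn_ge0//.
  by rewrite exprVn -natrX.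
rewrite dnZ exprVn sqr_sqrtr ?dn_ge0// mulVf// gt_eqF//.
by apply: lt_le_trans x4; rewrite invr_gt0 ltr0n.
Qed.

Lemma radial_id k (x : disk R k) : sphere x -> radial x = x.
Proof.
rewrite sphereE => x1; rewrite /radial x1 sqrtr1 max_r ?invr1 ?scale1r ?mkdisk_val//.
by rewrite invf_le1 ?ler1n.
Qed.

Lemma radial_continuous k : continuous (@radial k).
Proof.
apply: (@comp_continuous _ _ _ _ (@mkdisk k)); last exact: mkdisk_continuous.
apply: scale_continuous; last exact: dval_continuous.
apply: inv_continuous => [v|]; first by rewrite gt_eqF// radial_den.
apply: max_continuous; first exact: realcst_continuous.
by apply: (@comp_continuous _ _ _ (@dval k) (fun v => Num.sqrt (dn v))); [exact: dval_continuous|exact: sqrt_dn_continuous].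
Qed.

End Disks.

(** The tube lemma, which lets continuity on a product with R be tested on the pieces of a final
    topology. *)
Lemma tube_open (R : realType) (T W : topologicalType) (G : R * T -> W) (J : set R) (A : set W) :
  continuous G -> compact J -> open A ->
  open [set t | forall s, J s -> A (G (s, t))].
Proof.
move=> Gc cJ oA; rewrite openE => t /= Jt.
have /compact_near_coveringP nc := cJ.
apply: (nc _ (nbhs t) (fun t s => A (G (s, t)))) => s Js.
have : nbhs (G (s, t)) A by apply: open_nbhs_nbhs; split => //; exact: Jt.
by move=> /Gc; apply: (@filterS _ (nbhs (s, t))) => -[].
Qed.

Section Adjunction.
Variables (R : realType) (Z : topologicalType) (s : nat -> nat)
  (phi : forall k, 'I_(s k) -> disk R k -> Z).
Hypothesis phiC : forall k i, {within @sphere R k, continuous (@phi k i)}.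

Definition cell_point : Type :=
  {k : nat & ('I_(s k) * set_type (@open_disk R k))%type}.
HB.instance Definition _ := Choice.on cell_point.

(* [Z] with the open cells added; the topology is final for the inclusion and the
   characteristic maps. *)
Definition adj_of (psi : forall k, 'I_(s k) -> disk R k -> Z) : Type := (Z + cell_point)%type.
Local Notation adj := (adj_of phi).
HB.instance Definition _ := Choice.on adj.

Definition adj_in (z : Z) : adj := inl z.
Definition adj_cell k (i : 'I_(s k)) (x : disk R k) : adj :=
  match pselect (@open_disk R k x) with
  | left P => inr (existT (fun k => ('I_(s k) * set_type (@open_disk R k))%type) k (i, SigSub (mem_set P)))
  | right _ => inl (phi i x)
  end.

Lemma adj_cell_sphere k (i : 'I_(s k)) (x : disk R k) : ~ open_disk x ->
  adj_cell i x = adj_in (phi i x).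
Proof. by rewrite /adj_cell; case: pselect. Qed.

Lemma adj_cell_neq k (i : 'I_(s k)) (x : disk R k) z : open_disk x -> adj_cell i x <> adj_in z.
Proof. by rewrite /adj_cell; case: pselect. Qed.

Lemma adj_cell_inj k (i : 'I_(s k)) x l (j : 'I_(s l)) y : open_disk x -> open_disk y ->
  adj_cell i x = adj_cell j y ->
  existT (fun n => ('I_(s n) * disk R n)%type) k (i, x) =
  existT (fun n => ('I_(s n) * disk R n)%type) l (j, y).
Proof.
rewrite /adj_cell; case: pselect => // P _; case: pselect => // Q _ E.
apply: Some_inj; exact: (congr1 (fun a : adj => if a is inr c then
  Some (existT (fun n => ('I_(s n) * disk R n)%type) (projT1 c)
    ((projT2 c).1, set_val (projT2 c).2)) else None) E).
Qed.

Lemma adj_cell_inj1 k (i : 'I_(s k)) x y : open_disk x -> open_disk y ->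
  adj_cell i x = adj_cell i y -> x = y.
Proof.
move=> ox oy /(adj_cell_inj ox oy) E.
by have [] := inj_pair2_eq_dec _ (@eq_comparable _) _ _ _ _ E.
Qed.

Lemma adj_cell_inj2 k (i : 'I_(s k)) x l (j : 'I_(s l)) y : open_disk x -> open_disk y ->
  adj_cell i x = adj_cell j y ->
  existT (fun n => 'I_(s n)) k i = existT (fun n => 'I_(s n)) l j.
Proof.
move=> ox oy /(adj_cell_inj ox oy) E.
exact: (congr1 (fun c : {n : nat & ('I_(s n) * disk R n)%type} =>
  existT (fun n => 'I_(s n)) (projT1 c) (projT2 c).1) E).
Qed.

Lemma adj_cases (a : adj) : (exists z, a = adj_in z) \/
  exists k (i : 'I_(s k)) x, open_disk x /\ a = adj_cell i x.
Proof.
case: a => [z|[k [i x]]]; [by left; exists z|right].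
exists k, i, (set_val x); split; first exact: set_valP.
rewrite /adj_cell; case: pselect => [P|/(_ (set_valP x))//].
have E : x = SigSub (mem_set P) by exact: val_inj.
exact: (congr1 (fun y => inr (existT (fun k => ('I_(s k) * set_type (@open_disk R k))%type) k (i, y))) E).
Qed.

Definition adj_open : set (set adj) := [set A | open (adj_in @^-1` A) /\
  forall k i, open (@adj_cell k i @^-1` A)].

Lemma adj_openT : adj_open setT.
Proof. by split => [|k i]; rewrite preimage_setT; exact: openT. Qed.
Lemma adj_openI : setI_closed adj_open.
Proof.
by move=> A B [A1 A2] [B1 B2]; split => [|k i]; rewrite preimage_setI; apply: openI.
Qed.
Lemma adj_open_bigU (I : Type) (f : I -> set adj) :
  (forall i, adj_open (f i)) -> adj_open (\bigcup_i f i).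
Proof.
move=> fo; split => [|k j]; rewrite preimage_bigcup; apply: bigcup_open => i _.
  exact: (fo i).1.
exact: (fo i).2.
Qed.

HB.instance Definition _ :=
  isOpenTopological.Build adj adj_openT adj_openI adj_open_bigU.

Lemma adj_in_continuous : continuous adj_in.
Proof. by apply/continuousP => A []. Qed.

Lemma adj_cell_continuous k (i : 'I_(s k)) : continuous (adj_cell i).
Proof. by apply/continuousP => A [_]; exact. Qed.

HB.instance Definition _ := isContinuous.Build _ _ adj_in adj_in_continuous.
HB.instance Definition _ k i :=
  isContinuous.Build _ _ (@adj_cell k i) (@adj_cell_continuous k i).

Lemma adj_continuous (W : topologicalType) (f : adj -> W) :
  continuous (f \o adj_in) -> (forall k i, continuous (f \o @adj_cell k i)) -> continuous f.
Proof.
move=> /continuousP fi fc; apply/continuousP => A oA; split; first exact: fi.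
by move=> k i; have /continuousP := fc k i; apply.
Qed.

(** A product with a final topology need not be final; here the local compactness of the line helps.
    For a compact interval [J] around [s0], the set [V] of points good for all of [J] is open, as
    can be tested on [Z] and on each disk. *)
Lemma adj_prod_continuous (W : topologicalType) (F : R * adj -> W) :
  continuous (fun x : R * Z => F (x.1, adj_in x.2)) ->
  (forall k i, continuous (fun x : R * disk R k => F (x.1, @adj_cell k i x.2))) ->
  continuous F.
Proof.
move=> Fi Fc [s0 a] A; rewrite nbhsE => -[A' [oA' A'F] A'A].
have sliceC (b : adj) : continuous (fun u : R => F (u, b)).
  case: (adj_cases b) => [[z ->]|[k [i [x [_ ->]]]]].
    apply: (@comp_continuous _ _ _ (fun u : R => (u, z)) (fun x : R * Z => F (x.1, adj_in x.2))); last exact: Fi.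
    by apply: pair_continuous; [exact: id_continuous|move=> ?; exact: cvg_cst].
  apply: (@comp_continuous _ _ _ (fun u : R => (u, x)) (fun x : R * disk R k => F (x.1, adj_cell i x.2))); last exact: Fc.
  by apply: pair_continuous; [exact: id_continuous|move=> ?; exact: cvg_cst].
have slice : nbhs s0 [set u | A' (F (u, a))].
  by apply: sliceC; exact: open_nbhs_nbhs.
have /nbhs_ballP[e /= e0 eA] := slice.
pose J : set R := [set` `[s0 - e / 2, s0 + e / 2]].
have e2 : 0 < e / 2 by rewrite divr_gt0.
have JA u : J u -> A' (F (u, a)).
  rewrite /J /= in_itv /= => /andP[? ?]; apply: eA; rewrite /ball /= ltr_norml.
  by apply/andP; split; lra.
have cJ : compact J by exact: segment_compact.
pose V : set adj := [set b | forall u, J u -> A' (F (u, b))].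
have oV : open V.
  split; first exact: (tube_open Fi cJ oA').
  by move=> k i; exact: (tube_open (Fc k i) cJ oA').
exists (J, V); first split => /=.
- apply/nbhs_ballP; exists (e / 2) => // u; rewrite /ball /= ltr_norml => /andP[? ?].
  by rewrite /J /= in_itv /=; apply/andP; split; lra.
- by apply: open_nbhs_nbhs; split.
by move=> [u b] /= [Ju Vb]; apply: A'A; exact: Vb.
Qed.

Lemma adj_cell_open k (i : 'I_(s k)) (V : set (disk R k)) : open V -> V `<=` @open_disk R k ->
  open (adj_cell i @` V).
Proof.
move=> oV Vo; split.
  rewrite (_ : _ @^-1` _ = set0); first exact: open0.
  by apply/seteqP; split => // z /= [x /Vo ox] /(adj_cell_neq ox).
move=> l j; have [E|ne] := pselect (existT (fun n => 'I_(s n)) l j = existT (fun n => 'I_(s n)) k i).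
  have El : l = k := congr1 (@projT1 _ _) E; subst l.
  have {E} Ej : j = i by exact: (inj_pair2_eq_dec _ (@eq_comparable _) _ _ _ _ E).
  subst j; rewrite (_ : _ @^-1` _ = V) //.
  apply/seteqP; split => x /=; last by exists x.
  move=> [y Vy]; have oy := Vo _ Vy.
  have [ox|nx] := pselect (open_disk x); last by rewrite (adj_cell_sphere _ nx) => /(adj_cell_neq oy).
  by move=> /(adj_cell_inj1 oy ox) <-.
rewrite (_ : _ @^-1` _ = set0); first exact: open0.
apply/seteqP; split => // x /= [y Vy]; have oy := Vo _ Vy.
have [ox|nx] := pselect (open_disk x); last by rewrite (adj_cell_sphere _ nx) => /(adj_cell_neq oy).
by move=> /(adj_cell_inj2 oy ox) E; apply: ne.
Qed.

(** Extending a function of one open cell by a constant provides a coordinate on that cell and real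
    functions that separate points. *)
Definition cell_fun (W : Type) k (i : 'I_(s k)) (g : disk R k -> W) (c : W) (a : adj) : W :=
  match pselect (exists x, open_disk x /\ a = adj_cell i x) with
  | left P => g (projT1 (cid P))
  | right _ => c
  end.

Lemma cell_fun_in (W : Type) k (i : 'I_(s k)) (g : disk R k -> W) c x :
  open_disk x -> cell_fun i g c (adj_cell i x) = g x.
Proof.
move=> ox; rewrite /cell_fun; case: pselect => [P|[]]; last by exists x.
by case: (cid P) => y /= [oy /(adj_cell_inj1 ox oy) ->].
Qed.

Lemma cell_fun_out (W : Type) k (i : 'I_(s k)) (g : disk R k -> W) c a :
  (forall x, open_disk x -> a <> adj_cell i x) -> cell_fun i g c a = c.
Proof. move=> na; rewrite /cell_fun; case: pselect => // P; exfalso.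
by case: P => x [ox]; exact: na. Qed.

Lemma cell_fun_continuous (W : topologicalType) k (i : 'I_(s k)) (g : disk R k -> W) c :
  continuous g -> (forall x, sphere x -> g x = c) -> continuous (cell_fun i g c).
Proof.
move=> gc gs; apply: adj_continuous.
  have -> : cell_fun i g c \o adj_in = cst c.
    by apply/funext => z; apply: cell_fun_out => x ox /esym/(adj_cell_neq ox).
  exact: cst_continuous.
move=> l j; have [E|ne] := pselect (existT (fun n => 'I_(s n)) l j = existT (fun n => 'I_(s n)) k i).
  have El : l = k := congr1 (@projT1 _ _) E; subst l.
  have {E} Ej : j = i by exact: (inj_pair2_eq_dec _ (@eq_comparable _) _ _ _ _ E).
  subst j; have -> // : cell_fun i g c \o adj_cell i = g.
  apply/funext => x /=; have [ox|nx] := pselect (open_disk x); first exact: cell_fun_in.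
  rewrite (adj_cell_sphere _ nx) gs; last exact: not_open_disk.
  by apply: cell_fun_out => y oy /esym/(adj_cell_neq oy).
have -> : cell_fun i g c \o adj_cell j = cst c.
  apply/funext => x; apply: cell_fun_out => y oy.
  have [ox|nx] := pselect (open_disk x).
    by move=> /(adj_cell_inj2 ox oy).
  by rewrite (adj_cell_sphere _ nx) => /esym/(adj_cell_neq oy).
exact: cst_continuous.
Qed.

(** Adds a collar in each cell. The bound 1/4 on the squared norm is the radius 1/2 from which on
    [radial] maps to the sphere. *)
Definition thicken (W : set Z) : set adj := fun a => match a with
  | inl z => W z
  | inr (existT k (i, x)) => 4^-1 < dn (dval (set_val x)) /\ W (phi i (radial (set_val x)))
  end.

Lemma thicken_cell W k (i : 'I_(s k)) x : thicken W (adj_cell i x) =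
  (4^-1 < dn (dval x) /\ W (phi i (radial x))).
Proof.
rewrite /adj_cell; case: pselect => [//|/not_open_disk sx] /=.
rewrite radial_id// propeqE; split => [|[]//]; split => //.
by rewrite sphereE in sx; rewrite sx invf_lt1 ?ltr1n ?ltr0n.
Qed.

Lemma thicken_open W : open W -> open (thicken W).
Proof.
move=> oW; split => // k i; rewrite openE => x /=; rewrite thicken_cell => -[x4 Wx].
have dc : continuous (fun x : disk R k => dn (dval x)).
  by apply: comp_continuous; [exact: dval_continuous|exact: dn_continuous].
have n1 : nbhs x [set y | 4^-1 < dn (dval y)].
  by apply: (dc x [set y | 4^-1 < y]); apply: open_nbhs_nbhs; split => //; exact: open_gt.
have srx : sphere (radial x) by apply: radial_sphere; exact: ltW.
have /subspace_continuousP/(_ _ srx W) := @phiC k i.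
move=> /(_ (open_nbhs_nbhs (conj oW Wx))) n2.
have n3 : nbhs x (@radial R k @^-1` [set y | sphere y -> W (phi i y)]) by exact: radial_continuous.
rewrite /interior; apply: filterS (filterI n1 n3) => y /= [y4 yW]; rewrite thicken_cell; split => //.
by apply: yW; apply: radial_sphere; exact: ltW.
Qed.

(** [thicken] shows that [Z] carries the subspace topology. *)
Lemma adj_in_lift (T : topologicalType) (f : T -> adj) (g : T -> Z) : continuous f ->
  (forall t, f t = adj_in (g t)) -> continuous g.
Proof.
move=> /continuousP fc fg; apply/continuousP => W /thicken_open oW.
have := fc _ oW; congr open; apply/seteqP; split => t /=; by rewrite fg.
Qed.

Lemma separate_by_real (T : topologicalType) (h : T -> R) a b : continuous h -> h a <> h b ->
  exists A B : set T, [/\ open A, open B, A a, B b & A `&` B = set0].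
Proof.
move=> hc; wlog : a b / h a < h b.
  move=> W ab; have [lt|gt|//] := ltgtP (h a) (h b); first exact: (W a b).
  have [|A [B [oA oB Ab Ba AB]]] := W b a gt; first by move=> E; exact: ab.
  by exists B, A; split => //; rewrite setIC.
move=> lt _; pose m := (h a + h b) / 2.
exists (h @^-1` [set y | y < m]), (h @^-1` [set y | m < y]); split.
- by move/continuousP: hc; apply; exact: open_lt.
- by move/continuousP: hc; apply; exact: open_gt.
- by rewrite /= /m; lra.
- by rewrite /= /m; lra.
- by apply/seteqP; split => // t /= [? ?]; lra.
Qed.

(** Points of [Z] are separated by thickened neighbourhoods. A point of a cell is separated by a
    real function: the squared norm extended by 1 or, for two points of one cell with equal norm, a
    coordinate times a factor that vanishes on the sphere. *)
Lemma adj_hausdorff : hausdorff_space Z -> hausdorff_space adj.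
Proof.
move=> hZ; rewrite open_hausdorff => a b ab.
suff [A [B [oA oB Aa Bb AB]]] : exists A B : set adj,
    [/\ open A, open B, A a, B b & A `&` B = set0].
  by exists (A, B) => /=; rewrite ?inE; split => //; exact/eqP.
have dc k : continuous (fun x : disk R k => dn (dval x)).
  by apply: comp_continuous; [exact: dval_continuous|exact: dn_continuous].
have sep k (i : 'I_(s k)) x c : open_disk x ->
    (forall y, open_disk y -> c <> adj_cell i y) -> exists A B : set adj,
    [/\ open A, open B, A (adj_cell i x), B c & A `&` B = set0].
  move=> ox cn; apply: (@separate_by_real _ (cell_fun i (fun x => dn (dval x)) 1)).
    by apply: cell_fun_continuous.
  rewrite cell_fun_in// cell_fun_out// => E; move: ox; rewrite open_diskE E ltxx.
  by [].
have swap c d : (exists A B : set adj, [/\ open A, open B, A c, B d & A `&` B = set0]) ->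
    exists A B : set adj, [/\ open A, open B, A d, B c & A `&` B = set0].
  by move=> [A [B [? ? ? ? ?]]]; exists B, A; split => //; rewrite setIC.
have [[z az]|[k [i [x [ox ax]]]]] := adj_cases a; have [[z' bz]|[l [j [y [oy bY]]]]] := adj_cases b.
- move: hZ; rewrite open_hausdorff => /(_ z z') [|[W W'] /= [+ +] [oW oW' /eqP WW]].
    by apply: contra ab => /eqP E; rewrite az bz E.
  rewrite !inE => Wz Wz'; exists (thicken W), (thicken W'); split; rewrite ?az ?bz//; try exact: thicken_open.
  apply/seteqP; split => // -[c /= [Wc W'c]|[k [i x]] /= [[_ Wc] [_ W'c]]].
    by have : (W `&` W') c by []; rewrite WW.
  by have : (W `&` W') (phi i (radial (set_val x))) by []; rewrite WW.
- by rewrite az bY; apply: swap; apply: sep => // y' oy' /esym/(adj_cell_neq oy').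
- by rewrite ax bz; apply: sep => // y' oy' /esym/(adj_cell_neq oy').
have [E|ne] := pselect (existT (fun n => 'I_(s n)) l j = existT (fun n => 'I_(s n)) k i); last first.
  rewrite ax; apply: sep => // y' oy'; rewrite bY => /(adj_cell_inj2 oy oy') //.
have El : l = k := congr1 (@projT1 _ _) E; subst l.
have {E} Ej : j = i by exact: (inj_pair2_eq_dec _ (@eq_comparable _) _ _ _ _ E).
subst j; have xy : x <> y by move=> E; move: ab; rewrite ax bY E eqxx.
have [dxy|dxy] := eqVneq (dn (dval x)) (dn (dval y)); last first.
  apply: (@separate_by_real _ (cell_fun i (fun x => dn (dval x)) 1)).
    exact: cell_fun_continuous.
  by rewrite ax bY !cell_fun_in//; exact/eqP.
have [m xym] : exists m, dval x ord0 m != dval y ord0 m.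
  apply/existsP; apply: contra_notT xy => /existsPn H; apply: dval_inj; apply/rowP => m.
  by have := H m; rewrite negbK => /eqP.
apply: (@separate_by_real _ (cell_fun i (fun x => (1 - dn (dval x)) * dval x ord0 m) 0)).
  apply: cell_fun_continuous => [|w]; last by rewrite sphereE => ->; rewrite subrr mul0r.
  apply: realM_continuous; first by apply: realB_continuous => //; exact: realcst_continuous.
  apply: (@comp_continuous _ _ _ (@dval R k) (fun v : 'rV[R]_k => v ord0 m)).
    exact: dval_continuous.
  exact: row_coord_continuous.
rewrite ax bY !cell_fun_in// -dxy => /mulfI E; apply/negP: xym; rewrite negbK.
apply/eqP; apply: E; rewrite subr_eq0 eq_sym; move: ox; rewrite open_diskE => ox.
by rewrite lt_eqF.
Qed.

End Adjunction.

(** * Paths that avoid the centres of cells *)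

Section Avoid.
Variable R : realType.
Local Notation dn := (@dn R _).

Definition seg k (p q : 'rV[R]_k) (t : R) := (1 - t) *: p + t *: q.

Lemma seg0 k (p q : 'rV[R]_k) : seg p q 0 = p.
Proof. by rewrite /seg subr0 scale1r scale0r addr0. Qed.
Lemma seg1 k (p q : 'rV[R]_k) : seg p q 1 = q.
Proof. by rewrite /seg subrr scale1r scale0r add0r. Qed.

Lemma seg_continuous (T : topologicalType) k (p q : T -> 'rV[R]_k) (a : T -> R) :
  continuous p -> continuous q -> continuous a ->
  continuous (fun t => seg (p t) (q t) (a t)).
Proof.
move=> pc qc ac; apply: radd_continuous; apply: scale_continuous => //.
by apply: realB_continuous => //; exact: realcst_continuous.
Qed.

Lemma seg_lt1 k (p q : 'rV[R]_k) t : 0 <= t <= 1 -> dn p < 1 -> dn q < 1 -> dn (seg p q t) < 1.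
Proof.
move=> t01 p1 q1; apply: le_lt_trans (dn_convex _ _ t01) _.
move: t01 => /andP[t0 t1]; have [->|tn] := eqVneq t 0; first by rewrite subr0 mul1r mul0r addr0.
have t0' : 0 < t by rewrite lt_def tn.
by have := dn_ge0 p; have := dn_ge0 q; nra.
Qed.

Definition half_vec k (a b : bool) : 'rV[R]_k :=
  \row_j (if j == 0%N :> nat then a%:R / 2 else if j == 1%N :> nat then b%:R / 2 else 0).

Lemma dn_half_vec k a b : (2 <= k)%N -> dn (half_vec k a b) = a%:R / 4 + b%:R / 4.
Proof.
case: k => [|[|k]] // _; rewrite dnE !big_ord_recl big1 ?addr0 => [|i _]; last first.
  by rewrite mxE /= expr0n.
by rewrite !mxE /=; case: a; case: b => /=; field.
Qed.

Lemma half_vec_sep k (p : 'rV[R]_k) (i0 i1 : 'I_k) a b t : (i0 = 0 :> nat)%N -> (i1 = 1 :> nat)%N ->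
  p != 0 -> a || b -> 0 <= t <= 1 -> seg p (half_vec k a b) t = 0 ->
  ((p ord0 i0 < 0) = a) /\ ((p ord0 i1 < 0) = b).
Proof.
move=> E0 E1 p0 ab /andP[t0 t1] st.
have tp : 0 < t.
  rewrite lt_def t0 andbT; apply: contraNneq p0 => t0'.
  by rewrite -st t0' seg0.
have t1' : t < 1.
  rewrite lt_def t1 andbT eq_sym; apply/eqP => t1'; move: st; rewrite t1' seg1 => h0.
  have := congr1 (fun v : 'rV[R]_k => v ord0 i0) h0; have := congr1 (fun v : 'rV[R]_k => v ord0 i1) h0.
  rewrite !mxE E0 E1 /=; case: a ab {h0} => /=; case: b => //= _; lra.
have e0 := congr1 (fun v : 'rV[R]_k => v ord0 i0) st.
have e1 := congr1 (fun v : 'rV[R]_k => v ord0 i1) st.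
rewrite !mxE E0 /= in e0; rewrite !mxE E1 /= in e1.
by split; [move: e0; case: a {ab st e1} => /= e0|move: e1; case: b {ab st e0} => /= e1];
  apply/idP/idP => //; rewrite ?ltNge; first [nra|move=> ?; nra|apply/negP; nra].
Qed.

(** The path is broken at one of the three nonzero vectors [half_vec]. A segment between it and [p]
    meets 0 only if the negative ones among the first two coordinates of [p] are exactly those
    marked by [(a, b)]. So [p] and [q] rule out at most two of the three vectors. *)
Lemma avoid_path k (p q : 'rV[R]_k) : (2 <= k)%N -> p != 0 -> q != 0 -> dn p < 1 -> dn q < 1 ->
  exists g : R -> 'rV[R]_k, [/\ continuous g, g 0 = p, g 1 = q &
    forall t, 0 <= t <= 1 -> g t != 0 /\ dn (g t) < 1].
Proof.
move=> k2 p0 q0 p1 q1.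
pose i0 : 'I_k := Ordinal (ltnW k2); pose i1 : 'I_k := Ordinal k2.
have [w [w1 wp wq]] : exists w : 'rV[R]_k, [/\ dn w < 1,
    forall t, 0 <= t <= 1 -> seg p w t != 0 & forall t, 0 <= t <= 1 -> seg w q t != 0].
  have [[a b] [/= ab ap aq]] : exists ab : bool * bool, [/\ ab.1 || ab.2,
      ((p ord0 i0 < 0), (p ord0 i1 < 0)) != ab & ((q ord0 i0 < 0), (q ord0 i1 < 0)) != ab].
    case: (p ord0 i0 < 0); case: (p ord0 i1 < 0); case: (q ord0 i0 < 0); case: (q ord0 i1 < 0);
    first [by exists (true, true)|by exists (true, false)|by exists (false, true)].
  exists (half_vec k a b); split.
  - by rewrite dn_half_vec//; case: a {ab ap aq}; case: b => /=; lra.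
  - move=> t t01; apply: contra ap => /eqP /(half_vec_sep (erefl : (i0 = 0 :> nat)%N) (erefl : (i1 = 1 :> nat)%N) p0 ab t01)[-> ->] //.
  - move=> t /andP[t0 t1]; have t01 : 0 <= 1 - t <= 1 by apply/andP; split; lra.
    apply: contra aq => /eqP st.
    have : seg q (half_vec k a b) (1 - t) = 0 by rewrite -st /seg addrC subKr.
    by move=> /(half_vec_sep (erefl : (i0 = 0 :> nat)%N) (erefl : (i1 = 1 :> nat)%N) q0 ab t01)[-> ->].
exists (fun t => if t - 2^-1 <= 0 then seg p w (2 * t) else seg w q (2 * t - 1)); split.
- have dc : continuous (fun x : R => 2 * x).
    by apply: realM_continuous; [exact: realcst_continuous|exact: id_continuous].
  have cc (v : 'rV[R]_k) : continuous (fun _ : R => v) by move=> ?; exact: cvg_cst.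
  apply: if_le_continuous.
  + by apply: realB_continuous; [exact: id_continuous|exact: realcst_continuous].
  + exact: seg_continuous.
  + by apply: seg_continuous => //; apply: realB_continuous => //; exact: realcst_continuous.
  move=> t t2; have -> : 2 * t = 1 by lra.
  by rewrite subrr seg1 seg0.
- by rewrite ifT ?mulr0 ?seg0//; lra.
- rewrite ifF; last by apply/negbTE; rewrite -ltNge; lra.
  by rewrite (_ : 2 * 1 - 1 = 1) ?seg1//; lra.
move=> t /andP[t0 t1]; case: (leP (t - 2^-1) 0) => t2.
  by split; [apply: wp|apply: seg_lt1 => //]; apply/andP; split; lra.
by split; [apply: wq|apply: seg_lt1 => //]; apply/andP; split; lra.
Qed.

End Avoid.

Section Deform.
Variables (R : realType) (Z : topologicalType) (s : nat -> nat)
  (phi : forall k, 'I_(s k) -> disk R k -> Z).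
Hypothesis phiC : forall k i, {within @sphere R k, continuous (@phi k i)}.
Hypothesis s_ge2 : forall k, (0 < s k)%N -> (2 <= k)%N.
Local Notation A := (adj_of phi).
Local Notation ain := (@adj_in R Z s phi).
Local Notation acell := (@adj_cell R Z s phi _).
Local Notation clamp := (@clamp R).

Lemma cell_ge2 k : 'I_(s k) -> (2 <= k)%N.
Proof. by move=> i; apply: s_ge2; apply: leq_ltn_trans (ltn_ord i). Qed.

Definition center k (i : 'I_(s k)) : A := acell i (mkdisk 0).

Lemma dval_mkdisk0 k : dval (mkdisk (0 : 'rV[R]_k)) = 0.
Proof. by rewrite mkdiskE// dn0. Qed.

Lemma mkdisk_open k (v : 'rV[R]_k) : dn v < 1 -> open_disk (mkdisk v).
Proof. by move=> v1; rewrite open_diskE mkdiskE// ltW. Qed.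

Lemma open0_disk k : open_disk (mkdisk (0 : 'rV[R]_k)).
Proof. by apply: mkdisk_open; rewrite dn0. Qed.

Definition is_center (a : A) : Prop := exists ki : {k & 'I_(s k)}, a = center (projT2 ki).

Lemma is_center_cell k (i : 'I_(s k)) x : open_disk x -> is_center (acell i x) <-> dval x = 0.
Proof.
move=> ox; split=> [[[l j] /= E]|x0].
  have := adj_cell_inj ox (@open0_disk l) E => F.
  have H : forall p q : {n : nat & ('I_(s n) * disk R n)%type}, p = q ->
      (dval (projT2 q).2 = 0 -> dval (projT2 p).2 = 0) by move=> p q ->.
  by apply: (H _ _ F); rewrite /= dval_mkdisk0.
by exists (existT _ k i); rewrite /center /= -[x]mkdisk_val x0.
Qed.

Lemma not_center_in z : ~ is_center (ain z).
Proof. by move=> [[k i] /= /esym/(adj_cell_neq (@open0_disk k))]. Qed.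

Definition nu (a : A) : R := match a with
  | inl _ => 1 | inr (existT k (i, x)) => dn (dval (set_val x)) end.

Lemma nu_cell k (i : 'I_(s k)) x : nu (acell i x) = dn (dval x).
Proof. by rewrite /adj_cell; case: pselect => [//|/not_open_disk]; rewrite sphereE => ->. Qed.

Lemma nu_continuous : continuous nu.
Proof.
apply: adj_continuous => [|k i]; first exact: cst_continuous.
have -> : nu \o acell i = fun x => dn (dval x) by apply/funext => x; exact: nu_cell.
by apply: comp_continuous; [exact: dval_continuous|exact: dn_continuous].
Qed.

Lemma nu_gt0 a : ~ is_center a -> 0 < nu a.
Proof.
have [[z ->]|[k [i [x [ox ->]]]]] := adj_cases a; first by rewrite /= ltr01.
rewrite nu_cell is_center_cell// => x0; rewrite lt_def dn_ge0 andbT dn_eq0.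
by apply/eqP.
Qed.

Lemma nu_center a : 0 < nu a -> ~ is_center a.
Proof. by move=> + [[k i] E]; rewrite E nu_cell dval_mkdisk0 dn0 ltxx. Qed.

Definition hv k : 'rV[R]_k := half_vec R k true false.

(** Discontinuous in [a]: centres move along [hv], all other points stay. As [deformable] uses it
    only for the ends of a path, continuity in [u] is enough. *)
Definition eta1 (a : A) (u : R) : A := match pselect (is_center a) with
  | left P => acell (projT2 (projT1 (cid P))) (mkdisk (clamp u *: hv _))
  | right _ => a end.

Lemma eta1_non a u : ~ is_center a -> eta1 a u = a.
Proof. by rewrite /eta1; case: pselect. Qed.

Lemma eta1_center k (i : 'I_(s k)) u : eta1 (center i) u = acell i (mkdisk (clamp u *: hv _)).
Proof.
rewrite /eta1; case: pselect => [P|[]]; last by exists (existT _ k i).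
case: (cid P) => -[l j] /= E.
have F := adj_cell_inj2 (@open0_disk k) (@open0_disk l) E.
have H : forall p q : {n : nat & 'I_(s n)}, p = q ->
  acell (projT2 q) (mkdisk (clamp u *: hv (projT1 q))) =
  acell (projT2 p) (mkdisk (clamp u *: hv (projT1 p))) by move=> p q ->.
exact: (H _ _ F).
Qed.

Lemma hv_neq0 k : (2 <= k)%N -> hv k != 0.
Proof. by move=> k2; rewrite -dn_eq0 dn_half_vec//= mul0r addr0 gt_eqF// divr_gt0. Qed.

Lemma hv_lt1 k : (2 <= k)%N -> dn (hv k) < 1.
Proof. by move=> k2; rewrite dn_half_vec//= mul0r addr0; lra. Qed.

Lemma eta1_continuous a : continuous (eta1 a).
Proof.
have [[[k i] ->]|na] := pselect (is_center a); last first.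
  have -> : eta1 a = cst a by apply/funext => u; rewrite eta1_non.
  exact: cst_continuous.
have -> : eta1 (center i) = fun u => acell i (mkdisk (clamp u *: hv _)).
  by apply/funext => u; exact: eta1_center.
apply: (@comp_continuous _ _ _ _ (acell i)); last exact: adj_cell_continuous.
apply: (@comp_continuous _ _ _ _ (@mkdisk R k)); last exact: mkdisk_continuous.
apply: scale_continuous; first exact: clamp_continuous.
by move=> ?; exact: cvg_cst.
Qed.

Lemma eta1_0 a : eta1 a 0 = a.
Proof.
have [[[k i] ->]|na] := pselect (is_center a); last by rewrite eta1_non.
by rewrite eta1_center clamp0 scale0r.
Qed.

Lemma eta1_1 a : ~ is_center (eta1 a 1).
Proof.
have [[[k i] ->]|na] := pselect (is_center a); last by rewrite eta1_non.
rewrite eta1_center clamp1 scale1r is_center_cell; last by apply: mkdisk_open; exact: hv_lt1 (cell_ge2 i).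
rewrite mkdiskE; last by rewrite ltW// hv_lt1// cell_ge2.
by apply/eqP; exact: hv_neq0 (cell_ge2 i).
Qed.

Definition avoids (f : R -> A) (a b : R) : Prop := exists H : R * R -> A,
  [/\ continuous H,
    forall t, a <= t <= b -> H (0, t) = f t,
    forall t, a <= t <= b -> ~ is_center (H (1, t)),
    forall u, 0 <= u <= 1 -> H (u, a) = eta1 (f a) u &
    forall u, 0 <= u <= 1 -> H (u, b) = eta1 (f b) u].

Lemma avoids_cat f a b c : a <= b -> b <= c -> avoids f a b -> avoids f b c -> avoids f a c.
Proof.
move=> ab bc [H [Hc H0 H1 H2 H3]] [K [Kc K0 K1 K2 K3]].
exists (fun x => if x.2 - b <= 0 then H (clamp x.1, x.2) else K (clamp x.1, x.2)).
have cc : continuous (fun x : R * R => (clamp x.1, x.2)).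
  apply: pair_continuous; last exact: snd_continuous.
  by apply: comp_continuous; [exact: fst_continuous|exact: clamp_continuous].
split=> [|t /andP[at_ tc]|t /andP[at_ tc]|u u01|u u01] /=.
- apply: if_le_continuous; [|exact: comp_continuous|exact: comp_continuous|].
    by apply: realB_continuous; [exact: snd_continuous|exact: realcst_continuous].
  by move=> [u t] /= /eqP; rewrite subr_eq0 => /eqP ->; rewrite H3 ?K2 ?clamp_in.
- rewrite clamp0 subr_le0; case: (leP t b) => tb; first by apply: H0; rewrite at_.
  by apply: K0; rewrite ltW.
- rewrite clamp1 subr_le0; case: (leP t b) => tb; first by apply: H1; rewrite at_.
  by apply: K1; rewrite ltW.
- by rewrite subr_le0 ab clamp_id// H2.
- rewrite subr_le0 clamp_id//; case: (leP c b) => cb; last by rewrite K3.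
  by have -> : c = b by [apply/eqP; rewrite eq_le cb]; rewrite H3.
Qed.

Lemma avoids_point f a : avoids f a a.
Proof.
exists (fun x => eta1 (f a) x.1); split => //.
- by apply: comp_continuous; [exact: fst_continuous|exact: eta1_continuous].
- by move=> t; rewrite -eq_le => /eqP <-; exact: eta1_0.
- by move=> t _ /=; exact: eta1_1.
Qed.

Lemma avoids_non f a b : continuous f -> (forall t, a <= t <= b -> ~ is_center (f t)) ->
  a <= b -> avoids f a b.
Proof.
move=> fc fn ab; exists (fun x => f x.2); split => //=.
- by apply: comp_continuous => //; exact: snd_continuous.
- by move=> u _; rewrite eta1_non//; apply: fn; rewrite lexx.
- by move=> u _; rewrite eta1_non//; apply: fn; rewrite lexx ab.
Qed.

(** Inside one cell the path is moved along segments to a path that misses the centre and has the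
    same ends, except that an end at the centre is replaced by [hv]. *)
Lemma avoids_cell k (i : 'I_(s k)) f a b : continuous f -> a <= b ->
  (forall t, a <= t <= b -> exists x, open_disk x /\ f t = acell i x) -> avoids f a b.
Proof.
move=> fc; rewrite le_eqVlt => /orP[/eqP <- _|ab fx]; first exact: avoids_point.
have ab' := ltW ab.
pose xx t := cell_fun i idfun (mkdisk 0) (f (clampab a b t)).
have xxP t : open_disk (xx t) /\ f (clampab a b t) = acell i (xx t).
  by have [x [ox fE]] := fx _ (clampab_in t ab'); rewrite /xx fE cell_fun_in.
have xxc : continuous xx.
  move=> t V; rewrite nbhsE => -[V' [oV' V't] VV'].
  have oO : open (acell i @` (V' `&` @open_disk R k)).
    by apply: adj_cell_open => [|x []//]; apply: openI => //; exact: open_open_disk.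
  have fcc : continuous (fun t => f (clampab a b t)).
    by apply: comp_continuous => //; exact: clampab_continuous.
  have := fcc t _ (open_nbhs_nbhs (conj oO (ex_intro2 _ _ (xx t) (conj V't (xxP t).1) (esym (xxP t).2)))).
  apply: (@filterS _ (nbhs t)) => t' [y [V'y oy]] E; apply: VV'.
  have [ox E'] := xxP t'; rewrite /= -/(xx t').
  by rewrite -(adj_cell_inj1 oy ox (etrans E E')).
pose pt t := if dval (xx t) == 0 then hv k else dval (xx t).
have k2 := cell_ge2 i.
have pt0 t : pt t != 0 by rewrite /pt; case: ifPn => // _; exact: hv_neq0.
have xx1 t : dn (dval (xx t)) < 1 by have [] := xxP t.
have pt1 t : dn (pt t) < 1 by rewrite /pt; case: ifPn => // _; exact: hv_lt1.
have [g [gc g0 g1 gP]] := avoid_path k2 (pt0 a) (pt0 b) (pt1 a) (pt1 b).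
pose tau t := clamp ((t - a) / (b - a)).
have tauc : continuous tau.
  apply: (@comp_continuous _ _ _ (fun t : R => (t - a) / (b - a)) clamp); last exact: clamp_continuous.
  apply: realM_continuous; last exact: realcst_continuous.
  by apply: realB_continuous; [exact: id_continuous|exact: realcst_continuous].
have taua : tau a = 0 by rewrite /tau subrr mul0r clamp0.
have taub : tau b = 1 by rewrite /tau mulfV ?clamp1// gt_eqF// subr_gt0.
pose v (x : R * R) := seg (dval (xx x.2)) (g (tau x.2)) (clamp x.1).
have v1 x : dn (v x) < 1 by apply: seg_lt1; rewrite ?clamp_in//; exact: (gP _ (clamp_in _)).2.
have fE t : a <= t <= b -> f t = acell i (xx t).
  by move=> tab; have [_ <-] := xxP t; rewrite clampab_id.
have endE t u : a <= t <= b -> 0 <= u <= 1 -> acell i (mkdisk (seg (dval (xx t)) (pt t) u)) = eta1 (f t) u.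
  move=> tab u01; rewrite fE//; have [ox _] := xxP t; rewrite /pt; case: ifPn => [/eqP x0|x0].
    have -> : xx t = mkdisk 0 by rewrite -[LHS]mkdisk_val x0.
    by rewrite eta1_center dval_mkdisk0 /seg scaler0 add0r clamp_id.
  rewrite eta1_non; last by rewrite is_center_cell//; exact/eqP.
  by rewrite /seg -scalerDl subrK scale1r mkdisk_val.
exists (fun x => acell i (mkdisk (v x))); split.
- apply: (@comp_continuous _ _ _ _ (acell i)); last exact: adj_cell_continuous.
  apply: (@comp_continuous _ _ _ v (@mkdisk R k)); last exact: mkdisk_continuous.
  apply: seg_continuous.
  + apply: (@comp_continuous _ _ _ (fun x : R * R => xx x.2) (@dval R k)); last exact: dval_continuous.
    by apply: comp_continuous => //; exact: snd_continuous.
  + apply: (@comp_continuous _ _ _ (fun x : R * R => tau x.2) g) => //.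
    by apply: comp_continuous => //; exact: snd_continuous.
  + by apply: comp_continuous; [exact: fst_continuous|exact: clamp_continuous].
- by move=> t tab; rewrite /v /= clamp0 seg0 mkdisk_val fE.
- move=> t tab; rewrite /v /= clamp1 seg1 is_center_cell; last first.
    by apply: mkdisk_open; exact: (gP _ (clamp_in _)).2.
  have [n0 n1] := gP _ (clamp_in ((t - a) / (b - a))).
  by rewrite mkdiskE ?ltW//; exact/eqP.
- by move=> u u01; rewrite /v /= taua g0 clamp_id// endE// lexx ab'.
- by move=> u u01; rewrite /v /= taub g1 clamp_id// endE// lexx ab'.
Qed.

Lemma avoid_centers f : continuous f -> avoids f 0 1.
Proof.
move=> fc; apply: interval_induction.
  by move=> a b c _ ab bc _; exact: avoids_cat.
move=> x _; have [[[k i] /= fx]|nx] := pselect (is_center (f x)).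
  have oO : open (acell i @` @open_disk R k) by apply: adj_cell_open => //; exact: open_open_disk.
  have : nbhs x (f @^-1` (acell i @` @open_disk R k)).
    by apply: fc; apply: open_nbhs_nbhs; split => //; exists (mkdisk 0) => //; exact: open0_disk.
  move=> /nbhs_ballP[e /= e0 eB]; exists e => // a b _ ab _ ax bx.
  apply: (@avoids_cell k i) => // t /andP[at_ tb].
  have [|y oy <-] := eB t; last by exists y.
  rewrite /ball /= distrC; move: ax bx; rewrite !ltr_norml => /andP[??] /andP[??]; apply/andP; split; lra.
have : nbhs x (fun t => 0 < nu (f t)).
  have c : continuous (fun t => nu (f t)) by apply: comp_continuous => //; exact: nu_continuous.
  apply: (c x [set y | 0 < y]); apply: open_nbhs_nbhs; split; first exact: open_gt.
  exact: nu_gt0.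
move=> /nbhs_ballP[e /= e0 eB]; exists e => // a b _ ab _ ax bx.
apply: avoids_non => // t /andP[at_ tb]; apply: nu_center; apply: eB.
rewrite /ball /= distrC; move: ax bx; rewrite !ltr_norml => /andP[??] /andP[??]; apply/andP; split; lra.
Qed.

(** The radius is divided by this number, so that at [u = 1] points of norm at least [e] reach the
    sphere. A positive [e] keeps the division continuous at the centre. *)
Definition push_den (e : R) k (u : R) (x : disk R k) : R :=
  (1 - clamp u) + clamp u * Num.max (Num.sqrt (dn (dval x))) e.

Definition push_disk e k u (x : disk R k) : disk R k := mkdisk ((push_den e u x)^-1 *: dval x).

Definition push_adj e (ua : R * A) : A := match ua.2 with
  | inl z => inl z
  | inr (existT k (i, x)) => acell i (push_disk e ua.1 (set_val x))
  end.

Lemma push_disk_sphere e k u (x : disk R k) : e <= 1 -> sphere x -> push_disk e u x = x.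
Proof.
rewrite sphereE => e1 x1; rewrite /push_disk /push_den x1 sqrtr1 max_l// mulr1 subrK invr1 scale1r.
exact: mkdisk_val.
Qed.

Lemma push_adj_cell e u k (i : 'I_(s k)) x : e <= 1 ->
  push_adj e (u, acell i x) = acell i (push_disk e u x).
Proof.
move=> e1; rewrite {1}/adj_cell; case: pselect => [//|nx] /=.
rewrite push_disk_sphere//; last exact: not_open_disk.
by rewrite adj_cell_sphere.
Qed.

Lemma push_adj_continuous e : 0 < e -> e <= 1 -> continuous (push_adj e).
Proof.
move=> e0 e1; apply: adj_prod_continuous => [|k i].
  apply: (@comp_continuous _ _ _ (fun x : R * Z => x.2) ain); [exact: snd_continuous|exact: adj_in_continuous].
have -> : (fun x : R * disk R k => push_adj e (x.1, acell i x.2)) =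
    (fun x => acell i (push_disk e x.1 x.2)).
  by apply/funext => x; rewrite push_adj_cell.
apply: (@comp_continuous _ _ _ (fun x : R * disk R k => push_disk e x.1 x.2) (acell i)); last exact: adj_cell_continuous.
apply: (@comp_continuous _ _ _ _ (@mkdisk R k)); last exact: mkdisk_continuous.
have c1 : continuous (fun x : R * disk R k => clamp x.1).
  by apply: comp_continuous; [exact: fst_continuous|exact: clamp_continuous].
have c2 : continuous (fun x : R * disk R k => dval x.2).
  by apply: comp_continuous; [exact: snd_continuous|exact: dval_continuous].
apply: scale_continuous => //; apply: inv_continuous => [[u x]|].
  rewrite gt_eqF// /push_den.
  have : e <= Num.max (Num.sqrt (dn (dval x))) e by rewrite le_max lexx orbT.
  by have /andP[] := clamp_in u; set m := Num.max _ _ => ? ? ?; nra.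
apply: realD_continuous; first by apply: realB_continuous => //; exact: realcst_continuous.
apply: realM_continuous => //; apply: max_continuous; last exact: realcst_continuous.
by apply: (@comp_continuous _ _ _ (fun x : R * disk R k => dval x.2) (fun v => Num.sqrt (dn v))) => //; exact: sqrt_dn_continuous.
Qed.

Lemma push_adj_small e (a : A) u : 0 <= e -> e ^+ 2 <= nu a -> e <= 1 -> push_adj e (u, a) = push_adj 0 (u, a).
Proof.
move=> e0 + e1; have [[z ->]|[k [i [x [_ ->]]]]] := adj_cases a; first by [].
rewrite nu_cell => ex; rewrite (push_adj_cell _ _ _ e1) (push_adj_cell _ _ _ ler01).
have E : push_den e u x = push_den 0 u x; last by rewrite /push_disk E.
rewrite /push_den; congr (_ + _ * _); rewrite !max_l ?sqrtr_ge0//.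
by rewrite -[leLHS]ger0_norm// -sqrtr_sqr ler_sqrt// dn_ge0.
Qed.

Lemma push_adj0 e a : e <= 1 -> push_adj e (0, a) = a.
Proof.
move=> e1; have [[z ->]|[k [i [x [_ ->]]]]] := adj_cases a; first by [].
rewrite push_adj_cell// /push_disk /push_den clamp0 subr0 mul0r addr0 invr1 scale1r.
by rewrite mkdisk_val.
Qed.

Lemma push_adj1 a : ~ is_center a -> exists z, push_adj 0 (1, a) = ain z.
Proof.
have [[z ->]|[k [i [x [ox ->]]]]] := adj_cases a; first by exists z.
rewrite is_center_cell// => /eqP x0; rewrite push_adj_cell//; exists (phi i (push_disk 0 1 x)).
apply: adj_cell_sphere; apply: sphere_not_open.
have E : push_den 0 1 x = Num.sqrt (dn (dval x)).
  by rewrite /push_den clamp1 subrr add0r mul1r max_l// sqrtr_ge0.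
have dx : 0 < dn (dval x) by rewrite lt_def dn_ge0 andbT dn_eq0.
have D : dn ((push_den 0 1 x)^-1 *: dval x) = 1.
  by rewrite dnZ E exprVn sqr_sqrtr ?dn_ge0// mulVf// gt_eqF.
by rewrite sphereE mkdiskE D.
Qed.

(** Once the path misses the centres, its norm has a positive minimum, and pushing outwards with an
    [e] below it is continuous. On such points this agrees with [e = 0], the value used in [eta],
    which must not depend on the path. *)
Lemma adj_deformable : deformable R ain.
Proof.
exists (fun a u => if u - 2^-1 <= 0 then eta1 a (2 * u) else push_adj 0 (2 * u - 1, eta1 a 1)).
split=> [a|z u|f fc].
- by rewrite ifT ?mulr0 ?eta1_0//; lra.
- by case: ifP => _; rewrite eta1_non//; exact: not_center_in.
have [H [Hc H0 H1 H2 H3]] := avoid_centers fc.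
have Htc : continuous (fun t => nu (H (1, clamp t))).
  apply: (@comp_continuous _ _ _ (fun t : R => H (1, clamp t)) nu); last exact: nu_continuous.
  apply: comp_continuous => //; apply: pair_continuous; first exact: realcst_continuous.
  exact: clamp_continuous.
have [c c01 cmin] := EVT_min (@ler01 R) (@continuous_subspaceT _ _ _ _ Htc).
have mpos : 0 < nu (H (1, clamp c)) by apply: nu_gt0; apply: H1; exact: clamp_in.
pose e := Num.min 1 (Num.sqrt (nu (H (1, clamp c)))).
have e0 : 0 < e by rewrite lt_min ltr01 sqrtr_gt0.
have e1 : e <= 1 by rewrite ge_min lexx.
have eH t : e ^+ 2 <= nu (H (1, clamp t)).
  apply: (@le_trans _ _ (nu (H (1, clamp c)))); last first.
    by rewrite -(clampK t); apply: cmin; rewrite in_itv /= clamp_in.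
  rewrite -[leRHS]sqr_sqrtr ?(ltW mpos)// lerXn2r ?nnegrE ?(ltW e0) ?sqrtr_ge0//.
  by rewrite ge_min lexx orbT.
exists (fun x => if x.1 - 2^-1 <= 0 then H (2 * x.1, clamp x.2) else push_adj e (2 * x.1 - 1, H (1, clamp x.2))).
have sc : continuous (fun x : R * R => clamp x.2).
  by apply: comp_continuous; [exact: snd_continuous|exact: clamp_continuous].
have dc : continuous (fun x : R * R => 2 * x.1).
  by apply: realM_continuous; [exact: realcst_continuous|exact: fst_continuous].
have i1 : 0 <= (1 : R) <= 1 by rewrite lexx ler01.
split=> [|t t01|t t01|u /andP[u0 u1]|u /andP[u0 u1]] /=.
- apply: if_le_continuous.
  + by apply: realB_continuous; [exact: fst_continuous|exact: realcst_continuous].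
  + by apply: comp_continuous => //; exact: pair_continuous.
  + apply: (@comp_continuous _ _ _ (fun x : R * R => (2 * x.1 - 1, H (1, clamp x.2))) (push_adj e)); last exact: push_adj_continuous.
    apply: pair_continuous; first by apply: realB_continuous => //; exact: realcst_continuous.
    by apply: comp_continuous => //; apply: pair_continuous => //; exact: realcst_continuous.
  move=> [u t] /= st; have -> : 2 * u = 1 by lra.
  by rewrite subrr push_adj0.
- by rewrite ifT; [rewrite mulr0 clamp_id// H0|lra].
- rewrite ifF; last by apply/negbTE; rewrite -ltNge; lra.
  rewrite mulr1 (_ : 2 - 1 = 1); last by lra.
  rewrite push_adj_small ?(ltW e0)//; apply: push_adj1; apply: H1; exact: clamp_in.
- rewrite clamp0; case: ifPn => uu; first by rewrite H2//; apply/andP; split; lra.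
  by rewrite push_adj_small ?(ltW e0)//; [rewrite H2|have := eH 0; rewrite clamp0].
- rewrite clamp1; case: ifPn => uu; first by rewrite H3//; apply/andP; split; lra.
  by rewrite push_adj_small ?(ltW e0)//; [rewrite H3|have := eH 1; rewrite clamp1].
Qed.

End Deform.

(** * Maps from the adjunction space, connectedness, cell structure *)

Section AdjMaps.
Variables (R : realType) (Z : topologicalType) (s : nat -> nat)
  (phi : forall k, 'I_(s k) -> disk R k -> Z).
Local Notation A := (adj_of phi).
Local Notation ain := (@adj_in R Z s phi).
Local Notation acell := (@adj_cell R Z s phi _).

Definition adj_rec (W : Type) (f : Z -> W) (g : forall k, 'I_(s k) -> disk R k -> W) (a : A) : W :=
  match a with inl z => f z | inr (existT k (i, x)) => g k i (set_val x) end.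

Lemma adj_rec_cell (W : Type) (f : Z -> W) (g : forall k, 'I_(s k) -> disk R k -> W) k (i : 'I_(s k)) x :
  (forall x, sphere x -> g k i x = f (phi i x)) -> adj_rec f g (acell i x) = g k i x.
Proof.
by move=> H; rewrite {1}/adj_cell; case: pselect => [//|/not_open_disk/H ->].
Qed.

Lemma adj_rec_continuous (W : topologicalType) (f : Z -> W) (g : forall k, 'I_(s k) -> disk R k -> W) :
  continuous f -> (forall k i, continuous (g k i)) ->
  (forall k i x, sphere x -> g k i x = f (phi i x)) -> continuous (adj_rec f g).
Proof.
move=> fc gc gf; apply: adj_continuous => // k i.
have -> // : adj_rec f g \o acell i = g k i.
by apply/funext => x /=; rewrite adj_rec_cell// => y; exact: gf.
Qed.

Lemma connected_real_map (B : set R) : open B -> closed B -> B 0 -> B 1.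
Proof.
move=> oB cB B0; have cR : connected [set: R].
  by apply/connected_intervalP; move=> a b _ _ c.
have -> // : B = setT.
apply: cR; first by exists 0.
  by exists B; rewrite ?setTI.
by exists B; rewrite ?setTI.
Qed.

(** A segment in the disk joins each point of a cell to a point of the sphere, which is non-empty in
    positive dimension. So a set that is open and closed is determined by its trace on [Z]. *)
Lemma adj_connected : (forall k, (0 < s k)%N -> (0 < k)%N) -> connected [set: Z] ->
  connected [set: A].
Proof.
move=> s0 cZ B [b0 Bb0] [O oO BO] [F cF BF].
have oB : open B by rewrite BO setTI.
have cB : closed B by rewrite BF setTI.
have cell k (i : 'I_(s k)) x : exists z, B (acell i x) <-> B (ain z).
  have k0 : (0 < k)%N by apply: s0; apply: leq_ltn_trans (ltn_ord i).
  pose v : 'rV[R]_k := delta_mx ord0 (Ordinal k0).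
  have v1 : dn v = 1.
    rewrite /dn (bigD1 (Ordinal k0)) //= big1 ?addr0 => [|j jn]; rewrite mxE ?eqxx ?expr1n//=.
    by rewrite (negbTE jn) expr0n.
  have sv : sphere (mkdisk v) by rewrite sphereE mkdiskE ?v1.
  exists (phi i (mkdisk v)); rewrite -(@adj_cell_sphere R Z s phi k i _ (sphere_not_open sv)).
  pose g (t : R) := acell i (mkdisk (seg (dval x) v t)).
  have gc : continuous g.
    apply: (@comp_continuous _ _ _ _ (acell i)); last exact: adj_cell_continuous.
    apply: (@comp_continuous _ _ _ _ (@mkdisk R k)); last exact: mkdisk_continuous.
    by apply: seg_continuous; [move=> ?; exact: cvg_cst..|exact: id_continuous].
  have g0 : g 0 = acell i x by rewrite /g seg0 mkdisk_val.
  have g1 : g 1 = acell i (mkdisk v) by rewrite /g seg1.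
  rewrite -g0 -g1; move/continuousP in gc.
  have cc (D : set A) : closed D -> closed (g @^-1` D).
    by move=> cD; rewrite -openC preimage_setC; apply: gc; rewrite openC.
  split; first exact: (@connected_real_map (g @^-1` B) (gc _ oB) (cc _ cB)).
  apply: contraPP; apply: (@connected_real_map (g @^-1` (~` B)) (gc _ _) (cc _ _)).
    by rewrite openC.
  by rewrite closedC.
have [z1 Bz1] : exists z, B (ain z).
  have [[z E]|[k [i [x [_ E]]]]] := adj_cases b0; first by exists z; rewrite -E.
  by have [z zP] := cell k i x; exists z; apply/zP; rewrite -E.
have BZ : ain @^-1` B = setT.
  apply: cZ; first by exists z1.
    exists (ain @^-1` B); last by rewrite setTI.
    exact: oB.1.
  exists (ain @^-1` B); last by rewrite setTI.
  rewrite -openC preimage_setC; apply: (proj1 (_ : open (~` B))); by rewrite openC.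
have BZ' z : B (ain z) by have : setT z by []; rewrite -BZ.
apply/seteqP; split => // a _; have [[z ->] //|[k [i [x [_ ->]]]]] := adj_cases a.
by have [z zP] := cell k i x; apply/zP.
Qed.

End AdjMaps.

Section AdjCW.
Variables (R : realType) (Z : topologicalType) (K : finite_cw R Z) (s : nat -> nat)
  (phi : forall k, 'I_(s k) -> disk R k -> Z).
Hypothesis phiC : forall k i, {within @sphere R k, continuous (@phi k i)}.
Hypothesis phiS : forall k i x, @sphere R k x -> skel_lt K k (@phi k i x).
Hypothesis s_fin : exists N, forall n, (N <= n)%N -> s n = 0%N.
Local Notation A := (adj_of phi).
Local Notation ain := (@adj_in R Z s phi).
Local Notation acell := (@adj_cell R Z s phi _).
Local Notation nc k := (ncells K k + s k)%N.

Definition adj_char k (i : 'I_(nc k)) : continuousType (disk R k) A :=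
  match fintype.split i with
  | inl j => ain \o char_map j
  | inr j => acell j
  end.

Lemma adj_char_l k (j : 'I_(ncells K k)) x : adj_char (lshift _ j) x = ain (char_map j x).
Proof. by rewrite /adj_char (unsplitK (inl j)). Qed.

Lemma adj_char_r k (j : 'I_(s k)) x : adj_char (rshift _ j) x = acell j x.
Proof. by rewrite /adj_char (unsplitK (inr j)). Qed.

Lemma adj_finite : exists N, forall n, (N <= n)%N -> nc n = 0%N.
Proof.
have [N1 h1] := cw_finite K; have [N2 h2] := s_fin.
exists (maxn N1 N2) => n; rewrite geq_max => /andP[n1 n2].
by rewrite h1// h2.
Qed.

Lemma adj_cover (p : A) : exists n i x, open_disk x /\ @adj_char n i x = p.
Proof.
have [[z ->]|[k [i [x [ox ->]]]]] := adj_cases p.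
  have [n [i [x [ox <-]]]] := cw_cover K z.
  by exists n, (lshift _ i), x; rewrite adj_char_l.
by exists k, (rshift _ i), x; rewrite adj_char_r.
Qed.

Lemma adj_disjoint m i x n j y : open_disk x -> open_disk y -> @adj_char m i x = @adj_char n j y ->
  existT (fun n => ('I_(nc n) * disk R n)%type) m (i, x) =
  existT (fun n => ('I_(nc n) * disk R n)%type) n (j, y).
Proof.
move=> ox oy; have Ei := splitK i; have Ej := splitK j; move: Ei Ej.
case: (fintype.split i) => i' /= <-; case: (fintype.split j) => j' /= <-;
  rewrite ?adj_char_l ?adj_char_r => E.
- have /(cw_disjoint ox oy) F : char_map i' x = char_map j' y by case: E.
  exact: (congr1 (fun c : {n & ('I_(ncells K n) * disk R n)%type} =>
    existT (fun n => ('I_(nc n) * disk R n)%type) (projT1 c) (lshift _ (projT2 c).1, (projT2 c).2)) F).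
- by case: (adj_cell_neq oy (esym E)).
- by case: (adj_cell_neq ox E).
- exact: (congr1 (fun c : {n & ('I_(s n) * disk R n)%type} =>
    existT (fun n => ('I_(nc n) * disk R n)%type) (projT1 c) (rshift _ (projT2 c).1, (projT2 c).2))
    (adj_cell_inj ox oy E)).
Qed.

Lemma adj_attach n i x : sphere x -> exists m j y,
  [/\ (m < n)%N, open_disk y & @adj_char m j y = @adj_char n i x].
Proof.
move=> sx; have Ei := splitK i; move: Ei; case: (fintype.split i) => i' /= <-.
  rewrite adj_char_l; have [m [j [y [mn oy <-]]]] := cw_attach i' sx.
  by exists m, (lshift _ j), y; rewrite adj_char_l.
rewrite adj_char_r adj_cell_sphere; last exact: sphere_not_open.
have [m [j [y [mn oy <-]]]] := phiS i' sx.
by exists m, (lshift _ j), y; rewrite adj_char_l.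
Qed.

Definition adj_cw : finite_cw R A := @FiniteCW R A (fun k => nc k) adj_char adj_finite
  (adj_hausdorff phiC (cw_hausdorff K)) adj_cover adj_disjoint adj_attach.

Lemma adj_skel_in n z : skel_lt K n z -> skel_lt adj_cw n (ain z).
Proof.
by move=> [m [i [x [mn ox <-]]]]; exists m, (lshift _ i), x; rewrite adj_char_l.
Qed.

Lemma adj_skel_cell k (i : 'I_(s k)) x : skel_lt adj_cw k.+1 (acell i x).
Proof.
have [ox|/not_open_disk sx] := pselect (open_disk x).
  by exists k, (rshift _ i), x; rewrite adj_char_r.
have [m [j [y [mk oy E]]]] := phiS i sx.
rewrite adj_cell_sphere; last exact: sphere_not_open.
by exists m, (lshift _ j), y; rewrite adj_char_l E; split => //; exact: ltnW.
Qed.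

End AdjCW.

Lemma skel_ltS (R : realType) (Z : topologicalType) (K : finite_cw R Z) m n z :
  (m <= n)%N -> skel_lt K m z -> skel_lt K n z.
Proof. by move=> mn [k [i [x [km ox E]]]]; exists k, i, x; split => //; exact: leq_trans mn. Qed.

Lemma skel_ltT (R : realType) (Z : topologicalType) (K : finite_cw R Z) n z :
  (forall m, (n <= m)%N -> ncells K m = 0%N) -> skel_lt K n z.
Proof.
move=> Kn; have [k [i [x [ox E]]]] := cw_cover K z; exists k, i, x; split => //.
rewrite ltnNge; apply/negP => /Kn E'; case: i {E} => a; rewrite E' ltn0//.
Qed.

(** * Cellular boundaries *)

Section Homotopy.
Variable R : realType.
Local Notation simplex := (simplex R).

Lemma supported_bd_iota k : supported (@bdry R k.+1) (bd (iota_sx R k.+1)).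
Proof.
rewrite /iota_sx bd_sing; apply: supported_sum => i _; apply: supportedZ.
by apply: supported_sing => x; exists i; exact: sx_face_eq.
Qed.

Lemma zmod_rearr4 (V : zmodType) (a b d x y : V) :
  x - y - (a - y - b - (a - x - d)) = b - d.
Proof.
rewrite (opprB (a - y - b)) (opprD (a - y)) (opprD a) !opprK.
rewrite [a - x - d + _]addrACA [a - x + _]addrACA (subrr a) add0r (addrA (x - y)).
by rewrite [x - y + _]addrACA (subrr x) add0r addNr add0r addrC.
Qed.

(* The prism operator [tc] ends in the subdivision; the constant homotopy at
   the end [f1] compares the subdivision with the simplex itself. *)
Lemma homotopic_rel_homologous (W : topologicalType) (A B : set W) k
    (F : continuousType (simplex k.+1 * R)%type W) (f0 f1 : continuousType (simplex k.+1) W) :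
  (forall x, F (x, 0) = f0 x) -> (forall x, F (x, 1) = f1 x) ->
  (forall x, A (F x)) -> (forall x u, bdry x -> B (F (x, u))) ->
  rel_homologous A B (sing f0) (sing f1).
Proof.
move=> F0 F1 FA FB.
pose G : continuousType (simplex k.+1 * R)%type W := f1 \o @proj1R R (simplex k.+1).
have [GA GB] : (forall x, A (G x)) /\ (forall x u, bdry x -> B (G (x, u))).
  by split => [[x u]|x u bx]; rewrite /G /= /proj1R /= -F1//; exact: FB.
pose c := iota_sx R k.+1; pose e := push G (tc c) - push F (tc c).
exists e; split; first by apply: supportedB; apply: supported_pushT.
have E (H : continuousType (simplex k.+1 * R)%type W) (h : continuousType (simplex k.+1) W) : (forall x, H (x, 0) = h x) ->
    (forall x, H (x, 1) = f1 x) ->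
    bd (push H (tc c)) = push f1 (sd c) - sing h - push H (tc (bd c)).
  move=> H0 H1; rewrite bd_push bd_tcS !pushB; congr (_ - _ - _).
    by rewrite -(@push_comp _ _ _ _ _ _ f1) // => x; rewrite -H1.
  by rewrite (iota_push h) -(@push_comp _ _ _ _ _ _ h) // => x; rewrite -H0.
rewrite /e bdB (E F f0)// (E G f1)//.
set a := push f1 _; set b := push G _; set d := push F _.
have -> : sing f0 - sing f1 - (a - sing f1 - b - (a - sing f0 - d)) = b - d.
  exact: zmod_rearr4.
by apply: supportedB; (apply: (@supported_push _ _ _ (@bdry R k.+1 `*` setT));
  last (apply: supported_tc; exact: supported_bd_iota)) => -[x u] [/= bx _]; [exact: GB|exact: FB].
Qed.

End Homotopy.

(** * The homeomorphism between simplex and disk *)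

Section SimplexDisk.
Variable R : realType.
Local Notation simplex := (simplex R).

(** Only the point 0 needs an argument: the coordinates of [v] are bounded by [b v], so those of the
    value are bounded by [|a v|], which tends to 0. *)
Lemma ratio_continuous d (a b : 'rV[R]_d -> R) : continuous a -> continuous b ->
  a 0 = 0 -> (forall (v : 'rV[R]_d) i, `|v ord0 i| <= b v) ->
  continuous (fun v => (a v / b v) *: v).
Proof.
move=> ac bc a0 vb v; have [->|v0] := eqVneq v 0.
  apply: (@row_cvg R _ (nbhs (0 : 'rV[R]_d)) (nbhs_filter _)) => i; rewrite scaler0 mxE.
  have an : `|a w| @[w --> (0 : 'rV[R]_d)] --> (0 : R).
    have := @cvg_norm _ _ _ _ _ _ _ (ac 0); rewrite a0 normr0; exact.
  have an' : - `|a w| @[w --> (0 : 'rV[R]_d)] --> (0 : R) by have := cvgN an; rewrite oppr0; exact.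
  apply: squeeze_cvgr an' an; near=> w; rewrite mxE -ler_norml normrM normrM.
  have b0 : 0 <= b w by apply: le_trans (vb w i); exact: normr_ge0.
  rewrite -mulrA ler_piMr//; have [->|bw] := eqVneq (b w) 0; first by rewrite invr0 normr0 mul0r ler01.
  by rewrite normrV ?unitfE// (ger0_norm b0) mulrC ler_pdivrMr ?mul1r// lt_def bw.
have bv : b v != 0.
  apply: contraNneq v0 => b0; apply/eqP/rowP => i; rewrite mxE; apply/eqP.
  by rewrite -normr_eq0 eq_le normr_ge0 andbT -b0.
apply: (@row_cvg R _ (nbhs v) (nbhs_filter _)) => i.
under eq_fun do rewrite mxE; rewrite mxE; apply: cvgM; last exact: row_coord_continuous.
by apply: cvgM; [exact: ac|apply: cvgV => //; exact: bc].
Unshelve. all: by end_near. Qed.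

(** Row vectors are identified with the hyperplane of coordinate sum 0 in one dimension more, in
    which the simplex centred at its barycentre lies. *)
Definition scoord d (v : 'rV[R]_d) (i : 'I_d.+1) : R :=
  if unlift ord0 i is Some j then v ord0 j else - \sum_j v ord0 j.

Lemma scoord_lift d (v : 'rV[R]_d) j : scoord v (fintype.lift ord0 j) = v ord0 j.
Proof. by rewrite /scoord liftK. Qed.

Lemma scoord_0 d (v : 'rV[R]_d) : scoord v ord0 = - \sum_j v ord0 j.
Proof. by rewrite /scoord unlift_none. Qed.

Lemma sum_scoord d (v : 'rV[R]_d) : \sum_i scoord v i = 0.
Proof.
rewrite big_ord_recl scoord_0 [X in _ + X](eq_bigr (fun j => v ord0 j)) => [|j _]; first exact: addNr.
exact: scoord_lift.
Qed.

Lemma scoordZ d a (v : 'rV[R]_d) i : scoord (a *: v) i = a * scoord v i.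
Proof.
rewrite /scoord; case: unlift => [j|]; first by rewrite mxE.
by rewrite mulrN mulr_sumr; congr (- _); apply: eq_bigr => j _; rewrite mxE.
Qed.

Lemma scoord_continuous d i : continuous (fun v : 'rV[R]_d => scoord v i).
Proof.
rewrite /scoord; case: unlift => [j|]; first exact: row_coord_continuous.
under eq_fun do rewrite -sub0r; apply: realB_continuous; first exact: realcst_continuous.
by apply: sum_continuous => j _; exact: row_coord_continuous.
Qed.

(* The gauge of the simplex centred at its barycentre. *)
Definition gauge d (v : 'rV[R]_d) : R := \big[Num.max/0]_i (- d.+1%:R * scoord v i).

Lemma gauge_ge d (v : 'rV[R]_d) i : - d.+1%:R * scoord v i <= gauge v.
Proof. exact: le_bigmax_cond. Qed.

Lemma gauge_ge0 d (v : 'rV[R]_d) : 0 <= gauge v.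
Proof. by rewrite /gauge; elim/big_rec: _ => // i x _ x0; rewrite le_max x0 orbT. Qed.

Lemma gauge_attained d (v : 'rV[R]_d) : v != 0 -> exists i, gauge v = - d.+1%:R * scoord v i.
Proof.
move=> v0; have [i _ iP] := @arg_maxP _ _ _ ord0 predT (fun i => - d.+1%:R * scoord v i) isT.
exists i; apply/eqP; rewrite eq_le gauge_ge andbT; apply: bigmax_le => [|j _]; last exact: iP.
have ni j : scoord v i <= scoord v j.
  have := iP j isT; rewrite /= !mulNr lerN2 ler_pM2l ?ltr0Sn//.
rewrite mulNr oppr_ge0 pmulr_rle0 ?ltr0Sn//.
have : \sum_(j < d.+1) scoord v i <= \sum_j scoord v j by apply: ler_sum.
by rewrite sum_scoord sumr_const card_ord -mulr_natl pmulr_rle0 ?ltr0Sn.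
Qed.

(** The coordinates sum to 0, so a positive one is balanced by the [d] others, each of which is at
    least [- gauge v / (d + 1)]. *)
Lemma gauge_norm d (v : 'rV[R]_d) i : `|scoord v i| <= gauge v.
Proof.
have n1 : 1 <= (d.+1%:R : R) by rewrite ler1n.
have g0 := gauge_ge0 v; have low j : - gauge v <= d.+1%:R * scoord v j.
  by have := gauge_ge v j; rewrite mulNr => h; rewrite lerNl.
rewrite ler_norml; apply/andP; split; first by have := low i; nra.
have : \sum_(j | j != i) - gauge v <= \sum_(j | j != i) d.+1%:R * scoord v j by apply: ler_sum.
rewrite -mulr_sumr; have /eqP := sum_scoord v; rewrite (bigD1 i) //= addr_eq0 => /eqP -> .
set S := \sum_(j | _) scoord v j; rewrite sumr_const cardC1 card_ord /= -mulr_natl => h.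
have : (d%:R : R) <= d.+1%:R by rewrite ler_nat.
by nra.
Qed.

Lemma gaugeZ d a (v : 'rV[R]_d) : 0 <= a -> gauge (a *: v) = a * gauge v.
Proof.
move=> a0; rewrite /gauge (big_morph (fun x => a * x) (id1 := 0) (op1 := Num.max)) ?mulr0//.
  by apply: eq_bigr => i _; rewrite scoordZ mulrCA.
by move=> x y; rewrite maxr_pMr.
Qed.

Lemma gauge0 d : gauge (0 : 'rV[R]_d) = 0.
Proof. by rewrite -(scale0r 0) gaugeZ ?mul0r. Qed.

Lemma gauge_gt0 d (v : 'rV[R]_d) : v != 0 -> 0 < gauge v.
Proof.
move=> v0; rewrite lt_def gauge_ge0 andbT; apply: contraNneq v0 => g0.
apply/eqP/rowP => j; rewrite mxE -scoord_lift; apply/eqP.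
by rewrite -normr_eq0 eq_le normr_ge0 andbT -g0 gauge_norm.
Qed.

Lemma gauge_continuous d : continuous (@gauge d).
Proof.
rewrite /gauge; elim: (index_enum _) => [|i r IH].
  have -> : (fun v : 'rV[R]_d => \big[Num.max/0]_(i <- [::]) (- d.+1%:R * scoord v i)) = cst 0.
    by apply/funext => v; rewrite big_nil.
  exact: cst_continuous.
under eq_fun do rewrite big_cons; apply: max_continuous => //.
by apply: realM_continuous; [exact: realcst_continuous|exact: scoord_continuous].
Qed.

Definition enorm d (v : 'rV[R]_d) : R := Num.sqrt (dn v).

Lemma enorm_ge0 d (v : 'rV[R]_d) : 0 <= enorm v.
Proof. exact: sqrtr_ge0. Qed.

Lemma enormZ d a (v : 'rV[R]_d) : 0 <= a -> enorm (a *: v) = a * enorm v.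
Proof. by move=> a0; rewrite /enorm dnZ sqrtrM ?sqr_ge0// sqrtr_sqr ger0_norm. Qed.

Lemma enorm0 d : enorm (0 : 'rV[R]_d) = 0.
Proof. by rewrite /enorm dn0 sqrtr0. Qed.

Lemma enorm_gt0 d (v : 'rV[R]_d) : v != 0 -> 0 < enorm v.
Proof. by move=> v0; rewrite sqrtr_gt0 lt_def dn_ge0 dn_eq0 v0. Qed.

Lemma enorm_coord d (v : 'rV[R]_d) i : `|v ord0 i| <= enorm v.
Proof.
rewrite -sqrtr_sqr ler_sqrt ?dn_ge0// /dn (bigD1 i) //= lerDl.
by apply: sumr_ge0 => j _; exact: sqr_ge0.
Qed.

Lemma enorm_continuous d : continuous (@enorm d).
Proof. exact: sqrt_dn_continuous. Qed.

Lemma enorm_le1 d (v : 'rV[R]_d) : (enorm v <= 1) = (dn v <= 1).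
Proof. by rewrite /enorm -[in LHS](sqrtr1 R) ler_sqrt. Qed.

Definition srow d (t : simplex d) : 'rV[R]_d :=
  \row_j (sx t (fintype.lift ord0 j) - d.+1%:R^-1).

Lemma scoord_srow d (t : simplex d) i : scoord (srow t) i = sx t i - d.+1%:R^-1.
Proof.
have [j ->|->] := unliftP ord0 i; first by rewrite scoord_lift mxE.
have H := sx_sum t; rewrite big_ord_recl in H.
have E : \sum_(j < d) sx t (fintype.lift ord0 j) = 1 - sx t ord0 by rewrite -H addrC addKr.
rewrite scoord_0; under eq_bigr do rewrite mxE; rewrite sumrB E sumr_const card_ord.
set e := d.+1%:R^-1; have : d.+1%:R * e = 1 by rewrite mulfV// pnatr_eq0.
rewrite -[e *+ d]mulr_natl -natr1 mulrDl mul1r; move: (d%:R * e) => u; lra.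
Qed.

Lemma srow_continuous d : continuous (@srow d).
Proof.
apply: row_continuous => j; under eq_fun do rewrite mxE.
by apply: realB_continuous; [exact: sx_continuous|exact: realcst_continuous].
Qed.

Definition mksimp d (v : 'rV[R]_d) : simplex d := mksx (fun i => d.+1%:R^-1 + scoord v i).

Lemma sx_mksimp d (v : 'rV[R]_d) i : gauge v <= 1 -> sx (mksimp v) i = d.+1%:R^-1 + scoord v i.
Proof.
move=> g1; apply: mksxE => [j|].
  have := gauge_ge v j; rewrite mulNr => h.
  have n0 : 0 < (d.+1%:R : R) by rewrite ltr0Sn.
  rewrite -(pmulr_rge0 _ n0) mulrDr mulfV ?gt_eqF//; lra.
by rewrite big_split /= sum_scoord addr0 sumr_const card_ord -[_^-1 *+ _]mulr_natl mulfV// pnatr_eq0.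
Qed.

Lemma gauge_srow d (t : simplex d) : gauge (srow t) <= 1.
Proof.
apply: bigmax_le => // i _; rewrite scoord_srow mulrBr !mulNr opprK mulfV ?pnatr_eq0//.
by have := sx_ge0 t i; have : 0 <= (d.+1%:R : R) by []; nra.
Qed.

Lemma mksimpK d (t : simplex d) : mksimp (srow t) = t.
Proof. by apply: sxP => i; rewrite sx_mksimp ?gauge_srow// scoord_srow addrC subrK. Qed.

Lemma srowK d (v : 'rV[R]_d) : gauge v <= 1 -> srow (mksimp v) = v.
Proof. by move=> g1; apply/rowP => j; rewrite mxE sx_mksimp// scoord_lift addrC addKr. Qed.

Lemma gauge_bdry d (t : simplex d) : gauge (srow t) = 1 <-> bdry t.
Proof.
have n0 : (d.+1%:R : R) != 0 by rewrite pnatr_eq0.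
split=> [g1|[i ti]].
  have v0 : srow t != 0 by apply/eqP => E; move: g1; rewrite E gauge0 => /eqP; rewrite eq_sym oner_eq0.
  have [j] := gauge_attained v0; rewrite g1 scoord_srow mulrBr !mulNr opprK mulfV// => E.
  exists j; apply/eqP; have /eqP : d.+1%:R * sx t j = 0 by lra.
  by rewrite mulf_eq0 (negbTE n0).
apply/eqP; rewrite eq_le gauge_srow; have := gauge_ge (srow t) i.
by rewrite scoord_srow ti sub0r mulrNN mulfV.
Qed.

(** Rays from the barycentre are kept and rescaled, which turns the gauge into the Euclidean norm
    and the boundary of the simplex into the sphere. *)
Definition to_disk_row d (v : 'rV[R]_d) := (gauge v / enorm v) *: v.
Definition to_simp_row d (v : 'rV[R]_d) := (enorm v / gauge v) *: v.

Lemma to_disk_row_continuous d : continuous (@to_disk_row d).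
Proof.
apply: ratio_continuous; [exact: gauge_continuous|exact: enorm_continuous|exact: gauge0|].
exact: enorm_coord.
Qed.

Lemma to_simp_row_continuous d : continuous (@to_simp_row d).
Proof.
apply: ratio_continuous; [exact: enorm_continuous|exact: gauge_continuous|exact: enorm0|].
by move=> v i; rewrite -scoord_lift gauge_norm.
Qed.

Lemma enorm_to_disk d (v : 'rV[R]_d) : enorm (to_disk_row v) = gauge v.
Proof.
have [->|v0] := eqVneq v 0; first by rewrite /to_disk_row scaler0 enorm0 gauge0.
rewrite /to_disk_row enormZ ?divr_ge0 ?gauge_ge0 ?enorm_ge0// -mulrA mulVf ?mulr1//.
by rewrite gt_eqF// enorm_gt0.
Qed.

Lemma gauge_to_simp d (v : 'rV[R]_d) : gauge (to_simp_row v) = enorm v.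
Proof.
have [->|v0] := eqVneq v 0; first by rewrite /to_simp_row scaler0 enorm0 gauge0.
rewrite /to_simp_row gaugeZ ?divr_ge0 ?gauge_ge0 ?enorm_ge0// -mulrA mulVf ?mulr1//.
by rewrite gt_eqF// gauge_gt0.
Qed.

Lemma to_diskK d (v : 'rV[R]_d) : to_simp_row (to_disk_row v) = v.
Proof.
have [->|v0] := eqVneq v 0; first by rewrite /to_disk_row /to_simp_row !scaler0.
have g := gauge_gt0 v0; have e := enorm_gt0 v0.
rewrite /to_simp_row enorm_to_disk /to_disk_row gaugeZ ?divr_ge0 ?gauge_ge0 ?enorm_ge0// scalerA.
by rewrite -[RHS]scale1r; congr (_ *: _); field; rewrite !gt_eqF.
Qed.

Lemma to_simpK d (v : 'rV[R]_d) : to_disk_row (to_simp_row v) = v.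
Proof.
have [->|v0] := eqVneq v 0; first by rewrite /to_disk_row /to_simp_row !scaler0.
have g := gauge_gt0 v0; have e := enorm_gt0 v0.
rewrite /to_disk_row gauge_to_simp /to_simp_row enormZ ?divr_ge0 ?gauge_ge0 ?enorm_ge0// scalerA.
by rewrite -[RHS]scale1r; congr (_ *: _); field; rewrite !gt_eqF.
Qed.

Definition to_disk d (t : simplex d) : disk R d := mkdisk (to_disk_row (srow t)).
Definition to_simp d (x : disk R d) : simplex d := mksimp (to_simp_row (dval x)).

Lemma to_disk_le1 d (t : simplex d) : dn (to_disk_row (srow t)) <= 1.
Proof. by rewrite -enorm_le1 enorm_to_disk gauge_srow. Qed.

Lemma to_simp_le1 d (x : disk R d) : gauge (to_simp_row (dval x)) <= 1.
Proof. by rewrite gauge_to_simp enorm_le1 dval_le1. Qed.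

Lemma to_disk_can d : cancel (@to_disk d) (@to_simp d).
Proof. by move=> t; rewrite /to_simp mkdiskE ?to_disk_le1// to_diskK mksimpK. Qed.

Lemma to_simp_can d : cancel (@to_simp d) (@to_disk d).
Proof. by move=> x; rewrite /to_disk srowK ?to_simp_le1// to_simpK mkdisk_val. Qed.

Lemma to_disk_continuous d : continuous (@to_disk d).
Proof.
apply: (@comp_continuous _ _ _ _ (@mkdisk R d)); last exact: mkdisk_continuous.
by apply: (@comp_continuous _ _ _ (@srow d)); [exact: srow_continuous|exact: to_disk_row_continuous].
Qed.

Lemma to_simp_continuous d : continuous (@to_simp d).
Proof.
apply: simplex_continuous => i.
have -> : (fun x : disk R d => sx (to_simp x) i) = fun x => d.+1%:R^-1 + scoord (to_simp_row (dval x)) i.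
  by apply/funext => x; rewrite sx_mksimp// to_simp_le1.
apply: realD_continuous; first exact: realcst_continuous.
apply: (@comp_continuous _ _ _ (fun x : disk R d => to_simp_row (dval x)) (fun v => scoord v i)); last exact: scoord_continuous.
by apply: comp_continuous; [exact: dval_continuous|exact: to_simp_row_continuous].
Qed.

HB.instance Definition _ d := isContinuous.Build _ _ (@to_disk d) (@to_disk_continuous d).
HB.instance Definition _ d := isContinuous.Build _ _ (@to_simp d) (@to_simp_continuous d).

Lemma to_disk_sphere d (t : simplex d) : sphere (to_disk t) <-> bdry t.
Proof.
rewrite -gauge_bdry sphereE mkdiskE ?to_disk_le1// -enorm_to_disk /enorm.
split=> [->|E]; first exact: sqrtr1.
by rewrite -[LHS]sqr_sqrtr ?dn_ge0// E expr1n.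
Qed.

Lemma to_simp_bdry d (x : disk R d) : bdry (to_simp x) <-> sphere x.
Proof. by rewrite -to_disk_sphere to_simp_can. Qed.

Lemma to_disk_generator d : disk_generator (sing (@to_disk d : continuousType (simplex d) (disk R d))).
Proof.
split.
  split; first exact: supportedT.
  case: d => [|d]; first by move=> ? ; rewrite dom0.
  rewrite iota_push bd_push.
  apply: (@supported_push _ _ _ (@bdry R d.+1)); last exact: supported_bd_iota.
  by move=> x /to_disk_sphere.
move=> z' [_ z's]; have [|m [e [_ eB]]] := @simplex_bdry_generated R d (push (@to_simp d) z').
  split; first exact: supportedT.
  by rewrite bd_push; apply: supported_push z's => x /to_simp_bdry.
exists m; exists (push (@to_disk d) e); split; first exact: supportedT.
rewrite bd_push -[X in X - _ - _](@push_id R _ (@to_disk d \o @to_simp d)); last exact: to_simp_can.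
rewrite (@push_comp R _ _ _ (@to_simp d) (@to_disk d)) //.
have -> : m *: sing (@to_disk d : continuousType (simplex d) (disk R d)) = push (@to_disk d) (m *: iota_sx R d).
  by rewrite pushZ -iota_push.
by rewrite -!pushB; apply: supported_push eB => x /to_disk_sphere.
Qed.

End SimplexDisk.

(** * The attaching map and its corners *)

Section Attach.
Variable R : realType.
Local Notation simplex := (simplex R).
Local Notation clamp := (@clamp R).
Variables (X E W : topologicalType) (p : E -> X) (x0 : X) (e0 : E) (iota : X -> W).
Variables (k T : nat) (par : nat -> bool) (q : nat -> R -> E) (cell : nat -> disk R k -> W).
Hypothesis pC : continuous p.
Hypothesis iotaC : continuous iota.
Hypothesis qC : forall m, continuous (q m).
Hypothesis q0 : forall m, q m 0 = e0.
Hypothesis pq : forall m, p (q m 1) = x0.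
Hypothesis cellC : forall m, continuous (cell m).
Hypothesis cellS : forall m x, sphere x -> cell m x = iota x0.
Hypothesis Tk : (4 * T <= k)%N.

(* The [m]-th corner is the neighbourhood of the vertex [vx m] in the face opposite
   to the vertex [fx m], whose parity is the sign [par m]. Outside of the corners the
   attaching map stays in [X], where it lifts to [rho]. *)
Definition vx m : 'I_k.+2 := inord (4 * m + 2).
Definition fx m : 'I_k.+2 := inord (4 * m + par m).
Definition vxf m : 'I_k.+1 := odflt ord0 (unlift (fx m) (vx m)).

(** Indices come in blocks of four: the face is [4 * m] or [4 * m + 1], whichever has the parity
    [par m], and the vertex is [4 * m + 2]. Separate blocks keep the faces and vertices of different
    terms apart; [Tk] gives room for [T] blocks. *)
Lemma vx_val m : (m < T)%N -> vx m = (4 * m + 2)%N :> nat.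
Proof. by move=> mT; rewrite inordK//; lia. Qed.

Lemma fx_val m : (m < T)%N -> fx m = (4 * m + par m)%N :> nat.
Proof. by move=> mT; rewrite inordK//; case: (par m) => /=; lia. Qed.

Lemma vx_fx m m' : (m < T)%N -> (m' < T)%N -> vx m != fx m'.
Proof.
move=> mT mT'; apply/eqP => /(congr1 val) /=; rewrite vx_val// fx_val//.
by case: (par m') => /=; lia.
Qed.

Lemma fx_inj m m' : (m < T)%N -> (m' < T)%N -> fx m = fx m' -> m = m'.
Proof.
move=> mT mT' /(congr1 val) /=; rewrite !fx_val//.
by case: (par m); case: (par m') => /=; lia.
Qed.

Lemma vx_inj m m' : (m < T)%N -> (m' < T)%N -> vx m = vx m' -> m = m'.
Proof. by move=> mT mT' /(congr1 val) /=; rewrite !vx_val//; lia. Qed.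

Lemma lift_vxf m : (m < T)%N -> fintype.lift (fx m) (vxf m) = vx m.
Proof.
move=> mT; rewrite /vxf; case: unliftP => [j -> //|E'].
by have := vx_fx mT mT; rewrite E' eqxx.
Qed.

Definition tx (t : simplex k.+1) m : R := sx t (vx m).

Lemma tx_sum t m m' : (m < T)%N -> (m' < T)%N -> m != m' -> tx t m + tx t m' <= 1.
Proof.
move=> mT mT' mm; rewrite /tx -(sx_sum t) (bigD1 (vx m)) //= (bigD1 (vx m')) /=; last first.
  by apply: contra mm => /eqP/(vx_inj mT' mT) ->.
by rewrite addrA lerDl; apply: sumr_ge0 => i _; exact: sx_ge0.
Qed.

Lemma tx_continuous m : continuous (fun t => tx t m).
Proof. exact: sx_continuous. Qed.

(** Two coordinates of a point cannot both exceed 1/2, so the regions [tx > 1/2] are disjoint.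
    Between the levels 1/2 and 3/4 the path [q m] is run through, whence [4 * tx - 2]; above 3/4 the
    map rests at the end of the path, which leaves that part free for the sphere. *)
Fixpoint rho n (t : simplex k.+1) : E := match n with
  | 0 => e0
  | m.+1 => if tx t m - 2^-1 <= 0 then rho m t else q m (clamp (4 * tx t m - 2))
  end.

Lemma rho_low n t : (n <= T)%N -> (forall m, (m < n)%N -> tx t m <= 2^-1) -> rho n t = e0.
Proof.
elim: n => // n IH nT low /=; rewrite subr_le0 low// IH//; first exact: ltnW.
by move=> m mn; apply: low; rewrite ltnW.
Qed.

Lemma tx_other t m m' a : (m < T)%N -> (m' < T)%N -> m != m' -> 1 - a <= tx t m -> tx t m' <= a.
Proof. by move=> mT mT' mm h; have := tx_sum t mT mT' mm; lra. Qed.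

Lemma rho_at n m t : (m < n)%N -> (n <= T)%N -> 2^-1 <= tx t m ->
  rho n t = q m (clamp (4 * tx t m - 2)).
Proof.
elim: n => // n IH; rewrite ltnS leq_eqVlt => /orP[/eqP -> nT|mn nT] h.
  rewrite /= subr_le0; case: leP => // h'; rewrite rho_low ?(ltnW nT)//; last first.
    move=> m' m'n; apply: (@tx_other t n) => //; [exact: ltn_trans nT|by rewrite gt_eqF|lra].
  have -> : tx t n = 2^-1 by lra.
  by rewrite (_ : 4 * 2^-1 - 2 = 0) ?clamp0 ?q0//; lra.
rewrite /= subr_le0 IH ?(ltnW nT)// ifT//; apply: (@tx_other t m) => //; last lra.
  exact: ltn_trans nT.
by rewrite lt_eqF.
Qed.

Lemma rho_continuous n : (n <= T)%N -> continuous (rho n).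
Proof.
elim: n => [_|n IH nT] /=; first exact: cst_continuous.
apply: if_le_continuous.
- by apply: realB_continuous; [exact: tx_continuous|exact: realcst_continuous].
- exact: IH (ltnW nT).
- apply: (@comp_continuous _ _ _ (fun t => clamp (4 * tx t n - 2)) (q n)) => //.
  apply: (@comp_continuous _ _ _ (fun t => 4 * tx t n - 2) clamp); last exact: clamp_continuous.
  apply: realB_continuous; last exact: realcst_continuous.
  by apply: realM_continuous; [exact: realcst_continuous|exact: tx_continuous].
move=> t /eqP; rewrite subr_eq0 => /eqP E'; rewrite -(@rho_at n.+1 n)//; last by rewrite E'.
by rewrite /= E' subrr lexx.
Qed.

Lemma rho_high m t : (m < T)%N -> 3 / 4 <= tx t m -> rho T t = q m 1.
Proof.
move=> mT h; rewrite (@rho_at T m)//; last by lra.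
congr (q m _); rewrite clampE min_l; first by rewrite max_r// ler01.
lra.
Qed.

(** On the face [fx m] this inverts [x |-> x / 4 + 3 / 4 v] with [v] the vertex of the corner.
    Adding the coordinate at [fx m] to the one at [v] keeps the sum equal to 1 on the whole region
    above the level 3/4, also off the face. *)
Definition zoom_num m (t : simplex k.+1) (i : 'I_k.+1) : R :=
  if i == vxf m then Num.max (4 * sx t (fintype.lift (fx m) i) + 4 * sx t (fx m) - 3) 0
  else 4 * sx t (fintype.lift (fx m) i).

Definition zoom m (t : simplex k.+1) : simplex k :=
  mksx (fun i => zoom_num m t i / \sum_j zoom_num m t j).

Lemma zoom_num_ge0 m t i : 0 <= zoom_num m t i.
Proof.
by rewrite /zoom_num; case: ifP => _; [rewrite le_max lexx orbT|rewrite mulr_ge0// sx_ge0].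
Qed.

Lemma sum_sx_lift (f : 'I_k.+2) (t : simplex k.+1) :
  \sum_i sx t (fintype.lift f i) = 1 - sx t f.
Proof. by apply/eqP; rewrite eq_sym subr_eq -(sx_sum t) (bigD1_ord f) //= addrC. Qed.

Lemma zoom_num_sum m t : \sum_j zoom_num m t j =
  4 - 4 * (sx t (fintype.lift (fx m) (vxf m)) + sx t (fx m)) +
  Num.max (4 * sx t (fintype.lift (fx m) (vxf m)) + 4 * sx t (fx m) - 3) 0.
Proof.
rewrite (bigD1 (vxf m)) //= {1}/zoom_num eqxx.
have := sum_sx_lift (fx m) t; rewrite (bigD1 (vxf m)) //= => S.
have -> : \sum_(i < k.+1 | i != vxf m) zoom_num m t i =
    4 * \sum_(i < k.+1 | i != vxf m) sx t (fintype.lift (fx m) i).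
  by rewrite mulr_sumr; apply: eq_bigr => i /negbTE ni; rewrite /zoom_num ni.
by move: S; set a := \sum_(_ < _ | _) _; set M := Num.max _ _ => S; lra.
Qed.

Lemma zoom_num_sum_ge1 m t : 1 <= \sum_j zoom_num m t j.
Proof.
rewrite zoom_num_sum; set a := sx _ _; set b := sx t _.
by have : 4 * a + 4 * b - 3 <= Num.max (4 * a + 4 * b - 3) 0; [rewrite le_max lexx|lra].
Qed.

Lemma zoom_num_sum1 m t : (m < T)%N -> 3 / 4 <= tx t m -> \sum_j zoom_num m t j = 1.
Proof.
move=> mT; rewrite zoom_num_sum lift_vxf// -/(tx t m) => h.
by have := sx_ge0 t (fx m) => h'; rewrite max_l; lra.
Qed.

Lemma sx_zoom m t i : sx (zoom m t) i = zoom_num m t i / \sum_j zoom_num m t j.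
Proof.
have S := lt_le_trans ltr01 (zoom_num_sum_ge1 m t).
apply: mksxE => [j|]; first by rewrite divr_ge0// ?zoom_num_ge0// ltW.
by rewrite -mulr_suml mulfV// gt_eqF.
Qed.

Lemma zoom_num_continuous m i : continuous (fun t => zoom_num m t i).
Proof.
have c4 (j : 'I_k.+2) : continuous (fun t : simplex k.+1 => 4 * sx t j).
  by apply: realM_continuous; [exact: realcst_continuous|exact: sx_continuous].
rewrite /zoom_num; case: eqP => _; last exact: c4.
apply: max_continuous; last exact: realcst_continuous.
by apply: realB_continuous; [exact: realD_continuous|exact: realcst_continuous].
Qed.

Lemma zoom_continuous m : continuous (zoom m).
Proof.
apply: simplex_continuous => i; under eq_fun do rewrite sx_zoom.
apply: realM_continuous; first exact: zoom_num_continuous.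
apply: inv_continuous => [t|]; first by rewrite gt_eqF// (lt_le_trans ltr01)// zoom_num_sum_ge1.
by apply: sum_continuous => j _; exact: zoom_num_continuous.
Qed.

Lemma zoom_bdry_other m t i : (m < T)%N -> 3 / 4 <= tx t m -> sx t i = 0 -> i != fx m -> bdry (zoom m t).
Proof.
move=> mT h ti; rewrite eq_sym => /unlift_some[j Ej _]; exists j.
rewrite sx_zoom /zoom_num -Ej ti ifF ?mulr0 ?mul0r//.
apply/eqP => jv; move: h; rewrite /tx -(lift_vxf mT) -jv -Ej ti; lra.
Qed.

Lemma zoom_bdry_low m t : (m < T)%N -> tx t m = 3 / 4 -> bdry t -> bdry (zoom m t).
Proof.
move=> mT h [i ti]; have [E'|ni] := eqVneq i (fx m); last by apply: (@zoom_bdry_other m t i); rewrite ?h.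
exists (vxf m); rewrite sx_zoom /zoom_num eqxx lift_vxf// -/(tx t m) h -E' ti.
by rewrite max_r ?mul0r//; lra.
Qed.

(** Above the level 3/4 the corner is enlarged to a full simplex and sent over the sphere; at that
    level [rho] already lies over [x0], the base point of the sphere. *)
Fixpoint att n (t : simplex k.+1) : W := match n with
  | 0 => iota (p (rho T t))
  | m.+1 => if tx t m - 3 / 4 <= 0 then att m t else cell m (to_disk (zoom m t))
  end.

Lemma att_low n t : (forall m, (m < n)%N -> tx t m <= 3 / 4) -> att n t = iota (p (rho T t)).
Proof.
elim: n => // n IH low /=; rewrite subr_le0 low// IH// => m mn.
by apply: low; rewrite ltnW.
Qed.

Lemma att_cell n m t : (m < n)%N -> (n <= T)%N -> 3 / 4 < tx t m ->
  att n t = cell m (to_disk (zoom m t)).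
Proof.
elim: n => // n IH; rewrite ltnS leq_eqVlt => /orP[/eqP -> nT|mn nT] h.
  by rewrite /= subr_le0 leNgt h.
rewrite /= subr_le0 IH ?(ltnW nT)// ifT//.
apply: (@tx_other t m) => //; [exact: ltn_trans nT|by rewrite lt_eqF|lra].
Qed.

Lemma att_range (P : set W) n t : (forall x, P (iota x)) -> (forall m x, P (cell m x)) -> P (att n t).
Proof. by move=> P1 P2; elim: n => //= n IH; case: ifP. Qed.

(** A sphere is reached only from the face of its own corner: a point of the corner in another face
    is zoomed to the boundary, which [cell] sends to [x0]. *)
Lemma att_in_base n t : (n <= T)%N ->
  (forall m, (m < n)%N -> 3 / 4 < tx t m -> exists2 i, i != fx m & sx t i = 0) ->
  exists x, att n t = iota x.
Proof.
elim: n => [_ _|n IH nT H] /=; first by exists (p (rho T t)).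
case: (leP (tx t n - 3 / 4) 0) => h; first by apply: IH (ltnW nT) _ => m mn; apply: H; rewrite ltnW.
have h' : 3 / 4 < tx t n by lra.
have [i ni ti] := H n (ltnSn n) h'; exists x0; apply: cellS; apply/to_disk_sphere.
by apply: (zoom_bdry_other nT _ ti ni); lra.
Qed.

Lemma att_eq34 m t : (m < T)%N -> tx t m = 3 / 4 -> att m t = iota x0.
Proof.
move=> mT h; rewrite att_low => [|m' m'm]; first by rewrite (rho_high mT) ?h// pq.
have : tx t m' <= 4^-1 by apply: (@tx_other t m) => //; [exact: ltn_trans mT|by rewrite gt_eqF|rewrite h; lra].
lra.
Qed.

(** The two formulas must agree at the level 3/4, that is, the zoomed point must lie in the
    boundary. By [zoom_bdry_low] it does so for boundary points, hence the restriction to [bdry]. *)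
Lemma att_continuous n : (n <= T)%N ->
  continuous (fun t : set_type (@bdry R k.+1) => att n (set_val t)).
Proof.
have vc : continuous (set_val : set_type (@bdry R k.+1) -> simplex k.+1) by exact: subtype_val_continuous.
elim: n => [_|n IH nT] /=.
  apply: (@comp_continuous _ _ _ (fun t : set_type (@bdry R k.+1) => p (rho T (set_val t))) iota) => //.
  apply: (@comp_continuous _ _ _ (fun t : set_type (@bdry R k.+1) => rho T (set_val t)) p) => //.
  by apply: (@comp_continuous _ _ _ _ (rho T)) => //; exact: rho_continuous.
apply: if_le_continuous.
- apply: realB_continuous; last exact: realcst_continuous.
  by apply: (@comp_continuous _ _ _ _ (fun t => tx t n)) => //; exact: tx_continuous.
- exact: IH (ltnW nT).
- apply: (@comp_continuous _ _ _ _ (fun t => cell n (to_disk (zoom n t)))) => //.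
  apply: (@comp_continuous _ _ _ _ (cell n)) => //.
  apply: (@comp_continuous _ _ _ _ (@to_disk R k)); last exact: to_disk_continuous.
  exact: zoom_continuous.
move=> t /eqP; rewrite subr_eq0 => /eqP h; rewrite att_eq34//.
apply/esym/cellS/to_disk_sphere; apply: zoom_bdry_low => //; exact: set_valP.
Qed.

(** The retraction collapses the spheres to [x0], so [rho] lifts the retracted attaching map. Being
    defined on the whole simplex, it extends the retraction over the new cell and lifts that
    cell. *)
Lemma att_retract (r : W -> X) n t : (forall x, r (iota x) = x) -> (forall m x, r (cell m x) = x0) ->
  (n <= T)%N -> r (att n t) = p (rho T t).
Proof.
move=> ri rc; elim: n => //= n IH nT; case: (leP (tx t n - 3 / 4) 0) => h; first exact: IH (ltnW nT).
by rewrite rc (rho_high nT) ?pq//; lra.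
Qed.

(** Shrinks the face towards its vertex by the final factor 1/4, that is, onto the part above the
    level 3/4, where [zoom] undoes it. *)
Definition corner m (x : simplex k) (u : R) : simplex k.+1 :=
  face R (fx m) (lin (vertex R (vxf m)) x (3 / 4 * clamp u)).

Lemma clamp34 u : clamp (3 / 4 * clamp u) = 3 / 4 * clamp u.
Proof. by apply: clamp_id; have /andP[] := clamp_in u => ? ?; apply/andP; split; lra. Qed.

Lemma corner_lift m x u i : sx (corner m x u) (fintype.lift (fx m) i) =
  (1 - 3 / 4 * clamp u) * sx x i + 3 / 4 * clamp u * (i == vxf m)%:R.
Proof. by rewrite sx_face_lift sx_lin sx_vertex clamp34. Qed.

Lemma corner_fx m x u : sx (corner m x u) (fx m) = 0.
Proof. exact: sx_face_eq. Qed.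

Lemma corner0 m x : corner m x 0 = face R (fx m) x.
Proof. by rewrite /corner clamp0 mulr0 lin0. Qed.

Lemma corner_continuous m : continuous (fun xu : simplex k * R => corner m xu.1 xu.2).
Proof.
apply: (@comp_continuous _ _ _ _ (face R (fx m))); last exact: cts_fun.
apply: (@comp_continuous _ _ _ (fun xu : simplex k * R => (xu.1, 3 / 4 * clamp xu.2))
  (fun tu : simplex k * R => lin (vertex R (vxf m)) tu.1 tu.2)); last exact: lin_continuous.
apply: pair_continuous; first exact: fst_continuous.
apply: realM_continuous; first exact: realcst_continuous.
by apply: comp_continuous; [exact: snd_continuous|exact: clamp_continuous].
Qed.

(** Above the level 3/4 the image of a boundary point of the face still has a vanishing coordinate
    other than [fx m], so [att_in_base] applies: the shrinking is a homotopy of pairs. *)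
Lemma corner_bdry m x u : (m < T)%N -> bdry x -> exists y, att T (corner m x u) = iota y.
Proof.
move=> mT [i xi]; apply: att_in_base => // m' mT' h.
have [E'|ne] := eqVneq m' m; last first.
  exists (fx m); last exact: corner_fx.
  by apply: contra ne => /eqP/(fx_inj mT mT') ->.
move: h; rewrite E' /tx -(lift_vxf mT) corner_lift eqxx mulr1 => h.
have [iv|iv] := eqVneq i (vxf m).
  by have /andP[] := clamp_in u; move: h; rewrite -iv xi mulr0 => ? ? ?; lra.
exists (fintype.lift (fx m) i); first by rewrite eq_sym neq_lift.
by rewrite corner_lift xi (negbTE iv) !mulr0 addr0.
Qed.

Lemma tx_corner1 m x : (m < T)%N -> tx (corner m x 1) m = 4^-1 * sx x (vxf m) + 3 / 4.
Proof. by move=> mT; rewrite /tx -(lift_vxf mT) corner_lift clamp1 eqxx !mulr1; lra. Qed.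

Lemma rho_corner1 m x : (m < T)%N -> rho T (corner m x 1) = q m 1.
Proof. by move=> mT; apply: rho_high => //; rewrite tx_corner1//; have := sx_ge0 x (vxf m); lra. Qed.

Lemma zoom_corner m x : (m < T)%N -> zoom m (corner m x 1) = x.
Proof.
move=> mT; apply: sxP => i; rewrite sx_zoom zoom_num_sum1//; last first.
  by rewrite tx_corner1//; have := sx_ge0 x (vxf m); lra.
rewrite divr1 /zoom_num corner_lift clamp1 corner_fx; case: eqVneq => _ /=; last by lra.
by have := sx_ge0 x i => h; rewrite max_l; lra.
Qed.

Lemma att_corner1 m x : (m < T)%N -> att T (corner m x 1) = cell m (to_disk x).
Proof.
move=> mT; have x0' := sx_ge0 x (vxf m).
have [h|h] := ltP (3 / 4) (tx (corner m x 1) m); first by rewrite (@att_cell T m)// zoom_corner.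
have h' : tx (corner m x 1) m = 3 / 4 by move: h; rewrite tx_corner1//; lra.
rewrite cellS; last by apply/to_disk_sphere; exists (vxf m); move: h'; rewrite tx_corner1//; lra.
rewrite att_low ?(rho_high mT) ?pq ?h'// => m' mT'; have [-> |ne] := eqVneq m' m; first by rewrite h'.
have : tx (corner m x 1) m' <= 4^-1 by apply: (@tx_other _ m) => //; rewrite 1?eq_sym// h'; lra.
lra.
Qed.

Lemma att_face i x : (forall m, (m < T)%N -> i != fx m) -> exists y, att T (face R i x) = iota y.
Proof. by move=> H; apply: att_in_base => // m mT _; exists i; [exact: H|exact: sx_face_eq]. Qed.

End Attach.

Section Homologous.
Variable R : realType.

Lemma homotopic_rel_homologous_pos (W : topologicalType) (A B : set W) k
    (F : continuousType (simplex R k * R)%type W) (f0 f1 : continuousType (simplex R k) W) :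
  (0 < k)%N -> (forall x, F (x, 0) = f0 x) -> (forall x, F (x, 1) = f1 x) ->
  (forall x, A (F x)) -> (forall x u, bdry x -> B (F (x, u))) ->
  rel_homologous A B (sing f0) (sing f1).
Proof. by case: k F f0 f1 => // k F f0 f1 _; exact: homotopic_rel_homologous. Qed.

Variables (W : topologicalType) (A B : set W) (k : nat).
Implicit Types (c d : chain R k W).

Lemma rel_homologous_supported c d : supported B (c - d) -> rel_homologous A B c d.
Proof. by move=> h; exists 0; split; [exact: supported0|rewrite (raddf0 (@bd R W k.+1)) subr0]. Qed.

Lemma rel_homologousD c d c' d' : rel_homologous A B c d -> rel_homologous A B c' d' ->
  rel_homologous A B (c + c') (d + d').
Proof.
move=> [e [eA eB]] [e' [eA' eB']]; exists (e + e'); split; first exact: supportedD.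
rewrite bdD !opprD (addrACA c) (addrACA (c - d)).
exact: supportedD.
Qed.

Lemma rel_homologousZ a c d : rel_homologous A B c d -> rel_homologous A B (a *: c) (a *: d).
Proof.
move=> [e [eA eB]]; exists (a *: e); split; first exact: supportedZ.
by rewrite bdZ -!scalerBr; exact: supportedZ.
Qed.

Lemma rel_homologous_sum (I : Type) (r : seq I) (P : pred I) (F H : I -> chain R k W) :
  (forall i, P i -> rel_homologous A B (F i) (H i)) ->
  rel_homologous A B (\sum_(i <- r | P i) F i) (\sum_(i <- r | P i) H i).
Proof.
move=> h; elim/big_rec2: _ => [|i c d Pi cd]; last by apply: rel_homologousD => //; exact: h.
by apply: rel_homologous_supported; rewrite subrr; exact: supported0.
Qed.

End Homologous.

Section GrAct.
Variables (R : realType) (G : groupType) (X : topologicalType) (x0 : X)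
  (th : pi1_iso R G x0) (U : universal_covering th).

Lemma gr_actB k (x : chain R k (ucover U)) : zmod_morphism (fun a => @gr_act R G X x0 th U a k x).
Proof. exact: fglift_zmod_morphism. Qed.

Lemma gr_act_gr g k (x : chain R k (ucover U)) : gr_act (gr g) x = push (deck U g) x.
Proof. exact: fglift_gen. Qed.

Definition gr_act_on k (x : chain R k (ucover U)) (a : group_ring G) : chain R k (ucover U) := gr_act a x.
HB.instance Definition _ k (x : chain R k (ucover U)) :=
  GRing.isZmodMorphism.Build (group_ring G) (chain R k (ucover U)) (gr_act_on x) (gr_actB x).

Lemma gr_act0 k (x : chain R k (ucover U)) : gr_act 0 x = 0.
Proof. exact: (raddf0 (gr_act_on x)). Qed.

Lemma gr_act_sum k (x : chain R k (ucover U)) (I : Type) (r : seq I) (P : pred I) (F : I -> group_ring G) :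
  gr_act (\sum_(i <- r | P i) F i) x = \sum_(i <- r | P i) gr_act (F i) x.
Proof. exact: (raddf_sum (gr_act_on x)). Qed.

Lemma gr_actZ k (x : chain R k (ucover U)) (n : int) a : gr_act (n *: a) x = n *: gr_act a x.
Proof. by rewrite -[n in LHS]intz -[n in RHS]intz !scaler_int; exact: (raddfMz (gr_act_on x)). Qed.

End GrAct.

(** * The two-stage complex *)

Section TwoStage.
Variables (R : realType) (G : groupType) (X : topologicalType) (K : finite_cw R X)
  (x0 : X) (th : pi1_iso R G x0) (U : universal_covering th).
Local Notation simplex := (simplex R).
Local Notation E := (ucover U).
Local Notation p := (uproj U).
Local Notation base := (ubase U).
(** In dimension [k], [s k] spheres are added and as many cells of dimension [k + 1]. The [m]-th of
    the [T i] terms of row [i] consists of the sign [par], the group element [gs] and the column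
    [js]. By [s_dim] the cells of [X] have dimension at most [k - 2], so [X] counts as zero in all
    relative homology that concerns the new cells. *)
Variables (s : nat -> nat) (T : forall k, 'I_(s k) -> nat) (par : forall k, 'I_(s k) -> nat -> bool)
  (gs : forall k, 'I_(s k) -> nat -> G) (js : forall k, 'I_(s k) -> nat -> 'I_(s k)).
Hypothesis s_fin : exists N, forall n, (N <= n)%N -> s n = 0%N.
Hypothesis s_ge2 : forall k, (0 < s k)%N -> (2 <= k)%N.
Hypothesis s_dim : forall k, (0 < s k)%N -> forall m, (k <= m.+1)%N -> ncells K m = 0%N.
Hypothesis Tk : forall k (i : 'I_(s k)), (4 * T i <= k)%N.

Lemma ord_gt0 n : 'I_n -> (0 < n)%N.
Proof. by move=> i; apply: leq_ltn_trans (ltn_ord i). Qed.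

Lemma deck_path_ex (g : G) : exists f : R -> E, [/\ continuous f, f 0 = base & f 1 = deck U g base].
Proof. by have [H _] := ucover_sc U; apply/pconnP; exact: H. Qed.

Definition deck_path (g : G) : R -> E := projT1 (cid (deck_path_ex g)).

Lemma deck_path_continuous g : continuous (deck_path g).
Proof. by rewrite /deck_path; case: cid => f []. Qed.
Lemma deck_path0 g : deck_path g 0 = base.
Proof. by rewrite /deck_path; case: cid => f []. Qed.
Lemma deck_path1 g : deck_path g 1 = deck U g base.
Proof. by rewrite /deck_path; case: cid => f []. Qed.
Lemma p_deck_path1 g : p (deck_path g 1) = x0.
Proof. by rewrite deck_path1 deck_proj ubaseE. Qed.

Definition phi1 k (i : 'I_(s k)) (x : disk R k) : X := x0.
Arguments phi1 : clear implicits.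

Lemma phi1C k i : {within @sphere R k, continuous (phi1 k i)}.
Proof. by apply: continuous_subspaceT; exact: cst_continuous. Qed.

Lemma skel_new k z : (0 < s k)%N -> skel_lt K k.-1 z.
Proof. by move=> sk; apply: skel_ltT => m; rewrite -ltnS => km; apply: (s_dim sk); case: k {sk} km. Qed.

Lemma phi1S k i x : @sphere R k x -> skel_lt K k (phi1 k i x).
Proof. by move=> _; apply: skel_ltS (leq_pred k) _; apply: skel_new; exact: ord_gt0 i. Qed.

Definition W1 := adj_of phi1.
HB.instance Definition _ := Topological.on W1.
Definition in1 : X -> W1 := @adj_in R X s phi1.
Definition cell1 k (j : 'I_(s k)) : disk R k -> W1 := @adj_cell R X s phi1 k j.

Lemma in1_continuous : continuous in1.
Proof. exact: (@adj_in_continuous R X s phi1). Qed.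
Lemma cell1_continuous k (j : 'I_(s k)) : continuous (cell1 j).
Proof. exact: (@adj_cell_continuous R X s phi1). Qed.
Lemma cell1_sphere k (j : 'I_(s k)) x : sphere x -> cell1 j x = in1 x0.
Proof. by move=> sx; apply: (@adj_cell_sphere R X s phi1); exact: sphere_not_open. Qed.

Definition L1 : finite_cw R W1 := adj_cw phi1C phi1S s_fin.

Definition ret1 : W1 -> X := @adj_rec R X s phi1 X idfun phi1.
Lemma ret1_continuous : continuous ret1.
Proof.
apply: (@adj_rec_continuous R X s phi1); [exact: id_continuous| |by []].
by move=> k i; exact: cst_continuous.
Qed.
Lemma ret1_cell k (j : 'I_(s k)) x : ret1 (cell1 j x) = x0.
Proof. by rewrite /ret1 /cell1 (@adj_rec_cell R X s phi1). Qed.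

Definition s2 k : nat := if k is k'.+1 then s k' else 0%N.

Definition qq k (i : 'I_(s k)) m : R -> E := deck_path (gs i m).
(** Unlike the attaching map it is continuous on the whole disk. It serves both to extend the
    retraction over the new cells and to lift them. *)
Definition rho2 k : 'I_(s2 k) -> disk R k -> E :=
  match k return 'I_(s2 k) -> disk R k -> E with
  | 0 => fun _ _ => base
  | k'.+1 => fun i x => rho base (qq i) (T i) (to_simp x)
  end.
Definition att2 k (i : 'I_(s k)) : simplex k.+1 -> W1 :=
  att p base in1 (T i) (par i) (qq i) (fun m => cell1 (js i m)) (T i).
Definition phi2 k : 'I_(s2 k) -> disk R k -> W1 :=
  match k return 'I_(s2 k) -> disk R k -> W1 with
  | 0 => fun _ _ => in1 x0
  | k'.+1 => fun i x => att2 i (to_simp x)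
  end.

Lemma qqC k (i : 'I_(s k)) m : continuous (qq i m).
Proof. exact: deck_path_continuous. Qed.
Lemma qq0 k (i : 'I_(s k)) m : qq i m 0 = base.
Proof. exact: deck_path0. Qed.
Lemma qq1 k (i : 'I_(s k)) m : p (qq i m 1) = x0.
Proof. exact: p_deck_path1. Qed.

Lemma rho2C k (i : 'I_(s2 k)) : continuous (rho2 i).
Proof.
case: k i => [|k] i /=; first exact: cst_continuous.
apply: (@comp_continuous _ _ _ (@to_simp R k.+1)); first exact: to_simp_continuous.
by apply: rho_continuous; [exact: qqC|exact: qq0|exact: Tk|].
Qed.

Lemma ret1_phi2 k (i : 'I_(s2 k)) x : ret1 (phi2 i x) = p (rho2 i x).
Proof.
case: k i x => [|k] i x /=; first by rewrite ubaseE.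
apply: (att_retract (par i) (@qq0 _ i) (@qq1 _ i) (Tk i)) => //.
by move=> m y; exact: ret1_cell.
Qed.

Lemma within_bdry (Z : topologicalType) k (f : simplex k -> Z) :
  continuous (fun t : set_type (@bdry R k) => f (set_val t)) ->
  {within @sphere R k, continuous (fun x => f (to_simp x))}.
Proof.
move=> fc; apply/subspace_continuousP => x sx V.
have bx : bdry (to_simp x) by apply/to_simp_bdry.
pose y : set_type (@bdry R k) := SigSub (mem_set bx).
move=> /(fc y) [B [[O oO OB] By BV]].
have Ox : O (to_simp x) by move: By; rewrite -OB.
have := @to_simp_continuous R k x _ (open_nbhs_nbhs (conj oO Ox)).
apply: (@filterS _ (nbhs x)) => z /= Oz sz.
have bz : bdry (to_simp z) by apply/to_simp_bdry.
apply: (BV (SigSub (mem_set bz))); rewrite -OB; exact: Oz.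
Qed.

Lemma phi2C k i : {within @sphere R k, continuous (@phi2 k i)}.
Proof.
case: k i => [|k] i; first by apply: continuous_subspaceT; exact: cst_continuous.
apply: within_bdry; apply: att_continuous => //.
- exact: cts_fun.
- exact: in1_continuous.
- exact: qqC.
- exact: qq0.
- exact: qq1.
- by move=> m; exact: cell1_continuous.
- by move=> m x; exact: cell1_sphere.
Qed.

Lemma skel1_in n z : skel_lt K n z -> skel_lt L1 n (in1 z).
Proof. exact: adj_skel_in. Qed.

Lemma skel1_cell k (j : 'I_(s k)) x : skel_lt L1 k.+1 (cell1 j x).
Proof. exact: adj_skel_cell. Qed.

Lemma att2_skel k (i : 'I_(s k)) t : skel_lt L1 k.+1 (att2 i t).
Proof.
apply: att_range => [z|m x]; last exact: skel1_cell.
by apply: skel1_in; apply: skel_ltS (skel_new z (ord_gt0 i)); rewrite (leq_trans (leq_pred _)).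
Qed.

Lemma phi2S k i x : @sphere R k x -> skel_lt L1 k (@phi2 k i x).
Proof. by case: k i x => [|k] i x _; [case: (ord_gt0 i)|exact: att2_skel]. Qed.

Lemma s2_fin : exists N, forall n, (N <= n)%N -> s2 n = 0%N.
Proof. by have [N h] := s_fin; exists N.+1 => -[|n] // nN; exact: h. Qed.

Lemma s2_ge2 k : (0 < s2 k)%N -> (2 <= k)%N.
Proof. by case: k => // k /s_ge2; exact: ltnW. Qed.

Definition Y2 := adj_of phi2.
HB.instance Definition _ := Topological.on Y2.
Definition in2 : W1 -> Y2 := @adj_in R W1 s2 phi2.
Definition cell2 k (j : 'I_(s2 k)) : disk R k -> Y2 := @adj_cell R W1 s2 phi2 k j.

Lemma in2_continuous : continuous in2.
Proof. exact: (@adj_in_continuous R W1 s2 phi2). Qed.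
Lemma cell2_continuous k (j : 'I_(s2 k)) : continuous (cell2 j).
Proof. exact: (@adj_cell_continuous R W1 s2 phi2). Qed.
Lemma cell2_sphere k (j : 'I_(s2 k)) x : sphere x -> cell2 j x = in2 (phi2 j x).
Proof. by move=> sx; apply: (@adj_cell_sphere R W1 s2 phi2); exact: sphere_not_open. Qed.

Definition L2 : finite_cw R Y2 := @adj_cw R W1 L1 s2 phi2 phi2C phi2S s2_fin.

Definition ret2 : Y2 -> X := @adj_rec R W1 s2 phi2 X ret1 (fun k i x => p (rho2 i x)).
Lemma ret2_continuous : continuous ret2.
Proof.
apply: (@adj_rec_continuous R W1 s2 phi2).
- exact: ret1_continuous.
- by move=> k i; apply: (@comp_continuous _ _ _ (rho2 i)); [exact: rho2C|exact: cts_fun].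
- by move=> k i x _; rewrite ret1_phi2.
Qed.
HB.instance Definition _ := isContinuous.Build _ _ ret2 ret2_continuous.

Lemma ret2_cell k (j : 'I_(s2 k)) x : ret2 (cell2 j x) = p (rho2 j x).
Proof.
rewrite /ret2 /cell2 (@adj_rec_cell R W1 s2 phi2) // => y _.
by rewrite ret1_phi2.
Qed.

Definition in12 (z : X) : Y2 := in2 (in1 z).
Lemma in12_continuous : continuous in12.
Proof. by apply: comp_continuous; [exact: in1_continuous|exact: in2_continuous]. Qed.
HB.instance Definition _ := isContinuous.Build _ _ in12 in12_continuous.

Lemma ret2K z : ret2 (in12 z) = z.
Proof. by []. Qed.

Lemma in12_deformable : deformable R in12.
Proof.
apply: (@deformable_comp R X W1 Y2 in1 in2).
- move=> f fc fy; pose g t := projT1 (cid (fy t)).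
  have gE t : f t = in2 (g t) by rewrite /g; case: cid.
  by exists g => //; exact: (adj_in_lift phi2C fc gE).
- exact: in2_continuous.
- by move=> a b [].
- by apply: (@adj_deformable R X s phi1).
- by apply: (@adj_deformable R W1 s2 phi2); exact: s2_ge2.
Qed.

Lemma Y2_connected : connected [set: X] -> connected [set: Y2].
Proof.
move=> cX; apply: (@adj_connected R W1 s2 phi2); first by move=> k /s2_ge2; exact: ltnW.
apply: (@adj_connected R X s phi1) => // k /s_ge2; exact: ltnW.
Qed.

Local Notation rt := (ret2 : continuousType Y2 X).
Local Notation ic := (in12 : continuousType X Y2).
Definition U2 := @pb_universal_covering R G X x0 th U Y2 ic rt ret2K in12_deformable.
Local Notation PB := (@pb R G X x0 th U Y2 rt).
Local Notation incl := (@pb_incl R G X x0 th U Y2 ic rt ret2K : continuousType E PB).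

Lemma lift1_sub k (j : 'I_(s k)) x : ret2 (in2 (cell1 j x)) = p base.
Proof. by rewrite ubaseE; exact: ret1_cell. Qed.
Definition lift1_fun k (j : 'I_(s k)) : disk R k -> PB := mkpb (lift1_sub j).
Lemma lift1_continuous k (j : 'I_(s k)) : continuous (lift1_fun j).
Proof.
apply: mkpb_continuous; last exact: (@cst_continuous (disk R k) E base).
by apply: comp_continuous; [exact: cell1_continuous|exact: in2_continuous].
Qed.
HB.instance Definition _ k (j : 'I_(s k)) := isContinuous.Build _ _ (lift1_fun j) (@lift1_continuous k j).

Definition lift2_fun k (j : 'I_(s2 k)) : disk R k -> PB := mkpb (ret2_cell j).
Lemma lift2_continuous k (j : 'I_(s2 k)) : continuous (lift2_fun j).
Proof. by apply: mkpb_continuous; [exact: cell2_continuous|exact: rho2C]. Qed.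
HB.instance Definition _ k (j : 'I_(s2 k)) := isContinuous.Build _ _ (lift2_fun j) (@lift2_continuous k j).

(** Attaching twice numbers the cells by [(a + b) + c]: those of [X], the spheres, and the cells of
    the second stage. *)
Definition case3 (V : Type) (a b c : nat) (f : 'I_a -> V) (g : 'I_b -> V) (h : 'I_c -> V)
  (i : 'I_(a + b + c)) : V :=
  match fintype.split i with
  | inl i1 => match fintype.split i1 with inl j => f j | inr j => g j end
  | inr j => h j
  end.
Definition old3 a b c (j : 'I_a) : 'I_(a + b + c) := lshift c (lshift b j).
Definition mid3 a b c (j : 'I_b) : 'I_(a + b + c) := lshift c (rshift a j).
Definition new3 a b c (j : 'I_c) : 'I_(a + b + c) := rshift (a + b) j.

Lemma case3_old V a b c f g h j : @case3 V a b c f g h (old3 b c j) = f j.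
Proof. by rewrite /case3 /old3 (unsplitK (inl (lshift b j))) (unsplitK (inl j)). Qed.
Lemma case3_mid V a b c f g h j : @case3 V a b c f g h (mid3 a c j) = g j.
Proof. by rewrite /case3 /mid3 (unsplitK (inl (rshift a j))) (unsplitK (inr j)). Qed.
Lemma case3_new V a b c f g h j : @case3 V a b c f g h (new3 a b j) = h j.
Proof. by rewrite /case3 /new3 (unsplitK (inr j)). Qed.

Lemma ind3 a b c (P : 'I_(a + b + c) -> Prop) : (forall j, P (old3 b c j)) ->
  (forall j, P (mid3 a c j)) -> (forall j, P (new3 a b j)) -> forall i, P i.
Proof.
move=> P1 P2 P3 i; rewrite -(splitK i); case: (fintype.split i) => [i1|j] /=; last exact: P3.
by rewrite -(splitK i1); case: (fintype.split i1) => j /=; [exact: P1|exact: P2].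
Qed.

Lemma sum3 (V : zmodType) a b c (F : 'I_(a + b + c) -> V) :
  \sum_i F i = \sum_j F (old3 b c j) + \sum_j F (mid3 a c j) + \sum_j F (new3 a b j).
Proof. by rewrite big_split_ord big_split_ord. Qed.

Variable b : cellular_basis K U.

Definition lift_new n (i : 'I_(ncells K n + s n + s2 n)) : continuousType (disk R n) PB :=
  case3 (fun j => incl \o cell_lift b j : continuousType (disk R n) PB)
    (fun j => lift1_fun j : continuousType (disk R n) PB)
    (fun j => lift2_fun j : continuousType (disk R n) PB) i.

Definition orient_new n (i : 'I_(ncells K n + s n + s2 n)) : chain R n (disk R n) :=
  case3 (fun j => cell_orient b j) (fun=> sing (@to_disk R n)) (fun=> sing (@to_disk R n)) i.

Lemma char_old n j : char_map (f := L2) (old3 (s n) (s2 n) j) =1 in12 \o char_map j.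
Proof. by move=> x; rewrite /= adj_char_l adj_char_l. Qed.
Lemma char_mid n (j : 'I_(s n)) : char_map (f := L2) (mid3 (ncells K n) (s2 n) j) =1 in2 \o cell1 j.
Proof. by move=> x; rewrite /= adj_char_l adj_char_r. Qed.
Lemma char_new n (j : 'I_(s2 n)) : char_map (f := L2) (new3 (ncells K n) (s n) j) =1 cell2 j.
Proof. by move=> x; rewrite /= adj_char_r. Qed.

Lemma lift_newP n (i : 'I_(ncells L2 n)) x : uproj U2 (lift_new i x) = char_map i x.
Proof.
move: i; apply: ind3 => j.
- by rewrite char_old /lift_new case3_old; exact: (congr1 in12 (cell_liftP b j x)).
- by rewrite char_mid /lift_new case3_mid.
- by rewrite char_new /lift_new case3_new.
Qed.

Lemma orient_newP n (i : 'I_(ncells L2 n)) : disk_generator (orient_new i).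
Proof.
move: i; apply: ind3 => j; rewrite /orient_new ?case3_old ?case3_mid ?case3_new.
- exact: cell_orientP.
- exact: to_disk_generator.
- exact: to_disk_generator.
Qed.

Definition b2 : cellular_basis L2 U2 :=
  @CellularBasis R G Y2 L2 (in12 x0) _ U2 lift_new lift_newP orient_new orient_newP.

Variables (c : forall n, 'M[group_ring G]_(ncells K n.+1, ncells K n)) (A : forall k, 'M[group_ring G]_(s k)).
Hypothesis cP : cellular_differential b c.
Hypothesis AP : forall k (i j : 'I_(s k)),
  A k i j = \sum_(m < T i | js i m == j) ((-1) ^+ par i m : int) *: gr (gs i m).

Definition c2 n : 'M[group_ring G]_(ncells L2 n.+1, ncells L2 n) :=
  block_mx (block_mx (c n) 0 0 0) 0 (row_mx (0 : 'M_(s n, ncells K n)) (A n)) 0.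

Lemma skel_incl n e : uskel_lt K n e -> uskel_lt L2 (U := U2) n (incl e).
Proof. by move=> h; apply: adj_skel_in; exact: skel1_in. Qed.

Lemma push_incl_act a k (x : chain R k E) :
  push incl (gr_act a x) = gr_act (U := U2) a (push incl x).
Proof.
apply: (@freeg_additive_ext G _ (fun a => push incl (gr_act a x))
  (fun a => gr_act (U := U2) a (push incl x))) => [y z|y z|g].
- by rewrite (gr_actB _ y z) pushB.
- exact: (gr_actB (U := U2) (push incl x)).
rewrite -[fgen g]/(gr g) !gr_act_gr -(@push_comp R _ _ _ (deck U g) incl (incl \o deck U g)) //.
rewrite -(@push_comp R _ _ _ incl (deck U2 g) (incl \o deck U g)) // => e.
apply: pbP => //=; rewrite -[RHS]/(in12 (p e)); congr in12; exact: deck_proj.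
Qed.

Lemma cell_chain_old n j : cell_chain b2 (old3 (s n) (s2 n) j) = push incl (cell_chain b j).
Proof.
rewrite /cell_chain /= /lift_new /orient_new !case3_old.
exact: push_comp.
Qed.
Lemma cell_chain_mid n (j : 'I_(s n)) :
  cell_chain b2 (mid3 (ncells K n) (s2 n) j) = push (lift1_fun j) (sing (@to_disk R n)).
Proof. by rewrite /cell_chain /= /lift_new /orient_new !case3_mid. Qed.
Lemma cell_chain_new n (j : 'I_(s2 n)) :
  cell_chain b2 (new3 (ncells K n) (s n) j) = push (lift2_fun j) (sing (@to_disk R n)).
Proof. by rewrite /cell_chain /= /lift_new /orient_new !case3_new. Qed.

Lemma sphere_bd_to_disk n : supported (@sphere R n) (bd (sing (@to_disk R n))).
Proof. by have [[]] := @to_disk_generator R n. Qed.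

(** The lift of the shrinking [corner] is a homotopy from this face of the new cell to the sphere
    [js i m], translated by [gs i m] since the lift ends at the end of the path [qq i m]. The
    boundary of the face stays over [X], hence in the lower skeleton. *)
Lemma corner_homologous k (i : 'I_(s k)) m : (m < T i)%N ->
  rel_homologous (uskel_lt L2 (U := U2) k.+1) (uskel_lt L2 (U := U2) k)
    (sing (lift2_fun (i : 'I_(s2 k.+1)) \o @to_disk R k.+1 \o face R (fx k (par i) m)))
    (gr_act (U := U2) (gr (gs i m)) (cell_chain b2 (mid3 (ncells K k) (s2 k) (js i m)))).
Proof.
move=> mT; rewrite gr_act_gr cell_chain_mid !push_sing.
pose F (xu : simplex k * R) : PB := lift2_fun (i : 'I_(s2 k.+1)) (to_disk (corner (par i) m xu.1 xu.2)).
have Fc : continuous F.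
  apply: (@comp_continuous _ _ _ _ (fun t : simplex k.+1 => lift2_fun (i : 'I_(s2 k.+1)) (to_disk t))).
    exact: corner_continuous.
  apply: (@comp_continuous _ _ _ (@to_disk R k.+1)); first exact: to_disk_continuous.
  exact: lift2_continuous.
have FY xu : pbY (F xu) = in2 (att2 i (corner (par i) m xu.1 xu.2)).
  rewrite /F /= -[pbY _]/(cell2 (i : 'I_(s2 k.+1)) _) cell2_sphere /= ?to_disk_can//.
  by apply/to_disk_sphere; exists (fx k (par i) m); exact: corner_fx.
apply: (homotopic_rel_homologous_pos (F := mkcts Fc)).
- exact: ltnW (s_ge2 (ord_gt0 i)).
- by move=> x; rewrite -[LHS]/(lift2_fun (i : 'I_(s2 k.+1)) (to_disk (corner (par i) m x 0))) corner0.
- move=> x; apply: pbP.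
    rewrite -[pbY (mkcts Fc _)]/(pbY (F (x, 1))) FY /=.
    by rewrite /att2 (att_corner1 (par i) (@qq0 _ i) (@qq1 _ i) (fun m => @cell1_sphere k (js i m)) (Tk i)).
  rewrite -[pbE (mkcts Fc _)]/(rho2 (i : 'I_(s2 k.+1)) (to_disk (corner (par i) m x 1))) /= to_disk_can.
  by rewrite (rho_corner1 (par i) (@qq0 _ i) (Tk i)) // /qq deck_path1.
- by move=> xu; rewrite /uskel_lt /= -[uproj U2 _]/(pbY (F xu)) FY; apply: adj_skel_in; exact: att2_skel.
move=> x u bx; rewrite /uskel_lt /= -[uproj U2 _]/(pbY (F (x, u))) FY.
have [y Ey] := corner_bdry (p : E -> X) base (par i) (qq i) (fun m => @cell1_sphere k (js i m)) (Tk i) u mT bx.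
have {}Ey : att2 i (corner (par i) m x u) = in1 y := Ey.
rewrite -[in2 _]/(in2 (att2 i (corner (par i) m x u))) Ey.
by apply: adj_skel_in; apply: skel1_in; apply: skel_ltS (leq_pred k) _; apply: skel_new; exact: ord_gt0 i.
Qed.

(** Without a corner the face maps into [X], which lies in the lower skeleton by [s_dim]. *)
Lemma new_face_homologous k (i : 'I_(s k)) (f : 'I_k.+2) :
  (forall m, (m < T i)%N -> f != fx k (par i) m) ->
  supported (uskel_lt L2 (U := U2) k)
    (sing (lift2_fun (i : 'I_(s2 k.+1)) \o @to_disk R k.+1 \o face R f)).
Proof.
move=> nf; apply: supported_sing => x.
have bx : bdry (face R f x) by exists f; exact: sx_face_eq.
rewrite /uskel_lt /= -[uproj U2 _]/(cell2 (i : 'I_(s2 k.+1)) (to_disk (face R f x))).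
rewrite cell2_sphere /= ?to_disk_can; last by apply/to_disk_sphere.
have [y Ey] := att_face (p : E -> X) base (qq i) (fun m => @cell1_sphere k (js i m)) (Tk i) x nf.
have {}Ey : att2 i (face R f x) = in1 y := Ey.
rewrite Ey; apply: adj_skel_in; apply: skel1_in; apply: skel_ltS (leq_pred k) _.
by apply: skel_new; exact: ord_gt0 i.
Qed.

Lemma fx_sign k (i : 'I_(s k)) m : (m < T i)%N -> ((-1) ^+ fx k (par i) m : int) = (-1) ^+ par i m.
Proof.
move=> mT; rewrite (fx_val (par i) (Tk i) mT) exprD exprM.
by rewrite (_ : (-1) ^+ 4 = 1 :> int) // expr1n mul1r.
Qed.

(** The faces with a corner give the terms of the row, their sign in the boundary being the parity
    of the face; the remaining faces vanish modulo the lower skeleton. *)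
Lemma new_cell_homologous k (i : 'I_(s k)) :
  rel_homologous (uskel_lt L2 (U := U2) k.+1) (uskel_lt L2 (U := U2) k)
    (bd (cell_chain b2 (new3 (ncells K k.+1) (s k.+1) (i : 'I_(s2 k.+1)))))
    (\sum_j gr_act (U := U2) (A k i j) (cell_chain b2 (mid3 (ncells K k) (s2 k) j))).
Proof.
rewrite cell_chain_new push_sing bd_sing.
pose F (f : 'I_k.+2) := sing (lift2_fun (i : 'I_(s2 k.+1)) \o @to_disk R k.+1 \o face R f).
pose H m := gr_act (U := U2) (gr (gs i m)) (cell_chain b2 (mid3 (ncells K k) (s2 k) (js i m))).
have -> : \sum_j gr_act (U := U2) (A k i j) (cell_chain b2 (mid3 (ncells K k) (s2 k) j)) =
    \sum_(m < T i) ((-1) ^+ par i m : int) *: H m.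
  rewrite (partition_big (fun m : 'I_(T i) => js i m) predT) //=; apply: eq_bigr => j _.
  rewrite AP gr_act_sum; apply: eq_bigr => m /eqP <-; exact: (gr_actZ (U := U2)).
pose P := [pred f : 'I_k.+2 | [exists m : 'I_(T i), f == fx k (par i) m]].
rewrite -[\sum_(f < k.+2) _]/(\sum_(f < k.+2) (-1) ^+ f *: F f) (bigID P) /=.
rewrite -[X in rel_homologous _ _ _ X]addr0; apply: rel_homologousD; last first.
  apply: rel_homologous_supported; rewrite subr0; apply: supported_sum => f /existsPn nf.
  by apply: supportedZ; apply: new_face_homologous => m mT; exact: (nf (Ordinal mT)).
have [T0|T0] := posnP (T i).
  rewrite big_pred0 => [|f]; last first.
    by apply/negbTE/existsPn => m; have := ltn0 0; rewrite -{2}T0 (ord_gt0 m).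
  rewrite big1 => [|m _]; last by have := ltn0 0; rewrite -{2}T0 (ord_gt0 m).
  by apply: rel_homologous_supported; rewrite subr0; exact: supported0.
(* Different terms have different faces, so the faces with a corner can be numbered by the terms. *)
rewrite (reindex_onto (fun m : 'I_(T i) => fx k (par i) m)
  (fun f => odflt (Ordinal T0) [pick m : 'I_(T i) | f == fx k (par i) m])) /=; last first.
  move=> f /existsP[m /eqP fm]; case: pickP => [m' /eqP <-//|/(_ m)].
  by rewrite fm eqxx.
rewrite (eq_bigl predT) => [|m]; last first.
  rewrite /=; apply/andP; split; first by apply/existsP; exists m.
  case: pickP => [m' /eqP /(fx_inj (Tk i) (ltn_ord m) (ltn_ord m')) E'|/(_ m)]; last by rewrite eqxx.
  by apply/eqP/val_inj.
apply: rel_homologous_sum => m _; rewrite fx_sign//; apply: rel_homologousZ.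
exact: corner_homologous.
Qed.

Lemma c2_old n i j : c2 n (old3 (s n.+1) (s2 n.+1) i) (old3 (s n) (s2 n) j) = c n i j.
Proof. by rewrite /c2 /old3 block_mxEul block_mxEul. Qed.
Lemma c2_old_mid n i j : c2 n (old3 (s n.+1) (s2 n.+1) i) (mid3 (ncells K n) (s2 n) j) = 0.
Proof. by rewrite /c2 /old3 /mid3 block_mxEul block_mxEur mxE. Qed.
Lemma c2_old_new n i j : c2 n (old3 (s n.+1) (s2 n.+1) i) (new3 (ncells K n) (s n) j) = 0.
Proof. by rewrite /c2 /old3 /new3 block_mxEur mxE. Qed.
Lemma c2_mid n i j : c2 n (mid3 (ncells K n.+1) (s2 n.+1) i) j = 0.
Proof.
rewrite /c2 /mid3; move: j; apply: ind3 => j; rewrite /old3 /mid3 /new3.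
- by rewrite block_mxEul block_mxEdl mxE.
- by rewrite block_mxEul block_mxEdr mxE.
- by rewrite block_mxEur mxE.
Qed.
Lemma c2_new_old n i j : c2 n (new3 (ncells K n.+1) (s n.+1) i) (old3 (s n) (s2 n) j) = 0.
Proof. by rewrite /c2 /old3 /new3 block_mxEdl row_mxEl mxE. Qed.
Lemma c2_new_mid n i j : c2 n (new3 (ncells K n.+1) (s n.+1) i) (mid3 (ncells K n) (s2 n) j) = A n i j.
Proof. by rewrite /c2 /mid3 /new3 block_mxEdl row_mxEr. Qed.
Lemma c2_new_new n i j : c2 n (new3 (ncells K n.+1) (s n.+1) i) (new3 (ncells K n) (s n) j) = 0.
Proof. by rewrite /c2 /new3 block_mxEdr mxE. Qed.

Theorem two_stage_differential : cellular_differential b2 c2.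
Proof.
move=> n; apply: ind3 => i.
- have -> : \sum_j gr_act (U := U2) (c2 n (old3 (s n.+1) (s2 n.+1) i) j) (cell_chain b2 j) =
      push incl (\sum_j gr_act (c n i j) (cell_chain b j)).
    rewrite sum3 [X in _ + X + _]big1 => [|j _]; last by rewrite c2_old_mid gr_act0.
    rewrite [X in _ + X]big1 => [|j _]; last by rewrite c2_old_new gr_act0.
    rewrite !addr0 push_sum; apply: eq_bigr => j _.
    by rewrite c2_old cell_chain_old push_incl_act.
  rewrite cell_chain_old bd_push; have [e [eA eB]] := cP i.
  exists (push incl e); split; first by apply: supported_push eA => z; exact: skel_incl.
  rewrite (@bd_push R _ _ incl n.+1 e) -!pushB; apply: supported_push eB => z; exact: skel_incl.
- have -> : \sum_j gr_act (U := U2) (c2 n (mid3 (ncells K n.+1) (s2 n.+1) i) j) (cell_chain b2 j) = 0.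
    by apply: big1 => j _; rewrite c2_mid gr_act0.
  apply: rel_homologous_supported; rewrite subr0 cell_chain_mid bd_push.
  apply: supported_push (@sphere_bd_to_disk n.+1) => x sx.
  rewrite /uskel_lt /= -[uproj U2 _]/(in2 (cell1 i x)) cell1_sphere//.
  by apply: adj_skel_in; apply: skel1_in; apply: (@skel_new n.+1); exact: ord_gt0 i.
rewrite sum3 [X in X + _ + _]big1 => [|j _]; last by rewrite c2_new_old gr_act0.
rewrite [X in _ + X]big1 => [|j _]; last by rewrite c2_new_new gr_act0.
rewrite add0r addr0.
under eq_bigr do rewrite c2_new_mid.
exact: new_cell_homologous.
Qed.

End TwoStage.

Lemma freeg_ind (K : choiceType) (P : {freeg K / int} -> Prop) : P 0 ->
  (forall a b, P a -> P b -> P (a - b)) -> (forall k, P (fgen k)) -> forall a, P a.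
Proof.
move=> P0 PB Pg a; have PN b : P b -> P (- b) by move=> Pb; rewrite -sub0r; exact: PB.
have PD b d : P b -> P d -> P (b + d) by move=> Pb Pd; rewrite -[d]opprK; apply: PB => //; exact: PN.
rewrite -(freeg_sumE a); apply: (big_ind P) => // h _.
have -> : << coeff h a *g h >> = fgen h *~ coeff h a by rewrite freeg_mulz intz.
case: (coeff h a) => n; rewrite ?NegzE ?mulrNz.
  by elim: n => [|n IH]; rewrite ?mulr0z// -addn1 PoszD mulrzDr mulr1z; exact: PD.
by apply: PN; elim: n.+1 => [|k IH]; rewrite ?mulr0z// -addn1 PoszD mulrzDr mulr1z; exact: PD.
Qed.

(** * Weak isomorphisms *)

Section RightAction.
Variables (G : groupType) (V : zmodType).
Local Notation ZG := (group_ring G).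
Implicit Types (v w : G -> V) (a b : ZG).

(** Convolution with [a] from the right. Only integral multiples occur, so the values may lie in any
    abelian group, which covers real and complex functions at once. *)
Definition ract v a : G -> V := fun g => \sum_(h <- dom a) v (g * h^-1)%g *~ coeff h a.

Lemma ract_lift v a g : ract v a g = fglift (fun h => v (g * h^-1)%g : zmodule V) a.
Proof. by rewrite -[in RHS](Freeg_dom a) fglift_Freeg /prelift big_map. Qed.

Lemma ractB v a b : ract v (a - b) = ract v a - ract v b.
Proof.
apply/funext => g; rewrite -[RHS]/(ract v a g - ract v b g) !ract_lift.
exact: (@fglift_zmod_morphism G (zmodule V) (fun h => v (g * h^-1)%g : zmodule V) a b).
Qed.

Definition ract_on v (a : ZG) : G -> V := ract v a.
HB.instance Definition _ v := GRing.isZmodMorphism.Build ZG (G -> V) (ract_on v) (ractB v).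

Lemma ract0 v : ract v 0 = 0.
Proof. exact: (raddf0 (ract_on v)). Qed.
Lemma ractD v a b : ract v (a + b) = ract v a + ract v b.
Proof. exact: (raddfD (ract_on v)). Qed.
Lemma ract_sum v (I : Type) (r : seq I) (P : pred I) (F : I -> ZG) :
  ract v (\sum_(i <- r | P i) F i) = \sum_(i <- r | P i) ract v (F i).
Proof. exact: (raddf_sum (ract_on v)). Qed.

Lemma ract_gr v h : ract v (gr h) = fun g => v (g * h^-1)%g.
Proof. by apply/funext => g; rewrite ract_lift liftU scale1r. Qed.

Lemma ractBl v w a : ract (v - w) a = ract v a - ract w a.
Proof.
apply/funext => g; rewrite -[RHS]/(ract v a g - ract w a g) /ract -sumrB.
by apply: eq_bigr => h _; rewrite mulrzBl.
Qed.

Definition ract_by a v : G -> V := ract v a.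
HB.instance Definition _ a := GRing.isZmodMorphism.Build (G -> V) (G -> V) (ract_by a)
  (fun v w => ractBl v w a).

Lemma ractDl v w a : ract (v + w) a = ract v a + ract w a.
Proof. exact: (raddfD (ract_by a)). Qed.
Lemma ract_suml a (I : Type) (r : seq I) (P : pred I) (F : I -> G -> V) :
  ract (\sum_(i <- r | P i) F i) a = \sum_(i <- r | P i) ract (F i) a.
Proof. exact: (raddf_sum (ract_by a)). Qed.

Lemma gr_ind (P : ZG -> Prop) : (forall a b, P a -> P b -> P (a - b)) ->
  (forall h, P (gr h)) -> forall a, P a.
Proof. by move=> PB Pg a; apply: freeg_ind => //; rewrite -(subrr (gr 1%g)); exact: PB. Qed.

Lemma ract_mul v a b : ract (ract v a) b = ract v (a * b).
Proof.
move: b; apply: gr_ind => [b d|h].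
  by rewrite mulrBr !ractB => -> ->.
move: a; apply: gr_ind => [a d|k].
  by rewrite mulrBl !ractB ractBl => -> ->.
by rewrite -[gr k * gr h]/(gr_mul _ _) gr_mulg !ract_gr; apply/funext => g; rewrite invgM mulgA.
Qed.

Lemma ract1 v : ract v 1 = v.
Proof. by rewrite -[1]/(gr 1%g) ract_gr; apply/funext => g; rewrite invg1 mulg1. Qed.

End RightAction.

Lemma ract_raddf (G : groupType) (V W : zmodType) (F : {additive V -> W}) (v : G -> V) a g :
  F (ract v a g) = ract (F \o v) a g.
Proof. by rewrite raddf_sum; apply: eq_bigr => h _; rewrite raddfMz. Qed.

Section Involution.
Variable G : groupType.
Local Notation ZG := (group_ring G).

Definition ginv (a : ZG) : ZG := fglift (fun g => gr g^-1%g) a.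

Lemma ginvB (a b : ZG) : ginv (a - b) = ginv a - ginv b.
Proof. exact: fglift_zmod_morphism. Qed.
HB.instance Definition _ := GRing.isZmodMorphism.Build ZG ZG ginv ginvB.

Lemma ginv_gr g : ginv (gr g) = gr g^-1%g.
Proof. exact: fglift_gen. Qed.

Lemma ginvK (a : ZG) : ginv (ginv a) = a.
Proof.
move: a; apply: gr_ind => [a b|h]; first by rewrite !ginvB => -> ->.
by rewrite !ginv_gr invgK.
Qed.

Lemma ginvM (a b : ZG) : ginv (a * b) = ginv b * ginv a.
Proof.
move: b; apply: gr_ind => [b d|h]; first by rewrite mulrBr !ginvB mulrBl => -> ->.
move: a; apply: gr_ind => [a d|k]; first by rewrite mulrBl !ginvB mulrBr => -> ->.
by rewrite -[gr k * gr h]/(gr_mul _ _) gr_mulg !ginv_gr -[RHS]/(gr_mul _ _) gr_mulg invgM.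
Qed.

End Involution.

(** * Square-summable functions and their inner product *)

Section ScalarL2.
Variables (R : realType) (G : groupType).
Local Notation ZG := (group_ring G).
Implicit Types (v w : G -> R) (a b : ZG).

Definition N1 v : \bar R := \esum_(g in [set: G]) ((v g) ^+ 2)%:E.
Definition l2 v := (N1 v < +oo)%E.
(** Junk value 0 when [v] is not square-summable. *)
Definition n1 v : R := fine (N1 v).

Lemma N1_ge0 v : (0 <= N1 v)%E.
Proof. by apply: esum_ge0 => g _; rewrite lee_fin sqr_ge0. Qed.

Lemma n1_ge0 v : 0 <= n1 v.
Proof. exact: fine_ge0 (N1_ge0 v). Qed.

Lemma l2E v : l2 v -> N1 v = (n1 v)%:E.
Proof. by move=> lv; rewrite fineK// ge0_fin_numE// N1_ge0. Qed.

Lemma N1_le v M : (forall s : seq G, uniq s -> \sum_(g <- s) v g ^+ 2 <= M) -> (N1 v <= M%:E)%E.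
Proof.
move=> H; apply: ge_ereal_sup => _ [A [fA _] <-].
rewrite fsbig_finite// sumEFin lee_fin; apply: H; exact: finmap.fset_uniq.
Qed.

Lemma sum_le_N1 v (s : seq G) : uniq s -> ((\sum_(g <- s) v g ^+ 2)%:E <= N1 v)%E.
Proof.
move=> us; apply: esum_ge; exists [set` s]; first by split => //; exact: finite_seq.
by rewrite -fsbig_seq// sumEFin.
Qed.

Lemma l2_le v M : (forall s : seq G, uniq s -> \sum_(g <- s) v g ^+ 2 <= M) -> l2 v /\ n1 v <= M.
Proof.
move=> /N1_le h; have lv : l2 v by apply: le_lt_trans h _; rewrite ltry.
by split => //; rewrite -lee_fin -l2E.
Qed.

Lemma sum_le_n1 v (s : seq G) : l2 v -> uniq s -> \sum_(g <- s) v g ^+ 2 <= n1 v.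
Proof. by move=> lv us; rewrite -lee_fin -l2E// sum_le_N1. Qed.

Lemma pt_le_n1 v g : l2 v -> v g ^+ 2 <= n1 v.
Proof. by move=> lv; have := @sum_le_n1 v [:: g] lv isT; rewrite big_seq1. Qed.

Lemma l2Z (t : R) v : l2 v -> l2 (fun g => t * v g) /\ n1 (fun g => t * v g) <= t ^+ 2 * n1 v.
Proof.
move=> lv; apply: l2_le => s us; under eq_bigr do rewrite exprMn.
by rewrite -mulr_sumr ler_wpM2l ?sqr_ge0// sum_le_n1.
Qed.

Lemma l20 : l2 0.
Proof. by apply: (@l2_le _ 0 _).1 => s _; rewrite big1// => g _; rewrite expr0n. Qed.

Lemma N1_add (v1 v2 w1 w2 : G -> R) :
  (forall g, v1 g ^+ 2 + v2 g ^+ 2 = w1 g ^+ 2 + w2 g ^+ 2) -> (N1 v1 + N1 v2 = N1 w1 + N1 w2)%E.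
Proof.
move=> H; rewrite /N1 -!esumD//; try by move=> g _; rewrite lee_fin sqr_ge0.
by apply: eq_esum => g _; rewrite -!EFinD H.
Qed.

Lemma l2D v w : l2 v -> l2 w -> l2 (v + w).
Proof.
move=> lv lw; apply: (@l2_le _ (2 * n1 v + 2 * n1 w) _).1 => s us.
apply: (@le_trans _ _ (\sum_(g <- s) (2 * v g ^+ 2 + 2 * w g ^+ 2))).
  by apply: ler_sum => g _; rewrite -[(v + w) g]/(v g + w g); have := sqr_ge0 (v g - w g); nra.
by rewrite big_split /= -!mulr_sumr lerD// ler_wpM2l// sum_le_n1.
Qed.

Lemma l2N v : l2 v -> l2 (- v).
Proof.
move=> lv; apply: (@l2_le _ (n1 v) _).1 => s us; under eq_bigr do rewrite sqrrN.
exact: sum_le_n1.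
Qed.

Lemma l2B v w : l2 v -> l2 w -> l2 (v - w).
Proof. by move=> lv lw; apply: l2D => //; exact: l2N. Qed.

Lemma l2_sum (I : Type) (r : seq I) (P : pred I) (F : I -> G -> R) :
  (forall i, P i -> l2 (F i)) -> l2 (\sum_(i <- r | P i) F i).
Proof. by move=> H; elim/big_rec: _ => [|i v Pi lv]; [exact: l20|apply: l2D => //; exact: H]. Qed.

Lemma N1_shift v h : N1 (fun g => v (g * h)%g) = N1 v.
Proof.
rewrite /N1 (@reindex_esum R G G setT setT (fun g => (g * h)%g) (fun g => (v g ^+ 2)%:E)) //.
split => [g _//|g g' _ _|g _] /=; first exact: mulIg.
by exists (g * h^-1)%g; rewrite ?mulgKV// mulgVK.
Qed.

Lemma l2_gr v h : l2 v -> l2 (ract v (gr h)).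
Proof. by rewrite /l2 ract_gr N1_shift. Qed.

Lemma n1_gr v h : n1 (ract v (gr h)) = n1 v.
Proof. by rewrite /n1 ract_gr N1_shift. Qed.

Lemma l2_ract v a : l2 v -> l2 (ract v a).
Proof.
move=> lv; move: a; apply: gr_ind => [a b la lb|h]; last exact: l2_gr.
by rewrite ractB; exact: l2B.
Qed.

Lemma n1D_le v w : l2 v -> l2 w -> n1 (v + w) <= 2 * n1 v + 2 * n1 w.
Proof.
move=> lv lw; apply: (@l2_le _ _ _).2 => s us.
apply: (@le_trans _ _ (\sum_(g <- s) (2 * v g ^+ 2 + 2 * w g ^+ 2))).
  by apply: ler_sum => g _; rewrite -[(v + w) g]/(v g + w g); have := sqr_ge0 (v g - w g); nra.
by rewrite big_split /= -!mulr_sumr lerD// ler_wpM2l// sum_le_n1.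
Qed.

Lemma n1N v : n1 (- v) = n1 v.
Proof. by rewrite /n1 /N1; congr fine; apply: eq_esum => g _; rewrite sqrrN. Qed.

(** The bound is a natural number because it will serve as an integral multiple, both of families
    and in matrices over the group ring. *)
Lemma n1_ract_le a : exists2 c : nat, (0 < c)%N & forall v, l2 v -> n1 (ract v a) <= c%:R * n1 v.
Proof.
move: a; apply: gr_ind => [a b [c c0 cP] [d d0 dP]|h]; last first.
  by exists 1%N => // v _; rewrite n1_gr mul1r.
exists (2 * c + 2 * d)%N => [|v lv]; first by rewrite addn_gt0 !muln_gt0 c0.
rewrite ractB; apply: le_trans (n1D_le (l2_ract _ lv) (l2N (l2_ract _ lv))) _.
by rewrite n1N; have := cP v lv; have := dP v lv; rewrite natrD !natrM; nra.
Qed.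

(** Twice the inner product, obtained by polarization, so that only sums of non-negative terms have
    to be considered. *)
Definition ip v w : R := n1 (v + w) - n1 v - n1 w.

Lemma ipC v w : ip v w = ip w v.
Proof. by rewrite /ip [v + w]addrC addrAC. Qed.

(** The pointwise identity of squares behind the additivity of [ip]. All terms are non-negative, so
    it may be summed freely over the group. *)
Lemma n1_cube u v w : l2 u -> l2 v -> l2 w ->
  n1 (u + v + w) + n1 u + n1 v + n1 w = n1 (u + v) + n1 (v + w) + n1 (u + w).
Proof.
move=> lu lv lw; have lu2 := l2D lu lv; have lv2 := l2D lv lw; have lw2 := l2D lu lw.
have sq0 (f : G -> R) g : [set: G] g -> (0 <= (f g ^+ 2)%:E)%E by rewrite lee_fin sqr_ge0.
have E : (N1 (u + v + w)%R + N1 u + (N1 v + N1 w) = N1 (u + v)%R + N1 (v + w)%R + N1 (u + w)%R)%E.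
  rewrite /N1 -!esumD; try by move=> g Tg; do ?[apply: adde_ge0]; exact: sq0.
  apply: eq_esum => g _; rewrite -!EFinD; congr EFin.
  by rewrite -[(u + v + w) g]/(u g + v g + w g) -[(u + v) g]/(u g + v g)
    -[(v + w) g]/(v g + w g) -[(u + w) g]/(u g + w g); ring.
move: E; rewrite (l2E (l2D lu2 lw)) (l2E lu) (l2E lv) (l2E lw) (l2E lu2) (l2E lv2) (l2E lw2).
by rewrite -!EFinD => -[<-]; rewrite addrA.
Qed.

Lemma ipDl u v w : l2 u -> l2 v -> l2 w -> ip (u + v) w = ip u w + ip v w.
Proof. by move=> lu lv lw; rewrite /ip; have := n1_cube lu lv lw; lra. Qed.

Lemma n10 : n1 0 = 0.
Proof. by apply/eqP; rewrite eq_le n1_ge0 andbT (@l2_le _ 0 _).2 => // s _; rewrite big1// => g _; rewrite expr0n. Qed.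

Lemma ip0l w : ip 0 w = 0.
Proof. by rewrite /ip add0r n10 subr0 subrr. Qed.

Lemma ipNl v w : l2 v -> l2 w -> ip (- v) w = - ip v w.
Proof.
move=> lv lw; apply/eqP; rewrite -addr_eq0 -ipDl//; last exact: l2N.
by rewrite addNr ip0l.
Qed.

Lemma ipBl u v w : l2 u -> l2 v -> l2 w -> ip (u - v) w = ip u w - ip v w.
Proof. by move=> lu lv lw; rewrite ipDl ?ipNl//; exact: l2N. Qed.

Lemma ip_suml (I : Type) (r : seq I) (P : pred I) (F : I -> G -> R) w :
  (forall i, l2 (F i)) -> l2 w -> ip (\sum_(i <- r | P i) F i) w = \sum_(i <- r | P i) ip (F i) w.
Proof.
move=> lF lw; elim: r => [|i r IH]; first by rewrite !big_nil ip0l.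
rewrite !big_cons; case: ifP => // _; rewrite ipDl ?IH//.
by apply: l2_sum => j _.
Qed.

Lemma ipvv v : l2 v -> ip v v = 2 * n1 v.
Proof.
move=> lv; rewrite /ip; have := n1_cube lv lv (l2N lv).
by rewrite addrK subrr n10 n1N; lra.
Qed.

Lemma n1D v w : n1 (v + w) = n1 v + n1 w + ip v w.
Proof. by rewrite /ip; ring. Qed.

(** For a group element this is the invariance of the norm under right translation, from which [ip]
    is polarized. *)
Lemma ip_adj v w a : l2 v -> l2 w -> ip (ract v a) w = ip v (ract w (ginv a)).
Proof.
move=> lv lw; move: a; apply: gr_ind => [a b ha hb|h].
  rewrite ginvB !ractB ipBl ?ha ?hb//; try exact: l2_ract.
  by rewrite [RHS]ipC ipBl// ?[ip v _]ipC//; exact: l2_ract.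
rewrite ginv_gr /ip !n1_gr; congr (_ - _ - _).
rewrite -(n1_gr (ract v (gr h) + w) h^-1) ractDl ract_mul -[gr h * _]/(gr_mul _ _) gr_mulg mulgV.
by rewrite [ract v _](@ract1 G R v).
Qed.

End ScalarL2.

Section FinL2.
Variables (R : realType) (G : groupType).
Local Notation ZG := (group_ring G).
Local Notation fam I := (I -> G -> R).
Implicit Types (I J K : finType).

Definition l2f I (x : fam I) : Prop := forall i, l2 (x i).
Definition nn I (x : fam I) : R := \sum_i n1 (x i).
Definition ipf I (x y : fam I) : R := \sum_i ip (x i) (y i).
Definition app I J (f : I -> J -> ZG) (x : fam I) : fam J := fun j => \sum_i ract (x i) (f i j).
Definition fadj I J (f : I -> J -> ZG) : J -> I -> ZG := fun j i => ginv (f i j).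
Definition fmul I J K (f : I -> J -> ZG) (g : J -> K -> ZG) : I -> K -> ZG :=
  fun i k => \sum_j f i j * g j k.

Lemma l2f0 I : l2f (0 : fam I).
Proof. by move=> i; exact: l20. Qed.
Lemma l2fD I (x y : fam I) : l2f x -> l2f y -> l2f (x + y).
Proof. by move=> lx ly i; exact: l2D. Qed.
Lemma l2fB I (x y : fam I) : l2f x -> l2f y -> l2f (x - y).
Proof. by move=> lx ly i; exact: l2B. Qed.
Lemma l2fMn I (x : fam I) n : l2f x -> l2f (x *+ n).
Proof. by move=> lx; elim: n => [|n IH]; rewrite ?mulr0n ?mulrS; [exact: l2f0|exact: l2fD]. Qed.
Lemma l2f_app I J (f : I -> J -> ZG) x : l2f x -> l2f (app f x).
Proof. by move=> lx j; apply: l2_sum => i _; exact: l2_ract. Qed.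

Lemma appB I J (f : I -> J -> ZG) x y : app f (x - y) = app f x - app f y.
Proof.
apply/funext => j; rewrite -[RHS]/(app f x j - app f y j) /app -sumrB.
by apply: eq_bigr => i _; rewrite ractBl.
Qed.
HB.instance Definition _ I J (f : I -> J -> ZG) := GRing.isZmodMorphism.Build (fam I) (fam J) (app f) (@appB I J f).

Lemma app0 I J (f : I -> J -> ZG) : app f 0 = 0.
Proof. exact: raddf0. Qed.
Lemma appD I J (f : I -> J -> ZG) x y : app f (x + y) = app f x + app f y.
Proof. exact: raddfD. Qed.
Lemma appMn I J (f : I -> J -> ZG) x n : app f (x *+ n) = app f x *+ n.
Proof. exact: raddfMn. Qed.

Lemma app_mul I J K (f : I -> J -> ZG) (g : J -> K -> ZG) x : app g (app f x) = app (fmul f g) x.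
Proof.
apply/funext => k; rewrite /app; under eq_bigr do rewrite ract_suml.
rewrite exchange_big; apply: eq_bigr => i _; rewrite ract_sum.
by apply: eq_bigr => j _; rewrite ract_mul.
Qed.

Lemma nn_ge0 I (x : fam I) : 0 <= nn x.
Proof. by apply: sumr_ge0 => i _; exact: n1_ge0. Qed.

Lemma n1_le_nn I (x : fam I) i : n1 (x i) <= nn x.
Proof. by rewrite /nn (bigD1 i) //= lerDl; apply: sumr_ge0 => j _; exact: n1_ge0. Qed.

Lemma nn_pt I (x : fam I) i g : l2f x -> x i g ^+ 2 <= nn x.
Proof. by move=> lx; apply: le_trans (pt_le_n1 g (lx i)) _; exact: n1_le_nn. Qed.

Lemma nn_eq0 I (x : fam I) : l2f x -> nn x <= 0 -> x = 0.
Proof.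
move=> lx x0; apply/funext => i; apply/funext => g; apply/eqP; rewrite -sqrf_eq0 eq_le sqr_ge0 andbT.
by apply: le_trans x0; exact: nn_pt.
Qed.

Lemma nn_sub I (x : fam I) : l2f x -> (forall e : R, 0 < e -> nn x < e) -> x = 0.
Proof.
move=> lx H; apply: nn_eq0 => //; rewrite leNgt; apply/negP => x0.
by have := H _ x0; rewrite ltxx.
Qed.

Lemma nn0 I : nn (0 : fam I) = 0.
Proof. by rewrite /nn big1// => i _; exact: n10. Qed.
Lemma nnN I (x : fam I) : nn (- x) = nn x.
Proof. by apply: eq_bigr => i _; exact: n1N. Qed.
Lemma nnD I (x y : fam I) : nn (x + y) = nn x + nn y + ipf x y.
Proof. by rewrite /nn /ipf -!big_split /=; apply: eq_bigr => i _; exact: n1D. Qed.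

Lemma ipfC I (x y : fam I) : ipf x y = ipf y x.
Proof. by apply: eq_bigr => i _; exact: ipC. Qed.
Lemma ipfDl I (x y z : fam I) : l2f x -> l2f y -> l2f z -> ipf (x + y) z = ipf x z + ipf y z.
Proof. by move=> lx ly lz; rewrite /ipf -big_split /=; apply: eq_bigr => i _; exact: ipDl. Qed.
Lemma ipfBl I (x y z : fam I) : l2f x -> l2f y -> l2f z -> ipf (x - y) z = ipf x z - ipf y z.
Proof. by move=> lx ly lz; rewrite /ipf -sumrB; apply: eq_bigr => i _; exact: ipBl. Qed.
Lemma ipf0l I (z : fam I) : ipf 0 z = 0.
Proof. by rewrite /ipf big1// => i _; exact: ip0l. Qed.
Lemma ipfMnl I (x z : fam I) n : l2f x -> l2f z -> ipf (x *+ n) z = n%:R * ipf x z.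
Proof.
move=> lx lz; elim: n => [|n IH]; first by rewrite mulr0n ipf0l mul0r.
by rewrite mulrS ipfDl ?IH//; [rewrite -natr1; ring|exact: l2fMn].
Qed.
Lemma ipfxx I (x : fam I) : l2f x -> ipf x x = 2 * nn x.
Proof. by move=> lx; rewrite /ipf /nn mulr_sumr; apply: eq_bigr => i _; exact: ipvv. Qed.
Lemma nnB I (x y : fam I) : l2f x -> l2f y -> nn (x - y) = nn x + nn y - ipf x y.
Proof.
move=> lx ly; have lN : l2f (- y) by move=> i; exact: l2N.
rewrite nnD nnN; congr (_ + _).
have := ipfBl (@l2f0 I) ly lx; rewrite sub0r ipf0l sub0r => E.
by rewrite ipfC E ipfC.
Qed.
Lemma ipf_app I J (f : I -> J -> ZG) x y : l2f x -> l2f y ->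
  ipf (app f x) y = ipf x (app (fadj f) y).
Proof.
move=> lx ly; rewrite /ipf.
rewrite (eq_bigr (fun j => \sum_i ip (ract (x i) (f i j)) (y j))) => [|j _]; last first.
  by rewrite ip_suml// => i; exact: l2_ract.
rewrite exchange_big; apply: eq_bigr => i _; rewrite ipC ip_suml//; last by move=> j; exact: l2_ract.
by apply: eq_bigr => j _; rewrite ip_adj// ipC.
Qed.

Lemma nnD_le I (x y : fam I) : l2f x -> l2f y -> nn (x + y) <= 2 * nn x + 2 * nn y.
Proof.
move=> lx ly; rewrite /nn !mulr_sumr -big_split /=; apply: ler_sum => i _; exact: n1D_le.
Qed.

Lemma n1_sum_le (T : Type) (r : seq T) (F : T -> G -> R) : (forall i, l2 (F i)) ->
  n1 (\sum_(i <- r) F i) <= 2 ^+ size r * \sum_(i <- r) n1 (F i).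
Proof.
move=> lF; elim: r => [|i r IH]; first by rewrite !big_nil n10 mulr0.
rewrite !big_cons /= exprS; have ls : l2 (\sum_(j <- r) F j) by apply: l2_sum => j _.
apply: le_trans (n1D_le (lF i) ls) _.
have : (1 : R) <= 2 ^+ size r by apply: exprn_ege1; rewrite ler1n.
by have := n1_ge0 (F i); move: IH; set S := n1 (\sum_(_ <- r) _); set S' := \sum_(_ <- r) _; nra.
Qed.

Lemma app_bound I J (f : I -> J -> ZG) :
  exists2 c : nat, (0 < c)%N & forall x, l2f x -> nn (app f x) <= c%:R * nn x.
Proof.
have /choice[c cP] : forall ij : I * J, exists c : nat, forall v, l2 v -> n1 (ract v (f ij.1 ij.2)) <= (c%:R : R) * n1 v.
  by move=> ij; have [c _ cP] := n1_ract_le R (f ij.1 ij.2); exists c.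
exists (2 ^ size (index_enum I) * \sum_ij c ij).+1%N => // x lx.
have cle i j : (c (i, j) <= \sum_ij c ij)%N by rewrite (bigD1 (i, j)) //= leq_addr.
apply: (@le_trans _ _ (\sum_j 2 ^+ size (index_enum I) * \sum_i (c (i, j))%:R * n1 (x i))).
  apply: ler_sum => j _; apply: le_trans (n1_sum_le _ _) _ => [i|]; first exact: l2_ract.
  rewrite ler_wpM2l ?exprn_ge0//; apply: ler_sum => i _.
  exact: (cP (i, j)).
rewrite -mulr_sumr exchange_big /=; set N := (_ * _)%N.
have -> : N.+1%:R * nn x = N%:R * nn x + nn x by rewrite -natr1 mulrDl mul1r.
rewrite /N natrM natrX -mulrA.
rewrite ler_wpDr ?nn_ge0// ler_wpM2l ?exprn_ge0//.
rewrite /nn mulr_sumr; apply: ler_sum => i _; rewrite -mulr_suml ler_wpM2r ?n1_ge0//.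
have -> : (\sum_ij c ij = \sum_i \sum_j c (i, j))%N.
  by rewrite pair_bigA /=; apply: eq_bigr => -[].
by rewrite -natr_sum ler_nat [leqRHS](bigD1 i) //= leq_addr.
Qed.

Definition fscal I (t : R) (x : fam I) : fam I := fun i g => t * x i g.

Lemma l2f_scal I t (x : fam I) : l2f x -> l2f (fscal t x).
Proof. by move=> lx i; exact: (l2Z t (lx i)).1. Qed.

Lemma nn_scal I t (x : fam I) : l2f x -> nn (fscal t x) <= t ^+ 2 * nn x.
Proof. by move=> lx; rewrite /nn mulr_sumr; apply: ler_sum => i _; exact: (l2Z t (lx i)).2. Qed.

Lemma app_scal I J (f : I -> J -> ZG) t x : app f (fscal t x) = fscal t (app f x).
Proof.
apply/funext => j; apply/funext => g; rewrite /app /fscal !fct_sumE mulr_sumr.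
apply: eq_bigr => i _; rewrite /ract mulr_sumr; apply: eq_bigr => h _.
by rewrite mulrzAr.
Qed.

Definition finj I J (f : I -> J -> ZG) : Prop := forall x : fam I, l2f x -> app f x = 0 -> x = 0.
Definition approx I J (f : I -> J -> ZG) (y : fam J) : Prop :=
  forall e : R, 0 < e -> exists x, l2f x /\ nn (y - app f x) < e.
Definition fwi I J (f : I -> J -> ZG) : Prop := finj f /\ forall y, l2f y -> approx f y.

(* Pythagoras: [w] is orthogonal to the image of [f], so nothing in that image
   is closer to [w] than [0]. *)
Lemma approx_perp I J (f : I -> J -> ZG) w : l2f w -> approx f w -> app (fadj f) w = 0 -> w = 0.
Proof.
move=> lw aw fw; apply: nn_sub => // e e0; have [x [lx xe]] := aw e e0.
apply: le_lt_trans xe; rewrite nnB//; last exact: l2f_app.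
by rewrite ipfC ipf_app// fw ipfC ipf0l subr0 lerDl nn_ge0.
Qed.

Lemma approx_app I J (f : I -> J -> ZG) x : l2f x -> approx f (app f x).
Proof. by move=> lx e e0; exists x; rewrite subrr nn0. Qed.

(** If the composite kills [x], then [app f x] is in the image of [f] and orthogonal to it. *)
Lemma finj_fadj I J (f : I -> J -> ZG) : finj f -> finj (fmul f (fadj f)).
Proof.
move=> fi x lx; rewrite -app_mul => E; apply: fi => //.
by apply: approx_perp E; [exact: l2f_app|exact: approx_app].
Qed.

Lemma fwi_mul I J K (f : I -> J -> ZG) (g : J -> K -> ZG) : fwi f -> fwi g -> fwi (fmul f g).
Proof.
move=> [fi fd] [gi gd]; split=> [x lx|z lz e e0].
  by rewrite -app_mul => /(gi _ (l2f_app _ lx))/(fi _ lx).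
have [c c0 cP] := app_bound g.
have c0' : 0 < (c%:R : R) by rewrite ltr0n.
have [y [ly ye]] := gd z lz (e / 4) (divr_gt0 e0 (ltr0n _ 4)).
have [x [lx xe]] := fd y ly (e / 4 / c%:R) (divr_gt0 (divr_gt0 e0 (ltr0n _ 4)) c0').
exists x; split => //; rewrite -app_mul.
have -> : z - app g (app f x) = (z - app g y) + app g (y - app f x).
  by rewrite appB addrA subrK.
have l1 : l2f (z - app g y) by apply: l2fB => //; exact: l2f_app.
have l2 : l2f (y - app f x) by apply: l2fB => //; exact: l2f_app.
apply: le_lt_trans (nnD_le l1 (l2f_app _ l2)) _.
have := cP _ l2; move: xe; rewrite ltr_pdivlMr// => xe.
move=> h; have : nn (app g (y - app f x)) < e / 4 by apply: le_lt_trans h _; rewrite mulrC.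
lra.
Qed.

(** Injectivity comes from the composite in which [f] acts first, density from the one in which it
    acts last. *)
Lemma fwi_factors I J K K' (f : I -> J -> ZG) (g : J -> K -> ZG) (g' : K' -> I -> ZG) :
  fwi (fmul f g) -> (forall y, l2f y -> approx (fmul g' f) y) -> fwi f.
Proof.
move=> [fgi _] g'd; split=> [x lx fx|y ly e e0].
  by apply: fgi => //; rewrite -app_mul fx app0.
have [x [lx xe]] := g'd y ly e e0; exists (app g' x); split; first exact: l2f_app.
by rewrite app_mul.
Qed.

End FinL2.

Lemma cauchy_real_cvg (R : realType) (u : nat -> R) :
  (forall e, 0 < e -> exists K, forall k l, (K <= k)%N -> (K <= l)%N -> `|u k - u l| < e) ->
  cvg (u @ \oo).
Proof.
move=> H; apply/cauchy_cvgP/cauchyP => e e0; have [K KP] := H e e0.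
exists (u K); exists K => // k /= Kk; rewrite /ball /=; exact: KP.
Qed.

Lemma real_cvg_sum (R : realType) (T : Type) (r : seq T) (F : T -> nat -> R) (l : T -> R) :
  (forall i, F i k @[k --> \oo] --> l i) ->
  \sum_(i <- r) F i k @[k --> \oo] --> \sum_(i <- r) l i.
Proof.
move=> H; elim: r => [|i r IH].
  by rewrite big_nil; under eq_fun do rewrite big_nil; exact: cvg_cst.
by rewrite big_cons; under eq_fun do rewrite big_cons; exact: cvgD.
Qed.

(** * Convergence of the powers of 1 - S / c *)

Section PowerLimit.
Variables (R : realType) (G : groupType) (I J : finType) (f : I -> J -> group_ring G) (c : nat).
Local Notation fam I := (I -> G -> R).
Hypothesis c_gt0 : (0 < c)%N.
Hypothesis cg : forall x : fam J, l2f x -> nn (app (fadj f) x) <= c%:R * nn x.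
Local Notation S := (fmul f (fadj f)).

Let cR : 0 < (c%:R : R). Proof. by rewrite ltr0n. Qed.

(** [S] is self-adjoint and lies between 0 and [c], so the powers of [1 - S / c] converge strongly
    to the projection onto the kernel of [S], which is zero for injective [f]. Iterating [c - S]
    instead keeps the operator over the group ring; the division by [c ^ k] comes afterwards. *)
Definition pstep (x : fam I) : fam I := x *+ c - app S x.

Lemma pstep_l2 x : l2f x -> l2f (pstep x).
Proof. by move=> lx; apply: l2fB; [exact: l2fMn|exact: l2f_app]. Qed.

Lemma ipf_S (x z : fam I) : l2f x -> l2f z -> ipf (app S x) z = ipf (app f x) (app f z).
Proof.
move=> lx lz; rewrite -app_mul ipf_app//; last exact: l2f_app.
congr (ipf _ (app _ z)); apply/funext => i; apply/funext => j; exact: ginvK.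
Qed.

Lemma ipf_pstep x z : l2f x -> l2f z -> ipf (pstep x) z = ipf x (pstep z).
Proof.
move=> lx lz; have lSx := l2f_app S lx; have lSz := l2f_app S lz.
rewrite /pstep ipfBl//; last exact: l2fMn.
rewrite [RHS]ipfC ipfBl//; last exact: l2fMn.
by rewrite !ipfMnl// (ipfC z x) !ipf_S// (ipfC (app f z)).
Qed.

Lemma app_pstep x : app S (pstep x) = pstep (app S x).
Proof. by rewrite /pstep appB appMn. Qed.

Variable y : fam I.
Hypothesis ly : l2f y.
Local Notation it k := (iter k pstep y).

Lemma it_l2 k : l2f (it k).
Proof. by elim: k => //= k IH; exact: pstep_l2. Qed.

(** The moments of [c - S] at [y]: by self-adjointness the inner product of two iterates depends
    only on the sum of the exponents, as [ipf_it] shows. *)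
Definition dd k : R := ipf (it k) y.
Definition aa k : R := dd k / c%:R ^+ k.

Lemma ipf_it k l : ipf (it k) (it l) = dd (k + l).
Proof.
elim: l k => [|l IH] k; first by rewrite addn0.
by rewrite /= -ipf_pstep; [rewrite -iterS IH addSnnS|exact: it_l2..].
Qed.

Lemma ipf_S_it k l : ipf (app S (it k)) (it l) = ipf (app S (it (k + l))) y.
Proof.
elim: l k => [|l IH] k; first by rewrite addn0.
rewrite /= -ipf_pstep; [|apply: l2f_app; exact: it_l2|exact: it_l2].
by rewrite -app_pstep -iterS IH addSnnS.
Qed.

Lemma ddS k : dd k.+1 = c%:R * dd k - ipf (app S (it k)) y.
Proof.
rewrite /dd iterS {1}/pstep ipfBl ?ipfMnl//; first exact: it_l2.
  by apply: l2fMn; exact: it_l2.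
by apply: l2f_app; exact: it_l2.
Qed.

(** Half of the power is moved to the other side. With [u] the iterate of order [k./2], an even [k]
    leaves the norm of [f u]; an odd one leaves [c] times it minus the norm of [S u], which is
    non-negative by [cg]. *)
Lemma S_it_ge0 k : 0 <= ipf (app S (it k)) y.
Proof.
have lu := it_l2 k./2; set u := it k./2 in lu.
have lfu : l2f (app f u) by exact: l2f_app.
rewrite -[k]odd_double_half -addnn; case: (odd k); last first.
  by rewrite add0n -ipf_S_it ipf_S// ipfxx// mulr_ge0// nn_ge0.
have -> : (true + (k./2 + k./2) = k./2.+1 + k./2)%N by rewrite addSn.
rewrite -ipf_S_it iterS -/u app_pstep /pstep.
have lSu : l2f (app S u) by exact: l2f_app.
rewrite ipfBl// ?ipfMnl//; [|exact: l2fMn|exact: l2f_app].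
rewrite (ipf_S lSu lu) -(ipfC (app f u)) -(ipf_S lu lSu) (ipf_S lu lu) !ipfxx//.
by have := cg lfu; rewrite app_mul; lra.
Qed.

Lemma aa_decr k : aa k.+1 <= aa k.
Proof.
rewrite /aa exprS invfM mulrA ler_wpM2r ?invr_ge0 ?exprn_ge0//.
rewrite ler_pdivrMr// ddS mulrC; have := S_it_ge0 k; lra.
Qed.

Lemma aa_le k l : (k <= l)%N -> aa l <= aa k.
Proof.
move=> kl; rewrite -(subnK kl); elim: (l - k)%N => // n IH.
by rewrite addSn; apply: le_trans (aa_decr _) IH.
Qed.

Lemma dd_double k : dd (k + k) = 2 * nn (it k).
Proof. by rewrite -ipf_it ipfxx//; exact: it_l2. Qed.

Lemma aa_ge0 k : 0 <= aa k.
Proof.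
apply: le_trans (aa_le (leq_addr k k)); rewrite /aa divr_ge0 ?exprn_ge0//.
by rewrite dd_double mulr_ge0// nn_ge0.
Qed.

Lemma aa_inf e : 0 < e -> exists m K, forall k, (K <= k)%N -> m <= aa k < m + e.
Proof.
move=> e0; pose A := range aa; have hA : has_inf A.
  by split; [exists (aa 0); exists 0%N|exists 0 => _ [k _ <-]; exact: aa_ge0].
have [_ [K _ <-] KP] := inf_adherent e0 hA.
exists (inf A), K => k Kk; rewrite (le_lt_trans (aa_le Kk) KP) andbT.
by apply: ge_inf; [exact: hA.2|exists k].
Qed.

(* [FF k] is [(1 - S / c)^k y]; it converges to a vector of the kernel of [S]. *)
Definition FF k : fam I := fscal (c%:R ^- k) (it k).

Lemma FF_l2 k : l2f (FF k).
Proof. by apply: l2f_scal; exact: it_l2. Qed.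

(** Expanding the square leaves moments only. As [aa] decreases to a limit, the right-hand side
    tends to 0. *)
Lemma nn_FFB k l : nn (FF k - FF l) <= 2^-1 * aa (k + k) + 2^-1 * aa (l + l) - aa (k + l).
Proof.
have E : FF k - FF l = fscal (c%:R ^- (k + l)) (it k *+ c ^ l - it l *+ c ^ k).
  apply/funext => i; apply/funext => g; rewrite -[LHS]/(FF k i g - FF l i g) /FF /fscal.
  rewrite -[(_ - _) i g]/((it k *+ c ^ l) i g - (it l *+ c ^ k) i g).
  have mE (x : fam I) n : (x *+ n) i g = n%:R * x i g.
    elim: n => [|n IH]; first by rewrite mulr0n mul0r.
    by rewrite mulrS -[LHS]/(x i g + (x *+ n) i g) IH -natr1 mulrDl mul1r addrC.
  rewrite !mE !natrX exprD; have c1 : c%:R ^+ k != 0 :> R by rewrite expf_neq0// gt_eqF.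
  have c2 : c%:R ^+ l != 0 :> R by rewrite expf_neq0// gt_eqF.
  by field; rewrite ?c1 ?c2.
rewrite E; have lk := it_l2 k; have ll := it_l2 l.
have lu := l2fMn (c ^ l) lk; have lv := l2fMn (c ^ k) ll.
apply: le_trans (nn_scal _ (l2fB lu lv)) _.
have h (x : fam I) n : l2f x -> nn (x *+ n) = n%:R ^+ 2 * nn x.
  move=> lx; have := ipfxx (l2fMn n lx); rewrite ipfMnl//; last exact: l2fMn.
  by rewrite ipfC ipfMnl// ipfxx//; lra.
rewrite nnB// !h// ipfMnl// ipfC ipfMnl// ipf_it [(l + k)%N]addnC /aa !dd_double !natrX !exprD.
set C1 := c%:R ^+ k; set C2 := c%:R ^+ l.
have c1 : C1 != 0 by rewrite expf_neq0// gt_eqF.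
have c2 : C2 != 0 by rewrite expf_neq0// gt_eqF.
by rewrite le_eqVlt; apply/orP; left; apply/eqP; field; rewrite ?c1 ?c2.
Qed.

Lemma FF_cauchy e : 0 < e -> exists K, forall k l, (K <= k)%N -> (K <= l)%N -> nn (FF k - FF l) < e.
Proof.
move=> e0; have [m [K KP]] := aa_inf e0; exists K => k l Kk Kl.
apply: le_lt_trans (nn_FFB k l) _.
have /andP[_ h1] := KP (k + k)%N (leq_trans Kk (leq_addr _ _)).
have /andP[_ h2] := KP (l + l)%N (leq_trans Kl (leq_addr _ _)).
have /andP[h3 _] := KP (k + l)%N (leq_trans Kk (leq_addr _ _)).
lra.
Qed.

Lemma FF_pt_cvg i g : cvg (FF k i g @[k --> \oo]).
Proof.
apply: cauchy_real_cvg => e e0; have [K KP] := FF_cauchy (exprn_gt0 2 e0).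
exists K => k l Kk Kl; rewrite -(ltr_pXn2r (n := 2)) ?nnegrE ?normr_ge0 ?(ltW e0)//.
rewrite real_normK ?num_real//; apply: le_lt_trans (KP k l Kk Kl).
exact: (nn_pt i g (l2fB (FF_l2 k) (FF_l2 l))).
Qed.

Definition FL : fam I := fun i g => lim (FF k i g @[k --> \oo]).

Lemma app_FF_cvg i g : app S (FF k) i g @[k --> \oo] --> app S FL i g.
Proof.
rewrite /app fct_sumE; under eq_fun do rewrite fct_sumE.
apply: real_cvg_sum => j; apply: real_cvg_sum => h.
have mz (z : int) (a : R) : a *~ z = a * z%:~R by rewrite mulrzr.
under eq_fun do rewrite mz; rewrite mz.
by apply: cvgM; [exact: FF_pt_cvg|exact: cvg_cst].
Qed.

Lemma FF_S k i g : FF k.+1 i g = FF k i g - c%:R^-1 * app S (FF k) i g.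
Proof.
rewrite /FF app_scal /fscal iterS /pstep.
rewrite -[(_ - _) i g]/((it k *+ c) i g - app S (it k) i g).
have -> : (it k *+ c) i g = c%:R * it k i g.
  elim: (c) => [|n IH]; first by rewrite mulr0n mul0r.
  by rewrite mulrS -[LHS]/(it k i g + (it k *+ n) i g) IH -natr1 mulrDl mul1r addrC.
have c1 : c%:R ^+ k != 0 :> R by rewrite expf_neq0// gt_eqF.
by rewrite exprS; field; rewrite c1 gt_eqF.
Qed.

(** The limit is pointwise, and at a point [S] is a finite sum of translates. Passing to the limit
    in [FF_S] gives [FL = FL - S FL / c]. *)
Lemma app_FL : app S FL = 0.
Proof.
apply/funext => i; apply/funext => g; rewrite -[RHS]/(0 : R).
have h1 : FF k.+1 i g @[k --> \oo] --> FL i g.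
  have := (@FF_pt_cvg i g); rewrite -(cvg_shiftS (fun k => FF k i g)); exact.
have h2 : FF k.+1 i g @[k --> \oo] --> FL i g - c%:R^-1 * app S FL i g.
  under eq_fun do rewrite FF_S; apply: cvgB; first exact: FF_pt_cvg.
  by apply: cvgM; [exact: cvg_cst|exact: app_FF_cvg].
have E : FL i g = FL i g - c%:R^-1 * app S FL i g by exact: (cvg_unique _ h1 h2).
have : c%:R^-1 * app S FL i g = 0.
  by move: E; move: (c%:R^-1 * app S FL i g) (FL i g) => b a E; lra.
by move=> /eqP; rewrite mulf_eq0 invr_eq0 gt_eqF//= => /eqP.
Qed.

(** Fatou's lemma in finite form: bounds on finite partial sums survive pointwise limits, which
    spares the completeness of the Hilbert space. *)
Lemma sum_sqr_cvg_le (s : seq G) (v : nat -> G -> R) (w : G -> R) M K :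
  (forall g, v k g @[k --> \oo] --> w g) ->
  (forall k, (K <= k)%N -> \sum_(g <- s) v k g ^+ 2 <= M) -> \sum_(g <- s) w g ^+ 2 <= M.
Proof.
move=> vw h; have c1 : \sum_(g <- s) v k g ^+ 2 @[k --> \oo] --> \sum_(g <- s) w g ^+ 2.
  apply: real_cvg_sum => g; under eq_fun do rewrite expr2; rewrite expr2.
  by apply: cvgM; exact: vw.
by apply: (cvgr_to_le c1); exists K.
Qed.

Lemma nn_FF_le k : nn (FF k) <= aa 0.
Proof.
apply: le_trans (nn_scal _ (it_l2 k)) _; apply: le_trans (aa_le (leq0n (k + k))).
rewrite /aa dd_double exprD; set C := c%:R ^+ k.
have C0 : 0 < C by rewrite exprn_gt0.
have n0 := nn_ge0 (it k); have -> : 2 * nn (it k) / (C * C) = 2 * (C^-1 ^+ 2 * nn (it k)).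
  by field; rewrite gt_eqF.
have : 0 <= C^-1 ^+ 2 * nn (it k) by rewrite mulr_ge0// sqr_ge0.
lra.
Qed.

Lemma FL_l2 : l2f FL.
Proof.
move=> i; apply: (@l2_le R G _ (aa 0) _).1 => s us.
apply: (@sum_sqr_cvg_le s (fun k => FF k i) _ _ 0) => [g|k _]; first exact: FF_pt_cvg.
apply: le_trans (sum_le_n1 (FF_l2 k i) us) _; apply: le_trans (n1_le_nn _ i) _.
exact: nn_FF_le.
Qed.

Hypothesis fi : finj R f.

Lemma FL_eq0 : FL = 0.
Proof. by apply: (finj_fadj fi FL_l2); exact: app_FL. Qed.

(** The limit vanishes by injectivity, and sending one index of the Cauchy estimate to infinity
    bounds the norm itself. Each coordinate contributes at most [d], and [#|I|] times [d] is below
    [e]. *)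
Theorem FF_to0 e : 0 < e -> exists K, forall k, (K <= k)%N -> nn (FF k) < e.
Proof.
move=> e0; pose d := e / (#|I|%:R + 1); have d0 : 0 < d by rewrite divr_gt0// ltr_wpDl.
have [K KP] := FF_cauchy d0; exists K => k Kk.
apply: (@le_lt_trans _ _ (\sum_(i : I) d)); last first.
  rewrite sumr_const -mulr_natl /d mulrCA -ltr_pdivlMl// mulVf ?gt_eqF//.
  by rewrite ltr_pdivrMr ?mul1r ?ltrDl// ltr_wpDl.
apply: ler_sum => i _; apply: (@l2_le R G _ d _).2 => s us.
apply: (@sum_sqr_cvg_le s (fun l g => FF k i g - FF l i g) _ _ K) => [g|l Kl].
  rewrite -[X in _ --> X]subr0; apply: cvgB; first exact: cvg_cst.
  by have := (@FF_pt_cvg i g); rewrite /= -/(FL i g) FL_eq0.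
apply: le_trans (ltW (KP k l Kk Kl)); apply: le_trans (n1_le_nn _ i).
exact: (sum_le_n1 (l2fB (FF_l2 k) (FF_l2 l) i) us).
Qed.

(** [S] divides the difference of the [k]-th powers of [c] and [c - S]; so [y - FF k] lies in the
    image of [S]. *)
Lemma it_mod_S k : exists2 z, l2f z & y *+ c ^ k - it k = app S z.
Proof.
elim: k => [|k [z lz E]]; first by exists 0; [exact: l2f0|rewrite expn0 mulr1n subrr app0].
exists (z *+ c + it k); first by apply: l2fD; [exact: l2fMn|exact: it_l2].
rewrite appD appMn -E iterS /pstep mulrnBl -mulrnA -expnSr opprB addrA.
exact: addrAC.
Qed.

Theorem approx_S : approx S y.
Proof.
move=> e e0; have [K /(_ K (leqnn K)) h] := FF_to0 e0.
have [z lz E] := it_mod_S K; exists (fscal (c%:R ^- K) z); split; first exact: l2f_scal.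
rewrite app_scal -E; suff -> : y - fscal (c%:R ^- K) (y *+ c ^ K - it K) = FF K by [].
apply/funext => i; apply/funext => g; rewrite /FF /fscal.
rewrite -[LHS]/(y i g - c%:R ^- K * ((y *+ c ^ K) i g - it K i g)).
have -> : (y *+ c ^ K) i g = c%:R ^+ K * y i g.
  rewrite -natrX; elim: (c ^ K)%N => [|n IH]; first by rewrite mulr0n mul0r.
  by rewrite mulrS -[LHS]/(y i g + (y *+ n) i g) IH -natr1 mulrDl mul1r addrC.
by field; rewrite expf_neq0// gt_eqF.
Qed.

(** The form needed for traces: at a basis vector the moment is twice a diagonal coefficient of a
    matrix power. *)
Lemma aa_to0 e : 0 < e -> exists K, forall k, (K <= k)%N -> aa (k + k) < e.
Proof.
move=> e0; have [K KP] := FF_to0 (divr_gt0 e0 (ltr0n _ 2)); exists K => k Kk.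
have := KP k Kk; have C0 : 0 < c%:R ^+ k :> R by rewrite exprn_gt0.
have E : it k = fscal (c%:R ^+ k) (FF k).
  by apply/funext => i; apply/funext => g; rewrite /FF /fscal mulrA mulfV ?mul1r// gt_eqF.
have := nn_scal (c%:R ^+ k) (FF_l2 k); rewrite -E => h h'.
rewrite /aa dd_double exprD ltr_pdivrMr ?mulr_gt0//.
move: C0 h h'; set C := c%:R ^+ k; set u := nn (it k); set w := nn (FF k) => C0 h h'.
by have : C ^+ 2 * w < C ^+ 2 * (e / 2); [rewrite ltr_pM2l// exprn_gt0|rewrite expr2 in h *; nra].
Qed.

End PowerLimit.

Corollary fwi_fadj (R : realType) (G : groupType) (I J : finType) (f : I -> J -> group_ring G) :
  finj R f -> fwi R (fmul f (fadj f)).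
Proof.
move=> fi; split; first exact: finj_fadj.
have [c c0 cP] := app_bound R (fadj f).
by move=> y ly; apply: (@approx_S R G I J f c).
Qed.

(** * Traces and the equality of ranks *)

Section Trace.
Variables (R : realType) (G : groupType).
Local Notation ZG := (group_ring G).

Lemma coeff1_mulC (a b : ZG) : coeff 1%g (a * b) = coeff 1%g (b * a).
Proof.
move: b; apply: gr_ind => [b d|h]; first by rewrite mulrBr mulrBl !coeffB => -> ->.
move: a; apply: gr_ind => [a d|k]; first by rewrite mulrBr mulrBl !coeffB => -> ->.
rewrite -[gr k * gr h]/(gr_mul _ _) -[gr h * gr k]/(gr_mul _ _) !gr_mulg !coeffU; congr (_ * (nat_of_bool _)%:R).
by apply/eqP/eqP => /(canRL (mulgK _)); rewrite mul1g => ->; rewrite ?mulgV ?mulVg.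
Qed.

(** The Kaplansky trace. On matrices over the integral group ring its values are integers. *)
Definition ftr n (M : 'M[ZG]_n) : int := \sum_i coeff 1%g (M i i).

Lemma ftr_mulC m n (A : 'M[ZG]_(m, n)) (B : 'M[ZG]_(n, m)) : ftr (A *m B) = ftr (B *m A).
Proof.
rewrite /ftr; under eq_bigr do rewrite mxE raddf_sum; rewrite exchange_big.
apply: eq_bigr => j _; rewrite mxE raddf_sum; apply: eq_bigr => i _; exact: coeff1_mulC.
Qed.

Lemma ftrB n (A B : 'M[ZG]_n) : ftr (A - B) = ftr A - ftr B.
Proof. by rewrite /ftr -sumrB; apply: eq_bigr => i _; rewrite !mxE coeffB. Qed.

Lemma ftrMn n (A : 'M[ZG]_n) c : ftr (A *+ c) = ftr A *+ c.
Proof.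
elim: c => [|c IH]; first by rewrite !mulr0n /ftr big1// => i _; rewrite mxE coeff0.
by rewrite !mulrS -IH /ftr -big_split; apply: eq_bigr => i _; rewrite mxE coeffD.
Qed.

Lemma mulmx_mn m n (Q : 'M[ZG]_(m, n)) c : Q *m (1%:M *+ c) = Q *+ c.
Proof.
elim: c => [|c IH]; first by rewrite !mulr0n mulmx0.
by rewrite !mulrS mulmxDr mulmx1 IH.
Qed.
Lemma mulmx_nm m n (Q : 'M[ZG]_(m, n)) c : (1%:M *+ c) *m Q = Q *+ c.
Proof.
elim: c => [|c IH]; first by rewrite !mulr0n mul0mx.
by rewrite !mulrS mulmxDl mul1mx IH.
Qed.

Variables (m n : nat) (A : 'M[ZG]_(m, n)) (B : 'M[ZG]_(n, m)) (c : nat).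

Fixpoint mpow p (P : 'M[ZG]_p) k : 'M[ZG]_p := if k is k'.+1 then mpow P k' *m P else 1%:M.
Local Notation P1 := (1%:M *+ c - A *m B).
Local Notation P2 := (1%:M *+ c - B *m A).

Lemma mpow_comm k : mpow P1 k *m A = A *m mpow P2 k.
Proof.
elim: k => [|k IH] /=; first by rewrite mul1mx mulmx1.
have E : P1 *m A = A *m P2.
  by rewrite mulmxBl mulmxBr mulmxA mulmx_mn mulmx_nm.
by rewrite -mulmxA E mulmxA IH mulmxA.
Qed.

(** Corresponding powers of [A *m B] and [B *m A] have equal traces, so only the constant terms
    [c ^ k] of the two expansions contribute. *)
Lemma ftr_mpow k : ftr (mpow P1 k) - ftr (mpow P2 k) = (c%:R ^+ k) * (m%:R - n%:R).
Proof.
elim: k => [|k IH] /=.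
  have tr1 p : ftr (1%:M : 'M[ZG]_p) = p%:R.
    rewrite /ftr (eq_bigr (fun=> 1)) ?sumr_const ?card_ord// => i _.
    by rewrite mxE eqxx coeffU eqxx mulr1.
  by rewrite !tr1 expr0 mul1r.
rewrite !mulmxBr !ftrB !mulmx_mn !ftrMn exprS -mulrA -IH.
have -> : ftr (mpow P1 k *m (A *m B)) = ftr (mpow P2 k *m (B *m A)).
  by rewrite mulmxA mpow_comm -mulmxA ftr_mulC -mulmxA.
by rewrite -mulr_natl -[X in _ - (X - _)]mulr_natl; ring.
Qed.

End Trace.

Section Unit.
Variables (R : realType) (G : groupType).
Local Notation ZG := (group_ring G).

Definition delta1 : G -> R := fun g => (g == 1%g)%:R.

Lemma ract_delta1 (a : ZG) g : ract delta1 a g = (coeff g a)%:~R.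
Proof.
move: a; apply: gr_ind => [a b ha hb|h].
  by rewrite ractB -[LHS]/(ract delta1 a g - ract delta1 b g) ha hb coeffB intrB.
rewrite ract_gr /delta1 coeffU mul1r; case: eqVneq => [E|E]; case: eqVneq => [E'|E'] //.
  by case/eqP: E'; rewrite -[h]mul1g -E mulgVK.
by case/eqP: E; rewrite E' mulgV.
Qed.

Lemma n1_delta1 t : l2 (fun g => t * delta1 g) /\ n1 (fun g => t * delta1 g) = t ^+ 2.
Proof.
have [ld le] : l2 (fun g => t * delta1 g) /\ n1 (fun g => t * delta1 g) <= t ^+ 2.
  apply: l2_le => s us; have z g : g != 1%g -> (t * delta1 g) ^+ 2 = 0.
    by move=> /negbTE g1; rewrite /delta1 g1 mulr0 expr0n.
  have [h|h] := boolP (1%g \in s).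
    rewrite (bigD1_seq 1%g) //= big1 => [|g g1]; last exact: z.
    by rewrite /delta1 eqxx mulr1 addr0.
  rewrite big1_seq ?sqr_ge0// => g /= gs; apply: z.
  by apply: contraNneq h => <-.
split => //; apply/eqP; rewrite eq_le le /=.
by have := pt_le_n1 1%g ld; rewrite /delta1 eqxx mulr1.
Qed.

Lemma l2_delta1 : l2 delta1.
Proof. by have := (n1_delta1 1).1; under eq_fun do rewrite mul1r. Qed.

Lemma ip_delta1 v : l2 v -> ip v delta1 = 2 * v 1%g.
Proof.
move=> lv; have [l1 e1] := n1_delta1 (v 1%g); have [l2' e2] := n1_delta1 (v 1%g + 1).
have ld := l2_delta1; have n1d : n1 delta1 = 1.
  by have := (n1_delta1 1).2; under eq_fun do rewrite mul1r; rewrite expr1n.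
(* Exchanging the values at 1 between [v] and a multiple of [delta1] relates four norms pointwise;
   this avoids splitting the sum over the group. *)
have E : (N1 (v + delta1)%R + N1 (fun g => (v 1%g * delta1 g)%R) = N1 v + N1 (fun g => ((v 1%g + 1) * delta1 g)%R))%E.
  apply: N1_add => g; rewrite -[(v + delta1) g]/(v g + delta1 g) /delta1.
  by case: eqVneq => [->|_] /=; ring.
move: E; rewrite (l2E (l2D lv ld)) (l2E lv) (l2E l1) (l2E l2') -!EFinD => -[].
by rewrite e1 e2 /ip n1d; lra.
Qed.

Definition evec m (i : 'I_m) : 'I_m -> G -> R := fun i' => if i' == i then delta1 else 0.

Lemma l2f_evec m (i : 'I_m) : l2f (evec i).
Proof. by move=> i'; rewrite /evec; case: ifP => _; [exact: l2_delta1|exact: l20]. Qed.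

Lemma ipf_evec m (x : 'I_m -> G -> R) i : l2f x -> ipf x (evec i) = 2 * x i 1%g.
Proof.
move=> lx; rewrite /ipf (bigD1 i) //= big1 => [|i' /negbTE ni]; last by rewrite /evec ni ipC ip0l.
by rewrite /evec eqxx ip_delta1// addr0.
Qed.

Lemma app_evec m n (M : 'M[ZG]_(m, n)) i j : app M (evec i) j = ract delta1 (M i j).
Proof.
rewrite /app (bigD1 i) //= big1 => [|i' /negbTE ni]; last first.
  by rewrite /evec ni; exact: (raddf0 (ract_by (M i' j))).
by rewrite /evec eqxx addr0.
Qed.

Lemma app_mulmx m n p (M : 'M[ZG]_(m, n)) (N : 'M[ZG]_(n, p)) (x : 'I_m -> G -> R) :
  app (M *m N) x = app N (app M x).
Proof.
rewrite app_mul; congr app; apply/funext => i; apply/funext => j.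
by rewrite /fmul mxE.
Qed.

Lemma app1mx m (x : 'I_m -> G -> R) : app (1%:M : 'M[ZG]_m) x = x.
Proof.
apply/funext => j; rewrite /app (bigD1 j) //= big1 => [|i /negbTE ni]; last by rewrite mxE ni ract0.
by rewrite mxE eqxx ract1 addr0.
Qed.

Lemma app_mxB m n (M N : 'M[ZG]_(m, n)) (x : 'I_m -> G -> R) : app (M - N) x = app M x - app N x.
Proof.
apply/funext => j; rewrite -[RHS]/(app M x j - app N x j) /app -sumrB.
by apply: eq_bigr => i _; rewrite !mxE ractB.
Qed.

Lemma app_mx1Mn m c (x : 'I_m -> G -> R) : app ((1%:M : 'M[ZG]_m) *+ c) x = x *+ c.
Proof.
elim: c => [|c IH].
  by rewrite !mulr0n; apply/funext => j; rewrite /app big1// => i _; rewrite mxE ract0.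
rewrite !mulrS -IH -[X in _ = X + _](app1mx x); apply/funext => j.
rewrite -[RHS]/(app _ x j + app _ x j) /app -big_split /=.
by apply: eq_bigr => i _; rewrite mxE ractD.
Qed.

Definition mxadj m n (A : 'M[ZG]_(m, n)) : 'M[ZG]_(n, m) := \matrix_(j, i) ginv (A i j).

Lemma mxadjK m n (A : 'M[ZG]_(m, n)) : mxadj (mxadj A) = A.
Proof. by apply/matrixP => i j; rewrite !mxE ginvK. Qed.

Lemma fadj_mx m n (A : 'M[ZG]_(m, n)) : fadj A = mxadj A :> ('I_n -> 'I_m -> ZG).
Proof. by apply/funext => j; apply/funext => i; rewrite mxE. Qed.

(** The diagonal entries of the power are moments at the vectors [evec i], to which [aa_to0]
    applies. *)
Lemma trace_to0 m n (A : 'M[ZG]_(m, n)) c : (0 < c)%N -> finj R A ->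
  (forall x : 'I_n -> G -> R, l2f x -> nn (app (mxadj A) x) <= c%:R * nn x) ->
  forall e : R, 0 < e -> exists K, forall k, (K <= k)%N ->
  0 <= (ftr (mpow (1%:M *+ c - A *m mxadj A) (k + k)))%:~R / (c%:R : R) ^+ (k + k) < m%:R * e + e.
Proof.
move=> c0 Ai cg e e0; set P := 1%:M *+ c - _.
have cg' : forall x : 'I_n -> G -> R, l2f x -> nn (app (fadj A) x) <= c%:R * nn x by rewrite fadj_mx.
have stepE (x : 'I_m -> G -> R) : pstep A c x = app P x.
  by rewrite /pstep /P app_mxB app_mx1Mn fadj_mx -app_mul app_mulmx.
have itE i k : iter k (pstep A c) (evec i) = app (mpow P k) (evec i).
  by elim: k => [|k IH]; rewrite ?app1mx//= app_mulmx -IH stepE.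
have ddE i k : dd A c (evec i) k = 2 * (coeff 1%g (mpow P k i i))%:~R.
  rewrite /dd itE ipf_evec; last by apply: l2f_app; exact: l2f_evec.
  by rewrite app_evec ract_delta1.
have cR : 0 < (c%:R : R) by rewrite ltr0n.
have sumE k : (ftr (mpow P k))%:~R / c%:R ^+ k = \sum_i 2^-1 * aa A c (evec i) k.
  rewrite /ftr rmorph_sum mulr_suml; apply: eq_bigr => i _.
  by rewrite /aa ddE mulrA; congr (_ / _); field.
have /choice[K KP] : forall i : 'I_m, exists K, forall k, (K <= k)%N -> aa A c (evec i) (k + k) < e.
  by move=> i; exact: (aa_to0 c0 cg' (l2f_evec i) Ai e0).
exists (\max_i K i)%N => k Kk; rewrite sumE; apply/andP; split.
  apply: sumr_ge0 => i _; rewrite mulr_ge0 ?invr_ge0//; exact: (aa_ge0 c0 cg' (l2f_evec i)).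
apply: (@le_lt_trans _ _ (\sum_(i < m) e)); last by rewrite sumr_const card_ord -[e *+ m]mulr_natl ltrDl.
apply: ler_sum => i _; have := KP i k (leq_trans (leq_bigmax i) Kk).
have := aa_ge0 c0 cg' (l2f_evec i) (k + k); lra.
Qed.

(* The traces of [(1 - A A^* / c)^k] and [(1 - A^* A / c)^k] tend to 0, while they
   differ by [m - n], by [ftr_mpow]. *)
Theorem size_eq m n (A : 'M[ZG]_(m, n)) : finj R A -> finj R (mxadj A) -> m = n.
Proof.
move=> Ai Ai'; have [c1 c10 c1P] := app_bound R A; have [c2 c20 c2P] := app_bound R (mxadj A).
pose c := (c1 + c2)%N; have c0 : (0 < c)%N by rewrite addn_gt0 c10.
have cR : 0 < (c%:R : R) by rewrite ltr0n.
have h1 (x : 'I_m -> G -> R) : l2f x -> nn (app A x) <= c%:R * nn x.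
  by move=> lx; apply: le_trans (c1P x lx) _; rewrite ler_wpM2r ?nn_ge0// ler_nat leq_addr.
have h2 (x : 'I_n -> G -> R) : l2f x -> nn (app (mxadj A) x) <= c%:R * nn x.
  by move=> lx; apply: le_trans (c2P x lx) _; rewrite ler_wpM2r ?nn_ge0// ler_nat leq_addl.
(* With error [1 / d] the normalized traces lie in intervals from 0 whose lengths add up to 1, so
   the integer [m - n] has absolute value less than 1. *)
pose d : R := (m + n + 2)%:R; have d0 : 0 < d by rewrite ltr0n addn2.
have dE : d = m%:R + n%:R + 2 by rewrite /d !natrD.
have dm : 0 <= (m%:R : R) by []. have dn : 0 <= (n%:R : R) by [].
have [K1 K1P] := trace_to0 c0 Ai h2 (divr_gt0 ltr01 d0).
have h1' (x : 'I_m -> G -> R) : l2f x -> nn (app (mxadj (mxadj A)) x) <= c%:R * nn x by rewrite mxadjK; exact: h1.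
have [K2 K2P] := trace_to0 c0 Ai' h1' (divr_gt0 ltr01 d0).
pose k := (K1 + K2)%N; have := K1P k (leq_addr _ _); have := K2P k (leq_addl _ _).
rewrite mxadjK; have := ftr_mpow A (mxadj A) c (k + k).
set t1 := ftr _; set t2 := ftr _ => E.
have C0 : 0 < (c%:R : R) ^+ (k + k) by rewrite exprn_gt0.
have : t1%:~R / c%:R ^+ (k + k) - t2%:~R / c%:R ^+ (k + k) = m%:R - n%:R :> R.
  rewrite -mulrBl -intrB E rmorphM rmorphXn rmorphB /= !mulrz_nat mulrAC mulfV ?mul1r// gt_eqF//.
set a := _ / _; set b := _ / _ => ab /andP[b0 b1] /andP[a0 a1].
have md : m%:R * (1 / d) + 1 / d + (n%:R * (1 / d) + 1 / d) = 1 by rewrite dE; field; rewrite -dE gt_eqF.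
have : `|m%:R - n%:R| < (1 : R) by rewrite -ab ltr_norml; apply/andP; split; lra.
rewrite -[m%:R]/(m%:Z%:~R) -[n%:R]/(n%:Z%:~R) -intrB -intr_norm -[1]/(1%:~R) ltr_int.
by lia.
Qed.

End Unit.

(** * Integral matrices act separately on real and imaginary parts *)

Section ComplexReal.
Variables (R : realType) (G : groupType).
Local Notation ZG := (group_ring G).
Local Notation C := R[i].

Definition reF m (X : G -> 'rV[C]_m) : 'I_m -> G -> R := fun i g => complex.Re (X g ord0 i).
Definition imF m (X : G -> 'rV[C]_m) : 'I_m -> G -> R := fun i g => complex.Im (X g ord0 i).
Definition cpx m (x y : 'I_m -> G -> R) : G -> 'rV[C]_m := fun g => \row_i Complex (x i g) (y i g).

Lemma reF_cpx m (x y : 'I_m -> G -> R) : reF (cpx x y) = x.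
Proof. by apply/funext => i; apply/funext => g; rewrite /reF mxE. Qed.
Lemma imF_cpx m (x y : 'I_m -> G -> R) : imF (cpx x y) = y.
Proof. by apply/funext => i; apply/funext => g; rewrite /imF mxE. Qed.

Lemma cpxP m (X Y : G -> 'rV[C]_m) : reF X = reF Y -> imF X = imF Y -> X = Y.
Proof.
move=> h1 h2; apply/funext => g; apply/rowP => i.
have e1 := congr1 (fun f => f i g) h1; have e2 := congr1 (fun f => f i g) h2.
by move: e1 e2; rewrite /reF /imF; case: (X g ord0 i) => a b; case: (Y g ord0 i) => a' b' /= -> ->.
Qed.

Lemma Re_zmod : zmod_morphism (@complex.Re R).
Proof. by case=> a b [a' b']. Qed.
Lemma Im_zmod : zmod_morphism (@complex.Im R).
Proof. by case=> a b [a' b']. Qed.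
Definition re_part (z : C) : R := complex.Re z.
Definition im_part (z : C) : R := complex.Im z.
HB.instance Definition _ := GRing.isZmodMorphism.Build C R re_part Re_zmod.
HB.instance Definition _ := GRing.isZmodMorphism.Build C R im_part Im_zmod.

Lemma reF_Lambda m n (A : 'M[ZG]_(m, n)) X : reF (Lambda A X) = app A (reF X).
Proof.
apply/funext => j; apply/funext => g; rewrite /reF /Lambda mxE -[LHS]/(re_part _) raddf_sum /app fct_sumE.
by apply: eq_bigr => i _; rewrite -[LHS]/(re_part (ract (fun g => X g ord0 i) (A i j) g)) ract_raddf.
Qed.
Lemma imF_Lambda m n (A : 'M[ZG]_(m, n)) X : imF (Lambda A X) = app A (imF X).
Proof.
apply/funext => j; apply/funext => g; rewrite /imF /Lambda mxE -[LHS]/(im_part _) raddf_sum /app fct_sumE.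
by apply: eq_bigr => i _; rewrite -[LHS]/(im_part (ract (fun g => X g ord0 i) (A i j) g)) ract_raddf.
Qed.

Lemma l2_norm2E m (X : G -> 'rV[C]_m) :
  l2_norm2 X = (\sum_i (N1 (reF X i) + N1 (imF X i)))%E.
Proof.
rewrite /l2_norm2 (eq_bigr (fun i => \esum_(g in [set: G]) ((reF X i g ^+ 2)%:E + (imF X i g ^+ 2)%:E)%E)); last first.
  by move=> i _; rewrite esumD// => g _; rewrite lee_fin sqr_ge0.
rewrite -esum_sum => [|g i _ _]; last by rewrite -EFinD lee_fin addr_ge0// sqr_ge0.
by apply: eq_esum => g _; rewrite -sumEFin; apply: eq_bigr => i _; rewrite EFinD.
Qed.

Lemma in_l2P m (X : G -> 'rV[C]_m) : in_l2 X <-> l2f (reF X) /\ l2f (imF X).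
Proof.
rewrite /in_l2 l2_norm2E; split=> [h|[h1 h2]].
  have le i : (N1 (reF X i) + N1 (imF X i) < +oo)%E.
    apply: le_lt_trans h; rewrite (bigD1 i) //= leeDl//.
    by apply: sume_ge0 => j _; rewrite adde_ge0// N1_ge0.
  split=> i; apply: le_lt_trans (le i); [rewrite leeDl//|rewrite leeDr//]; exact: N1_ge0.
rewrite (eq_bigr (fun i => (n1 (reF X i) + n1 (imF X i))%:E)) => [|i _]; last first.
  by rewrite EFinD (l2E (h1 i)) (l2E (h2 i)).
by rewrite sumEFin ltry.
Qed.

Lemma l2_norm2_nn m (X : G -> 'rV[C]_m) : l2f (reF X) -> l2f (imF X) ->
  l2_norm2 X = (nn (reF X) + nn (imF X))%:E.
Proof.
move=> h1 h2; rewrite l2_norm2E (eq_bigr (fun i => (n1 (reF X i) + n1 (imF X i))%:E)) => [|i _].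
  by rewrite sumEFin big_split.
by rewrite EFinD (l2E (h1 i)) (l2E (h2 i)).
Qed.

Definition capprox m n (A : 'M[ZG]_(m, n)) (Y : G -> 'rV[C]_n) : Prop :=
  forall e : R, 0 < e -> exists X, in_l2 X /\ (l2_norm2 (Y \- Lambda A X)%R < e%:E)%E.

Lemma reF_sub m (X Y : G -> 'rV[C]_m) : reF (X \- Y)%R = reF X - reF Y.
Proof.
apply/funext => i; apply/funext => g; rewrite /reF /= !mxE.
by rewrite -[RHS]/(complex.Re (X g ord0 i) - complex.Re (Y g ord0 i)); exact: Re_zmod.
Qed.
Lemma imF_sub m (X Y : G -> 'rV[C]_m) : imF (X \- Y)%R = imF X - imF Y.
Proof.
apply/funext => i; apply/funext => g; rewrite /imF /= !mxE.
by rewrite -[RHS]/(complex.Im (X g ord0 i) - complex.Im (Y g ord0 i)); exact: Im_zmod.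
Qed.

Lemma capproxP m n (A : 'M[ZG]_(m, n)) Y : in_l2 Y ->
  capprox A Y <-> approx A (reF Y) /\ approx A (imF Y).
Proof.
move=> /in_l2P[l1 l2]; split=> [h|[h1 h2] e e0].
  have H e : 0 < e -> exists X, [/\ l2f (reF X), l2f (imF X) &
      nn (reF Y - app A (reF X)) + nn (imF Y - app A (imF X)) < e].
    move=> e0; have [X [/in_l2P[lX1 lX2]]] := h e e0; rewrite l2_norm2_nn.
    - by rewrite lte_fin reF_sub imF_sub reF_Lambda imF_Lambda; exists X.
    - by rewrite reF_sub reF_Lambda; apply: l2fB => //; exact: l2f_app.
    - by rewrite imF_sub imF_Lambda; apply: l2fB => //; exact: l2f_app.
  split=> e e0; have [X [lX1 lX2 XE]] := H e e0; [exists (reF X)|exists (imF X)]; split => //.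
    by apply: le_lt_trans XE; rewrite lerDl nn_ge0.
  by apply: le_lt_trans XE; rewrite lerDr nn_ge0.
have e2 : 0 < e / 2 by rewrite divr_gt0.
have [x [lx xe]] := h1 _ e2; have [y [ly ye]] := h2 _ e2.
exists (cpx x y); split; first by apply/in_l2P; rewrite reF_cpx imF_cpx.
rewrite l2_norm2_nn ?reF_sub ?imF_sub ?reF_Lambda ?imF_Lambda ?reF_cpx ?imF_cpx.
- by rewrite lte_fin; lra.
- by apply: l2fB => //; exact: l2f_app.
- by apply: l2fB => //; exact: l2f_app.
Qed.

Lemma reF0 m : reF (0 : G -> 'rV[C]_m) = 0.
Proof. by apply/funext => i; apply/funext => g; rewrite /reF mxE. Qed.
Lemma imF0 m : imF (0 : G -> 'rV[C]_m) = 0.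
Proof. by apply/funext => i; apply/funext => g; rewrite /imF mxE. Qed.

Lemma cpx_eq0 m (X : G -> 'rV[C]_m) : X = 0 <-> reF X = 0 /\ imF X = 0.
Proof.
split=> [->|[h1 h2]]; first by rewrite reF0 imF0.
by apply: cpxP; rewrite ?reF0 ?imF0.
Qed.

Lemma in_l2_cpx m (x : 'I_m -> G -> R) : l2f x -> in_l2 (cpx x 0).
Proof. by move=> lx; apply/in_l2P; rewrite reF_cpx imF_cpx; split => //; exact: l2f0. Qed.

Lemma weak_isoP m n (A : 'M[ZG]_(m, n)) : weak_iso R A <-> fwi R A.
Proof.
split=> [[Ai Ad]|[Ai Ad]]; split.
- move=> x lx Ax; have [] : reF (cpx x 0) = 0 /\ imF (cpx x 0) = 0.
    apply/cpx_eq0; apply: Ai; first exact: in_l2_cpx.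
    by apply/cpx_eq0; rewrite reF_Lambda imF_Lambda reF_cpx imF_cpx Ax app0.
  by rewrite reF_cpx.
- move=> y ly; have ly' := in_l2_cpx ly.
  by have [] := proj1 (capproxP A ly') (Ad _ ly'); rewrite reF_cpx.
- move=> X /in_l2P[l1 l2] /cpx_eq0; rewrite reF_Lambda imF_Lambda => -[h1 h2].
  by apply/cpx_eq0; split; exact: Ai.
- move=> Y lY; apply/(capproxP A lY); have [l1 l2] := proj1 (in_l2P Y) lY.
  by split; exact: Ad.
Qed.

Section Acyclic.
Variables (r : nat -> nat) (c : forall n, 'M[ZG]_(r n.+1, r n)).

Definition rcycle n : ('I_(r n) -> G -> R) -> Prop :=
  match n with 0 => fun=> True | n'.+1 => fun x => app (c n') x = 0 end.

Lemma rcycle0 n : rcycle (0 : 'I_(r n) -> G -> R).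
Proof. by case: n => [|n] //=; rewrite app0. Qed.

Definition racyclic : Prop := forall n (x : 'I_(r n) -> G -> R), l2f x -> rcycle x -> approx (c n) x.

Lemma l2_acyclicP : l2_acyclic R c <-> racyclic.
Proof.
have cyc n (X : G -> 'rV[C]_(r n)) : l2_cycle c X <-> rcycle (reF X) /\ rcycle (imF X).
  by case: n X => [|n] X //=; rewrite cpx_eq0 reF_Lambda imF_Lambda.
split=> [h n x lx cx|h n X lX cX].
  have lX := in_l2_cpx lx; have [] := proj1 (capproxP (c n) lX) (h n _ lX _).
    apply/cyc; rewrite reF_cpx imF_cpx; split => //.
    exact: rcycle0.
  by rewrite reF_cpx.
have [l1 l2] := proj1 (in_l2P X) lX; have [c1 c2] := proj1 (cyc n X) cX.
by apply/(capproxP (c n) lX); split; exact: h.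
Qed.

End Acyclic.

End ComplexReal.

Section FamilyWeakIso.
Variables (R : realType) (G : groupType).
Local Notation ZG := (group_ring G).
Local Notation fam I := (I -> G -> R).
Implicit Types (I J K : finType).

Lemma fwi_ext I J (f g : I -> J -> ZG) : (forall i j, f i j = g i j) -> fwi R f -> fwi R g.
Proof. by move=> fg; have -> : g = f by apply/funext => i; apply/funext => j. Qed.

Definition fone I : I -> I -> ZG := fun i j => (i == j)%:R.

Lemma app_fone I (x : fam I) : app (@fone I) x = x.
Proof.
apply/funext => j; rewrite /app (bigD1 j) //= big1 => [|i /negbTE ni]; last first.
  by rewrite /fone ni mulr0n ract0.
by rewrite /fone eqxx mulr1n ract1 addr0.
Qed.

Lemma fwi_one I : fwi R (@fone I).
Proof.
split=> [x _|y ly e e0]; first by rewrite app_fone.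
by exists y; rewrite app_fone subrr nn0.
Qed.

Section Bij.
Variables (I I' J J' : finType) (a : I' -> I) (b : J' -> J).
Hypotheses (ba : bijective a) (bb : bijective b).

Lemma app_bij (f : I -> J -> ZG) (x : fam I) j :
  app (fun i' j' => f (a i') (b j')) (x \o a) j = app f x (b j).
Proof. by rewrite /app [RHS](reindex a)//; exact: onW_bij. Qed.

Lemma nn_bij (y : fam J) : nn (y \o b) = nn y.
Proof. by rewrite /nn [RHS](reindex b)//; exact: onW_bij. Qed.

(** Indexing by arbitrary finite types lets bases be renumbered and blocks be regrouped without
    casts between sizes. *)
Lemma fwi_bij (f : I -> J -> ZG) : fwi R f -> fwi R (fun i' j' => f (a i') (b j')).
Proof.
have [a' aK a'K] := ba; have [b' bK b'K] := bb.
move=> [fi fd]; split=> [x lx fx|y ly e e0].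
  have E : x = (x \o a') \o a by apply/funext => i /=; rewrite aK.
  rewrite E in fx *; have -> : x \o a' = 0; last by [].
  apply: fi => [i|]; first exact: lx.
  apply/funext => j; rewrite -(b'K j) -app_bij.
  by rewrite fx.
have ly' : l2f (y \o b') by move=> j; exact: ly.
have [x [lx xe]] := fd _ ly' e e0; exists (x \o a); split; first by move=> i; exact: lx.
move: xe; rewrite -nn_bij; congr (nn _ < _); apply/funext => j.
by rewrite -[LHS]/(y (b' (b j)) - app f x (b j)) bK -app_bij.
Qed.

End Bij.

End FamilyWeakIso.

(** * The weak K-group *)

Section Quotients.
Variables (V : zmodType) (S : set V).

Definition qpi (x : V) : quotient_by S := \pi_(Quotient.quot (generated_subgroup S)) x.

Lemma qpiB : zmod_morphism qpi.
Proof. by move=> x y; rewrite /qpi; exact: raddfB. Qed.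
HB.instance Definition _ := GRing.isZmodMorphism.Build V (quotient_by S) qpi qpiB.

Lemma generated_incl z : S z -> z \in generated_subgroup S.
Proof. by move=> Sz; apply/asboolP => H _ _; exact. Qed.

Lemma qpi_eq x y : qpi x = qpi y <-> x - y \in generated_subgroup S.
Proof.
split=> [/eqP|h]; first by rewrite /qpi Quotient.idealrBE.
by apply/eqP; rewrite /qpi -Quotient.idealrBE.
Qed.

Lemma qpi_rel z : S z -> qpi z = 0.
Proof. by move=> Sz; rewrite -(raddf0 qpi); apply/qpi_eq; rewrite subr0; exact: generated_incl. Qed.

(** The kernel of [F] is one of the subgroups over which [generated_subgroup] quantifies. *)
Lemma qpi_lift_eq (W : zmodType) (F : {additive V -> W}) x y :
  (forall z, S z -> F z = 0) -> qpi x = qpi y -> F x = F y.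
Proof.
move=> FS /qpi_eq/asboolP h; apply/eqP; rewrite -subr_eq0 -raddfB; apply/eqP.
apply: (h [set z | F z = 0]) => //=; first exact: raddf0.
by move=> a b /= Fa Fb; rewrite raddfB Fa Fb subrr.
Qed.

Lemma qpi_repr (q : Quotient.quot (generated_subgroup S)) : qpi (repr q) = q.
Proof. exact: reprK. Qed.

End Quotients.

Section K1.
Variables (R : realType) (G : groupType).
Local Notation ZG := (group_ring G).
Local Notation cls := (@K1w_class R G _).
Implicit Types (I J : finType).

Lemma fmul_mx m n p (A : 'M[ZG]_(m, n)) (B : 'M[ZG]_(n, p)) i k : fmul A B i k = (A *m B) i k.
Proof. by rewrite mxE. Qed.

Lemma weak_iso_mul m n p (A : 'M[ZG]_(m, n)) (B : 'M[ZG]_(n, p)) :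
  weak_iso R A -> weak_iso R B -> weak_iso R (A *m B).
Proof.
move=> /weak_isoP Aw /weak_isoP Bw; apply/weak_isoP.
by apply: fwi_ext (fwi_mul Aw Bw) => i k; exact: fmul_mx.
Qed.

Lemma cls_mul n (A B : 'M[ZG]_n) : weak_iso R A -> weak_iso R B -> cls (A *m B) = cls A + cls B.
Proof.
move=> Aw Bw; apply/eqP; rewrite -subr_eq0; apply/eqP.
rewrite -[LHS]/(qpi (@K1w_relators R G) _ - (qpi _ _ + qpi _ _)) -raddfD -raddfB.
by apply: qpi_rel; left; exists n, A, B.
Qed.

Lemma cls_block m n (A : 'M[ZG]_m) (B : 'M[ZG]_(n, m)) (D : 'M[ZG]_n) :
  weak_iso R A -> weak_iso R D -> cls (block_mx A 0 B D) = cls A + cls D.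
Proof.
move=> Aw Dw; apply/eqP; rewrite -subr_eq0; apply/eqP.
rewrite -[LHS]/(qpi (@K1w_relators R G) _ - (qpi _ _ + qpi _ _)) -raddfD -raddfB.
by apply: qpi_rel; right; exists m, n, A, B, D.
Qed.

Lemma weak_iso1 n : weak_iso R (1%:M : 'M[ZG]_n).
Proof. by apply/weak_isoP; apply: fwi_ext (fwi_one R G 'I_n) => i j; rewrite mxE. Qed.

Lemma cls1 n : cls (1%:M : 'M[ZG]_n) = 0.
Proof.
have := cls_mul (weak_iso1 n) (weak_iso1 n); rewrite mulmx1 => /eqP.
by rewrite -subr_eq0 opprD addrA subrr sub0r oppr_eq0 => /eqP.
Qed.

Lemma weak_iso_perm n (s : 'S_n) : weak_iso R (perm_mx s : 'M[ZG]_n).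
Proof.
apply/weak_isoP; have bs : bijective s by exists (s^-1)%g; [exact: permK|exact: permKV].
have bi : bijective (@id 'I_n) by exists id.
by apply: fwi_ext (fwi_bij bs bi (fwi_one R G 'I_n)) => i j; rewrite !mxE.
Qed.

Definition emx I (f : I -> I -> ZG) n (a : 'I_n -> I) : 'M[ZG]_n := \matrix_(i, j) f (a i) (a j).

Lemma emx_weak I (f : I -> I -> ZG) n (a : 'I_n -> I) : bijective a -> fwi R f -> weak_iso R (emx f a).
Proof.
move=> ba fw; apply/weak_isoP; apply: fwi_ext (fwi_bij ba ba fw) => i j.
by rewrite mxE.
Qed.

(** The class of an endomorphism whose basis is an arbitrary finite type; by [fcls_any] the
    enumeration does not matter. *)
Definition fcls I (f : I -> I -> ZG) : K1w R G := cls (emx f (@enum_val I I)).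

(** Two enumerations differ by conjugation with a permutation matrix, and in an abelian group its
    class cancels that of its inverse. *)
Lemma fcls_any I (f : I -> I -> ZG) n (a : 'I_n -> I) : fwi R f -> bijective a ->
  cls (emx f a) = fcls f.
Proof.
move=> fw ba; have E : n = #|I| by rewrite -[LHS]card_ord; exact: bij_eq_card ba.
subst n; have inj : injective (fun i => enum_rank (a i)).
  by move=> i j /enum_rank_inj /(bij_inj ba).
pose s := perm inj; have -> : emx f a = perm_mx s *m emx f (@enum_val I I) *m perm_mx s^-1.
  rewrite -col_permE -row_permE; apply/matrixP => i j.
  by rewrite !mxE !permE !enum_rankK.
have we := emx_weak (enum_val_bij I) fw.
rewrite cls_mul; [|by apply: weak_iso_mul => //; exact: weak_iso_perm|exact: weak_iso_perm].
rewrite cls_mul//; last exact: weak_iso_perm.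
rewrite addrAC -cls_mul; [|exact: weak_iso_perm..].
by rewrite -perm_mxM mulgV perm_mx1 cls1 add0r.
Qed.

Lemma fcls_ext I (f g : I -> I -> ZG) : (forall i j, f i j = g i j) -> fcls f = fcls g.
Proof. by move=> fg; have -> : f = g by apply/funext => i; apply/funext => j. Qed.

Lemma fcls_bij I I' (e : I' -> I) (f : I -> I -> ZG) : fwi R f -> bijective e ->
  fcls (fun i j => f (e i) (e j)) = fcls f.
Proof.
move=> fw be; rewrite -(fcls_any fw (bij_comp be (enum_val_bij I'))).
by congr cls; apply/matrixP => i j; rewrite !mxE.
Qed.

Lemma fcls_mul I (f g : I -> I -> ZG) : fwi R f -> fwi R g -> fcls (fmul f g) = fcls f + fcls g.
Proof.
move=> fw gw; rewrite -cls_mul; [|exact: emx_weak (enum_val_bij I) _..].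
congr cls; apply/matrixP => i j; rewrite !mxE /fmul (reindex (@enum_val I I)).
  by apply: eq_bigr => k _; rewrite !mxE.
by apply: onW_bij; exact: enum_val_bij.
Qed.

Lemma fcls_one I : fcls (@fone G I) = 0.
Proof.
rewrite /fcls -(cls1 #|I|); congr cls; apply/matrixP => i j.
by rewrite !mxE /fone (inj_eq enum_val_inj).
Qed.

Definition fsum I J (f : I -> I -> ZG) (g : J -> J -> ZG) (i j : I + J) : ZG :=
  match i, j with inl i, inl j => f i j | inr i, inr j => g i j | _, _ => 0 end.

Lemma app_fsum I J (f : I -> I -> ZG) (g : J -> J -> ZG) (x : I + J -> G -> R) :
  (forall i, app (fsum f g) x (inl i) = app f (x \o inl) i) /\
  (forall j, app (fsum f g) x (inr j) = app g (x \o inr) j).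
Proof.
split=> k; rewrite /app big_sumType /=.
  by rewrite [X in _ + X]big1 => [|j _]; [rewrite addr0|exact: ract0].
by rewrite [X in X + _]big1 => [|i _]; [rewrite add0r|exact: ract0].
Qed.

Lemma nn_fsum I J (x : I + J -> G -> R) : nn x = nn (x \o inl) + nn (x \o inr).
Proof. by rewrite /nn big_sumType. Qed.

Lemma fwi_fsum I J (f : I -> I -> ZG) (g : J -> J -> ZG) : fwi R f -> fwi R g -> fwi R (fsum f g).
Proof.
move=> [fi fd] [gi gd]; split=> [x lx E|y ly e e0].
  have [E1 E2] := app_fsum f g x.
  have x1 : x \o inl = 0.
    by apply: fi => [i|]; [exact: lx|apply/funext => i; rewrite -E1 E].
  have x2 : x \o inr = 0.
    by apply: gi => [i|]; [exact: lx|apply/funext => i; rewrite -E2 E].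
  apply/funext => -[i|j]; [exact: (congr1 (fun h => h i) x1)|exact: (congr1 (fun h => h j) x2)].
have e2 : 0 < e / 2 by rewrite divr_gt0.
have [x1 [l1 h1]] := fd (y \o inl) (fun i => ly (inl i)) _ e2.
have [x2 [l2 h2]] := gd (y \o inr) (fun i => ly (inr i)) _ e2.
pose x (k : I + J) := match k with inl i => x1 i | inr j => x2 j end.
exists x; split; first by move=> [i|j]; [exact: l1|exact: l2].
have [E1 E2] := app_fsum f g x; rewrite nn_fsum.
have -> : (y - app (fsum f g) x) \o inl = y \o inl - app f x1.
  by apply/funext => i; rewrite -[LHS]/(y (inl i) - app (fsum f g) x (inl i)) E1.
have -> : (y - app (fsum f g) x) \o inr = y \o inr - app g x2.
  by apply/funext => i; rewrite -[LHS]/(y (inr i) - app (fsum f g) x (inr i)) E2.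
lra.
Qed.

Lemma fcls_fsum I J (f : I -> I -> ZG) (g : J -> J -> ZG) : fwi R f -> fwi R g ->
  fcls (fsum f g) = fcls f + fcls g.
Proof.
move=> fw gw; pose a (i : 'I_(#|I| + #|J|)) : I + J :=
  match fintype.split i with inl i => inl (enum_val i) | inr j => inr (enum_val j) end.
pose b (k : I + J) : 'I_(#|I| + #|J|) :=
  match k with inl i => lshift _ (enum_rank i) | inr j => rshift _ (enum_rank j) end.
have ab : bijective a.
  exists b => [i|[i|j]]; rewrite /a /b.
  - by rewrite -[RHS]splitK; case: (fintype.split i) => k /=; rewrite enum_valK.
  - by rewrite (unsplitK (inl (enum_rank i))) enum_rankK.
  - by rewrite (unsplitK (inr (enum_rank j))) enum_rankK.
rewrite -(fcls_any (fwi_fsum fw gw) ab) -(@cls_block _ _ _ 0).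
- congr cls; apply/matrixP => i j; rewrite mxE /a -{2}(splitK i) -{2}(splitK j).
  case: (fintype.split i) => i'; case: (fintype.split j) => j' /=.
  + by rewrite block_mxEul mxE.
  + by rewrite block_mxEur mxE.
  + by rewrite block_mxEdl mxE.
  + by rewrite block_mxEdr mxE.
- exact: emx_weak (enum_val_bij I) _.
- exact: emx_weak (enum_val_bij J) _.
Qed.

(** [K1wt_to_Whw] goes through a representative, which is known only up to multiples of [[- id]];
    that class comes from a trivial unit. *)
Lemma K1wt_to_WhwE (x : K1w R G) : K1wt_to_Whw (K1w_to_K1wt x) = K1w_to_Whw x.
Proof.
rewrite /K1wt_to_Whw -[LHS]/(qpi (@trivial_units R G) _) -[RHS]/(qpi (@trivial_units R G) x).
apply: (@qpi_lift_eq _ (@minus_id R G)); last exact: qpi_repr.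
move=> z ->; apply: qpi_rel; exists true, 1%g; congr K1w_class.
by rewrite expr1 mulN1r; apply/matrixP => i j; rewrite !mxE mulNrn.
Qed.

Lemma weak_genE n (A : 'M[ZG]_n) (h : `[< weak_iso R A >]) :
  weak_gen R A = fgen (existT (weak_aut_n R G) n (exist _ A h : weak_aut_n R G n) : weak_aut R G).
Proof.
rewrite /weak_gen; case: insubP => [B _ BE|]; last by rewrite h.
by congr (fgen (existT _ n _ : weak_aut R G)); apply: val_inj.
Qed.

(** Block sums gather all positive generators of a word into one matrix and all negative ones into
    another; the 0 x 0 matrix stands for the empty word. *)
Lemma K1w_classes (x : K1w R G) : exists m (A : 'M[ZG]_m) n (B : 'M[ZG]_n),
  [/\ weak_iso R A, weak_iso R B & x = cls A - cls B].
Proof.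
rewrite -(qpi_repr (x : Quotient.quot (generated_subgroup (@K1w_relators R G)))); move: (repr _) => z.
have bl m n (A : 'M[ZG]_m) (B : 'M[ZG]_n) : weak_iso R A -> weak_iso R B ->
    weak_iso R (block_mx A 0 0 B) /\ cls (block_mx A 0 0 B) = cls A + cls B.
  move=> Aw Bw; split; last exact: cls_block.
  have ab : bijective (@fintype.split m n).
    by exists (@unsplit m n); [exact: splitK|exact: unsplitK].
  apply/weak_isoP; have /weak_isoP fA := Aw; have /weak_isoP fB := Bw.
  apply: fwi_ext (fwi_bij ab ab (fwi_fsum fA fB)) => i j.
  rewrite -{2}(splitK i) -{2}(splitK j); case: (fintype.split i) => i'; case: (fintype.split j) => j' /=.
  - by rewrite block_mxEul.
  - by rewrite block_mxEur mxE.
  - by rewrite block_mxEdl mxE.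
  - by rewrite block_mxEdr.
move: z; apply: freeg_ind => [|z z' [m [A [n [B [Aw Bw E]]]]] [m' [A' [n' [B' [Aw' Bw' E']]]]]|k].
- exists 0%N, 1%:M, 0%N, 1%:M; split; try exact: weak_iso1.
  by rewrite cls1 subr0; exact: raddf0.
- have [W1 E1] := bl _ _ _ _ Aw Bw'; have [W2 E2] := bl _ _ _ _ Bw Aw'.
  exists (m + n')%N, (block_mx A 0 0 B'), (n + m')%N, (block_mx B 0 0 A'); split => //.
  by rewrite raddfB /= [X in X - _ = _]E [X in _ - X = _]E' E1 E2 opprB opprD addrACA.
- case: k => n [B hB]; exists n, B, 0%N, 1%:M; split; [exact/asboolP|exact: weak_iso1|].
  by rewrite cls1 subr0 /K1w_class (weak_genE hB).
Qed.

Lemma Whw_classes (w : Whw R G) : exists m (A : 'M[ZG]_m) n (B : 'M[ZG]_n),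
  [/\ weak_iso R A, weak_iso R B & w = K1w_to_Whw (cls A - cls B)].
Proof.
have [m [A [n [B [Aw Bw E]]]]] := K1w_classes (repr (w : Quotient.quot (generated_subgroup (@trivial_units R G)))).
by exists m, A, n, B; split => //; rewrite -E; exact/esym/qpi_repr.
Qed.

End K1.

(** * Universal torsion *)

Section Sizes.
Variables (R : realType) (G : groupType).
Local Notation ZG := (group_ring G).

(** Density of the image makes the adjoint injective, by [approx_perp], so that [size_eq]
    applies. *)
Lemma weak_iso_size m n (A : 'M[ZG]_(m, n)) : weak_iso R A -> m = n.
Proof.
move=> /weak_isoP[Ai Ad]; apply: (@size_eq R G m n A) => // w lw; rewrite -fadj_mx => Aw.
exact: (approx_perp lw (Ad w lw) Aw).
Qed.

Lemma mxadj_mul m n p (A : 'M[ZG]_(m, n)) (B : 'M[ZG]_(n, p)) : mxadj (A *m B) = mxadj B *m mxadj A.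
Proof.
apply/matrixP => i j; rewrite !mxE raddf_sum; apply: eq_bigr => k _.
by rewrite !mxE; exact: ginvM.
Qed.

Lemma mxadj0 m n : mxadj (0 : 'M[ZG]_(m, n)) = 0.
Proof. by apply/matrixP => i j; rewrite !mxE; exact: raddf0. Qed.

End Sizes.

Section BlockDiagonal.
Variables (R : realType) (G : groupType) (K : nat) (q : 'I_K -> nat).
Local Notation ZG := (group_ring G).
Local Notation sigq := {k : 'I_K & 'I_(q k)}.

Definition fdiag (M : forall k, 'M[ZG]_(q k)) (x y : sigq) : ZG :=
  if tag y == tag x then M (tag x) (tagged x) (tagged_as x y) else 0.

Lemma fdiag_conform (M : forall k, 'M[ZG]_(q k)) (x y : sigq) :
  fdiag M x y = (if tag x == tag y then conform_mx (0 : 'M_(q (tag x), q (tag y))) (M (tag x)) else 0)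
    (tagged x) (tagged y).
Proof.
case: x y => k i [l j]; rewrite /fdiag /= [k == l]eq_sym; case: eqVneq => [E|_]; last by rewrite mxE.
by subst l; rewrite conform_mx_id tagged_asE.
Qed.

Lemma mxdiagE (M : forall k, 'M[ZG]_(q k)) i j :
  (\mxdiag_k M k) i j = fdiag M (tagnat.sig i) (tagnat.sig j).
Proof. by rewrite fdiag_conform /mxdiag mxE. Qed.

Definition Sg k (i : 'I_(q k)) : sigq := existT (fun k => 'I_(q k)) k i.

Lemma sum_sig (V : nmodType) (F : sigq -> V) : \sum_s F s = \sum_k \sum_i F (@Sg k i).
Proof.
rewrite (@sig_big_dep _ _ _ _ (fun k => 'I_(q k) : finType) predT (fun=> predT) (fun k i => F (@Sg k i))) /=.
by apply: eq_bigr => -[k i] _.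
Qed.

Lemma app_fdiag (M : forall k, 'M[ZG]_(q k)) (x : sigq -> G -> R) k (j : 'I_(q k)) :
  app (fdiag M) x (Sg j) = app (M k) (fun i => x (Sg i)) j.
Proof.
rewrite /app sum_sig (bigD1 k) //= [X in _ + X]big1 ?addr0 => [|l nl]; last first.
  by apply: big1 => i _; rewrite /fdiag /= eq_sym (negbTE nl) ract0.
by apply: eq_bigr => i _; rewrite /fdiag /= eqxx tagged_asE.
Qed.

Lemma nn_sig (x : sigq -> G -> R) : nn x = \sum_k nn (fun i : 'I_(q k) => x (Sg i)).
Proof. exact: sum_sig. Qed.

Lemma fwi_fdiag (M : forall k, 'M[ZG]_(q k)) : (forall k, fwi R (M k)) -> fwi R (fdiag M).
Proof.
move=> Mw; split=> [x lx E|y ly e e0].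
  apply/funext => -[k i]; have [Mi _] := Mw k.
  have h : (fun i : 'I_(q k) => x (Sg i)) = 0.
    apply: Mi => [j|]; first exact: lx.
    by apply/funext => j; rewrite -app_fdiag E.
  exact: (congr1 (fun h => h i) h).
have d0 : 0 < e / (K%:R + 1) by rewrite divr_gt0// ltr_wpDl.
have ex k : exists z : 'I_(q k) -> G -> R, l2f z /\
    nn ((fun i : 'I_(q k) => y (Sg i)) - app (M k) z) < e / (K%:R + 1).
  by have [_ Md] := Mw k; apply: Md => // i; exact: ly.
pose z' k := projT1 (cid (ex k)).
have zP' k : l2f (z' k) /\ nn ((fun i : 'I_(q k) => y (Sg i)) - app (M k) (z' k)) < e / (K%:R + 1).
  exact: projT2 (cid (ex k)).
exists (fun s => z' (tag s) (tagged s)); split; first by move=> [k i]; exact: (zP' k).1.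
rewrite nn_sig; apply: (@le_lt_trans _ _ (\sum_(k < K) e / (K%:R + 1))); last first.
  rewrite sumr_const card_ord -[_ *+ K]mulr_natl mulrA -ltr_pdivlMr ?divr_gt0 ?invr_gt0 ?ltr_wpDl//.
  rewrite mulrC; set t := (K%:R + 1)^-1 ^-1.
  by rewrite /t invrK ltr_pM2l// ltrDl.
apply: ler_sum => k _; have [_ /ltW] := zP' k; congr (nn _ <= _); apply/funext => i.
by rewrite -[RHS]/(y (Sg i) - app (fdiag M) _ (Sg i)) app_fdiag.
Qed.

Lemma fmul_fdiag (M N : forall k, 'M[ZG]_(q k)) x y :
  fmul (fdiag M) (fdiag N) x y = fdiag (fun k => M k *m N k) x y.
Proof.
case: x y => k i [l j]; rewrite /fmul sum_sig (bigD1 k) //= [X in _ + X]big1 ?addr0 => [|k' nk]; last first.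
  by apply: big1 => i' _; rewrite {1}/fdiag /= (negbTE nk) mul0r.
rewrite {2}/fdiag {2}/fdiag /=; case: eqVneq => [E|_]; last by apply: big1 => i' _; rewrite mulr0.
subst l; rewrite tagged_asE mxE; apply: eq_bigr => i' _.
by rewrite /fdiag /= eqxx !tagged_asE.
Qed.

Lemma fcls_fdiag_single (M : forall k, 'M[ZG]_(q k)) k0 : (forall k, fwi R (M k)) ->
  (forall k, k != k0 -> q k = 0%N) -> fcls R (fdiag M) = K1w_class R (M k0).
Proof.
move=> Mw q0; rewrite -(fcls_any (fwi_fdiag Mw) (a := @Sg k0)).
  congr K1w_class; apply/matrixP => i j; rewrite mxE /fdiag /= eqxx tagged_asE//.
have tg (s : sigq) : tag s = k0.
  case: s => k i /=; apply/eqP/negP => /negP/q0 E.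
  by have := ltn_ord i; rewrite [X in (_ < X)%N]E.
exists (fun s => cast_ord (congr1 q (tg s)) (tagged s)) => [i|[k i]].
  by apply: val_inj.
have E := tg (existT _ k i); rewrite /= in E; subst k.
by rewrite /Sg; congr existT; apply: val_inj.
Qed.

End BlockDiagonal.

Section Torsion.
Variables (R : realType) (G : groupType).
Local Notation ZG := (group_ring G).
Variables (r : nat -> nat) (c : forall n, 'M[ZG]_(r n.+1, r n)).
Variables (u : forall n, 'M[ZG]_(r n)) (gamma : forall n, 'M[ZG]_(r n, r n.+1)).

(** The component from degree [n] to degree [m] of [uc + gamma] on the whole complex. Both parities
    are needed, as the even-to-odd part serves as a partner of the odd-to-even one. *)
Definition grd n m : 'M[ZG]_(r n, r m) :=
  if m.+1 == n then conform_mx 0 (c m *m u m)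
  else if m == n.+1 then conform_mx 0 (gamma n) else 0.

Lemma grd_down n : grd n.+1 n = c n *m u n.
Proof. by rewrite /grd eqxx conform_mx_id. Qed.
Lemma grd_up n : grd n n.+1 = gamma n.
Proof.
have ne : (n.+2 == n) = false by lia.
by rewrite /grd ne eqxx conform_mx_id.
Qed.
Lemma grd_other n m : m.+1 <> n -> m <> n.+1 -> grd n m = 0.
Proof. by rewrite /grd => /eqP/negbTE -> /eqP/negbTE ->. Qed.

Lemma odd_to_evenE K : odd_to_even c u gamma K = \mxblock_(k < K, l < K) grd k.*2.+1 l.*2.
Proof.
apply/matrixP => i j; rewrite !mxE; move: (tagnat.sig1 i) (tagnat.sig1 j) (tagnat.sig2 i) (tagnat.sig2 j).
move=> k l {}i {}j; have [E|ne] := eqVneq l k.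
  by subst l; rewrite grd_down conform_mx_id.
rewrite {1}/grd eqSS (inj_eq double_inj) (negbTE (_ : (l : nat) != k))//.
have -> : (l.*2 == k.*2.+2) = (l == k.+1 :> nat) by rewrite -doubleS (inj_eq double_inj).
by case: eqP => // E; rewrite !mxE.
Qed.

Hypothesis wc : weak_contraction R c u gamma.
Hypothesis cc : forall n, c n.+1 *m c n = 0.
Hypothesis gg : forall n, gamma n *m gamma n.+1 = 0.

Lemma sum_neighbours (V : zmodType) (F : nat -> V) M n : (forall m, m.+1 <> n -> m <> n.+1 -> F m = 0) ->
  (forall m, (M <= m)%N -> F m = 0) ->
  \sum_(m < M) F m = (if n is n'.+1 then F n' else 0) + F n.+1.
Proof.
(* The range is enlarged so as to contain both neighbours of [n]; the added terms vanish. *)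
move=> F1 F2; have -> : \sum_(m < M) F m = \sum_(m < M + n.+2) F m.
  by rewrite big_split_ord /= [X in _ + X]big1 ?addr0// => m _; apply: F2; rewrite leq_addr.
have n2 : (n.+1 < M + n.+2)%N by rewrite ltn_addl.
rewrite (bigD1 (Ordinal n2)) //= addrC; congr (_ + _).
case: n F1 n2 => [|n] F1 n2.
  by apply: big1 => m /eqP mn; apply: F1 => // E; apply: mn; apply: val_inj.
have n3 : (n < M + n.+3)%N by lia.
rewrite (bigD1 (Ordinal n3)) /=; last by apply/eqP => /(congr1 val) /= E; move: (ltnSn n); rewrite {2}E; lia.
rewrite big1 ?addr0// => m /andP[/eqP m1 /eqP m2]; apply: F1 => [[E]|E].
  by apply: m2; apply: val_inj.
by apply: m1; apply: val_inj.
Qed.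

Lemma mulmx_dim0 (m n p : nat) (A : 'M[ZG]_(m, n)) (B : 'M[ZG]_(n, p)) : n = 0%N -> A *m B = 0.
Proof. by move=> n0; apply/matrixP => i j; rewrite !mxE; apply: big1 => k; have := ltn_ord k; rewrite [X in (_ < X)%N]n0. Qed.

(** The square of [uc + gamma] is that of [u]: [c c] and [gamma gamma] vanish, and since [u]
    commutes with [c] and [gamma], the mixed terms add up to [u] times [c gamma + gamma c], which is
    [u]. *)
Lemma grd_square M n p : (forall m, (M <= m)%N -> r m = 0%N) ->
  \sum_(m < M) grd n m *m grd m p = if n == p then conform_mx 0 (u n *m u n) else 0.
Proof.
have [cu _ w0 wS ug] := wc; move=> rM.
rewrite (@sum_neighbours _ (fun m => grd n m *m grd m p) M n) => [|m m1 m2|m Mm]; first last.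
- by apply: mulmx_dim0; exact: rM.
- by rewrite grd_other// mul0mx.
have up : grd n n.+1 *m grd n.+1 p = if n == p then conform_mx 0 (gamma n *m c n *m u n) else 0.
  rewrite grd_up; case: eqVneq => [E|ne].
    by subst p; rewrite grd_down conform_mx_id mulmxA.
  have [E|ne'] := eqVneq p n.+2; first by subst p; rewrite grd_up gg.
  by rewrite grd_other ?mulmx0// => [[E]|]; [case/eqP: ne|exact/eqP].
rewrite up; case: n up => [|n] _.
  by rewrite add0r; case: eqVneq => // E; subst p; rewrite !conform_mx_id -w0.
have -> : grd n.+1 n *m grd n p = if n.+1 == p then conform_mx 0 (c n *m gamma n *m u n.+1) else 0.
  rewrite grd_down; case: eqVneq => [E|ne].
    by subst p; rewrite grd_up conform_mx_id -mulmxA ug mulmxA.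
  have [E|ne'] := eqVneq p.+1 n.
    by subst n; rewrite grd_down -mulmxA (mulmxA (u p.+1)) -cu !mulmxA cc !mul0mx.
  by rewrite (grd_other (n := n) (m := p)) ?mulmx0//; [exact/eqP|move=> E; case/eqP: ne].
case: eqVneq => [E|_]; last by rewrite addr0.
by subst p; rewrite !conform_mx_id -mulmxDl addrC wS.
Qed.

Lemma sum_double (V : nmodType) (F : nat -> V) K :
  \sum_(m < K.*2) F m = \sum_(l < K) F l.*2 + \sum_(l < K) F l.*2.+1.
Proof.
elim: K => [|K IH]; first by rewrite !big_ord0 addr0.
by rewrite doubleS !big_ord_recr /= IH -!addrA; congr (_ + _); rewrite addrCA.
Qed.

Lemma grd_parity n m : odd n = odd m -> grd n m = 0.
Proof.
move=> E; apply: grd_other => E'; move: E.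
  by rewrite -E' /=; case: (odd m).
by rewrite E' /=; case: (odd n).
Qed.

Definition even_to_odd K := \mxblock_(l < K, k < K) grd l.*2 k.*2.+1.

Lemma weak_iso_mxdiag K (q : 'I_K -> nat) (M : forall k, 'M[ZG]_(q k)) :
  (forall k, weak_iso R (M k)) -> weak_iso R (\mxdiag_k M k).
Proof.
move=> Mw; apply/weak_isoP; have fw := fwi_fdiag (fun k => proj1 (weak_isoP R (M k)) (Mw k)).
apply: fwi_ext (fwi_bij tagnat.sig_bij tagnat.sig_bij fw) => i j.
by rewrite mxdiagE.
Qed.

(** Composed with the even-to-odd part on either side it gives the diagonal of the squares of [u], a
    weak isomorphism; [fwi_factors] does the rest. *)
Lemma odd_to_even_weak K : (forall n, (K.*2 <= n)%N -> r n = 0%N) -> weak_iso R (odd_to_even c u gamma K).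
Proof.
move=> rK; have [_ uw _ _ _] := wc.
have DE : odd_to_even c u gamma K *m even_to_odd K = \mxdiag_k (u k.*2.+1 *m u k.*2.+1).
  rewrite odd_to_evenE mul_mxblock /mxdiag; apply/eq_mxblockP => k k'.
  have := grd_square k.*2.+1 k'.*2.+1 rK.
  rewrite (@sum_double _ (fun m => grd k.*2.+1 m *m grd m k'.*2.+1))  [X in _ + X]big1 ?addr0 => [->|l _].
    by rewrite eqSS (inj_eq double_inj).
  by rewrite grd_parity ?mul0mx//= !odd_double.
have ED : even_to_odd K *m odd_to_even c u gamma K = \mxdiag_l (u l.*2 *m u l.*2).
  rewrite odd_to_evenE mul_mxblock /mxdiag; apply/eq_mxblockP => k k'.
  have := grd_square k.*2 k'.*2 rK.
  rewrite (@sum_double _ (fun m => grd k.*2 m *m grd m k'.*2))  [X in X + _]big1 ?add0r => [->|l _].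
    by rewrite (inj_eq double_inj).
  by rewrite grd_parity ?mul0mx//= !odd_double.
have DEw : weak_iso R (odd_to_even c u gamma K *m even_to_odd K).
  by rewrite DE; apply: weak_iso_mxdiag => k; exact: weak_iso_mul.
have EDw : weak_iso R (even_to_odd K *m odd_to_even c u gamma K).
  by rewrite ED; apply: weak_iso_mxdiag => k; exact: weak_iso_mul.
apply/weak_isoP.
have h1 : fwi R (fmul (odd_to_even c u gamma K) (even_to_odd K)).
  by apply: fwi_ext (proj1 (weak_isoP _ _) DEw) => i j; rewrite fmul_mx.
have [_ h2] : fwi R (fmul (even_to_odd K) (odd_to_even c u gamma K)).
  by apply: fwi_ext (proj1 (weak_isoP _ _) EDw) => i j; rewrite fmul_mx.
exact: fwi_factors h1 h2.
Qed.

Variable K : nat.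
Hypothesis rK : forall n, (K.*2 <= n)%N -> r n = 0%N.
Local Notation sO := {k : 'I_K & 'I_(r k.*2.+1)}.
Local Notation sE := {l : 'I_K & 'I_(r l.*2)}.

Definition fO2E (x : sO) (y : sE) : ZG := grd (tag x).*2.+1 (tag y).*2 (tagged x) (tagged y).

Lemma odd_to_even_sig i j : odd_to_even c u gamma K i j = fO2E (tagnat.sig i) (tagnat.sig j).
Proof. by rewrite odd_to_evenE mxE. Qed.

Lemma fO2E_weak : fwi R fO2E.
Proof.
have br : bijective (@tagnat.rank K (fun k : 'I_K => r k.*2.+1)).
  by exists tagnat.sig; [exact: tagnat.rankK|exact: tagnat.sigK].
have br' : bijective (@tagnat.rank K (fun k : 'I_K => r k.*2)).
  by exists tagnat.sig; [exact: tagnat.rankK|exact: tagnat.sigK].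
have /weak_isoP w := odd_to_even_weak rK.
by apply: fwi_ext (fwi_bij br br' w) => x y; rewrite odd_to_even_sig !tagnat.rankK.
Qed.

Lemma based_class_theta (Theta : sO -> sE) : bijective Theta ->
  based_class (odd_to_even c u gamma K) (K1w_to_K1wt (fcls R (fun x y => fO2E x (Theta y)))).
Proof.
move=> bT; split; first exact: odd_to_even_weak.
have e := esym (weak_iso_size (odd_to_even_weak rK)).
pose th j := cast_ord e (tagnat.rank (Theta (tagnat.sig j))).
have thi : injective th.
  move=> i j /cast_ord_inj /(can_inj (@tagnat.rankK _ _)) /(bij_inj bT).
  exact: (can_inj (@tagnat.sigK _ _)).
exists e, (perm thi); congr K1w_to_K1wt.
have bi : bijective (@id sO) by exists id.
rewrite -(fcls_any (fwi_bij bi bT fO2E_weak) tagnat.sig_bij); congr K1w_class.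
apply/matrixP => i j; rewrite !mxE castmxE cast_ord_id permE /th cast_ordK.
by rewrite odd_to_even_sig tagnat.rankK.
Qed.

(** Both bases may be parametrized by one index type; a type adapted to a direct sum makes the
    matrix block diagonal. *)
Lemma based_class_bij (I : finType) (J : I -> sO) (H : I -> sE) : bijective J -> bijective H ->
  based_class (odd_to_even c u gamma K) (K1w_to_K1wt (fcls R (fun x y => fO2E (J x) (H y)))).
Proof.
move=> bJ bH; have [J' JK J'K] := bJ.
have bT : bijective (fun y => H (J' y)) by apply: bij_comp => //; exists J.
have bi : bijective (@id sO) by exists id.
have := based_class_theta bT; rewrite -(fcls_bij (fwi_bij bi bT fO2E_weak) bJ).
by rewrite (fcls_ext _ (g := fun x y => fO2E (J x) (H y)))// => x y; rewrite JK.
Qed.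

Lemma u_odd_cls : K1w_class R (u_odd u K) = fcls R (fdiag (fun k : 'I_K => u k.*2.+1)).
Proof.
have [_ uw _ _ _] := wc.
have fw : fwi R (fdiag (fun k : 'I_K => u k.*2.+1)).
  by apply: fwi_fdiag => k; apply/weak_isoP.
rewrite -(fcls_any fw tagnat.sig_bij); congr K1w_class; apply/matrixP => i j.
by rewrite /u_odd mxdiagE mxE.
Qed.

Lemma theta_exists : exists Theta : sO -> sE, bijective Theta.
Proof.
have e := weak_iso_size (odd_to_even_weak rK).
exists (fun s => tagnat.sig (cast_ord e (tagnat.rank s))).
exists (fun s => tagnat.sig (cast_ord (esym e) (tagnat.rank s))) => s.
  by rewrite tagnat.sigK cast_ordK tagnat.rankK.
by rewrite tagnat.sigK cast_ordKV tagnat.rankK.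
Qed.

End Torsion.

(** * The contraction given by the Laplacian *)

Section Laplacian.
Variables (R : realType) (G : groupType).
Local Notation ZG := (group_ring G).
Variables (r : nat -> nat) (c : forall n, 'M[ZG]_(r n.+1, r n)).

Definition adj_gamma n : 'M[ZG]_(r n, r n.+1) := mxadj (c n).

Definition laplacian n : 'M[ZG]_(r n) :=
  match n with
  | 0 => adj_gamma 0 *m c 0
  | n'.+1 => adj_gamma n'.+1 *m c n'.+1 + c n' *m adj_gamma n'
  end.

Hypothesis cc : forall n, c n.+1 *m c n = 0.
Hypothesis acyclic : racyclic R c.

Lemma adj_gamma_square n : adj_gamma n *m adj_gamma n.+1 = 0.
Proof. by rewrite /adj_gamma -mxadj_mul cc mxadj0. Qed.

(** A cycle is a limit of boundaries, and a vector killed by the adjoint of [c n] is orthogonal to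
    all of these. *)
Lemma cycle_coclosed_eq0 n (x : 'I_(r n) -> G -> R) : l2f x -> rcycle c x -> app (adj_gamma n) x = 0 -> x = 0.
Proof. by move=> lx cx gx; apply: (approx_perp lx (acyclic lx cx)); rewrite fadj_mx. Qed.

(** The Laplacian is [f] followed by its adjoint for [f] pairing the adjoint of one differential
    with the other differential. This [f] is injective by [cycle_coclosed_eq0], so [fwi_fadj]
    applies. *)
Lemma laplacian_weak n : weak_iso R (laplacian n).
Proof.
apply/weak_isoP; case: n => [|n].
  have fi : finj R (adj_gamma 0) by move=> x lx; exact: (@cycle_coclosed_eq0 0).
  apply: fwi_ext (fwi_fadj fi) => i j.
  by rewrite fadj_mx fmul_mx /adj_gamma mxadjK.
pose f (i : 'I_(r n.+1)) (j : 'I_(r n.+2) + 'I_(r n)) : ZG :=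
  match j with inl j => adj_gamma n.+1 i j | inr j => c n i j end.
have fi : finj R f.
  move=> x lx fx; apply: (@cycle_coclosed_eq0 n.+1) => //; apply/funext => j.
    exact: (congr1 (fun h => h (inr j)) fx).
  exact: (congr1 (fun h => h (inl j)) fx).
apply: fwi_ext (fwi_fadj fi) => i k.
rewrite /fmul big_sumType /= !mxE; congr (_ + _); apply: eq_bigr => j _.
  by rewrite /fadj /= /adj_gamma !mxE ginvK.
by rewrite /fadj /= /adj_gamma !mxE.
Qed.

Lemma laplacian_contraction : weak_contraction R c laplacian adj_gamma.
Proof.
have c0 m q (B : 'M_(q, _)) : B *m c m.+1 *m c m = 0 by rewrite -mulmxA cc mulmx0.
have g0 m : adj_gamma m *m adj_gamma m.+1 = 0 by exact: adj_gamma_square.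
split=> [n||//|//|n].
- by case: n => [|n]; rewrite /= ?mulmxDr mulmxDl !mulmxA c0 ?cc ?mul0mx ?add0r ?addr0.
- exact: laplacian_weak.
case: n => [|n]; rewrite /= ?mulmxDl !mulmxDr !mulmxA g0 mul0mx add0r//.
by rewrite -(mulmxA (c n)) g0 mulmx0 addr0.
Qed.

End Laplacian.

(** * The sum of a complex with two-term complexes *)

Section TwoStageComplex.
Variables (R : realType) (G : groupType).
Local Notation ZG := (group_ring G).
Variables (a b : nat -> nat) (c : forall n, 'M[ZG]_(a n.+1, a n)) (A : forall n, 'M[ZG]_(b n)).

Definition shift_rank n : nat := if n is n'.+1 then b n' else 0%N.
Local Notation sh := shift_rank.
Definition rank2 n : nat := (a n + b n + sh n)%N.

(** Written so as to be convertible to [c2], the cellular differential of the two-stage space: the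
    algebra below then applies to it directly. *)
Definition diff2 n : 'M[ZG]_(rank2 n.+1, rank2 n) :=
  block_mx (block_mx (c n) 0 0 0) 0 (row_mx (0 : 'M_(b n, a n)) (A n)) 0.

Lemma diff2_square : (forall n, c n.+1 *m c n = 0) -> forall n, diff2 n.+1 *m diff2 n = 0.
Proof.
move=> cc n; rewrite /diff2 mulmx_block mulmx_block mul_row_block cc !(mulmx0, mul0mx, addr0, add0r).
by rewrite !(block_mx0, row_mx0).
Qed.

Lemma diff2_complex : is_fbf_complex c -> (exists N, forall n, (N <= n)%N -> b n = 0%N) -> is_fbf_complex diff2.
Proof.
move=> [cc [N aN]] [M bM]; split; first exact: diff2_square.
exists (N + M.+1)%N => -[|n] nN; first by lia.
by rewrite /rank2 /= aN ?bM//; lia.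
Qed.

Lemma app_diff2_old n (x : 'I_(rank2 n.+1) -> G -> R) j : app (diff2 n) x (old3 (b n) (sh n) j) = app (c n) (fun i => x (old3 _ _ i)) j.
Proof.
rewrite /app (@sum3 _ (a n.+1) (b n.+1) (sh n.+1)) [X in _ + X + _]big1 ?addr0 => [|i _]; last first.
  by rewrite /diff2 /old3 /mid3 block_mxEul block_mxEdl mxE ract0.
rewrite [X in _ + X]big1 ?addr0 => [|i _]; last by rewrite /diff2 /old3 /new3 block_mxEdl row_mxEl mxE ract0.
by apply: eq_bigr => i _; rewrite /diff2 /old3 block_mxEul block_mxEul.
Qed.

Lemma app_diff2_mid n (x : 'I_(rank2 n.+1) -> G -> R) j : app (diff2 n) x (mid3 (a n) (sh n) j) =
  app (A n) (fun i => x (new3 (a n.+1) (b n.+1) (i : 'I_(sh n.+1)))) j.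
Proof.
rewrite /app (@sum3 _ (a n.+1) (b n.+1) (sh n.+1)) [X in X + _ + _]big1 ?add0r => [|i _]; last first.
  by rewrite /diff2 /old3 /mid3 block_mxEul block_mxEur mxE ract0.
rewrite [X in X + _]big1 ?add0r => [|i _]; last by rewrite /diff2 /mid3 block_mxEul block_mxEdr mxE ract0.
by apply: eq_bigr => i _; rewrite /diff2 /mid3 /new3 block_mxEdl row_mxEr.
Qed.

Lemma app_diff2_new n (x : 'I_(rank2 n.+1) -> G -> R) j : app (diff2 n) x (new3 (a n) (b n) j) = 0.
Proof.
rewrite /app big1// => i _; rewrite (_ : diff2 n i _ = 0) ?ract0//.
by rewrite /diff2 /new3 -(splitK i); case: (fintype.split i) => {}i /=; rewrite ?block_mxEur ?block_mxEdr mxE.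
Qed.

Lemma nn3 n (x : 'I_(rank2 n) -> G -> R) : nn x =
  nn (fun i => x (old3 (b n) (sh n) i)) + nn (fun i => x (mid3 (a n) (sh n) i)) +
  nn (fun i => x (new3 (a n) (b n) i)).
Proof. exact: sum3. Qed.

Hypothesis Aw : forall n, weak_iso R (A n).

(** In the two-term summands, injectivity of [A] kills the cycles of the upper degree, and density
    of its image makes the lower degree a closure of boundaries. *)
Lemma diff2_acyclic : racyclic R c -> racyclic R diff2.
Proof.
move=> ca n x lx cx e e0.
have [_ Ad] : fwi R (A n) by apply/weak_isoP.
have cx1 : rcycle c (fun i => x (old3 (b n) (sh n) i)).
  case: n x {lx Ad} cx => //= n x cx; apply/funext => j.
  by rewrite -(app_diff2_old (n := n)) cx.
have x3 : (fun i => x (new3 (a n) (b n) i)) = 0.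
  case: n x lx {cx1 Ad} cx => [|n] x lx cx; first by apply/funext => -[].
  have [Ai _] : fwi R (A n) by apply/weak_isoP.
  apply: Ai => [i|]; first exact: lx.
  by apply/funext => j; rewrite -(app_diff2_mid x j) cx.
have e2 : 0 < e / 2 by rewrite divr_gt0.
have [y1 [ly1 y1e]] := ca n _ (fun i => lx _) cx1 _ e2.
have [y2 [ly2 y2e]] := Ad (fun i => x (mid3 (a n) (sh n) i)) (fun i => lx _) _ e2.
exists (@case3 _ (a n.+1) (b n.+1) (sh n.+1) y1 (fun=> 0) y2); split.
  by apply: ind3 => j; rewrite ?case3_old ?case3_mid ?case3_new//; exact: l20.
rewrite nn3 [X in _ + X](_ : _ = 0) ?addr0; last first.
  rewrite -[RHS](nn0 R G 'I_(sh n)); congr nn; rewrite -x3; apply/funext => i.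
  by rewrite -[LHS]/(x _ - app _ _ _) app_diff2_new subr0.
rewrite (splitr e); apply: ltrD.
  move: y1e; congr (nn _ < _); apply/funext => i; rewrite -[RHS]/(x _ - app _ _ _) app_diff2_old.
  by congr (_ - app _ _ _); apply/funext => j; rewrite case3_old.
move: y2e; congr (nn _ < _); apply/funext => i; rewrite -[RHS]/(x _ - app _ _ _) app_diff2_mid.
by congr (_ - app _ _ _); apply/funext => j; rewrite case3_new.
Qed.

Lemma weak_iso_diag m n (M : 'M[ZG]_m) (N : 'M[ZG]_n) : weak_iso R M -> weak_iso R N ->
  weak_iso R (block_mx M 0 0 N).
Proof.
move=> /weak_isoP Mw /weak_isoP Nw; apply/weak_isoP.
have bs : bijective (@fintype.split m n) by exists unsplit; [exact: splitK|exact: unsplitK].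
apply: fwi_ext (fwi_bij bs bs (fwi_fsum Mw Nw)) => i j.
rewrite -{2}(splitK i) -{2}(splitK j); case: (fintype.split i) => {}i; case: (fintype.split j) => {}j /=.
- by rewrite block_mxEul.
- by rewrite block_mxEur mxE.
- by rewrite block_mxEdl mxE.
by rewrite block_mxEdr.
Qed.

Variables (u : forall n, 'M[ZG]_(a n)) (gamma : forall n, 'M[ZG]_(a n, a n.+1)).
Hypothesis wc : weak_contraction R c u gamma.
Hypothesis cc : forall n, c n.+1 *m c n = 0.
Hypothesis gg : forall n, gamma n *m gamma n.+1 = 0.

Definition shift_mx n : 'M[ZG]_(sh n) :=
  match n return 'M[ZG]_(sh n) with 0 => 1%:M | n'.+1 => A n' end.
(** On a two-term summand [gamma2] is the identity from the lower to the upper degree; this forces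
    [u2] to be [A] in both degrees. *)
Definition u2 n : 'M[ZG]_(rank2 n) := block_mx (block_mx (u n) 0 0 (A n)) 0 0 (shift_mx n).
Definition gamma2 n : 'M[ZG]_(rank2 n, rank2 n.+1) :=
  block_mx (block_mx (gamma n) 0 0 0) (col_mx (0 : 'M_(a n, b n)) 1%:M) 0 0.

Lemma diff2_u2 n : diff2 n *m u2 n =
  block_mx (block_mx (c n *m u n) 0 0 0) 0 (row_mx (0 : 'M_(b n, a n)) (A n *m A n)) 0.
Proof.
rewrite /diff2 /u2 mulmx_block mulmx_block mul_row_block.
by rewrite !(mulmx0, mul0mx, addr0, add0r).
Qed.

Lemma contraction2 : weak_contraction R diff2 u2 gamma2.
Proof.
have [cu uw w0 wS ug] := wc; split=> [n|n||n|n].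
- rewrite diff2_u2 /diff2 /u2 mulmx_block mulmx_block (mul_mx_row (A n)) !(mulmx0, mul0mx, addr0, add0r).
  by rewrite cu.
- apply: weak_iso_diag; first exact: weak_iso_diag.
  by case: n => [|n] /=; [exact: weak_iso1|exact: Aw].
- rewrite /gamma2 /diff2 /u2 mulmx_block mulmx_block (mul_col_row _ _ (0 : 'M_(b 0, a 0))) !(mulmx0, mul0mx, mul1mx, addr0, add0r).
  rewrite add_block_mx !(addr0, add0r) w0; congr block_mx.
  by apply/matrixP => -[].
- rewrite /gamma2 /diff2 /u2 !mulmx_block (mul_col_row _ _ (0 : 'M_(b n.+1, a n.+1))) mul_row_block.
  rewrite (mul_block_col (c n)) (mul_row_col (0 : 'M_(b n, a n))) !(mulmx0, mul0mx, mulmx1, mul1mx, addr0, add0r).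
  by rewrite !add_block_mx !(col_mx0, row_mx0, addr0, add0r) wS.
rewrite /gamma2 /u2 !mulmx_block (mul_block_col (u n)) (mul_col_mx (0 : 'M_(a n, b n))).
rewrite (mul_col_mx _ _ (shift_mx n.+1)).
by rewrite !(mulmx0, mul0mx, mulmx1, mul1mx, addr0, add0r) ug col_mx0 addr0.
Qed.

Lemma gamma2_square n : gamma2 n *m gamma2 n.+1 = 0.
Proof.
rewrite /gamma2 !mulmx_block (mul_block_col (gamma n)) !(mulmx0, mul0mx, mulmx1, mul1mx, addr0, add0r).
by rewrite gg !(block_mx0, col_mx0).
Qed.

End TwoStageComplex.

Lemma K1w_to_K1wtB (R : realType) (G : groupType) (x y : K1w R G) :
  K1w_to_K1wt (x - y) = K1w_to_K1wt x - K1w_to_K1wt y.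
Proof. exact: qpiB. Qed.

Section TwoStageTorsion.
Variables (R : realType) (G : groupType).
Local Notation ZG := (group_ring G).
Variables (a b : nat -> nat) (c : forall n, 'M[ZG]_(a n.+1, a n)) (A : forall n, 'M[ZG]_(b n)).
Variables (u : forall n, 'M[ZG]_(a n)) (gamma : forall n, 'M[ZG]_(a n, a n.+1)).
Hypothesis Aw : forall n, weak_iso R (A n).
Hypothesis wc : weak_contraction R c u gamma.
Hypothesis cc : forall n, c n.+1 *m c n = 0.
Hypothesis gg : forall n, gamma n *m gamma n.+1 = 0.
Local Notation sh := (shift_rank b).
Local Notation r2 := (rank2 a b).
Local Notation grd2 := (grd (diff2 c A) (u2 A u) (gamma2 b gamma)).
Local Notation O3 n i := (old3 (b n) (sh n) i).
Local Notation M3 n i := (mid3 (a n) (sh n) i).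
Local Notation N3 n i := (new3 (a n) (b n) i).

Local Notation mxE3 := (block_mxEul, block_mxEur, block_mxEdl, block_mxEdr, col_mxEu, col_mxEd, row_mxEl, row_mxEr).

Lemma grd2_cases n m (P : 'M[ZG]_(r2 n, r2 m) -> Prop) :
  (forall n', n = n'.+1 -> m = n' -> P (conform_mx 0 (diff2 c A n' *m u2 A u n'))) ->
  (m = n.+1 -> P (conform_mx 0 (gamma2 b gamma n))) ->
  (m.+1 <> n -> m <> n.+1 -> P 0) -> P (grd2 n m).
Proof.
move=> P1 P2 P3; rewrite /grd; case: eqP => [E|ne]; first exact: P1.
by case: eqP => [E|ne']; [exact: P2|exact: P3].
Qed.

Lemma grd2_old n m i j : grd2 n m (O3 n i) (O3 m j) = grd c u gamma n m i j.
Proof.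
rewrite /grd; case: eqP => [E|ne].
  by subst n; rewrite !conform_mx_id diff2_u2 /old3 !mxE3.
case: eqP => [E|ne']; last by rewrite !mxE.
by subst m; rewrite !conform_mx_id /gamma2 /old3 !mxE3.
Qed.

Lemma grd2_old_mid n m i j : grd2 n m (O3 n i) (M3 m j) = 0.
Proof.
elim/grd2_cases: (grd2 n m) => [n' E E'|E|_ _]; last by rewrite mxE.
  by subst n m; rewrite conform_mx_id diff2_u2 /old3 /mid3 !mxE3 mxE.
by subst m; rewrite conform_mx_id /gamma2 /old3 /mid3 !mxE3 mxE.
Qed.

Lemma grd2_old_new n m i j : grd2 n m (O3 n i) (N3 m j) = 0.
Proof.
elim/grd2_cases: (grd2 n m) => [n' E E'|E|_ _]; last by rewrite mxE.
  by subst n m; rewrite conform_mx_id diff2_u2 /old3 /new3 !mxE3 mxE.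
by subst m; rewrite conform_mx_id /gamma2 /old3 /new3 !mxE3 mxE.
Qed.

Lemma grd2_mid_old n m i j : grd2 n m (M3 n i) (O3 m j) = 0.
Proof.
elim/grd2_cases: (grd2 n m) => [n' E E'|E|_ _]; last by rewrite mxE.
  by subst n m; rewrite conform_mx_id diff2_u2 /old3 /mid3 !mxE3 mxE.
by subst m; rewrite conform_mx_id /gamma2 /old3 /mid3 !mxE3 mxE.
Qed.

Lemma grd2_mid n m i j : grd2 n m (M3 n i) (M3 m j) = 0.
Proof.
elim/grd2_cases: (grd2 n m) => [n' E E'|E|_ _]; last by rewrite mxE.
  by subst n m; rewrite conform_mx_id diff2_u2 /mid3 !mxE3 mxE.
by subst m; rewrite conform_mx_id /gamma2 /mid3 !mxE3 mxE.
Qed.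

Lemma grd2_mid_new n i j : grd2 n n.+1 (M3 n i) (N3 n.+1 (j : 'I_(sh n.+1))) = (i == j)%:R.
Proof. by rewrite grd_up /gamma2 /mid3 /new3 !mxE3 mxE. Qed.

Lemma grd2_mid_new0 n m i j : m != n.+1 -> grd2 n m (M3 n i) (N3 m j) = 0.
Proof.
move=> /eqP nm; elim/grd2_cases: (grd2 n m) => [n' E E'|//|_ _]; last by rewrite mxE.
by subst n m; rewrite conform_mx_id diff2_u2 /mid3 /new3 !mxE3 mxE.
Qed.

Lemma grd2_new_old n m i j : grd2 n m (N3 n i) (O3 m j) = 0.
Proof.
elim/grd2_cases: (grd2 n m) => [n' E E'|E|_ _]; last by rewrite mxE.
  by subst n m; rewrite conform_mx_id diff2_u2 /old3 /new3 !mxE3 mxE.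
by subst m; rewrite conform_mx_id /gamma2 /old3 /new3 !mxE3 mxE.
Qed.

Lemma grd2_new_mid n i j : grd2 n.+1 n (N3 n.+1 (i : 'I_(sh n.+1))) (M3 n j) = (A n *m A n) i j.
Proof. by rewrite grd_down diff2_u2 /mid3 /new3 !mxE3. Qed.

Lemma grd2_new_mid0 n m i j : n != m.+1 -> grd2 n m (N3 n i) (M3 m j) = 0.
Proof.
move=> /eqP nm; elim/grd2_cases: (grd2 n m) => [n' E E'|E|_ _]; last by rewrite mxE.
  by case: nm; rewrite E E'.
by subst m; rewrite conform_mx_id /gamma2 /mid3 /new3 !mxE3 mxE.
Qed.

Lemma grd2_new n m i j : grd2 n m (N3 n i) (N3 m j) = 0.
Proof.
elim/grd2_cases: (grd2 n m) => [n' E E'|E|_ _]; last by rewrite mxE.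
  by subst n m; rewrite conform_mx_id diff2_u2 /new3 !mxE3 mxE.
by subst m; rewrite conform_mx_id /gamma2 /new3 !mxE3 mxE.
Qed.

Variable K : nat.
Hypothesis aK : forall n, (K.*2 <= n)%N -> a n = 0%N.
Hypothesis bK : forall n, (K.*2 <= n.+1)%N -> b n = 0%N.

Lemma rK2 n : (K.*2 <= n)%N -> r2 n = 0%N.
Proof. by case: n => [|n] Kn; rewrite /rank2 /= aK ?bK//; lia. Qed.

Local Notation sO r := {k : 'I_K & 'I_(r k.*2.+1)}.
Local Notation sE r := {l : 'I_K & 'I_(r l.*2)}.
Local Notation ev q := (fun k : 'I_K => q (k : nat).*2) (only parsing).
Local Notation od q := (fun k : 'I_K => q (k : nat).*2.+1) (only parsing).
Local Notation dom := (sO a + (sO b + sE b))%type.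

Definition odd_cell (x : dom) : sO r2 :=
  match x with
  | inl (existT k i) => @Sg K (od r2) k (O3 k.*2.+1 i)
  | inr (inl (existT k i)) => @Sg K (od r2) k (M3 k.*2.+1 i)
  | inr (inr (existT k i)) => @Sg K (od r2) k (N3 k.*2.+1 i)
  end.

Definition odd_cell_inv (y : sO r2) : dom :=
  let: existT k i := y in
  case3 (fun j => inl (@Sg K (od a) k j) : dom) (fun j => inr (inl (@Sg K (od b) k j)))
    (fun j => inr (inr (@Sg K (ev b) k j))) i.

Lemma odd_cell_bij : bijective odd_cell.
Proof.
exists odd_cell_inv.
  by case=> [[k i]|[[k i]|[k i]]]; rewrite /= ?case3_old ?case3_mid ?case3_new.
by case=> k; apply: ind3 => j; rewrite /= ?case3_old ?case3_mid ?case3_new.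
Qed.

Lemma mid_degree (k : 'I_K) (i : 'I_(b k.*2.+1)) : (k.+1 < K)%N.
Proof.
rewrite ltnNge; apply/negP => Kk; have := ltn_ord i.
by rewrite [X in (_ < X)%N]bK//; lia.
Qed.

Variable Theta : sO a -> sE a.

(* A middle cell of degree [2k+1] is matched by [gamma2] with the new cell of degree
   [2k+2] above it, a new cell of degree [2k+1] by [diff2] with the middle cells below. *)
Definition even_cell (x : dom) : sE r2 :=
  match x with
  | inl s => @Sg K (ev r2) (tag (Theta s)) (O3 (tag (Theta s)).*2 (tagged (Theta s)))
  | inr (inl (existT k i)) =>
      @Sg K (ev r2) (Ordinal (mid_degree i)) (N3 (k.+1).*2 (i : 'I_(sh (k.+1).*2)))
  | inr (inr (existT k i)) => @Sg K (ev r2) k (M3 k.*2 i)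
  end.

(** An invariant from which injectivity of [even_cell] is read off. The second-stage cells are
    labelled by plain numbers, as their degrees arise there in a shifted form. *)
Definition even_label (y : sE r2) : sE a + (sE b + nat * nat) :=
  let: existT k i := y in
  case3 (fun j => inl (@Sg K (ev a) k j)) (fun j => inr (inl (@Sg K (ev b) k j)))
    (fun j => inr (inr (k : nat, j : nat))) i.

Hypothesis Theta_bij : bijective Theta.

Lemma even_cell_inj : injective even_cell.
Proof.
have lab1 s : even_label (even_cell (inl s)) = inl (Theta s).
  by rewrite /= case3_old; case: (Theta s).
have lab2 k i : even_label (even_cell (inr (inl (@Sg K (od b) k i)))) = inr (inr (k.+1, i : nat)).
  by rewrite /= case3_new.
have lab3 s : even_label (even_cell (inr (inr s))) = inr (inl s).
  by case: s => k i; rewrite /= case3_mid.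
move=> x y /(congr1 even_label); case: x => [s|[[k i]|s]]; case: y => [t|[[l j]|t]];
  rewrite ?lab1 ?lab2 ?lab3 //.
- by case=> /(bij_inj Theta_bij) ->.
- case=> /val_inj E; subst l => /val_inj -> //.
by case=> ->.
Qed.

(** Surjectivity is a count: the odd and the even basis are equally large, the odd-to-even map of
    the sum being a weak isomorphism. *)
Lemma even_cell_bij : bijective even_cell.
Proof.
apply: (inj_card_bij even_cell_inj); rewrite (bij_eq_card odd_cell_bij).
have [T bT] := theta_exists (contraction2 Aw wc) (diff2_square A cc) (gamma2_square b gg) rK2.
by rewrite (bij_eq_card bT).
Qed.

Local Notation fX := (fun x y : sO a => fO2E c u gamma x (Theta y)).
Local Notation Aodd := (fdiag (fun k : 'I_K => A k.*2.+1)).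
Local Notation Aeven := (fdiag (fun k : 'I_K => A k.*2)).

Lemma sig_eqE (q : 'I_K -> nat) k (i : 'I_(q k)) l (j : 'I_(q l)) :
  (existT (fun k => 'I_(q k)) k i == existT _ l j) = (k == l) && (i == j :> nat).
Proof.
case: eqVneq => [/eqP E|ne] /=.
  have E' := congr1 tag (eqP E); rewrite /= in E'; subst l; rewrite eqxx /=.
  by move: E; rewrite eq_Tagged /= => /eqP ->; rewrite eqxx.
have [E|//] := eqVneq k l; subst l.
by rewrite /=; apply/esym/negbTE; move: ne; apply: contraNN => /eqP/val_inj ->.
Qed.

(** With the cells so matched the odd-to-even map is block diagonal: the part of the given complex,
    the identity that is [gamma2], and [A *m A], the differential times [u2]. *)
Lemma fO2E_two_stage x y : fO2E (diff2 c A) (u2 A u) (gamma2 b gamma) (odd_cell x) (even_cell y) =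
  fsum fX (fsum (@fone G (sO b)) (fmul Aeven Aeven)) x y.
Proof.
case: x => [[k i]|[[k i]|[k i]]]; case: y => [t|[[l j]|[l j]]]; rewrite /fO2E /=.
- by rewrite grd2_old.
- exact: grd2_old_new.
- exact: grd2_old_mid.
- exact: grd2_mid_old.
- rewrite /fone sig_eqE; case: (eqVneq k l) => [E|ne].
    by subst l; rewrite grd2_mid_new.
  by rewrite grd2_mid_new0//= doubleS !eqSS (inj_eq double_inj) eq_sym.
- exact: grd2_mid.
- exact: grd2_new_old.
- exact: grd2_new.
rewrite fmul_fdiag /fdiag /=; case: (eqVneq l k) => [E|ne].
  by subst l; rewrite tagged_asE grd2_new_mid.
by rewrite grd2_new_mid0// eqSS (inj_eq double_inj) eq_sym.
Qed.

Lemma u_two_stage x y : fdiag (fun k : 'I_K => u2 A u k.*2.+1) (odd_cell x) (odd_cell y) =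
  fsum (fdiag (fun k : 'I_K => u k.*2.+1)) (fsum Aodd Aeven) x y.
Proof.
case: x => [[k i]|[[k i]|[k i]]]; case: y => [[l j]|[[l j]|[l j]]]; rewrite /fdiag /=;
  case: (eqVneq l k) => // E; subst l;
  rewrite !tagged_asE /u2 /old3 /mid3 /new3 ?mxE3 ?mxE//.
Qed.

(** The blocks [A *m A] in even degrees contribute twice the class of the even part of [A]. The odd
    part of [u2] takes away the class of the even part once, from the second-stage cells, and that
    of the odd part once, from the spheres. *)
Lemma two_stage_torsion : is_universal_torsion (diff2 c A)
  (K1w_to_K1wt (fcls R fX - fcls R (fdiag (fun k : 'I_K => u k.*2.+1)) + (fcls R Aeven - fcls R Aodd))).
Proof.
have w2 := contraction2 Aw wc; have D2 := diff2_square A cc; have g2 := gamma2_square b gg.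
have uw k : weak_iso R (u k) by case: wc.
have fA q : fwi R (fdiag (fun k : 'I_K => A (q k))) by apply: fwi_fdiag => k; apply/weak_isoP.
have fu : fwi R (fdiag (fun k : 'I_K => u k.*2.+1)) by apply: fwi_fdiag => k; apply/weak_isoP.
have fu2 : fwi R (fdiag (fun k : 'I_K => u2 A u k.*2.+1)).
  by apply: fwi_fdiag => k; apply/weak_isoP; case: w2.
have fXw : fwi R fX by apply: (fwi_bij _ Theta_bij (fO2E_weak wc cc gg aK)); exists id.
have := based_class_bij w2 D2 g2 rK2 odd_cell_bij even_cell_bij.
rewrite (fcls_ext _ fO2E_two_stage) => bc.
eexists (u2 A u), (gamma2 b gamma), K, _; split; [exact: w2|exact: rK2|exact: bc|].
rewrite (u_odd_cls w2) -(fcls_bij fu2 odd_cell_bij) (fcls_ext _ u_two_stage) -K1w_to_K1wtB.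
have f1 := fwi_one R G (sO b); have fAA := fwi_mul (fA (fun k => k.*2)) (fA (fun k => k.*2)).
rewrite !fcls_fsum//; [|exact: fwi_fsum..].
rewrite fcls_one fcls_mul// add0r; congr K1w_to_K1wt.
rewrite [fcls R Aodd + _]addrC !opprD !addrA; congr (_ - _).
by rewrite [RHS]addrAC addrK addrAC.
Qed.

End TwoStageTorsion.

(** * Realization *)

Section Terms.
Variable G : groupType.
Local Notation ZG := (group_ring G).
Implicit Type t : bool * G.

Definition term t : ZG := ((-1) ^+ t.1 : int) *: gr t.2.

Lemma sum_of_terms (x : ZG) : exists s : seq (bool * G), x = \sum_(t <- s) term t.
Proof.
elim/gr_ind: x => [x y [s ->] [s' ->]|g]; last by exists [:: (false, g)]; rewrite big_seq1 /term scale1r.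
exists (s ++ [seq (~~ t.1, t.2) | t <- s']); rewrite big_cat big_map /= -sumrN; congr (_ + _).
by apply: eq_bigr => -[[] g] _; rewrite /term /= !(expr0, expr1) !(scale1r, scaleN1r) ?opprK.
Qed.

(** The terms of all entries of a row are strung into one sequence, each tagged with its column,
    since the corners of one attaching map are numbered through all columns. *)
Lemma row_terms m (A : 'M[ZG]_m) i : exists s : seq (bool * G * 'I_m),
  forall j, A i j = \sum_(t <- s | t.2 == j) term t.1.
Proof.
have ex j := sum_of_terms (A i j); pose f j := projT1 (cid (ex j)).
exists (flatten [seq [seq (t, j) | t <- f j] | j <- enum 'I_m]) => j.
rewrite big_flatten big_map /= big_enum /= (bigD1 j) //= [X in _ + X]big1 ?addr0 => [|k kj]; last first.
  by rewrite big_map /= big_pred0// => t; exact/negbTE.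
by rewrite big_map /= eqxx; exact: projT2 (cid (ex j)).
Qed.

Definition row_seq m (A : 'M[ZG]_m) i := projT1 (cid (row_terms A i)).

Lemma row_seqE m (A : 'M[ZG]_m) i j :
  A i j = \sum_(k < size (row_seq A i) | (nth (false, 1%g, i) (row_seq A i) k).2 == j)
    term (nth (false, 1%g, i) (row_seq A i) k).1.
Proof. by rewrite (projT2 (cid (row_terms A i)) j) -/(row_seq A i) (big_nth (false, 1%g, i)) big_mkord. Qed.

End Terms.

Section Widen.
Variables (q : nat -> nat) (M N : nat) (MN : (M <= N)%N).
Hypothesis qM : forall k, (M <= k)%N -> q k = 0%N.

Definition widen_sig (s : {k : 'I_M & 'I_(q k)}) : {k : 'I_N & 'I_(q k)} :=
  @Sg N (fun k => q k) (widen_ord MN (tag s)) (tagged s).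

Lemma narrow_lt (k : 'I_N) (i : 'I_(q k)) : (k < M)%N.
Proof. by rewrite ltnNge; apply/negP => /qM E; have := ltn_ord i; rewrite [X in (_ < X)%N]E. Qed.

Lemma widen_sig_bij : bijective widen_sig.
Proof.
exists (fun s => let: existT k i := s in @Sg M (fun k => q k) (Ordinal (narrow_lt i)) i).
  case=> -[k pk] i; rewrite /widen_sig /=.
  by move: (narrow_lt _) => pk'; rewrite (bool_irrelevance pk' pk).
case=> -[k pk] i; rewrite /widen_sig /Sg /=.
suff E (pk' : (k < N)%N) : existT (fun k : 'I_N => 'I_(q k)) (Ordinal pk') i =
  existT (fun k : 'I_N => 'I_(q k)) (Ordinal pk) i by exact: E.
by rewrite (bool_irrelevance pk' pk).
Qed.

End Widen.

Section WidenTorsion.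
Variables (R : realType) (G : groupType).
Local Notation ZG := (group_ring G).
Variables (r : nat -> nat) (c : forall n, 'M[ZG]_(r n.+1, r n)).
Variables (u : forall n, 'M[ZG]_(r n)) (gamma : forall n, 'M[ZG]_(r n, r n.+1)).
Hypothesis wc : weak_contraction R c u gamma.
Hypothesis cc : forall n, c n.+1 *m c n = 0.
Hypothesis gg : forall n, gamma n *m gamma n.+1 = 0.
Variables (M N : nat).
Hypothesis MN : (M <= N)%N.
Hypothesis rM : forall n, (M.*2 <= n)%N -> r n = 0%N.

(** The torsion of the given space is fixed before the dimension of the new cells is known, which
    depends on it. Enlarging the range of degrees afterwards adds only empty summands. *)
Lemma widen_torsion (Theta : {k : 'I_M & 'I_(r k.*2.+1)} -> {k : 'I_M & 'I_(r k.*2)}) : bijective Theta ->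
  exists Theta' : {k : 'I_N & 'I_(r k.*2.+1)} -> {k : 'I_N & 'I_(r k.*2)}, bijective Theta' /\
    fcls R (fun x y => fO2E c u gamma x (Theta' y)) = fcls R (fun x y => fO2E c u gamma x (Theta y)).
Proof.
move=> bT.
have rN n : (N.*2 <= n)%N -> r n = 0%N by move=> Nn; apply: rM; apply: leq_trans Nn; rewrite leq_double.
have odd0 k : (M <= k)%N -> r k.*2.+1 = 0%N by move=> Mk; apply: rM; rewrite leqW// leq_double.
have ev0 k : (M <= k)%N -> r k.*2 = 0%N by move=> Mk; apply: rM; rewrite leq_double.
have bO := widen_sig_bij MN odd0; have bE := widen_sig_bij MN ev0; have [O' OK O'K] := bO.
have bT' : bijective (fun y => @widen_sig (fun k => r k.*2) M N MN (Theta (O' y))).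
  by apply: (bij_comp bE); apply: (bij_comp bT); exists (@widen_sig (fun k => r k.*2.+1) M N MN).
exists (fun y => @widen_sig (fun k => r k.*2) M N MN (Theta (O' y))); split => //.
have bi : bijective (@id {k : 'I_N & 'I_(r k.*2.+1)}) by exists id.
rewrite -(fcls_bij (fwi_bij bi bT' (fO2E_weak wc cc gg rN)) bO).
by apply: fcls_ext => x y; rewrite OK.
Qed.

Lemma widen_u : fcls R (fdiag (fun k : 'I_N => u k.*2.+1)) = fcls R (fdiag (fun k : 'I_M => u k.*2.+1)).
Proof.
have odd0 k : (M <= k)%N -> r k.*2.+1 = 0%N by move=> Mk; apply: rM; rewrite leqW// leq_double.
have [_ uw _ _ _] := wc.
have fu : fwi R (fdiag (fun k : 'I_N => u k.*2.+1)) by apply: fwi_fdiag => k; apply/weak_isoP.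
rewrite -(fcls_bij fu (widen_sig_bij MN odd0)); apply: fcls_ext => -[k i] [l j].
rewrite /fdiag /= -(inj_eq val_inj) /=; case: (eqVneq (l : nat) k) => [/val_inj E|ne].
  by subst l; rewrite eqxx !tagged_asE.
by rewrite -(inj_eq val_inj) /= (negbTE ne).
Qed.

End WidenTorsion.

Section Realize.
Variables (R : realType) (G : groupType) (X : topologicalType) (K : finite_cw R X)
  (x0 : X) (th : pi1_iso R G x0) (U : universal_covering th) (b : cellular_basis K U).
Variable c : forall n, 'M[group_ring G]_(ncells K n.+1, ncells K n).
Variables (s : nat -> nat) (A : forall k, 'M[group_ring G]_(s k)).
Hypothesis s_fin : exists N, forall n, (N <= n)%N -> s n = 0%N.
Hypothesis s_ge2 : forall k, (0 < s k)%N -> (2 <= k)%N.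
Hypothesis s_dim : forall k, (0 < s k)%N -> forall m, (k <= m.+1)%N -> ncells K m = 0%N.
Hypothesis A_terms : forall k (i : 'I_(s k)), (4 * size (row_seq (A k) i) <= k)%N.

(** Here geometry and algebra meet: the differential found in [two_stage_differential] is the
    [diff2] whose torsion is computed algebraically. *)
Lemma realize_family : connected [set: X] -> cellular_differential b c -> is_fbf_complex c -> racyclic R c ->
  (forall k, weak_iso R (A k)) ->
  exists (Y : topologicalType) (L : finite_cw R Y) (y0 : Y) (et : pi1_iso R G y0),
    [/\ connected [set: Y], l2_acyclic_cw L et &
      forall x, is_universal_torsion (R := R) (diff2 c A) x -> has_universal_torsion L et (K1wt_to_Whw x)].
Proof.
move=> Xc cP cf ca Aw.
pose nt k (i : 'I_(s k)) m := nth (false, 1%g, i) (row_seq (A k) i) m.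
pose T k (i : 'I_(s k)) := size (row_seq (A k) i).
pose par k (i : 'I_(s k)) m := (nt k i m).1.1.
pose gs k (i : 'I_(s k)) m := (nt k i m).1.2.
pose js k (i : 'I_(s k)) m := (nt k i m).2.
have AP k (i j : 'I_(s k)) : A k i j = \sum_(m < T k i | js k i m == j) ((-1) ^+ par k i m : int) *: gr (gs k i m).
  exact: row_seqE.
have Yc := Y2_connected (U := U) (T := T) (par := par) (gs := gs) (js := js) s_ge2 Xc.
have dP := @two_stage_differential R G X K x0 th U s T par gs js s_fin s_ge2 s_dim A_terms b c A cP AP.
have df : is_fbf_complex (diff2 c A) by apply: diff2_complex cf s_fin.
have da : l2_acyclic R (diff2 c A) by apply/l2_acyclicP; exact: diff2_acyclic Aw ca.
eexists _, (@L2 R G X K x0 th U s T par gs js s_fin s_dim A_terms), _, _; split; first exact: Yc.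
  by eexists _, _, _; split; [exact: dP|exact: df|exact: da].
move=> x tx; eexists _, _, _; split; [exact: dP|exact: df|exact: da|].
by exists x.
Qed.

End Realize.

Lemma K1wt_to_WhwD (R : realType) (G : groupType) (x y : K1w R G) :
  K1wt_to_Whw (K1w_to_K1wt (x + y)) = K1w_to_Whw x + K1w_to_Whw y.
Proof. by rewrite K1wt_to_WhwE; exact: (raddfD (@qpi _ (@trivial_units R G)) x y). Qed.

Section Concentrated.
Variables (R : realType) (G : groupType).
Local Notation ZG := (group_ring G).
Local Notation sq := {m : nat & 'M[ZG]_m}.
Variables (PA PB : sq) (h : nat).

(** A matrix travels together with its size, so that the family can be defined by cases on the
    degree without casts. *)
Definition conc n : sq := if n == h.*2 then PA else if n == h.*2.+1 then PB else existT (fun m => 'M[ZG]_m) 0%N 0.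
Definition conc_rank n := tag (conc n).
Definition conc_mx n : 'M[ZG]_(conc_rank n) := tagged (conc n).

Lemma conc_ind (P : nat -> sq -> Prop) : P h.*2 PA -> P h.*2.+1 PB ->
  (forall n, P n (existT (fun m => 'M[ZG]_m) 0%N 0)) -> forall n, P n (conc n).
Proof. by move=> P1 P2 P3 n; rewrite /conc; case: eqP => [->//|_]; case: eqP => [->//|_]. Qed.

Lemma conc_even : conc h.*2 = PA. Proof. by rewrite /conc eqxx. Qed.
Lemma conc_odd : conc h.*2.+1 = PB.
Proof. by rewrite /conc (_ : (h.*2.+1 == h.*2) = false) ?eqxx//; apply: gtn_eqF. Qed.

Lemma conc_weak : weak_iso R (tagged PA) -> weak_iso R (tagged PB) -> forall n, weak_iso R (conc_mx n).
Proof.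
move=> wA wB; apply: (conc_ind (P := fun _ p => weak_iso R (tagged p))) => //= _.
by rewrite (_ : 0 = 1%:M); [exact: weak_iso1|apply/matrixP => -[]].
Qed.

Lemma conc_rank0 n : n != h.*2 -> n != h.*2.+1 -> conc_rank n = 0%N.
Proof. by move=> /negbTE n1 /negbTE n2; rewrite /conc_rank /conc n1 n2. Qed.

Variable N : nat.
Hypothesis hN : (h < N)%N.

Lemma fcls_conc_even : (forall n, weak_iso R (conc_mx n)) ->
  fcls R (fdiag (fun k : 'I_N => conc_mx k.*2)) = K1w_class R (tagged PA).
Proof.
move=> w; rewrite (@fcls_fdiag_single R G N (fun k => conc_rank k.*2) _ (Ordinal hN)) => [|k|k kh].
- by rewrite /conc_mx /= -[in RHS]conc_even.
- exact/weak_isoP.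
apply: conc_rank0; first by rewrite (inj_eq double_inj); apply: contraNN kh => /eqP kh; apply/eqP/val_inj.
by apply/eqP => /(congr1 odd); rewrite /= !odd_double.
Qed.

Lemma fcls_conc_odd : (forall n, weak_iso R (conc_mx n)) ->
  fcls R (fdiag (fun k : 'I_N => conc_mx k.*2.+1)) = K1w_class R (tagged PB).
Proof.
move=> w; rewrite (@fcls_fdiag_single R G N (fun k => conc_rank k.*2.+1) _ (Ordinal hN)) => [|k|k kh].
- by rewrite /conc_mx /= -[in RHS]conc_odd.
- exact/weak_isoP.
apply: conc_rank0; last by rewrite eqSS (inj_eq double_inj); apply: contraNN kh => /eqP kh; apply/eqP/val_inj.
by apply/eqP => /(congr1 odd); rewrite /= !odd_double.
Qed.

End Concentrated.

Definition max_row_terms (G : groupType) (P : {m : nat & 'M[group_ring G]_m}) : nat :=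
  \max_i size (row_seq (tagged P) i).

Theorem mainTheorem4 (R : realType) (pi : groupType)
    (hpi : exists (X : topologicalType) (K : finite_cw R X) (x0 : X)
      (th : pi1_iso R pi x0),
        connected [set: X]%classic /\ l2_acyclic_cw K th)
    (w : Whw R pi) :
  exists (Y : topologicalType) (L : finite_cw R Y) (y0 : Y)
    (et : pi1_iso R pi y0),
    [/\ connected [set: Y]%classic, l2_acyclic_cw L et &
        has_universal_torsion L et w].
Proof.
have [X [K [x0 [th [Xc [U [b [c [cP cf /l2_acyclicP ca]]]]]]]]] := hpi.
have [cc [M rM]] := cf.
have wc := laplacian_contraction cc ca; have gg := adj_gamma_square cc.
have rM2 n : (M.*2 <= n)%N -> ncells K n = 0%N by move=> Mn; apply: rM; lia.
have [Theta bT] := theta_exists wc cc gg rM2.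
pose tX := fcls R (fun x y => fO2E c (laplacian c) (adj_gamma c) x (Theta y)) -
  fcls R (fdiag (fun k : 'I_M => laplacian c k.*2.+1)).
have [mA [A [mB [B [wA wB E]]]]] := Whw_classes (w - K1w_to_Whw tX).
pose PA := existT (fun m => 'M[group_ring pi]_m) mA A.
pose PB := existT (fun m => 'M[group_ring pi]_m) mB B.
(* [M + 2] makes the dimensions of the new cells at least 2 and puts them well above those of [X];
   the last summand makes room for four vertices per term in every row of either matrix. *)
pose h := (M + 2 + 4 * (max_row_terms PA + max_row_terms PB))%N.
(* The top cells have dimension [h.*2 + 2], and the blocks of even and odd degrees cover the degrees
   below [N.*2]. *)
pose N := h.+2.
have cw := @conc_weak R pi PA PB h wA wB.
have MN : (M <= N)%N by rewrite /N /h; lia.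
have bN n : (N.*2 <= n.+1)%N -> conc_rank PA PB h n = 0%N.
  by move=> Nn; apply: conc_rank0; apply/eqP => En; move: Nn; rewrite /N En; lia.
have s_pos n : (0 < conc_rank PA PB h n)%N -> (h.*2 <= n)%N.
  by rewrite leqNgt => s0; apply/negP => nh; move: s0; rewrite conc_rank0//; apply/eqP; lia.
have [||||Y [L [y0 [et [Yc Ya Yt]]]]] := @realize_family R pi X K x0 th U b c _ (conc_mx PA PB h) _ _ _ _ Xc cP cf ca cw.
- by exists N.*2 => n Nn; apply: bN; lia.
- by move=> k /s_pos; rewrite /h; lia.
- by move=> k /s_pos kh m km; apply: rM; move: kh; rewrite /h; lia.
- rewrite /conc_mx /conc_rank; apply: (conc_ind (P := fun k p => forall i, (4 * size (row_seq (tagged p) i) <= k)%N)) => [i|i|n []//].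
    have : (size (row_seq (tagged PA) i) <= max_row_terms PA)%N by exact: leq_bigmax.
    by rewrite /h; lia.
  have : (size (row_seq (tagged PB) i) <= max_row_terms PB)%N by exact: leq_bigmax.
  by rewrite /h; lia.
exists Y, L, y0, et; split => //.
have rN n : (N.*2 <= n)%N -> ncells K n = 0%N by move=> Nn; apply: rM2; lia.
have [Theta' [bT' ET]] := widen_torsion wc cc gg MN rM2 bT.
have := Yt _ (two_stage_torsion cw wc cc gg rN bN bT').
rewrite ET (widen_u wc MN rM2) -/tX fcls_conc_even ?fcls_conc_odd//; try by rewrite /N; lia.
by rewrite K1wt_to_WhwD -E addrC subrK.
Qed.
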